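(* Let $\alpha,\sigma,\beta$ and the sets $\Omega,\bar{\mathcal K}$ (depending on $b_0$ and $\theta$) be as in the context. There is $\theta>1$, not depending on $b_0$, such that for every $\lambda\in(0,1)$ there exist $k>0$ and $B$ for which the following holds for all integers $b_0\ge B$: if $\bar f\in\bar{\mathcal K}\cap\bar{\mathcal L}_\Omega$ and $1-c_1^+(\mathcal R\bar f)\ge\lambda$, then $D\mathcal R$ is strongly expanding on the cone field $\bar f\mapsto H(\bar f,1)$, namely $$\|D\mathcal R_{\bar f}z\|\ge k\cdot\min\{|U|^{-1},|V|^{-1}\}\cdot\|z\|\qquad\text{for all }z\in H(\bar f,1)\setminus\{0\},$$ where $k$ does not depend on $\bar f$.
   Context: Lorenz maps. Fix $\alpha>1$. For $u,v\in[0,1]$, $c\in(0,1)$ let $Q(x)=u\bigl(1-(\frac{c-x}{c})^\alpha\bigr)$ for $x\in[0,c)$ and $Q(x)=1+v\bigl(-1+(\frac{x-c}{1-c})^\alpha\bigr)$ for $x\in(c,1]$. A Lorenz map $f=(u,v,c,\phi,\psi)$ is a map on $[0,1]\setminus\{c\}$ with $f=\phi\circ Q$ on $[0,c)$ (left branch $f_0$), $f=\psi\circ Q$ on $(c,1]$ (right branch $f_1$), $\phi,\psi$ orientation-preserving diffeomorphisms of $[0,1]$. Put $c_1^-(f)=\lim_{x\uparrow c}f(x)$, $c_1^+(f)=\lim_{x\downarrow c}f(x)$; $f$ is nontrivial if $c_1^+<c<c_1^-$. Renormalization. $f$ is renormalizable if there is an interval $C\subsetneq[0,1]$ properly containing $c$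 such that the first-return map $\tilde f$ to $C$ is affinely conjugate to a nontrivial Lorenz map; $C$ is chosen maximal. Let $L,R$ be the left and right components of $C\setminus\{c\}$; $\tilde f=f^{a+1}$ on $L$, $\tilde f=f^{b+1}$ on $R$. $\mathcal Rf=h^{-1}\circ\tilde f\circ h$, $h$ the orientation-preserving affine map of $[0,1]$ onto $C$. The type is the monotone type $\omega=(0\,1^a,1\,0^b)$ if $f^i(L)\subset(c,1)$ for $1\le i\le a$ and $f^j(R)\subset(0,c)$ for $1\le j\le b$. $\Omega$. Fix $\sigma\in(0,1)$ such that some integer $a$ satisfies $\alpha+\sigma\le a+1\le2\alpha-\sigma$, and $\beta\in(0,(\sigma/\alpha)^2)$. $\Omega=\{(0\,1^a,1\,0^b):\alpha+\sigma\le a+1\le2\alpha-\sigma,\ b_0\le b\le(1+(\sigma/\alpha)^2-\beta)b_0\}$. Decomposed maps. A time set is a totally ordered, at most countable set. For $s\in\mathbb R$ let $\mu_0=\mathrm{id}$ and, for $s\ne0$, $\mu_s(x)=\frac{(1+(e^{s/(\alpha-1)}-1)x)^\alpha-1}{e^{\alpha s/(\alpha-1)}-1}$ on $[0,1]$ (pure maps; $|s|$ is the distortion $\sup_{x,y}\log\frac{D\mu_s(x)}{D\mu_s(y)}$). A pure decomposition over $T$ is a family $\bar\phi=(\phi_\tau)_{\tau\in T}$, $\phi_\tau=\mu_{s_\tau}$; $\mathrm{Dist}\,\bar\phi=\sum_\tau|s_\tau|$. When this is finite, $\phi=O\bar\phi$ is the composition of all $\phi_\tau$ in the order of $T$ (limit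 of the ordered compositions over finite subsets), and $O_{<\tau}\bar\phi$ is the composition of the maps at times $<\tau$. A pure decomposed Lorenz map over $(T_0,T_1)$ is $\bar f=(u,v,c,\bar\phi,\bar\psi)$ with $\bar\phi,\bar\psi$ pure decompositions over $T_0,T_1$; $f=O\bar f=(u,v,c,O\bar\phi,O\bar\psi)$. For an orientation-preserving diffeomorphism $g$ on an interval $J$, $Z(g;J)=\zeta_{g(J)}^{-1}\circ g\circ\zeta_J$, $\zeta_A:[0,1]\to A$ the increasing affine bijection; $Z(\bar\phi;J)$ has at time $\tau$ the map $Z(\phi_\tau;O_{<\tau}\bar\phi(J))$. $\oplus$ denotes concatenation of decompositions (left one first). If $f=O\bar f$ is renormalizable of monotone type, put $U=\phi^{-1}f_1^{-a}(C)$, $V=\psi^{-1}f_0^{-b}(C)$, $U_1=\phi(U)$, $U_{i+1}=f^i(U_1)$, $V_1=\psi(V)$, $V_{j+1}=f^j(V_1)$, and $\mathcal R\bar f=(u',v',c',\bar\phi',\bar\psi')$ with $u'=|Q(L)|/|U|$, $v'=|Q(R)|/|V|$, $c'=|L|/|C|$, $\bar\phi'=Z(\bar\phi;U)\oplus Z(Q;U_1)\oplus Z(\bar\psi;Q(U_1))\oplus\cdots\oplus Z(Q;U_a)\oplus Z(\bar\psi;Q(U_a))$, $\bar\psi'=Z(\bar\psi;V)\oplus Z(Q;V_1)\oplus Z(\bar\phi;Q(V_1))\oplus\cdots\oplus Z(Q;V_b)\oplus Z(\bar\phi;Q(V_b))$. Then $O\mathcal R\bar f=\mathcal RO\bar f$.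 $\bar{\mathcal L}_\Omega$ is the set of decomposed maps with $O\bar f$ $\omega$-renormalizable for some $\omega\in\Omega$; $c_1^\pm(\bar f)=c_1^\pm(O\bar f)$. $\bar{\mathcal K}$ is the set of pure decomposed Lorenz maps with $\alpha^{-b_0/\alpha}\le1-c\le\theta\alpha^{-b_0\sigma/\alpha^2}$, $\mathrm{Dist}\,\bar\phi\le\delta$, $\mathrm{Dist}\,\bar\psi\le\delta$, $\delta=(1/b_0)^2$. Derivative and cones. Pure decomposed Lorenz maps over fixed time sets have coordinates $(u,v;c,(s_\tau),(t_\tau))$, where $s_\tau,t_\tau$ are the parameters of the pure maps in $\bar\phi,\bar\psi$. The tangent space is $X\times Y$, $X=\mathbb R^2$ (the $(u,v)$-directions), $Y=\mathbb R\times\ell^1\times\ell^1$, with max norms: $\|x\|=\max\{|x_1|,|x_2|\}$, $\|y\|$ the max of the three component norms, $\|(x,y)\|=\max\{\|x\|,\|y\|\}$. $D\mathcal R_{\bar f}$ is the derivative of $\mathcal R$ at $\bar f$ in these coordinates. The horizontal $1$-cone is $H(\bar f,1)=\{(x,y):\|y\|\le\|x\|\}$ in the tangent space at $\bar f$. *)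

(* Defs.v *)
From HB Require Import structures.
Set Warnings "-redundant-canonical-projection".
From mathcomp Require Import all_boot all_order all_algebra finmap.
From mathcomp Require Import all_classical all_reals all_analysis.
Set Implicit Arguments.
Unset Strict Implicit.
Unset Printing Implicit Defensive.
Import Order.TTheory GRing.Theory Num.Theory.
Import numFieldNormedType.Exports.
Local Open Scope classical_set_scope.
Local Open Scope ring_scope.

(* The ordered sum of two totally ordered sets (the left summand comes first);
   it indexes the concatenation of two decompositions. *)
Definition ordsum (T T' : Type) : Type := (T + T')%type.

Definition ordsum_display (d d' : Order.disp_t) : Order.disp_t.
Proof. exact: Order.Disp tt tt. Qed.

Section OrdSum.
Variables (d d' : Order.disp_t) (T : orderType d) (T' : orderType d').

Definition ordsum_le (x y : ordsum T T') : bool :=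
  match x, y with
  | inl x, inl y => (x <= y)%O
  | inl _, inr _ => true
  | inr _, inl _ => false
  | inr x, inr y => (x <= y)%O
  end.

Lemma ordsum_le_refl : reflexive ordsum_le.
Proof. by case=> x /=. Qed.

Lemma ordsum_le_anti : antisymmetric ordsum_le.
Proof. by case=> x [] y //= /le_anti->. Qed.

Lemma ordsum_le_trans : transitive ordsum_le.
Proof. by case=> y [] x [] z //=; apply: le_trans. Qed.

Lemma ordsum_le_total : total ordsum_le.
Proof. by case=> x [] y //=; apply: le_total. Qed.

HB.instance Definition _ := Choice.copy (ordsum T T') (T + T')%type.
HB.instance Definition _ :=
  Order.Le_isPOrder.Build (ordsum_display d d') (ordsum T T')
    ordsum_le_refl ordsum_le_anti ordsum_le_trans.
HB.instance Definition _ :=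
  Order.POrder_isTotal.Build (ordsum_display d d') (ordsum T T')
    ordsum_le_total.
End OrdSum.

(* The time set of  phi (+) (Q (+) psi) (+) ... (+) (Q (+) psi)  with n blocks
   "Q (+) psi": T indexes phi, 'I_1 indexes the single map Q, and T' psi. *)
Definition rtime (d d' : Order.disp_t) (T : orderType d) (T' : orderType d')
    (n : nat) :=
  ordsum T ('I_n *l ordsum 'I_1 T').

(* The filter along which limits over the directed set of finite subsets of T
   are taken. *)
Definition finsets (T : choiceType) : set_system {fset T} :=
  filter_from setT (fun A : {fset T} => [set B : {fset T} | A `<=` B]%fset).
Arguments finsets : clear implicits.

(* A compact interval [l, r] is the pair (l, r) of its endpoints. *)

Section Intervals.
Variable R : realType.
Implicit Types (J : R * R) (g : R -> R).

Definition ilen J : R := J.2 - J.1.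

(* zeta J : the increasing affine bijection from [0, 1] onto J *)
Definition zeta J (x : R) : R := J.1 + ilen J * x.
Definition zeta_inv J (y : R) : R := (y - J.1) / ilen J.

(* The image of J under a continuous increasing map. *)
Definition imI g J : R * R := (g J.1, g J.2).

Definition zoom g J : R -> R := zeta_inv (imI g J) \o g \o zeta J.

(* The endpoints of an interval given as a set. *)
Definition hull (S : set R) : R * R := (inf S, sup S).
End Intervals.

(* A Lorenz map is a total function R -> R of which only the values on
   [0, 1] minus the critical point c are meaningful. *)

Section Lorenz.
Variables (R : realType) (alpha : R).

Definition stdQ (u v c x : R) : R :=
  if x < c then u * (1 - ((c - x) / c) `^ alpha)
  else 1 + v * (- 1 + ((x - c) / (1 - c)) `^ alpha).

Definition lorenz (u v c : R) (phi psi : R -> R) (x : R) : R :=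
  if x < c then phi (stdQ u v c x) else psi (stdQ u v c x).

(* Orientation-preserving (C^1) diffeomorphisms of [0, 1]. *)
Definition diffeo01 (phi : R -> R) : Prop :=
  [/\ phi 0 = 0, phi 1 = 1 &
    exists g : R -> R,
      [/\ forall x, derivable g x 1,
          continuous (g^`())%classic,
          {in `[0, 1], phi =1 g} &
          {in `[0, 1], forall x, 0 < (g^`())%classic x}]].

Definition is_lorenz (f : R -> R) (c : R) : Prop :=
  0 < c < 1 /\
  exists u v phi psi,
    [/\ 0 <= u <= 1, 0 <= v <= 1, diffeo01 phi, diffeo01 psi &
        {in `[0, 1], forall x, x != c -> f x = lorenz u v c phi psi x}].

Definition crit_left (f : R -> R) (c : R) : R := lim (f x @[x --> c^'-]).
Definition crit_right (f : R -> R) (c : R) : R := lim (f x @[x --> c^'+]).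

Definition nontrivial (f : R -> R) (c : R) : Prop :=
  crit_right f c < c /\ c < crit_left f c.

Definition first_return (f : R -> R) (C : R * R) (x : R) (n : nat) : Prop :=
  [/\ (0 < n)%N, iter n f x \in `[C.1, C.2] &
      forall i, (0 < i < n)%N -> iter i f x \notin `[C.1, C.2]].

Definition return_interval (f : R -> R) (c : R) (C : R * R) : Prop :=
  [/\ 0 <= C.1, C.1 < c < C.2, C.2 <= 1, C <> (0, 1) &
    exists g : R -> R,
      [/\ forall x, x \in `[C.1, C.2] -> x != c ->
            exists2 n, first_return f C x n & g x = iter n f x,
          is_lorenz (zeta_inv C \o g \o zeta C) (zeta_inv C c) &
          nontrivial (zeta_inv C \o g \o zeta C) (zeta_inv C c)]].

Definition maximal_return_interval (f : R -> R) (c : R) (C : R * R) : Prop :=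
  return_interval f c C /\
  forall C', return_interval f c C' -> C'.1 <= C.1 -> C.2 <= C'.2 -> C' = C.

(* The interval C of a renormalizable map (irrelevant value otherwise). *)
Definition retint (f : R -> R) (c : R) : R * R :=
  xget (0, 1) [set C | maximal_return_interval f c C].

(* f is renormalizable of monotone type (0 1^a, 1 0^b); the components of
   C minus c are L = [C.1, c) and R = (c, C.2]. *)
Definition renormalizable (a b : nat) (f : R -> R) (c : R) : Prop :=
  let C := retint f c in
  [/\ maximal_return_interval f c C,
      forall x, x \in `[C.1, c[ -> first_return f C x a.+1,
      forall x, x \in `]c, C.2] -> first_return f C x b.+1,
      forall x i, x \in `[C.1, c[ -> (1 <= i <= a)%N -> iter i f x \in `]c, 1[
    & forall x j, x \in `]c, C.2] -> (1 <= j <= b)%N -> iter j f x \in `]0, c[].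

(* phi^-1 (g^-n (C)), where g is the restriction of f to D. *)
Definition pullback (phi f : R -> R) (D : interval R) (n : nat) (C : R * R) :
    set R :=
  [set y | [/\ y \in `[0, 1], forall i, (i < n)%N -> iter i f (phi y) \in D &
               iter n f (phi y) \in `[C.1, C.2]]].

Definition mu (s x : R) : R :=
  if s == 0 then x
  else ((1 + (expR (s / (alpha - 1)) - 1) * x) `^ alpha - 1)
       / (expR (alpha * s / (alpha - 1)) - 1).

(* The parameter s of a pure map g = mu s. *)
Definition pure_param (g : R -> R) : R :=
  xget 0 [set s | {in `[0, 1], g =1 mu s}].

Section Decomposition.
Variables (d : Order.disp_t) (T : orderType d).
Implicit Type s : T -> R.

(* Dist of the pure decomposition with parameters s; also the norm of l^1(T). *)
Definition l1norm s : \bar R := (\esum_(t in [set: T]) `|s t|%:E)%E.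

(* The composition, earlier times being applied first, of the maps mu (s t)
   at the times t of A that satisfy P. *)
Definition fincomp s (P : pred T) (A : {fset T}) (x : R) : R :=
  foldl (fun y t => mu (s t) y) x [seq t <- sort <=%O (enum_fset A) | P t].

Definition comp_on s (P : pred T) (x : R) : R :=
  lim (fincomp s P A x @[A --> finsets T]).

Definition comp_all s : R -> R := comp_on s predT.
Definition comp_before s (t : T) : R -> R := comp_on s (fun t' => (t' < t)%O).

(* The parameter at time t of the zoom of the decomposition to J. *)
Definition zoom_param s (J : R * R) (t : T) : R :=
  pure_param (zoom (mu (s t)) (imI (comp_before s t) J)).
End Decomposition.

(* Points (u, v; c, s, t) of X * Y, X = R^2, Y = R * (T0 -> R) * (T1 -> R).
   Both decomposed maps and tangent vectors are such points. *)
Definition coords (T0 T1 : Type) : lmodType R :=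
  ((R^o * R^o) * (R^o * (T0 -> R^o) * (T1 -> R^o)))%type.

Section Coordinates.
Variables (d0 d1 : Order.disp_t) (T0 : orderType d0) (T1 : orderType d1).
Implicit Types f z : coords T0 T1.

Definition co_u f : R := f.1.1.
Definition co_v f : R := f.1.2.
Definition co_c f : R := f.2.1.1.
Definition co_s f : T0 -> R := f.2.1.2.
Definition co_t f : T1 -> R := f.2.2.

(* The norms are extended-real valued: a point of [coords] has finite norm iff
   both families of parameters are in l^1. *)
Definition normX z : \bar R := (Num.max `|co_u z| `|co_v z|)%:E.
Definition normY z : \bar R :=
  maxe (maxe `|co_c z|%:E (l1norm (co_s z))) (l1norm (co_t z)).
Definition norm z : \bar R := maxe (normX z) (normY z).

Definition tangent : set (coords T0 T1) := [set z | norm z < +oo]%E.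

Definition hcone : set (coords T0 T1) :=
  [set z | tangent z /\ (normY z <= normX z)%E].

Definition decomposed f : Prop :=
  [/\ 0 <= co_u f <= 1, 0 <= co_v f <= 1, 0 < co_c f < 1 & tangent f].

Definition mapQ f : R -> R := stdQ (co_u f) (co_v f) (co_c f).
Definition mapO f : R -> R :=
  lorenz (co_u f) (co_v f) (co_c f) (comp_all (co_s f)) (comp_all (co_t f)).

Definition retC f : R * R := retint (mapO f) (co_c f).

Definition intU (a : nat) f : R * R :=
  hull (pullback (comp_all (co_s f)) (mapO f) `]co_c f, 1] a (retC f)).
Definition intV (b : nat) f : R * R :=
  hull (pullback (comp_all (co_t f)) (mapO f) `[0, co_c f[ b (retC f)).

(* L_omega, omega = (0 1^a, 1 0^b) *)
Definition Lset (a b : nat) : set (coords T0 T1) :=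
  [set f | decomposed f /\ renormalizable a b (mapO f) (co_c f)].
End Coordinates.

(* The parameters of Z(phi; U) (+) Z(Q; U_1) (+) Z(psi; Q(U_1)) (+) ...
   (+) Z(Q; U_n) (+) Z(psi; Q(U_n)), where U_(i+1) = f^i(phi(U)); s and t are
   the parameters of phi and psi. *)
Definition renorm_param (d d' : Order.disp_t) (T : orderType d)
    (T' : orderType d') (s : T -> R) (t : T' -> R) (f Q : R -> R)
    (U : R * R) (n : nat) : rtime T T' n -> R :=
  let U_ (i : nat) := imI (iter i f) (imI (comp_all s) U) in
  fun tau => match tau with
  | inl x => zoom_param s U x
  | inr (i, inl _) => pure_param (zoom Q (U_ i))
  | inr (i, inr y) => zoom_param t (imI Q (U_ i)) y
  end.
Arguments renorm_param {d d' T T'} s t f Q U n tau.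

(* Meaningful on Lset a b only. The images of Q are taken over the half-open
   components [C.1, c) and (c, C.2] because Q jumps at c. *)
Definition renorm (d0 d1 : Order.disp_t) (T0 : orderType d0)
    (T1 : orderType d1) (a b : nat) (f : coords T0 T1) :
    coords (rtime T0 T1 a) (rtime T1 T0 b) :=
  let C := retC f in
  let U := intU a f in
  let V := intV b f in
  ((ilen (hull (mapQ f @` `[C.1, co_c f[)) / ilen U,
    ilen (hull (mapQ f @` `]co_c f, C.2])) / ilen V),
   ((co_c f - C.1) / ilen C,
    renorm_param (co_s f) (co_t f) (mapO f) (mapQ f) U a,
    renorm_param (co_t f) (co_s f) (mapO f) (mapQ f) V b)).

(* A is a Frechet derivative of F at f relative to the set D. (A map that is
   renormalizable with c_1^+(R f) = 0 or c_1^-(R f) = 1 lies on the boundary of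
   Lset a b, so that the derivative has to be taken within this set.)
   Only the values of A on vectors of finite norm are relevant. *)
Definition is_derivative_within (d0 d1 d0' d1' : Order.disp_t)
    (T0 : orderType d0) (T1 : orderType d1)
    (T0' : orderType d0') (T1' : orderType d1')
    (F : coords T0 T1 -> coords T0' T1') (D : set (coords T0 T1))
    (f : coords T0 T1) (A : coords T0 T1 -> coords T0' T1') : Prop :=
  [/\ forall (r : R) z w, tangent z -> tangent w ->
        A (r *: z + w) = r *: A z + A w,
      exists M : R, forall z, tangent z -> (norm (A z) <= M%:E * norm z)%E &
      forall eps : R, 0 < eps -> exists2 delta : R, 0 < delta &
        forall g, D g -> (norm (g - f)%R < delta%:E)%E ->
          (norm (F g - F f - A (g - f))%R <= eps%:E * norm (g - f)%R)%E].

Definition Omega (sigma beta : R) (b0 : nat) : set (nat * nat) :=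
  [set ab | alpha + sigma <= ab.1%:R + 1 <= 2 * alpha - sigma /\
            b0%:R <= ab.2%:R :> R /\
            ab.2%:R <= (1 + (sigma / alpha) ^+ 2 - beta) * b0%:R].

Definition Kset (d0 d1 : Order.disp_t) (T0 : orderType d0) (T1 : orderType d1)
    (sigma theta : R) (b0 : nat) : set (coords T0 T1) :=
  [set f | [/\ decomposed f,
      alpha `^ (- b0%:R / alpha) <= 1 - co_c f,
      1 - co_c f <= theta * alpha `^ (- b0%:R * sigma / alpha ^+ 2),
      (l1norm (co_s f) <= ((b0%:R^-1) ^+ 2)%:E)%E &
      (l1norm (co_t f) <= ((b0%:R^-1) ^+ 2)%:E)%E]].
End Lorenz.

(* Main.v *)
(** Conjugation by x |-> 1 - x exchanges the branches, so each estimate is proved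
    once, for iterates of the left branch.  The end points p, q of the return
    interval C are expanding fixed points of the return map F, hence vary smoothly;
    first-order expansions with quadratic remainders, carried along their orbits
    and through the limits that define the decompositions, give the derivative of
    the renormalization.  With x, y the normalized shifts of p, q, its (u, v) part
    on the cone is, since C is tiny compared with 1 - c, close to the pair
    F'(p) x - u'(x + y), F'(q) y - v'(x + y), and as u' / F'(p) + v' / F'(q) is at
    most about 1 / alpha < 1, this pair cannot be small unless x and y are.
    Uniqueness of the derivative, although Lset is not open: f + r z is in Lset for
    small r > 0 if the (u, v) part of DR z is negative, and such z generate. *)
Require Import Defs.
From mathcomp Require Import all_boot all_order all_algebra finmap.
From mathcomp Require Import all_classical all_reals all_analysis.
From mathcomp Require Import ring lra.
Import Order.TTheory GRing.Theory Num.Theory.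
Import numFieldNormedType.Exports.
Local Open Scope classical_set_scope.
Local Open Scope ring_scope.
Set Implicit Arguments.
Unset Strict Implicit.
Unset Printing Implicit Defensive.

(** The interval C is chosen by maximality, so its definition does not show that it moves
    continuously. Bounded distortion controls it: after the first application of Q the return map is
    nearly affine, because logarithmic gaps to the critical value telescope along the orbit
    ([KK_slopes]). With the power law at c, this leaves the return branch at most one fixed point on
    each side, forces every return interval into [p, q], and so identifies C for all maps near f.
    One small number [ka], depending on alpha only, bounds the relative size of C, the distortion
    and the perturbation terms; b0 >= B makes it admissible.

    The inequality u' / F'(p) + v' / F'(q) < 1 has its origin in F'(q) |R| = alpha D |Q(R)|, D being
    the slope of the nearly affine part: D |V| is close to |C|, so v' / F'(q) is close to |R| /
    (alpha |C|), likewise on the left, and |L| + |R| = |C|. The factor min(1 / |U|, 1 / |V|) arises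
    since a change dv of v moves q, relative to C, by the order of dv / |V|. Only the (u, v) part of
    the image vector is estimated; this suffices for the maximum norm. *)

Ltac andlra := apply/andP; split; lra.
Tactic Notation "lrd" hyp_list(h) := clear h; lra.
Tactic Notation "lrc" hyp_list(h) := clear - h; lra.

(** * Elementary bounds for exp and ln, mean value estimates, intermediate values *)

Section Basics.
Variable R : realType.
Implicit Types x y a b : R.

Lemma normD_le a b x y : `|a| <= x -> `|b| <= y -> `|a + b| <= x + y.
by move=> h k; exact: le_trans (ler_normD _ _) (lerD h k). Qed.

Lemma normB_le a b x y : `|a| <= x -> `|b| <= y -> `|a - b| <= x + y.
by move=> h k; apply: normD_le => //; rewrite normrN. Qed.

Lemma normM_le a b x y : `|a| <= x -> `|b| <= y -> `|a * b| <= x * y.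
by move=> h k; rewrite normrM ler_pM. Qed.

Lemma expR_sub1_le x : `|expR x - 1| <= `|x| * expR `|x|.
have h y : expR y - 1 <= y * expR y.
  have := expR_ge1Dx (- y); rewrite expRN => h1.
  have y0 := expR_gt0 y.
  have : (1 - y) * expR y <= 1 by rewrite -ler_pdivlMr // mul1r.
  by lra.
have [x0|x0] := leP 0 x.
  by rewrite !ger0_norm //; have := expR_ge1Dx x; lra.
rewrite ler0_norm; last by rewrite subr_le0 expR_le1 ltW.
rewrite ltr0_norm //; have := h (- x); have e1 := expR_ge1Dx x.
have e2 := expR_ge1Dx (- x).
have : 0 <= - x * (expR (- x) - 1) by rewrite mulr_ge0; lra.
by lra.
Qed.

Lemma expR_taylor x : `|expR x - 1 - x| <= x ^+ 2 * expR `|x|.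
have e1 := expR_ge1Dx x.
rewrite ger0_norm; last by lra.
have := expR_ge1Dx (- x); rewrite expRN => h1.
have y0 := expR_gt0 x.
have h2 : (1 - x) * expR x <= 1 by rewrite -ler_pdivlMr // mul1r.
apply: (@le_trans _ _ (x * (expR x - 1))); first by lra.
apply: (le_trans (ler_norm _)); rewrite -real_normK ?num_real // expr2 -mulrA normrM.
by rewrite ler_wpM2l // expR_sub1_le.
Qed.

Lemma ln_sub_le x y : 0 < x -> 0 < y -> ln y - ln x <= (y - x) / x.
move=> x0 y0; rewrite -ln_div ?posrE //.
have -> : y / x = 1 + (y - x) / x by field; rewrite gt_eqF.
apply: le_ln1Dx; rewrite ltr_pdivlMr //; lra.
Qed.

(** Concavity bounds [ln y - ln x] from above by the tangent at [x] and from below by the tangent at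
    [y]; the gap between these two bounds is exactly the right-hand side. *)
Lemma ln_taylor x y : 0 < x -> 0 < y ->
  `|ln y - ln x - (y - x) / x| <= (y - x) ^+ 2 / (x * y).
move=> x0 y0; have h1 := ln_sub_le x0 y0; have h2 := ln_sub_le y0 x0.
rewrite ler0_norm; last by lra.
have -> : (y - x) ^+ 2 / (x * y) = (y - x) / x + (x - y) / y.
  by field; rewrite !gt_eqF.
lra.
Qed.

Lemma ln_norm_le x m : 0 < m -> m <= x -> `|ln x| <= x + m^-1.
move=> m0 mx; have x0 : 0 < x by lra.
have h1 := ltW (ln_sublinear x0).
have xV0 : 0 < x^-1 by rewrite invr_gt0.
have h2 := ltW (ln_sublinear xV0); rewrite lnV ?posrE // in h2.
have h3 : x^-1 <= m^-1 by rewrite lef_pV2 ?posrE.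
have m1 : 0 < m^-1 by rewrite invr_gt0.
by rewrite ler_norml; andlra.
Qed.

Lemma mvt (g dg : R -> R) a b : a <= b ->
  (forall x, a <= x <= b -> is_derive x 1 g (dg x)) ->
  exists2 c, a <= c <= b & g b - g a = dg c * (b - a).
move=> ab dgP.
have h x : x \in `]a, b[ -> is_derive x 1 g (dg x).
  by rewrite in_itv /= => /andP[x1 x2]; apply: dgP; rewrite !ltW.
have [] := MVT_segment ab h.
  apply: derivable_within_continuous => x; rewrite in_itv /= => x1.
  by have [] := dgP _ x1.
by move=> c; rewrite in_itv /= => c1 c2; exists c.
Qed.

Lemma mvt_lip (g dg : R -> R) K a b :
  (forall x, a <= x <= b -> is_derive x 1 g (dg x)) ->
  (forall x, a <= x <= b -> `|dg x| <= K) ->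
  forall x y, a <= x <= b -> a <= y <= b -> `|g y - g x| <= K * `|y - x|.
move=> h1 h2 x y.
wlog xy : x y / x <= y.
  move=> H xab yab; have [xy|/ltW yx] := leP x y; first exact: H.
  by rewrite distrC (distrC y); exact: H.
move=> /andP[ax xb] /andP[ay yb].
have [|c /andP[c1 c2] ->] := @mvt g dg x y xy.
  by move=> t /andP[t1 t2]; apply: h1; andlra.
by rewrite normrM ler_wpM2r // h2 //; andlra.
Qed.

(** The increment equals [dg c * (y - x)] for a mean value point, and the Lipschitz bound compares
    [dg c] with [dg x], so that no second derivative is needed. *)
Lemma mvt_quad (g dg : R -> R) K a b : 0 <= K ->
  (forall x, a <= x <= b -> is_derive x 1 g (dg x)) ->
  (forall x y, a <= x <= b -> a <= y <= b -> `|dg y - dg x| <= K * `|y - x|) ->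
  forall x y, a <= x <= b -> a <= y <= b ->
    `|g y - g x - dg x * (y - x)| <= K * (y - x) ^+ 2.
move=> K0 h1 h2 x y xab yab.
suff [c cab [-> cxy]] : exists2 c, a <= c <= b &
    g y - g x = dg c * (y - x) /\ `|c - x| <= `|y - x|.
  rewrite -mulrBl normrM -real_normK ?num_real // expr2 mulrA ler_wpM2r //.
  apply: le_trans (h2 _ _ xab cab) _; exact: ler_wpM2l.
case/andP: xab => ax xb; case/andP: yab => ay yb.
have [xy|/ltW xy] := leP x y.
  have [|c /andP[c1 c2] ->] := @mvt g dg x y xy.
    by move=> t /andP[t1 t2]; apply: h1; andlra.
  exists c; first by andlra.
  by split=> //; rewrite !ger0_norm; lra.
have [|c /andP[c1 c2] e] := @mvt g dg y x xy.
  by move=> t /andP[t1 t2]; apply: h1; andlra.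
exists c; first by andlra.
by split; [lra | rewrite !ler0_norm; lra].
Qed.

(** Clamping to [[a, b]] turns the Lipschitz bound, which is known only there, into continuity on
    the whole line. The branches are meaningful only on their own interval, whence this form. *)
Lemma lip_IVT (g : R -> R) K a b v : a <= b ->
  (forall x y, a <= x <= b -> a <= y <= b -> `|g y - g x| <= K * `|y - x|) ->
  g a <= v <= g b -> exists2 c, a <= c <= b & g c = v.
move=> ab lip vab.
have K0 : 0 < `|K| + 1 by rewrite ltr_wpDl.
pose cl (x : R) := Num.max a (Num.min b x).
have clab x : a <= cl x <= b.
  by rewrite /cl le_max lexx /= ge_max ab ge_min lexx.
have cll x y : `|cl y - cl x| <= `|y - x|.

  have nrm (z w : R) : [/\ 0 <= `|w - z|, w - z <= `|w - z| & z - w <= `|w - z|].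
    by split; rewrite ?normr_ge0 ?ler_norm // distrC ler_norm.
  have mx (z w : R) : `|Num.max a w - Num.max a z| <= `|w - z|.
    have [? ? ?] := nrm z w; rewrite ler_norml.
    by case: (leP a z) => ?; case: (leP a w) => ?; apply/andP; split; lrd ab vab K0.
  apply: le_trans (mx _ _) _; have [? ? ?] := nrm x y; rewrite ler_norml.
  by case: (leP b x) => ?; case: (leP b y) => ?; apply/andP; split; lrd ab vab K0.
have cg : continuous (g \o cl).
  move=> x; apply/cvgrPdist_lt => e e0; near=> y.
  apply: le_lt_trans (lip _ _ (clab y) (clab x)) _.
  apply: (@le_lt_trans _ _ ((`|K| + 1) * `|x - y|)).
    apply: (@le_trans _ _ ((`|K| + 1) * `|cl x - cl y|)).
      by rewrite ler_wpM2r // (le_trans (ler_norm _)) // lerDl.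
    by rewrite ler_wpM2l ?cll // ltW.
  rewrite mulrC -ltr_pdivlMr //.
  by near: y; apply: cvgr_dist_lt => //; rewrite divr_gt0.
have cla : cl a = a by rewrite /cl (min_idPr ab) maxxx.
have clb : cl b = b by rewrite /cl minxx (max_idPr ab).
have [] := @IVT R (g \o cl) a b v ab.
- exact: continuous_subspaceT.
- rewrite /= cla clb; case/andP: vab => h1 h2.
  by have h3 := le_trans h1 h2; rewrite (min_idPl h3) (max_idPr h3) h1.
- move=> c; rewrite in_itv /= => h1 h2; exists c => //.
  move: h2; rewrite /cl; case/andP: h1 => h1 h1'.
  by rewrite (min_idPr h1') (max_idPr h1).
Unshelve. all: by end_near. Qed.
End Basics.

(** [nu i] measures the size of the perturbation with index [i]; the bound by 1 absorbs higher
    powers of [nu] into lower ones. Convergence of [nu] to 0 is not included: for [F = globally A]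
    the same calculus yields second-order bounds uniform on [A], and smallness is assumed only where
    roots have to be found. *)
Definition jctx {R : realType} {I : Type} (F : set_system I) (nu : I -> R) :=
  Filter F /\ F [set i | 0 <= nu i <= 1].

(** * Calculus of first-order expansions with quadratic remainder *)

Section Jets.
Context {R : realType} {I : Type} (F : set_system I) (nu : I -> R).
Hypothesis hj : jctx F nu.
Implicit Types X Y dX dY : I -> R.
#[local] Instance jctx_filter : Filter F := proj1 hj.
Let nu01 : F [set i | 0 <= nu i <= 1] := proj2 hj.

(* First-order expansions with a quadratic remainder along F; the base value X0
   may depend on the index, so that one choice of F gives expansions that are
   uniform in parameters. *)
Definition jet X X0 dX := exists K, F [set i |
  [/\ `|X0 i| <= K, `|dX i| <= K * nu i & `|X i - X0 i - dX i| <= K * nu i ^+ 2]].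

Lemma jetE X X0 dX : jet X X0 dX -> exists2 K, 1 <= K & F [set i |
  [/\ 0 <= nu i <= 1, `|X0 i| <= K, `|dX i| <= K * nu i
    & `|X i - X0 i - dX i| <= K * nu i ^+ 2]].
case=> K hK; exists (`|K| + 1); first by rewrite lerDr.
apply: filterS2 nu01 hK => i /andP[n0 n1] [h1 h2 h3].
have K1 : K <= `|K| + 1 by apply: (le_trans (ler_norm _)); rewrite lerDl.
split; first exact/andP.
- exact: le_trans K1.
- by apply: le_trans h2 _; rewrite ler_wpM2r.
- by apply: le_trans h3 _; rewrite ler_wpM2r // exprn_ge0.
Qed.

Lemma jet2E X X0 dX Y Y0 dY : jet X X0 dX -> jet Y Y0 dY ->
  exists2 K, 1 <= K & F [set i | [/\ 0 <= nu i <= 1,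
  [/\ `|X0 i| <= K, `|dX i| <= K * nu i & `|X i - X0 i - dX i| <= K * nu i ^+ 2]
  & [/\ `|Y0 i| <= K, `|dY i| <= K * nu i & `|Y i - Y0 i - dY i| <= K * nu i ^+ 2]]].
move=> /jetE[K K1 hK] /jetE[L L1 hL]; exists (Num.max K L).
  by rewrite le_max K1.
apply: filterS2 hK hL => i [/andP[n0 n1] a1 a2 a3] [_ b1 b2 b3].
have KM : K <= Num.max K L by rewrite le_max lexx.
have LM : L <= Num.max K L by rewrite le_max lexx orbT.
have n2 : 0 <= nu i ^+ 2 by rewrite exprn_ge0.
split; first exact/andP.
- by split; [exact: le_trans KM | apply: le_trans a2 _; rewrite ler_wpM2r
            | apply: le_trans a3 _; rewrite ler_wpM2r].
- by split; [exact: le_trans LM | apply: le_trans b2 _; rewrite ler_wpM2r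
            | apply: le_trans b3 _; rewrite ler_wpM2r].
Qed.

Lemma jet_ext X X0 dX Y Y0 dY : F [set i | [/\ X i = Y i, X0 i = Y0 i & dX i = dY i]] ->
  jet X X0 dX -> jet Y Y0 dY.
by move=> e [K hK]; exists K; apply: filterS2 e hK => i /= [<- <- <-]. Qed.

Lemma jet_eq X X0 dX Y0 dY : jet X X0 dX -> (forall i, X0 i = Y0 i) ->
  (forall i, dX i = dY i) -> jet X Y0 dY.
by move=> h e1 e2; apply: jet_ext h; apply: filterE => i; split. Qed.

Lemma jet_cst X K : (forall i, `|X i| <= K) -> jet X X (fun=> 0).
move=> hK; exists K; apply: filterS nu01 => i /andP[n0 n1].
have K0 : 0 <= K by exact: le_trans (hK i).
by split => //; rewrite ?subrr ?subr0 normr0 mulr_ge0 // exprn_ge0.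
Qed.

Lemma jet_const (x : R) : jet (fun=> x) (fun=> x) (fun=> 0).
by apply: (@jet_cst _ `|x|). Qed.

(** The increment itself serves as the differential, with zero remainder. This is how independent
    variables enter the calculus. *)
Lemma jet_lip X X0 K : F [set i | `|X0 i| <= K /\ `|X i - X0 i| <= K * nu i] ->
  jet X X0 (fun i => X i - X0 i).
move=> h; exists K; apply: filterS2 nu01 h => i /andP[n0 n1] [h1 h2].
have K0 : 0 <= K by exact: le_trans h1.
by split => //; rewrite subrr normr0 mulr_ge0 // exprn_ge0.
Qed.

Lemma jet_near X X0 dX : jet X X0 dX -> exists2 K, 0 < K & F [set i |
  [/\ `|X0 i| <= K, `|X i| <= K & `|X i - X0 i| <= K * nu i]].
move=> /jetE[K K1 hK]; exists (3 * K); first by lra.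
apply: filterS hK => i /= [/andP[n0 n1] a1 a2 a3].
have K0 : 0 <= K by lra.
have n2 : K * nu i ^+ 2 <= K * nu i by rewrite ler_wpM2l // expr2 ler_piMl.
have n3 : K * nu i <= K by rewrite ler_piMr.
have h : `|X i - X0 i| <= K * nu i + K * nu i.
  have -> : X i - X0 i = (X i - X0 i - dX i) + dX i by ring.
  by apply: normD_le => //; exact: le_trans n2.
split; [lra | | by apply: le_trans h _; nra].
have -> : X i = X0 i + (X i - X0 i) by ring.
apply: le_trans (normD_le a1 h) _; nra.
Qed.

Lemma jetD X X0 dX Y Y0 dY : jet X X0 dX -> jet Y Y0 dY ->
  jet (fun i => X i + Y i) (fun i => X0 i + Y0 i) (fun i => dX i + dY i).
move=> h1 h2; have [K K1 hK] := jet2E h1 h2; exists (K + K).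
apply: filterS hK => i /= [n01 [a1 a2 a3] [b1 b2 b3]]; rewrite !mulrDl.
split; [exact: normD_le | exact: normD_le |].
rewrite (_ : X i + Y i - _ - _ = (X i - X0 i - dX i) + (Y i - Y0 i - dY i)); last by ring.
by apply: normD_le.
Qed.

Lemma jetM X X0 dX Y Y0 dY : jet X X0 dX -> jet Y Y0 dY ->
  jet (fun i => X i * Y i) (fun i => X0 i * Y0 i)
      (fun i => X0 i * dY i + dX i * Y0 i).
move=> h1 h2; have [K K1 hK] := jet2E h1 h2; exists (6 * K ^+ 2).
apply: filterS hK => i /= [/andP[n0 n1] [a1 a2 a3] [b1 b2 b3]].
set n := nu i in n0 n1 a2 a3 b2 b3 *.
have K2 : 0 <= K ^+ 2 by rewrite exprn_ge0 //; lra.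
have n2 : 0 <= n ^+ 2 by rewrite exprn_ge0.
have n21 : n ^+ 2 <= n by rewrite expr2; nra.
have KK : K ^+ 2 = K * K by [].
have K2n : 0 <= K ^+ 2 * n by rewrite mulr_ge0.
split.
- by apply: le_trans (normM_le a1 b1) _; rewrite -expr2; lra.
- apply: le_trans (normD_le (normM_le a1 b2) (normM_le a2 b1)) _.
  have -> : K * (K * n) + K * n * K = 2 * (K ^+ 2 * n) by ring.
  by rewrite -mulrA -/n; lra.
- set eX := X i - _ - _ in a3; set eY := Y i - _ - _ in b3.
  have -> : X i * Y i - X0 i * Y0 i - (X0 i * dY i + dX i * Y0 i) =
    dX i * dY i + X0 i * eY + eX * Y0 i + dX i * eY + eX * dY i + eX * eY.
    by rewrite /eX /eY; ring.
  have a3' : `|eX| <= K * n by apply: le_trans a3 _; nra.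
  apply: le_trans (normD_le (normD_le (normD_le (normD_le (normD_le
    (normM_le a2 b2) (normM_le a1 b3)) (normM_le a3 b1)) (normM_le a2 b3))
    (normM_le a3 b2)) (normM_le a3' b3)) _.
  have h3 : n * n ^+ 2 <= n ^+ 2 by nra.
  have -> : K * n * (K * n) + K * (K * n ^+ 2) + K * n ^+ 2 * K +
    K * n * (K * n ^+ 2) + K * n ^+ 2 * (K * n) + K * n * (K * n ^+ 2) =
    K ^+ 2 * (3 * n ^+ 2 + 3 * (n * n ^+ 2)) by ring.
  have -> : 6 * K ^+ 2 * n ^+ 2 = K ^+ 2 * (6 * n ^+ 2) by ring.
  by rewrite ler_wpM2l //; lra.
Qed.

Lemma jetZ x X X0 dX : jet X X0 dX ->
  jet (fun i => x * X i) (fun i => x * X0 i) (fun i => x * dX i).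
move=> h; apply: jet_eq (jetM (jet_const x) h) _ _ => // i; ring.
Qed.

Lemma jetN X X0 dX : jet X X0 dX ->
  jet (fun i => - X i) (fun i => - X0 i) (fun i => - dX i).
move=> h; apply: jet_ext (jetZ (-1) h).
by apply: filterE => i /=; rewrite !mulN1r.
Qed.

Lemma jetB X X0 dX Y Y0 dY : jet X X0 dX -> jet Y Y0 dY ->
  jet (fun i => X i - Y i) (fun i => X0 i - Y0 i) (fun i => dX i - dY i).
by move=> h1 h2; exact: jetD h1 (jetN h2). Qed.

Lemma jetV X X0 dX (m : R) : 0 < m -> F [set i | m <= `|X0 i|] -> F [set i | m <= `|X i|] ->
  jet X X0 dX -> jet (fun i => (X i)^-1) (fun i => (X0 i)^-1)
      (fun i => - dX i / X0 i ^+ 2).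
move=> m0 hm0 hm h; have [K K1 hK] := jetE h; have [L L1 hL] := jet_near h.
have mV : 0 <= m^-1 by rewrite invr_ge0 ltW.
exists (m^-1 + K * (m^-1 ^+ 2) + L * K * (m^-1 ^+ 3)).
apply: filterS3 (filterI hm0 hm) hK hL =>
  i [/= x0m xm] [/andP[n0 n1] a1 a2 a3] [b1 b2 b3].
set n := nu i in n0 n1 a2 a3 b3 *.
have x00 : X0 i != 0 by rewrite -normr_gt0; lra.
have xx0 : X i != 0 by rewrite -normr_gt0; lra.
have v0 : `|(X0 i)^-1| <= m^-1 by rewrite normrV ?unitfE // lef_pV2 ?posrE //; lra.
have v1 : `|(X i)^-1| <= m^-1 by rewrite normrV ?unitfE // lef_pV2 ?posrE //; lra.
have m2 : 0 <= m^-1 ^+ 2 by rewrite exprn_ge0.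
have m3 : 0 <= m^-1 ^+ 3 by rewrite exprn_ge0.
have n2 : 0 <= n ^+ 2 by rewrite exprn_ge0.
have K0 : 0 <= K by lra.
have p1 : 0 <= K * m^-1 ^+ 2 by rewrite mulr_ge0.
have p2 : 0 <= L * K * m^-1 ^+ 3 by rewrite !mulr_ge0 //; lra.
split.
- by apply: le_trans v0 _; rewrite -addrA lerDl addr_ge0.
- rewrite mulNr normrN -exprVn.
  have v2 : `|(X0 i)^-1 ^+ 2| <= m^-1 ^+ 2 by rewrite !expr2; exact: normM_le.
  apply: le_trans (normM_le a2 v2) _.
  have -> : K * n * m^-1 ^+ 2 = (K * m^-1 ^+ 2) * n by ring.
  by rewrite ler_wpM2r //; lrc mV p2.
- have -> : (X i)^-1 - (X0 i)^-1 - - dX i / X0 i ^+ 2 =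
    dX i * (X i - X0 i) * ((X i)^-1 * ((X0 i)^-1 * (X0 i)^-1))
    - (X i - X0 i - dX i) * ((X i)^-1 * (X0 i)^-1) by field; rewrite x00 xx0.
  apply: le_trans (normB_le (normM_le (normM_le a2 b3) (normM_le v1 (normM_le v0 v0)))
    (normM_le a3 (normM_le v1 v0))) _.
  have -> : K * n * (L * n) * (m^-1 * (m^-1 * m^-1)) + K * n ^+ 2 * (m^-1 * m^-1) =
    (K * (m^-1 ^+ 2) + L * K * (m^-1 ^+ 3)) * n ^+ 2 by ring.
  by rewrite ler_wpM2r //; lrc mV.
Qed.

(** Chain rule. The Taylor bound of [h] is required only at the pairs that occur, so that functions
    singular elsewhere, such as [ln], are covered. *)
Lemma jet_fun X X0 dX (h h' : R -> R) K : jet X X0 dX -> 0 <= K ->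
  F [set i | [/\ `|h (X0 i)| <= K, `|h' (X0 i)| <= K &
     `|h (X i) - h (X0 i) - h' (X0 i) * (X i - X0 i)| <= K * (X i - X0 i) ^+ 2]] ->
  jet (fun i => h (X i)) (fun i => h (X0 i)) (fun i => h' (X0 i) * dX i).
move=> hX K0 hh; have [L L1 hL] := jetE hX; have [M M1 hM] := jet_near hX.
exists (K + K * L + K * M ^+ 2).
apply: filterS3 hL hM hh => i /= [/andP[n0 n1] a1 a2 a3] [b1 b2 b3] [c1 c2 c3].
set n := nu i in n0 n1 a2 a3 b3 *.
have n2 : 0 <= n ^+ 2 by rewrite exprn_ge0.
have M2 : 0 <= M ^+ 2 by rewrite exprn_ge0 // ltW.
have KL : 0 <= K * L by rewrite mulr_ge0 //; lra.
have KM : 0 <= K * M ^+ 2 by rewrite mulr_ge0.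
split.
- by apply: le_trans c1 _; rewrite -addrA lerDl addr_ge0.
- apply: le_trans (normM_le c2 a2) _; rewrite mulrA ler_wpM2r //; lra.
- have -> : h (X i) - h (X0 i) - h' (X0 i) * dX i =
    (h (X i) - h (X0 i) - h' (X0 i) * (X i - X0 i)) + h' (X0 i) * (X i - X0 i - dX i).
    by ring.
  apply: le_trans (normD_le c3 (normM_le c2 a3)) _.
  have : (X i - X0 i) ^+ 2 <= M ^+ 2 * n ^+ 2.
    by rewrite -exprMn -real_normK ?num_real // lerXn2r ?nnegrE ?mulr_ge0 // ltW.
  move=> e; have := ler_wpM2l K0 e; have := mulr_ge0 K0 n2; lra.
Qed.

Lemma jet_exp X X0 dX : jet X X0 dX ->
  jet (fun i => expR (X i)) (fun i => expR (X0 i)) (fun i => expR (X0 i) * dX i).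
move=> h; have [K K0 hK] := jet_near h.
apply: (@jet_fun _ _ _ expR expR (expR K * expR (2 * K)) h).
  by rewrite mulr_ge0 // expR_ge0.
apply: filterS hK => i /= [a1 a2 _].
have e1 : expR (X0 i) <= expR K by rewrite ler_expR (le_trans (ler_norm _)).
have e2 : 1 <= expR (2 * K) by have := expR_ge1Dx (2 * K); lra.
have e3 : expR (X0 i) <= expR K * expR (2 * K).
  by apply: le_trans e1 _; rewrite ler_peMr // expR_ge0.
split; [by rewrite ger0_norm ?expR_ge0 | by rewrite ger0_norm ?expR_ge0 |].
have -> : expR (X i) - expR (X0 i) - expR (X0 i) * (X i - X0 i) =
  expR (X0 i) * (expR (X i - X0 i) - 1 - (X i - X0 i)).
  by rewrite expRB; field; rewrite gt_eqF // expR_gt0.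
rewrite -mulrA normrM ger0_norm ?expR_ge0 //.
apply: ler_pM; rewrite ?expR_ge0 //.
apply: le_trans (expR_taylor _) _; rewrite mulrC ler_wpM2r ?sqr_ge0 // ler_expR.
by have := normB_le a2 a1; lra.
Qed.

Lemma jet_ln X X0 dX (m : R) : 0 < m -> F [set i | m <= X0 i] -> F [set i | m <= X i] ->
  jet X X0 dX -> jet (fun i => ln (X i)) (fun i => ln (X0 i)) (fun i => dX i / X0 i).
move=> m0 hm0 hm h; have [K K0 hK] := jet_near h.
have mV : 0 < m^-1 by rewrite invr_gt0.
have mV2 : 0 < m^-1 ^+ 2 by rewrite exprn_gt0.
suff : jet (fun i => ln (X i)) (fun i => ln (X0 i)) (fun i => (X0 i)^-1 * dX i).
  by move=> H; apply: jet_eq H _ _ => // i; rewrite mulrC.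
apply: (@jet_fun _ _ _ (@ln R) (fun x => x^-1) (K + m^-1 + m^-1 ^+ 2) h); first by lra.
apply: filterS3 hm0 hm hK => i /= h0 h1 [a1 a2 _].
have x0 : 0 < X0 i by lra.
have x1 : 0 < X i by lra.
have v0 : (X0 i)^-1 <= m^-1 by rewrite lef_pV2 ?posrE.
have v1 : (X i)^-1 <= m^-1 by rewrite lef_pV2 ?posrE.
split.
- apply: le_trans (ln_norm_le m0 h0) _; have := ler_norm (X0 i); lra.
- by rewrite ger0_norm ?invr_ge0 ?ltW //; lra.
- rewrite (mulrC (X0 i)^-1); apply: le_trans (ln_taylor x0 x1) _.
  rewrite mulrC ler_wpM2r ?sqr_ge0 // invfM.
  suff : (X0 i)^-1 * (X i)^-1 <= m^-1 ^+ 2 by lra.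
  by rewrite expr2; apply: ler_pM; rewrite // invr_ge0 ltW.
Qed.

Lemma jet_pow X X0 dX (m g : R) : 0 < m -> F [set i | m <= X0 i] -> F [set i | m <= X i] ->
  jet X X0 dX -> jet (fun i => X i `^ g) (fun i => X0 i `^ g)
    (fun i => g * X0 i `^ (g - 1) * dX i).
move=> m0 hm0 hm h.
have := jet_exp (jetZ g (jet_ln m0 hm0 hm h)).
apply: jet_ext; apply: filterS2 hm0 hm => i /= h0 h1.
have x0 : X0 i != 0 by rewrite gt_eqF //; lra.
have x1 : X i != 0 by rewrite gt_eqF //; lra.
have e Z : Z != 0 -> expR (g * ln Z) = Z `^ g by move=> z0; rewrite /powR (negbTE z0).
rewrite !e //; split => //.
have -> : X0 i `^ g = X0 i * X0 i `^ (g - 1).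
  by rewrite -{2}(powRr1 (ltW (lt_le_trans m0 h0))) -powRD ?x0 ?implybT // addrC subrK.
by field.
Qed.
End Jets.

(** * Differentiation rules whose value is fixed by a separate equation, left to [ring] or
    [field] *)

Section Derive.
Variable R : realType.
Implicit Types (f g : R -> R) (x a b c : R).

Lemma dv_cst x a c : c = 0 -> is_derive x 1 (fun=> a) c.
by move=> ->; exact: is_derive_cst. Qed.

Lemma dv_id x c : c = 1 -> is_derive x 1 (fun t : R => t) c.
by move=> ->; exact: is_derive_id. Qed.

Lemma dv_add f g x a b c : is_derive x 1 f a -> is_derive x 1 g b -> c = a + b ->
  is_derive x 1 (fun t => f t + g t) c.
by move=> h k ->; exact: is_deriveD. Qed.

Lemma dv_sub f g x a b c : is_derive x 1 f a -> is_derive x 1 g b -> c = a - b ->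
  is_derive x 1 (fun t => f t - g t) c.
by move=> h k ->; exact: is_deriveB. Qed.

Lemma dv_mul f g x a b c : is_derive x 1 f a -> is_derive x 1 g b ->
  c = f x * b + g x * a -> is_derive x 1 (fun t => f t * g t) c.
by move=> h k ->; exact: is_deriveM. Qed.

Lemma dv_scale f x a b c : is_derive x 1 f a -> c = b * a ->
  is_derive x 1 (fun t => b * f t) c.
by move=> h ->; apply: dv_mul (dv_cst _ _ erefl) h _; rewrite mulr0 addr0.
Qed.

Lemma dv_aff x a b c : c = b -> is_derive x 1 (fun t => a + b * t) c.
move=> ->; have h := dv_scale (dv_id x erefl) (erefl (b * 1)).
by apply: dv_add (dv_cst x a erefl) h _; rewrite add0r mulr1.
Qed.

Lemma dv_pow f x a b c : 0 < f x -> is_derive x 1 f a ->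
  c = b * f x `^ (b - 1) * a -> is_derive x 1 (fun t => f t `^ b) c.
move=> h k ->; exact: (@is_derive1_comp _ (fun y => y `^ b) f x _ _
  (@is_derive1_powR _ b _ h) k).
Qed.

Lemma dv_powaff x a b (g : R) c : 0 < a + b * x -> c = g * (a + b * x) `^ (g - 1) * b ->
  is_derive x 1 (fun t => (a + b * t) `^ g) c.
move=> h ->.
exact: (@dv_pow (fun t => a + b * t) x b g _ h (dv_aff x a (erefl b)) erefl).
Qed.
End Derive.

(** * Distortion of increasing maps *)

Section Slopes.
Variable R : realType.
Implicit Types (g h : R -> R) (a b x y eta D : R).

(* All slopes of g on [a, b] agree with D up to a factor e^eta. *)
Definition slopes eta g a b D := forall z w, a <= z -> z <= w -> w <= b ->
  D * (w - z) <= expR eta * (g w - g z) /\ g w - g z <= expR eta * (D * (w - z)).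

Lemma slopes_sub eta g a b D a' b' : a <= a' -> b' <= b ->
  slopes eta g a b D -> slopes eta g a' b' D.
by move=> ha hb h z w h1 h2 h3; apply: h; lra. Qed.

Lemma slopes_comp eta g a b D eta' h D' : 0 <= D' ->
  (forall z w, a <= z -> z <= w -> w <= b -> g z <= g w) ->
  slopes eta g a b D -> slopes eta' h (g a) (g b) D' ->
  slopes (eta + eta') (h \o g) a b (D' * D).
move=> D0 mg hg hh z w h1 h2 h3.
have aw : a <= w by lra.
have zb : z <= b by lra.
have [p1 p2] := hg _ _ h1 h2 h3.
have [q1 q2] := hh _ _ (mg _ _ (lexx _) h1 zb) (mg _ _ h1 h2 h3) (mg _ _ aw h3 (lexx _)).
have e0 := expR_gt0 eta; have e0' := expR_gt0 eta'.
rewrite expRD /=; split.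
  rewrite -mulrA; apply: le_trans (ler_wpM2l D0 p1) _.
  by rewrite mulrCA -mulrA ler_wpM2l // ltW.
apply: le_trans q2 _.
rewrite (mulrC (expR eta)) -!mulrA ler_wpM2l ?(ltW e0') //.
by rewrite (mulrCA (expR eta)) ler_wpM2l.
Qed.

Lemma slopes_weak eta eta' g a b D : 0 <= D -> eta <= eta' ->
  (forall z w, a <= z -> z <= w -> w <= b -> g z <= g w) ->
  slopes eta g a b D -> slopes eta' g a b D.
move=> D0 ee mg h z w h1 h2 h3; have [p1 p2] := h _ _ h1 h2 h3.
have e : expR eta <= expR eta' by rewrite ler_expR.
split.
- by apply: le_trans p1 _; rewrite ler_wpM2r // subr_ge0; apply: mg.
- by apply: le_trans p2 _; rewrite ler_wpM2r // mulr_ge0 // subr_ge0.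
Qed.

Lemma slopes_flip eta g a b D : slopes eta g a b D ->
  slopes eta (fun x => 1 - g (1 - x)) (1 - b) (1 - a) D.
by move=> h z w h1 h2 h3; have [|||p1 p2] := h (1 - w) (1 - z); lra.
Qed.

(** The form in which phi and psi enter the geometric estimates: distortion expressed through
    chords, which survives limits of compositions without any statement about derivatives. *)
Definition sl (d : R) g := [/\ g 0 = 0, g 1 = 1 & forall x y, 0 <= x -> x <= y -> y <= 1 ->
  expR (- d) * (y - x) <= g y - g x /\ g y - g x <= expR d * (y - x)].

Definition flip g x := 1 - g (1 - x).

Lemma flipK g x : flip (flip g) x = g x.
by rewrite /flip (_ : 1 - (1 - x) = x) ; ring. Qed.

Lemma sl_flip d g : sl d g -> sl d (flip g).
case=> g0 g1 h; split; rewrite /flip ?subr0 ?subrr ?g0 ?g1 ?subrr ?subr0 // => x y h1 h2 h3.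
by have [|||p1 p2] := h (1 - y) (1 - x); lra.
Qed.

Lemma sl_lt d g x y : sl d g -> 0 <= x -> x < y -> y <= 1 -> g x < g y.
case=> _ _ h h1 h2 h3; have [p1 _] := h _ _ h1 (ltW h2) h3.
have : 0 < expR (- d) * (y - x) by rewrite mulr_gt0 ?expR_gt0 ?subr_gt0.
by lra.
Qed.

Lemma sl_le d g x y : sl d g -> 0 <= x -> x <= y -> y <= 1 -> g x <= g y.
move=> h h1; rewrite le_eqVlt => /predU1P[-> //|h2 h3].
by apply: ltW; exact: sl_lt h h1 h2 h3.
Qed.

Lemma sl_in d g x : sl d g -> 0 <= x <= 1 -> 0 <= g x <= 1.
move=> h /andP[x0 x1]; have [g0 g1 _] := h.
have e0 := sl_le h (lexx 0) x0 x1; have e1 := sl_le h x0 x1 (lexx 1).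
by rewrite g0 in e0; rewrite g1 in e1; rewrite e0 e1.
Qed.

Lemma sl_bound d g x : sl d g -> 0 <= x <= 1 ->
  expR (- d) * x <= g x /\ g x <= expR d * x.
move=> [g0 g1 h] /andP[x0 x1]; have := h _ _ (lexx 0) x0 x1.
by rewrite g0 !subr0.
Qed.

Lemma sl_lip d g x y : sl d g -> 0 <= x <= 1 -> 0 <= y <= 1 ->
  `|g y - g x| <= expR d * `|y - x|.
move=> h; wlog xy : x y / x <= y.
  move=> H xab yab; have [xy|/ltW yx] := leP x y; first exact: H.
  by rewrite distrC (distrC y); exact: H.
move=> /andP[x0 x1] /andP[y0 y1].
rewrite !ger0_norm ?subr_ge0 // ?(sl_le h) //.
by have [_ _ /(_ _ _ x0 xy y1)[]] := h.
Qed.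

(** The reference slope and the actual slope may both be off by a factor e^d, hence the doubled
    exponent. Any [D] in the range is allowed, in particular 1. *)
Lemma sl_slopes d g D : sl d g -> expR (- d) <= D <= expR d -> slopes (d + d) g 0 1 D.
move=> [_ _ h] /andP[D1 D2] z w h1 h2 h3; have [p1 p2] := h _ _ h1 h2 h3.
have e0 := expR_gt0 d; have e1 : expR d * expR (- d) = 1 by rewrite -expRD subrr expR0.
have wz : 0 <= w - z by rewrite subr_ge0.
rewrite expRD; split.
  apply: (@le_trans _ _ (expR d * (w - z))); first by rewrite ler_wpM2r.
  rewrite -mulrA ler_wpM2l ?(ltW e0) //.
  by apply: le_trans (ler_wpM2l (ltW e0) p1); rewrite mulrA e1 mul1r.
apply: le_trans p2 _; rewrite -mulrA ler_wpM2l ?(ltW e0) // mulrA.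
rewrite -{1}(mul1r (w - z)) ler_wpM2r // -e1 ler_wpM2l // ltW //.
Qed.

(** Chords have slope [al * c ^ (al - 1)] with [c] in [[r1, r2]], and two such values differ at most
    by the factor (r2 / r1) ^ (al - 1). *)
Lemma pow_slope (al r1 r2 x : R) : 1 < al -> 0 < r1 -> r1 <= x <= r2 ->
  slopes ((al - 1) * (ln r2 - ln r1)) (fun t => t `^ al) r1 r2 (al * x `^ (al - 1)).
move=> al1 r10 /andP[x1 x2] z w h1 h2 h3.
have be0 : 0 <= al - 1 by lra.
have [c /andP[c1 c2] ->] : exists2 c, z <= c <= w &
    w `^ al - z `^ al = (al * c `^ (al - 1)) * (w - z).
  have := @mvt R (fun t => t `^ al) (fun c => al * c `^ (al - 1)) z w h2; apply.
  by move=> t /andP[t1 t2]; apply: is_derive1_powR; lra.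
have key s t : r1 <= s <= r2 -> r1 <= t <= r2 ->
    s `^ (al - 1) <= expR ((al - 1) * (ln r2 - ln r1)) * t `^ (al - 1).
  move=> /andP[s1 s2] /andP[t1 t2].
  rewrite /powR !gt_eqF; try lra.
  rewrite -expRD ler_expR -mulrDr ler_wpM2l //.
  have l1 : ln s <= ln r2 by rewrite ler_ln ?posrE //; lra.
  have l2 : ln r1 <= ln t by rewrite ler_ln ?posrE //; lra.
  lra.
have wz : 0 <= al * (w - z) by rewrite mulr_ge0; lra.
have e1 := key x c; have e2 := key c x.
have -> : al * x `^ (al - 1) * (w - z) = x `^ (al - 1) * (al * (w - z)) by ring.
have -> : al * c `^ (al - 1) * (w - z) = c `^ (al - 1) * (al * (w - z)) by ring.
rewrite !mulrA -!(mulrA _ al (w - z)).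
by split; apply: ler_wpM2r => //; [apply: e1 | apply: e2]; apply/andP; split; lrd wz al1 r10 h2 be0.
Qed.
End Slopes.

(* With u' and v' weighted by the multipliers, the linear map of (x, y) is
   injective because u' / Fp + v' / Fq < 1. *)
Lemma two_by_two {R : realType} (Fp Fq u v x y E th : R) : 1 <= Fp -> 1 <= Fq -> 0 <= u <= 1 ->
  0 <= v <= 1 -> u / Fp + v / Fq <= th -> th < 1 ->
  `|Fp * x - u * (x + y)| <= E -> `|Fq * y - v * (x + y)| <= E ->
  (Fp - 1) * `|x| <= (1 + 2 / (1 - th)) * E /\ (Fq - 1) * `|y| <= (1 + 2 / (1 - th)) * E.
move=> p1 q1 /andP[u0 u1] /andP[v0 v1] ht t1 h1 h2.
have p0 : 0 < Fp by lra.
have q0 : 0 < Fq by lra.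
have s0 : 0 <= `|x| + `|y| by rewrite addr_ge0.
have k0 : `|x + y| <= `|x| + `|y| by exact: ler_normD.
have E0 : 0 <= E by apply: le_trans h1.
have bound (F w z : R) : 0 < F -> 0 <= w -> `|F * z - w * (x + y)| <= E -> F * `|z| <= w * (`|x| + `|y|) + E.
  move=> F0 w0 h; have e1 : F * `|z| = `|F * z| by rewrite normrM gtr0_norm.
  have := ler_normD (F * z - w * (x + y)) (w * (x + y)); rewrite subrK (_ : `|w * (x + y)| = w * `|x + y|) -?e1; last by rewrite normrM ger0_norm.
  by have := ler_wpM2l w0 k0; lrc h.
have b1 := bound _ _ _ p0 u0 h1; have b2 := bound _ _ _ q0 v0 h2.
have div (F w z : R) : 1 <= F -> F * z <= w * (`|x| + `|y|) + E -> z <= w / F * (`|x| + `|y|) + E.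
  move=> F1 h; have F0 : 0 < F by lra.
  rewrite -(ler_pM2l F0) mulrDr mulrA mulrCA mulfV ?gt_eqF // mulr1.
  by apply: le_trans h _; rewrite lerD2l ler_peMl.
have c1 := div _ _ _ p1 b1; have c2 := div _ _ _ q1 b2.
set s := `|x| + `|y| in s0 k0 b1 b2 c1 c2; have es : s = `|x| + `|y| by [].
(* After division by the multipliers the two bounds are added: [th < 1] lets the term [th * s] be
   moved to the left. *)
have c3 : s * (1 - th) <= 2 * E.
  by have := ler_wpM2r s0 ht; rewrite mulrDl; move: c1 c2 es; lra.
have c4 : s <= 2 / (1 - th) * E.
  by rewrite mulrAC ler_pdivlMr ?subr_gt0.
have x1 : `|x| >= 0 by []. have y1 : `|y| >= 0 by [].
have us : u * s <= s by rewrite ler_piMl. have vs : v * s <= s by rewrite ler_piMl.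
by split; rewrite mulrBl mul1r [(1 + _) * E]mulrDl mul1r; lrc b1 b2 es c3 c4 x1 y1 us vs.
Qed.

(** The constant of [two_by_two] for [th = 2 / (1 + al)], a number strictly between 1 / al and 1
    that leaves room for distortion. *)
Definition coneK {R : realType} (al : R) := 1 + 2 / (1 - 2 / (1 + al)).

(** [N] is the norm of the vector, [lU] and [lV] are the lengths of U and V, [mu] the smaller of
    their inverses, and [W] an error term. A large [du] or [dv] forces a large normalized shift,
    [N * mu <= 4 * T]; then [two_by_two] bounds [T] by the image vector plus a multiple of [ka * T]
    that is absorbed on the left. *)
Lemma cone_combine {R : realType} (al ka w0 Fp Fq u v x y du dv Du Dv lU lV N mu W : R) : 1 < al ->
  (1 + al) / 2 <= Fp -> (1 + al) / 2 <= Fq -> 0 <= u <= 1 -> 0 <= v <= 1 ->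
  u / Fp + v / Fq <= 2 / (1 + al) ->
  `|du| <= 2 * lU * ((Fp - 1) * `|x| + W) -> `|dv| <= 2 * lV * ((Fq - 1) * `|y| + W) ->
  N <= `|du| \/ N <= `|dv| -> 0 <= N -> 0 < mu -> mu * lU <= 1 -> mu * lV <= 1 -> 0 <= W ->
  W <= w0 * ka * (N * mu) -> 0 <= ka -> 0 <= w0 -> w0 * ka <= 1 / 8 ->
  `|Du - (Fp * x - u * (x + y))| <= 10 * ka * ((Fp - 1) * `|x|) + 4 * W + 36 * ka * `|y| ->
  `|Dv - (Fq * y - v * (x + y))| <= 10 * ka * ((Fq - 1) * `|y|) + 4 * W + 36 * ka * `|x| ->
  coneK al * (10 + 16 * w0 + 72 / (al - 1)) * ka <= 1 / 2 ->
  N * mu <= 8 * coneK al * Num.max `|Du| `|Dv|.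
move=> al1 hFp hFq hu hv hth hdu hdv hN N0 mu0 hU hV W0 hW k0 w00 wk hDu hDv hK.
have Fp1 : 0 <= Fp - 1 by lrc al1 hFp.
have Fq1 : 0 <= Fq - 1 by lrc al1 hFq.
set X := (Fp - 1) * `|x| in hdu hDu *; set Y := (Fq - 1) * `|y| in hdv hDv *.
have X0 : 0 <= X by exact: mulr_ge0.
have Y0 : 0 <= Y by exact: mulr_ge0.
pose T := Num.max X Y; have XT : X <= T by rewrite le_max lexx.
have YT : Y <= T by rewrite le_max lexx orbT.
have T0 : 0 <= T by exact: le_trans XT.
have NT : N * mu <= 2 * (T + W).
  have side (l Z D : R) : `|D| <= 2 * l * (Z + W) -> 0 <= Z -> Z <= T -> mu * l <= 1 -> N <= `|D| -> N * mu <= 2 * (T + W).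
    move=> h1 Z0 ZT hl h; apply: (@le_trans _ _ (2 * l * (Z + W) * mu)); first by rewrite ler_pM2r //; lra.
    have -> : 2 * l * (Z + W) * mu = 2 * ((mu * l) * (Z + W)) by ring.
    have h2 : mu * l * (Z + W) <= Z + W by rewrite ler_piMl //; lrc W0 Z0.
    by lrc ZT h2.
  by case: hN; [exact: (side _ _ _ hdu X0 XT hU) | exact: (side _ _ _ hdv Y0 YT hV)].
have n0 : 0 <= N * mu by rewrite mulr_ge0 // ltW.
have W8 : W <= 1 / 8 * (N * mu) by apply: le_trans hW _; exact: ler_wpM2r.
have N4 : N * mu <= 4 * T by lrc NT n0 W8.
have WT : W <= 4 * w0 * ka * T.
  apply: (le_trans hW); have wk0 : 0 <= w0 * ka by exact: mulr_ge0.
  by have := ler_wpM2l wk0 N4; lrc.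
have small (F z Z : R) : (1 + al) / 2 <= F -> Z = (F - 1) * `|z| -> Z <= T -> `|z| <= 2 / (al - 1) * T.
  move=> hF -> hZ; rewrite mulrAC ler_pdivlMr ?subr_gt0 //.
  have : 0 <= (F - 1 - (al - 1) / 2) * `|z| by apply: mulr_ge0 => //; clear - hF al1; lra.
  by move: hZ; clear; lra.
have xs := small _ _ _ hFp (erefl X) XT; have ys := small _ _ _ hFq (erefl Y) YT.
(* The three errors are expressed through [T]: [4 * W] gives [16 * w0] by [WT], and [36 * ka * |y|]
   gives [72 / (al - 1)] since both multipliers exceed 1 by at least [(al - 1) / 2]. *)
pose K1 := 10 + 16 * w0 + 72 / (al - 1); pose E := Num.max `|Du| `|Dv| + K1 * ka * T.
have err (Z z : R) : Z <= T -> `|z| <= 2 / (al - 1) * T -> 10 * ka * Z + 4 * W + 36 * ka * `|z| <= K1 * ka * T.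
  move=> h1 h2; have a1 := ler_wpM2l k0 h1; have a2 := ler_wpM2l k0 h2.
  have -> : K1 * ka * T = 10 * (ka * T) + 4 * (4 * w0 * ka * T) + 36 * (ka * (2 / (al - 1) * T)).
    by rewrite /K1; field; rewrite subr_eq0 gt_eqF.
  by move: a1 a2 WT; clear; lra.
have bd (D Z : R) : `|D - Z| <= K1 * ka * T -> `|D| <= Num.max `|Du| `|Dv| -> `|Z| <= E.
  move=> h1 h2; have := ler_normB D (D - Z); have -> : D - (D - Z) = Z by [ring]; rewrite /E; move: h1 h2; clear; lra.
have mu_ : `|Du| <= Num.max `|Du| `|Dv| by rewrite le_max lexx.
have mv_ : `|Dv| <= Num.max `|Du| `|Dv| by rewrite le_max lexx orbT.
have b1 := bd _ _ (le_trans hDu (err _ _ XT ys)) mu_.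
have b2 := bd _ _ (le_trans hDv (err _ _ YT xs)) mv_.
have Fp1' : 1 <= Fp by clear - hFp al1; lra.
have Fq1' : 1 <= Fq by clear - hFq al1; lra.
have th1 : 2 / (1 + al) < 1 by rewrite ltr_pdivrMr; clear - al1 al1; lra.
have [c1 c2] := two_by_two Fp1' Fq1' hu hv hth th1 b1 b2.
have TE : T <= coneK al * E by rewrite ge_max c1 c2.
move: TE; rewrite /E; set M := Num.max _ _ => TE.
have : coneK al * K1 * ka * T <= 1 / 2 * T by exact: ler_wpM2r.
by move: TE; rewrite mulrDr !mulrA; move: N4; clear; lra.
Qed.

(** On this range [(1 + 2 * x) * (1 - x) >= 1], while [expR x * (1 - x) <= 1]. *)
Lemma exp_lin {R : realType} (x : R) : 0 <= x <= 1 / 2 -> expR x <= 1 + 2 * x.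
move=> /andP[x0 x1]; have h := @expR_ge1Dx R (- x); have e2 : expR x * expR (- x) = 1 by rewrite -expRD subrr expR0.
have ep := expR_gt0 x; rewrite leNgt; apply/negP => h2.
have h3 : expR x * (1 - x) <= 1 by rewrite -[leRHS]e2 ler_pM2l.
have : (1 + 2 * x) * (1 - x) < expR x * (1 - x) by rewrite ltr_pM2r //; lra.
by have : 0 <= x * (1 - 2 * x) by [apply: mulr_ge0 => //; lra]; lra.
Qed.

Section Main.
Context {R : realType} {al : R}.
Hypothesis al1 : 1 < al.
Let al0 : 0 < al. by have := al1; lra. Qed.
Let be0 : 0 < al - 1. by have := al1; lra. Qed.
Tactic Notation "lrc" hyp_list(h) := clear - al1 al0 be0 h; lra.

(** * Pure maps and their smoothness at parameter 0 *)

Section PureMaps.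
Implicit Types s x y w tau : R.

Let e1 : R := expR 1.
Let em : R := expR (-1).

Lemma expRm1_e : 0 < em /\ em < 1 /\ 1 < e1.
by rewrite /em /e1 expR_gt0 expR_lt1 expR_gt1 oppr_lt0 ltr01. Qed.

Lemma pow_bd g y : em <= y <= e1 -> `|y `^ g| <= expR `|g|.
move=> /andP[y1 y2]; have [m0 _] := expRm1_e; have y0 : 0 < y by lra.
rewrite ger0_norm ?powR_ge0 // /powR gt_eqF // ler_expR.
apply: le_trans (ler_norm _) _; rewrite normrM ler_piMr // ler_norml.
have -> : -1 = ln em :> R by rewrite /em expRK.
have -> : 1 = ln e1 :> R by rewrite /e1 expRK.
by rewrite !ler_ln ?posrE ?expR_gt0 // y1.
Qed.

Lemma pow_quad g : exists2 K, 0 < K & forall x y, em <= x <= e1 -> em <= y <= e1 ->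
  [/\ `|x `^ g| <= K, `|y `^ g - x `^ g| <= K * `|y - x| &
   `|y `^ g - x `^ g - g * x `^ (g - 1) * (y - x)| <= K * (y - x) ^+ 2].
have [m0 _] := expRm1_e.
have dp h x : em <= x <= e1 -> is_derive x 1 (fun t => t `^ h) (h * x `^ (h - 1)).
  by move=> /andP[x1 _]; apply: is_derive1_powR; lra.
have lp h x y : em <= x <= e1 -> em <= y <= e1 ->
    `|y `^ h - x `^ h| <= `|h| * expR `|h - 1| * `|y - x|.
  apply: (mvt_lip (dp h)) => t t1; rewrite normrM ler_wpM2l //; exact: pow_bd.
pose A := expR `|g|; pose B := `|g| * expR `|g - 1|.
pose C := `|g| * (`|g - 1| * expR `|g - 1 - 1|).
have A0 : 0 < A by exact: expR_gt0.
have B0 : 0 <= B by rewrite mulr_ge0 ?expR_ge0.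
have C0 : 0 <= C by rewrite !mulr_ge0 ?expR_ge0.
exists (A + B + C) => [|x y xd yd]; first by lra.
split.
- by apply: le_trans (pow_bd g xd) _; rewrite -/A; lra.
- by apply: le_trans (lp g _ _ xd yd) _; rewrite ler_wpM2r // -/B; lra.
- apply: le_trans (mvt_quad C0 (dp g) _ xd yd) _.
    move=> s t sd td; rewrite -mulrBr normrM -mulrA ler_wpM2l //; exact: lp.
  by rewrite ler_wpM2r ?sqr_ge0 //; lra.
Qed.

(* [Gam w tau / tau] extends the difference quotient of [(1 + .)^al] at 0;
   [dGam] is its derivative in [w]. *)
Definition Gam w tau := if w == 0 then al * tau else ((1 + w * tau) `^ al - 1) / w.
Definition dGam w tau := if w == 0 then al * (al - 1) / 2 * (tau * tau) else
  w^-1 * (tau * (al * (1 + w * tau) `^ (al - 1))) - (w ^+ 2)^-1 * ((1 + w * tau) `^ al - 1).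
Definition W w := Gam w 1.
Definition dW w := dGam w 1.

(** Keeps the base [1 + w * tau] of every power in [[1 / e, e]] for [tau] in [[0, 1]], where powers
    are uniformly bounded together with their differences. *)
Definition wdom w := em <= 1 + w <= e1.

Lemma wdomM w tau : wdom w -> 0 <= tau <= 1 -> em <= 1 + w * tau <= e1.
have [m0 [m1 e0]] := expRm1_e.
move=> /andP[w1 w2] /andP[t0 t1]; apply/andP; split; nra.
Qed.

Lemma wdomM_gt0 w tau : wdom w -> 0 <= tau <= 1 -> 0 < 1 + w * tau.
by have [m0 _] := expRm1_e; move=> h k; have /andP[h1 _] := wdomM h k; lra.
Qed.

Lemma Gam_derive w tau : wdom w -> 0 <= tau <= 1 ->
  is_derive tau 1 (Gam w) (al * (1 + w * tau) `^ (al - 1)).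
move=> hw ht; have h0 := wdomM_gt0 hw ht; rewrite /Gam; case: eqVneq => [->|w0].
  rewrite mul0r addr0 powR1 mulr1.
  by apply: dv_scale (dv_id _ erefl) _; rewrite mulr1.
have h := dv_sub (dv_powaff (g := al) h0 erefl) (dv_cst tau 1 erefl) erefl.
have := dv_mul h (dv_cst tau w^-1 erefl); apply.
by rewrite mulr0 add0r subr0; field.
Qed.

Lemma dGam_derive w tau : wdom w -> 0 <= tau <= 1 ->
  is_derive tau 1 (dGam w) (al * (al - 1) * tau * (1 + w * tau) `^ (al - 1 - 1)).
move=> hw ht; have h0 := wdomM_gt0 hw ht; rewrite /dGam; case: eqVneq => [->|w0].
  rewrite mul0r addr0 powR1 mulr1.
  apply: dv_scale (dv_mul (dv_id _ erefl) (dv_id _ erefl) erefl) _.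
  by field.
have h := dv_sub (dv_powaff (g := al) h0 erefl) (dv_cst tau 1 erefl) erefl.
have h2 := dv_scale h (erefl ((w ^+ 2)^-1 * _)).
have h3 := dv_scale (dv_powaff (g := al - 1) h0 erefl) (erefl (al * _)).
have h4 := dv_mul (dv_id tau erefl) h3 erefl.
have h5 := dv_scale h4 (erefl (w^-1 * _)).
apply: dv_sub h5 h2 _; by field.
Qed.

Lemma Gam0 w : Gam w 0 = 0.
by rewrite /Gam !mulr0 addr0 powR1 subrr mul0r if_same. Qed.

Lemma dGam0 w : dGam w 0 = 0.
by rewrite /dGam !mulr0 addr0 powR1 subrr mul0r !mulr0 subr0 if_same. Qed.

Lemma in01_0 : 0 <= (0 : R) <= 1. by rewrite lexx ler01. Qed.
Lemma in01_1 : 0 <= (1 : R) <= 1. by rewrite lexx ler01. Qed.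

(** The division by [w] in [W] is removed by passing to [tau]: [Gam w] vanishes at [tau = 0], and
    its [tau]-derivative is an honest power. Mean values in [tau] thus give bounds that are uniform
    through [w = 0]. *)
Lemma W_facts : exists m K, [/\ 0 < m, 0 < K &
  forall w, wdom w -> [/\ m <= W w, W w <= K, `|dW w| <= K &
  forall w', wdom w' -> `|W w' - W w - dW w * (w' - w)| <= K * (w' - w) ^+ 2]].
have [m0 [m1 e0]] := expRm1_e; have b0 := be0; have a0 := al0.
have [K1 K10 hK1] := pow_quad (al - 1).
have [K2 K20 hK2] := pow_quad (al - 1 - 1).
have a1 : 0 < al * K1 by rewrite mulr_gt0 //; lra.
have a2 : 0 < al * (al - 1) * K2 by rewrite !mulr_gt0 //; lra.
exists (al * em `^ (al - 1)), (al * K1 + al * (al - 1) * K2); split; [|lra|].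
  by rewrite mulr_gt0 ?powR_gt0 //; lra.
move=> w hw.
have [c hc ec] := mvt ler01 (fun t => Gam_derive (tau := t) hw).
have [d hd ed] := mvt ler01 (fun t => dGam_derive (tau := t) hw).
have cd := wdomM hw hc; have dd := wdomM hw hd.
rewrite Gam0 !subr0 mulr1 in ec; rewrite dGam0 !subr0 mulr1 in ed.
have a0' := ltW a0.
split.
- rewrite /W ec ler_wpM2l // ge0_ler_powR ?nnegrE; try lrd a0'; by case/andP: cd; lrd a0'.
- have [h1 _ _] := hK1 _ _ cd cd.
  rewrite /W ec; apply: (@le_trans _ _ (al * K1)); last by lrc a2.
  by rewrite ler_wpM2l // (le_trans (ler_norm _)).
- have [h1 _ _] := hK2 _ _ dd dd.
  rewrite /dW ed; apply: (@le_trans _ _ (al * (al - 1) * K2)); last by lrc a1.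
  rewrite normrM; apply: ler_pM => //.
  have aa0 : 0 <= al * (al - 1) by rewrite mulr_ge0 //; lrc b0.
  case/andP: hd => d0 d1; rewrite normrM (ger0_norm aa0) (ger0_norm d0).
  by rewrite ler_piMr.
- move=> w' hw'.
  (* The remainder in [w] is the increment of [Phi] from 0 to 1, and the [tau]-derivative of [Phi]
     is a Taylor remainder of the power [al - 1]. *)
  pose Phi t := Gam w' t - Gam w t - (w' - w) * dGam w t.
  have dPhi (t : R) : 0 <= t <= 1 -> is_derive t 1 Phi
      (al * ((1 + w' * t) `^ (al - 1) - (1 + w * t) `^ (al - 1) -
        (al - 1) * (1 + w * t) `^ (al - 1 - 1) * ((1 + w' * t) - (1 + w * t)))).
    move=> ht; apply: dv_sub (dv_sub (Gam_derive hw' ht) (Gam_derive hw ht) erefl)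
      (dv_scale (dGam_derive hw ht) erefl) _; ring.
  have [t ht et] := mvt ler01 dPhi.
  have -> : W w' - W w - dW w * (w' - w) = Phi 1 - Phi 0.
    by rewrite /Phi !Gam0 dGam0 /W /dW; ring.
  rewrite et subr0 mulr1 normrM (ger0_norm a0').
  have [_ _ h3] := hK1 _ _ (wdomM hw ht) (wdomM hw' ht).
  apply: le_trans (ler_wpM2l a0' h3) _.
  have -> : (1 + w' * t - (1 + w * t)) ^+ 2 = (t * t) * (w' - w) ^+ 2 by ring.
  case/andP: ht => t0 t1.
  have tt : t * t <= 1 by nra.
  have q0 := sqr_ge0 (w' - w); set q := (w' - w) ^+ 2 in q0 *.
  have := mulr_ge0 (ltW a1) q0; have := mulr_ge0 (ltW a2) q0.
  have : al * K1 * (t * t) * q <= al * K1 * q.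
    by rewrite ler_wpM2r // ler_piMr // ltW.
  lrc.
Qed.

Definition kk s := expR (s / (al - 1)) - 1.

(** Radius of admissible parameters: [al - 1] puts [kk s] into [wdom], and [1 / 2] makes the
    difference of two parameters at most 1, as the scale of a jet must be. *)
Definition rb := Num.min (al - 1) (1 / 2).

Lemma rb_gt0 : 0 < rb.
by have b0 := be0; rewrite /rb lt_min; andlra. Qed.

Lemma kk_dom s : `|s| <= rb -> wdom (kk s).
rewrite /rb le_min ler_norml => /andP[/andP[h1 h2] _].
rewrite /wdom /kk addrC subrK /em /e1 !ler_expR; apply/andP; split.
  by rewrite ler_pdivlMr // mulN1r.
by rewrite ler_pdivrMr // mul1r.
Qed.

Lemma kk_gtN1 s x : 0 <= x <= 1 -> 0 < 1 + kk s * x.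
move=> /andP[x0 x1]; have h := expR_gt0 (s / (al - 1)); rewrite /kk.
have [->|] := eqVneq x 0; first by lra.
move=> xn; have : 0 < x by lra.
move=> xp; have : 0 < expR (s / (al - 1)) * x by rewrite mulr_gt0.
by lra.
Qed.

Lemma expR_eq1 x : (expR x == 1) = (x == 0).
by rewrite -[1]expR0 (inj_eq (@expR_inj R)). Qed.

Lemma one_kk s : 1 + kk s = expR (s / (al - 1)).
by rewrite /kk addrC subrK. Qed.

Lemma kk0 : kk 0 = 0.
by rewrite /kk mul0r expR0 subrr. Qed.

Lemma kk_eq0 s : (kk s == 0) = (s == 0).
by rewrite /kk subr_eq0 expR_eq1 mulf_eq0 invr_eq0 (gt_eqF be0) orbF.
Qed.

Lemma kk_pow s : (1 + kk s) `^ al = expR (al * s / (al - 1)).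
by rewrite one_kk /powR gt_eqF ?expR_gt0 // expRK -mulrA.
Qed.

Lemma muE s x : s != 0 ->
  mu al s x = ((1 + kk s * x) `^ al - 1) / ((1 + kk s) `^ al - 1).
by move=> s0; rewrite /mu (negbTE s0) kk_pow. Qed.

Lemma mu0 x : mu al 0 x = x.
by rewrite /mu eqxx. Qed.

Lemma W0 : W 0 = al.
by rewrite /W /Gam eqxx mulr1. Qed.

(** This form has no case distinction at [s = 0], so the expansions in [s] follow from those of
    [W]. *)
Lemma mu_W s x : mu al s x = x * W (kk s * x) / W (kk s).
have [->|s0] := eqVneq s 0.
  by rewrite mu0 kk0 mul0r W0; field; rewrite gt_eqF ?al0.
have k0 : kk s != 0 by rewrite kk_eq0.
rewrite muE // /W /Gam !mulr1 (negbTE k0) mulf_eq0 (negbTE k0) /=.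
have [->|x0] := eqVneq x 0; first by rewrite mulr0 addr0 powR1 subrr !mul0r.
have [->|d0] := eqVneq ((1 + kk s) `^ al - 1) 0; first by rewrite !mul0r !invr0 !mulr0.
by field; rewrite d0 k0 x0.
Qed.

(** [mux] and [mus] are the partial derivatives of [mu] in the point and in the parameter. *)
Definition mux s x := al * (1 + kk s * x) `^ (al - 1) / W (kk s).
Definition mus s x := x * ((1 + kk s) / (al - 1)) *
  (dW (kk s * x) * x * W (kk s) - W (kk s * x) * dW (kk s)) / W (kk s) ^+ 2.

Lemma kk_pow_neq0 s : s != 0 -> (1 + kk s) `^ al - 1 != 0.
move=> s0; rewrite kk_pow subr_eq0.
by rewrite expR_eq1 !mulf_eq0 invr_eq0 (negbTE s0) (gt_eqF be0) (gt_eqF al0).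
Qed.

Lemma mu_end s : mu al s 0 = 0 /\ mu al s 1 = 1.
have [->|s0] := eqVneq s 0; first by rewrite !mu0.
by rewrite !muE // mulr0 addr0 powR1 subrr mul0r mulr1 divff // kk_pow_neq0.
Qed.

Lemma mu_derive s x : 0 <= x <= 1 -> is_derive x 1 (mu al s) (mux s x).
move=> hx; have [->|s0] := eqVneq s 0.
  have -> : mu al 0 = fun x => x by apply/funext => t; rewrite mu0.
  by apply: dv_id; rewrite /mux kk0 mul0r addr0 powR1 W0 mulr1 divff // gt_eqF ?al0.
have -> : mu al s = fun x => ((1 + kk s * x) `^ al - 1) / ((1 + kk s) `^ al - 1).
  by apply/funext => t; rewrite muE.
have h0 := kk_gtN1 s hx.
have h := dv_sub (dv_powaff (g := al) h0 erefl) (dv_cst x 1 erefl) erefl.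
have := dv_mul h (dv_cst x ((1 + kk s) `^ al - 1)^-1 erefl); apply.
have k0 : kk s != 0 by rewrite kk_eq0.
have d0 := kk_pow_neq0 s0.
rewrite /mux /W /Gam (negbTE k0) mulr1 mulr0 add0r subr0.
by field; rewrite k0 d0.
Qed.

(** As [mu] fixes 0 and 1, its derivative equals 1 somewhere. Every chord slope is therefore a ratio
    of two derivatives, and the logarithm [(al - 1) * ln (1 + kk s * x)] of the derivative, up to a
    constant, varies only between 0 and [s]. *)
Lemma mu_sl s : sl `|s| (mu al s).
have [m0 m1] := mu_end s; split => // x y x0 xy y1.
have [c /andP[c0 c1] ec] := mvt ler01 (fun t => @mu_derive s t).
have [|d /andP[d0 d1] ed] := @mvt _ (mu al s) (mux s) x y xy.
  by move=> t /andP[t0 t1]; apply: mu_derive; andlra.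
rewrite m0 m1 !subr0 mulr1 in ec; rewrite ed.
have key p q : 0 <= p <= 1 -> 0 <= q <= 1 ->
    (1 + kk s * p) `^ (al - 1) <= expR `|s| * (1 + kk s * q) `^ (al - 1).
  move=> hp hq; have p0 := kk_gtN1 s hp; have q0 := kk_gtN1 s hq.
  rewrite /powR !gt_eqF // -expRD ler_expR.
  have lb t : 0 <= t <= 1 ->
      (s <= 0 -> s <= (al - 1) * ln (1 + kk s * t) <= 0) /\
      (0 <= s -> 0 <= (al - 1) * ln (1 + kk s * t) <= s).
    move=> ht; have t0 := kk_gtN1 s ht; case/andP: ht => tt0 tt1.
    have E : s / (al - 1) = ln (1 + kk s) by rewrite one_kk expRK.
    have e0 := expR_gt0 (s / (al - 1)).
    split=> hs.
      have k0 : kk s <= 0.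
        by rewrite /kk subr_le0 expR_le1 pmulr_lle0 // invr_gt0.
      rewrite mulrC -ler_pdivrMr // E pmulr_lle0 // ln_le0 ?andbT; last by nra.
      by rewrite ler_ln ?posrE //; [nra | rewrite /kk; lrc e0].
    have k0 : 0 <= kk s.
      by have := expR_ge1Dx (s / (al - 1)); have := divr_ge0 hs (ltW be0); rewrite /kk; lrc.
    have kt : 0 <= kk s * t by rewrite mulr_ge0.
    apply/andP; split; first by rewrite mulr_ge0 ?(ltW be0) // ln_ge0 // lerDl.
    rewrite mulrC -ler_pdivlMr // E ler_ln ?posrE //; last by lrc k0.
    by rewrite lerD2l ler_piMr.
  have [hp1 hp2] := lb p hp; have [hq1 hq2] := lb q hq.
  have [s0|s0] := leP 0 s.
    by rewrite ger0_norm //; have := hp2 s0; have := hq2 s0; lrc.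
  by rewrite ltr0_norm //; have := hp1 (ltW s0); have := hq1 (ltW s0); lrc.
have dc : d * 1 = d := mulr1 d.
have cd01 : 0 <= c <= 1 by rewrite c0.
have dd01 : 0 <= d <= 1 by apply/andP; split; lrc x0 y1 d0 d1.
have k1 := key c d cd01 dd01; have k2 := key d c dd01 cd01.
set P := (1 + kk s * c) `^ _ in k1 k2; set Q := (1 + kk s * d) `^ _ in k1 k2.
have P0 : 0 < P by rewrite powR_gt0 // kk_gtN1.
have Q0 : 0 < Q by rewrite powR_gt0 // kk_gtN1.
have eW : W (kk s) = al * P.
  move: ec; rewrite /mux -/P => ec.
  have wn0 : W (kk s) != 0.
    by apply/eqP => w0; move: ec; rewrite w0 invr0 mulr0 => /eqP; rewrite oner_eq0.
  by apply: (mulIf (invr_neq0 wn0)); rewrite -ec divff.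
have -> : mux s d = Q / P by rewrite /mux -/Q eW; field; rewrite !gt_eqF ?al0.
have yx : 0 <= y - x by rewrite subr_ge0.
split; apply: ler_wpM2r => //.
  by rewrite expRN ler_pdivlMr // mulrC ler_pdivrMr ?expR_gt0 // mulrC.
by rewrite ler_pdivrMr.
Qed.
End PureMaps.

(** * Uniform second-order expansions of pure maps and of their zoom parameters *)

Section SecondOrder.
Implicit Types s x y w tau : R.

Lemma kk_bound s : `|s| <= rb -> `|kk s| <= expR 1 / (al - 1) * `|s|.
move=> hs; rewrite /kk; apply: le_trans (expR_sub1_le _) _.
have h : `|s / (al - 1)| = `|s| / (al - 1).
  by rewrite normrM normfV (gtr0_norm be0).
rewrite h (_ : expR 1 / (al - 1) * `|s| = `|s| / (al - 1) * expR 1); last by ring.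
rewrite ler_wpM2l ?mulr_ge0 ?invr_ge0 ?(ltW be0) // ler_expR.
by rewrite ler_pdivrMr // mul1r; move: hs; rewrite /rb le_min => /andP[].
Qed.

(** Triples (base parameter, perturbed parameter, point). With the filter [globally so_dom] a jet is
    a bound valid for all triples at once. *)
Definition so_dom : set (R * R * R) :=
  [set i | [/\ `|i.1.1| <= rb, `|i.1.2| <= rb & 0 <= i.2 <= 1]].
Let F := globally so_dom.
Let nu (i : R * R * R) : R := `|i.1.2 - i.1.1|.
Let FF : Filter F. exact: globally_filter. Qed.

Let hj : jctx F nu.
split => // i [h1 h2 _]; rewrite /= /nu normr_ge0 /=.
apply: le_trans (normB_le h2 h1) _.
have : rb <= 1 / 2 by rewrite /rb ge_min lexx orbT.
lra.
Qed.

Let wdom0 s x : `|s| <= rb -> 0 <= x <= 1 -> @wdom (kk s * x).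
by move=> hs hx; apply: wdomM => //; exact: kk_dom. Qed.

Let jet_kk : jet F nu (fun i => kk i.1.2) (fun i => kk i.1.1)
  (fun i => (1 + kk i.1.1) / (al - 1) * (i.1.2 - i.1.1)).
have h : jet F nu (fun i => i.1.2) (fun i => i.1.1) (fun i => i.1.2 - i.1.1).
  apply: (@jet_lip R _ F nu hj _ _ (Num.max rb 1)) => i [h1 h2 h3] /=; split.
    by rewrite le_max h1.
  by rewrite -/(nu i) ler_peMl ?le_max ?lexx ?orbT ?normr_ge0.
have h2 := jetB hj (jet_exp hj (jetZ hj (al - 1)^-1 h)) (jet_const hj 1).
apply: (jet_ext hj) h2; apply: filterE => i /=.
rewrite one_kk /kk ![_^-1 * _]mulrC !subr0; split => //; field.
by rewrite gt_eqF.
Qed.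

Let jet_x : jet F nu (fun i => i.2) (fun i => i.2) (fun=> 0).
have h : jet F nu (fun i => i.2) (fun i => i.2) (fun i => i.2 - i.2).
  apply: (@jet_lip R _ F nu hj _ _ 1) => i [h1 h2 /andP[x0 x1]] /=.
  by rewrite subrr normr0 mul1r ger0_norm // normr_ge0.
by apply: (jet_eq hj) h _ _ => // i; rewrite subrr.
Qed.

Let jet_kkx := jetM hj jet_kk jet_x.

Let jet_W (X X0 dX : R * R * R -> R) : jet F nu X X0 dX ->
  (forall i, so_dom i -> wdom (X i) /\ wdom (X0 i)) ->
  jet F nu (fun i => W (X i)) (fun i => W (X0 i)) (fun i => dW (X0 i) * dX i).
move=> h hd; have [m [K [m0 K0 hW]]] := W_facts.
apply: (@jet_fun R _ F nu hj _ _ _ W dW K h (ltW K0)) => i di.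
have [d1 d2] := hd i di; have [w1 w2 w3 w4] := hW _ d2.
by split => //; [rewrite ger0_norm //; lra | exact: w4].
Qed.

Let jet_Wk := jet_W jet_kk (fun i => fun h : so_dom i => let: And3 h1 h2 _ := h in
  conj (kk_dom h2) (kk_dom h1)).
Let jet_Wkx := jet_W jet_kkx (fun i => fun h : so_dom i => let: And3 h1 h2 h3 := h in
  conj (wdom0 h2 h3) (wdom0 h1 h3)).

Let jet_Wki : jet F nu (fun i => (W (kk i.1.2))^-1) (fun i => (W (kk i.1.1))^-1)
  (fun i => - (dW (kk i.1.1) * ((1 + kk i.1.1) / (al - 1) * (i.1.2 - i.1.1)))
     / W (kk i.1.1) ^+ 2).
have [m [K [m0 K0 hW]]] := W_facts.
apply: (jetV hj m0 _ _ jet_Wk) => i [h1 h2 _] /=.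
  by have [w1 _ _ _] := hW _ (kk_dom h1); rewrite ger0_norm //; lra.
by have [w1 _ _ _] := hW _ (kk_dom h2); rewrite ger0_norm //; lra.
Qed.

Lemma W_neq0 s : `|s| <= rb -> W (kk s) != 0.
have [m [K [m0 K0 hW]]] := W_facts.
by move=> hs; have [w1 _ _ _] := hW _ (kk_dom hs); rewrite gt_eqF //; lra.
Qed.

Lemma mu_s_quad : exists2 K, 0 < K & forall s s' x, `|s| <= rb -> `|s'| <= rb ->
  0 <= x <= 1 -> `|mus s x * (s' - s)| <= K * `|s' - s| /\
    `|mu al s' x - mu al s x - mus s x * (s' - s)| <= K * (s' - s) ^+ 2.
have h := jetM hj (jetM hj jet_x jet_Wkx) jet_Wki.
have {}h : jet F nu (fun i => mu al i.1.2 i.2) (fun i => mu al i.1.1 i.2)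
    (fun i => mus i.1.1 i.2 * (i.1.2 - i.1.1)).
  apply: (jet_ext hj) h => i [h1 h2 h3] /=; rewrite !(mu_W); split => //.
  rewrite /mus; field; rewrite W_neq0 // gt_eqF //.
have [K K1 hK] := jetE hj h; exists K; first by lra.
move=> s s' x hs hs' hx.
have := hK (s, s', x) (And3 hs hs' hx); rewrite /nu /= => -[_ _ a2 a3].
by rewrite real_normK ?num_real in a3.
Qed.

Lemma mux_s_lip : exists2 K, 0 < K & forall s s' x, `|s| <= rb -> `|s'| <= rb ->
  0 <= x <= 1 -> `|mux s x| <= K /\ `|mux s' x - mux s x| <= K * `|s' - s|.
have [m0 _] := @expRm1_e.
have hp := jet_pow hj (al - 1) m0
   (fun i (h : so_dom i) => let: And3 h1 h2 h3 := h in proj1 (andP (wdom0 h1 h3)))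
   (fun i (h : so_dom i) => let: And3 h1 h2 h3 := h in proj1 (andP (wdom0 h2 h3)))
   (jetD hj (jet_const hj 1) jet_kkx).
have h := jetM hj (jetZ hj al hp) jet_Wki.
have [K K1 hK] := jet_near hj h; exists K; first by lra.
move=> s s' x hs hs' hx.
by have := hK (s, s', x) (And3 hs hs' hx); rewrite /nu /= => -[].
Qed.

(** For [s = 0] the map is the identity, and its curvature is of the order of [kk s]; this produces
    the factor [|s|]. *)
Lemma mu_x_quad : exists2 K, 0 < K & forall s x x', `|s| <= rb ->
  0 <= x <= 1 -> 0 <= x' <= 1 ->
  `|mu al s x' - mu al s x - mux s x * (x' - x)| <= K * `|s| * (x' - x) ^+ 2.
have [K0 K00 hK0] := pow_quad (al - 1).
have [m [KW [m0 KW0 hW]]] := W_facts.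
pose C := al / m * K0 * (expR 1 / (al - 1)).
have C0 : 0 < C by rewrite /C !mulr_gt0 ?invr_gt0 ?expR_gt0.
exists C => // s x x' hs hx hx'.
have [w1 _ _ _] := hW _ (kk_dom hs).
have Cs : 0 <= C * `|s| by rewrite mulr_ge0 // ltW.
apply: (mvt_quad Cs (fun t => @mu_derive s t)) => // t t' ht ht'.
have [_ h2 _] := hK0 _ _ (wdom0 hs ht) (wdom0 hs ht').
rewrite /mux -mulrBl -mulrBr !normrM normfV.
rewrite (gtr0_norm al0) (gtr0_norm (lt_le_trans m0 w1)).
have e : 1 + kk s * t' - (1 + kk s * t) = kk s * (t' - t) by ring.
rewrite e normrM in h2.
have -> : C * `|s| * `|t' - t| = al * (K0 * (expR 1 / (al - 1) * `|s| * `|t' - t|)) / m.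
  by rewrite /C; field; rewrite !gt_eqF.
apply: ler_pM; rewrite ?mulr_ge0 ?normr_ge0 ?invr_ge0 ?(ltW al0) //.
- by lra.
- rewrite ler_wpM2l ?(ltW al0) //; apply: le_trans h2 _.
  by rewrite ler_wpM2l ?(ltW K00) // ler_wpM2r // kk_bound.
- by rewrite lef_pV2 ?posrE //; lra.
Qed.

(** Every term of the remainder carries a factor [|s|] or [|s' - s|]. This is what makes the
    remainders summable over an infinite time set, although the displacement [x' - x] does not decay
    with time. *)
Definition so_family (f fx fs : R -> R -> R) := exists2 K, 0 < K &
  forall s s' x x', `|s| <= rb -> `|s'| <= rb -> 0 <= x <= 1 -> 0 <= x' <= 1 ->
  [/\ `|fs s x * (s' - s)| <= K * `|s' - s|, `|fx s x| <= K &
   `|f s' x' - f s x - (fs s x * (s' - s) + fx s x * (x' - x))| <=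
     K * ((s' - s) ^+ 2 + `|s| * (x' - x) ^+ 2 + `|s' - s| * `|x' - x|)].

Lemma so_familyP (f fx fs : R -> R -> R) K1 K2 K3 :
  (forall s s' x, `|s| <= rb -> `|s'| <= rb -> 0 <= x <= 1 ->
    `|fs s x * (s' - s)| <= K1 * `|s' - s| /\
    `|f s' x - f s x - fs s x * (s' - s)| <= K1 * (s' - s) ^+ 2) ->
  (forall s s' x, `|s| <= rb -> `|s'| <= rb -> 0 <= x <= 1 ->
    `|fx s x| <= K2 /\ `|fx s' x - fx s x| <= K2 * `|s' - s|) ->
  (forall s x x', `|s| <= rb -> 0 <= x <= 1 -> 0 <= x' <= 1 ->
    `|f s x' - f s x - fx s x * (x' - x)| <= K3 * `|s| * (x' - x) ^+ 2) ->
  0 < K1 -> 0 < K2 -> 0 < K3 -> so_family f fx fs.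
move=> h1 h2 h3 p1 p2 p3; exists (K1 + K2 + K3); first by lra.
move=> s s' x x' hs hs' hx hx'.
have [a1 a2] := h1 _ _ _ hs hs' hx; have [b1 b2] := h2 _ _ _ hs hs' hx.
have c := h3 _ _ _ hs' hx hx'.
have n0 := normr_ge0 (s' - s); have n1 := normr_ge0 (x' - x).
split.
- by apply: le_trans a1 _; rewrite ler_wpM2r //; lra.
- by apply: le_trans b1 _; lra.
have -> : f s' x' - f s x - (fs s x * (s' - s) + fx s x * (x' - x)) =
  (f s' x - f s x - fs s x * (s' - s)) + ((f s' x' - f s' x - fx s' x * (x' - x)) +
   (fx s' x - fx s x) * (x' - x)) by ring.
apply: le_trans (normD_le a2 (normD_le c (normM_le b2 (lexx _)))) _.
have x1 : `|x' - x| <= 1.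
  by case/andP: hx => ? ?; case/andP: hx' => ? ?; rewrite ler_norml; apply/andP; split; lrd jet_Wki p1 p2 p3 hs b1 b2 c n0 n1 a1 a2 al0 hs'.
have q0 := sqr_ge0 (s' - s); have q1 := sqr_ge0 (x' - x).
have qs : `|s'| <= `|s| + `|s' - s| by rewrite -{1}(subrK s s') addrC; exact: ler_normD.
have qx : (x' - x) ^+ 2 <= `|x' - x|.
  by rewrite -real_normK ?num_real // expr2 ler_piMr.
set S := (s' - s) ^+ 2 in q0 *; set X := (x' - x) ^+ 2 in q1 qx *.
set n := `|s' - s| in n0 qs *; set k := `|x' - x| in n1 x1 qx *.
have sX : `|s'| * X <= `|s| * X + n * k.
  apply: le_trans (ler_wpM2r q1 qs) _; rewrite mulrDl lerD2l ler_wpM2l //.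
have s0 := normr_ge0 s.
have t1 := mulr_ge0 s0 q1; have t2 := mulr_ge0 n0 n1.
have p3' := ltW p3; have := ler_wpM2l p3' sX.
have := mulr_ge0 (ltW p2) q0; have := mulr_ge0 (ltW p3) q0.
have := mulr_ge0 (ltW p1) t1; have := mulr_ge0 (ltW p1) t2.
have := mulr_ge0 (ltW p2) t1; rewrite !mulrDl !mulrDr !mulrA; lrc al1 be0 jet_kk jet_x.
Qed.

Lemma mu_so : so_family (mu al) mux mus.
have [K1 p1 h1] := mu_s_quad; have [K2 p2 h2] := mux_s_lip.
have [K3 p3 h3] := mu_x_quad; exact: so_familyP h1 h2 h3 p1 p2 p3.
Qed.

(** The difference of two pure maps vanishes at both ends and is Lipschitz in [x]. The factor [x] is
    kept because perturbations are later compared with the position of the orbit. *)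
Lemma mu_param_lip : exists2 K, 0 < K & forall s s' x, `|s| <= rb -> `|s'| <= rb ->
  0 <= x <= 1 -> `|mu al s' x - mu al s x| <= K * `|s' - s| * x /\
    `|mu al s' x - mu al s x| <= K * `|s' - s| * (1 - x).
have [K K0 hK] := mux_s_lip; exists K => // s s' x hs hs' hx.
have dd (t : R) : 0 <= t <= 1 -> is_derive t 1 (fun t => mu al s' t - mu al s t) (mux s' t - mux s t).
  by move=> ht; apply: dv_sub (mu_derive s' ht) (mu_derive s ht) erefl.
have l := mvt_lip dd (fun t ht => (hK s s' t hs hs' ht).2).
have [m0 m1] := mu_end s; have [m0' m1'] := mu_end s'.
case/andP: (hx) => x0 x1.
have := l _ _ (@in01_0) hx; have := l _ _ hx (@in01_1).
rewrite m0 m0' m1 m1' !subrr sub0r subr0 normrN subr0 => h1 h2.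
rewrite (ger0_norm x0) in h2; rewrite (_ : `|1 - x| = 1 - x) in h1 => //.
by rewrite ger0_norm // subr_ge0.
Qed.

(** The logarithm of the derivative of [mu s] up to a constant: zooming [mu s] to [[x, y]] gives the
    pure map with parameter [ml s y - ml s x]. [mlx] and [mls] are its partial derivatives. *)
Definition ml s x := (al - 1) * ln (1 + kk s * x).
Definition mlx s x := (al - 1) * (kk s / (1 + kk s * x)).
Definition mls s x := x * (1 + kk s) / (1 + kk s * x).

Let em_lt s x : `|s| <= rb -> 0 <= x <= 1 -> expR (-1) <= 1 + kk s * x.
by move=> hs hx; have /andP[] := wdom0 hs hx. Qed.

Let ml_s_quad : exists2 K, 0 < K & forall s s' x, `|s| <= rb -> `|s'| <= rb ->
  0 <= x <= 1 -> `|mls s x * (s' - s)| <= K * `|s' - s| /\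
    `|ml s' x - ml s x - mls s x * (s' - s)| <= K * (s' - s) ^+ 2.
have h := jetZ hj (al - 1) (jet_ln hj (@expR_gt0 R (-1)) 
   (fun i (h : so_dom i) => let: And3 h1 h2 h3 := h in em_lt h1 h3)
   (fun i (h : so_dom i) => let: And3 h1 h2 h3 := h in em_lt h2 h3)
   (jetD hj (jet_const hj 1) jet_kkx)).
have {}h : jet F nu (fun i => ml i.1.2 i.2) (fun i => ml i.1.1 i.2)
    (fun i => mls i.1.1 i.2 * (i.1.2 - i.1.1)).
  apply: (jet_ext hj) h => i [h1 h2 h3] /=; split => //.
  rewrite /mls; field; rewrite !gt_eqF //=.
  exact: lt_le_trans (expR_gt0 _) (em_lt h1 h3).
have [K K1 hK] := jetE hj h; exists K; first by lra.
move=> s s' x hs hs' hx.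
have := hK (s, s', x) (And3 hs hs' hx); rewrite /nu /= => -[_ _ a2 a3].
by rewrite real_normK ?num_real in a3.
Qed.

Let ml_x s x : `|s| <= rb -> 0 <= x <= 1 ->
  `|mlx s x| <= expR 1 * expR 1 * `|s|.
move=> hs hx; have h := em_lt hs hx; have e0 := @expR_gt0 R (-1).
have e1 := @expR_gt0 R 1.
rewrite /mlx normrM (gtr0_norm be0) normrM normfV (gtr0_norm (lt_le_trans e0 h)).
have -> : expR 1 * expR 1 * `|s| = (al - 1) * (expR 1 / (al - 1) * `|s| * expR 1).
  by field; rewrite gt_eqF.
rewrite ler_wpM2l ?(ltW be0) //; apply: ler_pM => //.
- by rewrite invr_ge0; lra.
- exact: kk_bound.
- by rewrite -[X in _ <= X]invrK -expRN lef_pV2 ?posrE //; lra.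
Qed.

Let mlx_s_lip : exists2 K, 0 < K & forall s s' x, `|s| <= rb -> `|s'| <= rb ->
  0 <= x <= 1 -> `|mlx s x| <= K /\ `|mlx s' x - mlx s x| <= K * `|s' - s|.
have e0 := @expR_gt0 R (-1).
have h := jetZ hj (al - 1) (jetM hj jet_kk (jetV hj e0
   (fun i (h : so_dom i) => let: And3 h1 h2 h3 := h in le_trans (em_lt h1 h3) (ler_norm _))
   (fun i (h : so_dom i) => let: And3 h1 h2 h3 := h in le_trans (em_lt h2 h3) (ler_norm _))
   (jetD hj (jet_const hj 1) jet_kkx))).
have [K K1 hK] := jet_near hj h; exists K; first by lra.
move=> s s' x hs hs' hx.
by have := hK (s, s', x) (And3 hs hs' hx); rewrite /nu /= => -[].
Qed.

Let ml_x_quad : exists2 K, 0 < K & forall s x x', `|s| <= rb ->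
  0 <= x <= 1 -> 0 <= x' <= 1 ->
  `|ml s x' - ml s x - mlx s x * (x' - x)| <= K * `|s| * (x' - x) ^+ 2.
have e0 := @expR_gt0 R (-1); have e1 := @expR_gt0 R 1.
pose B := expR 1 / (al - 1) * rb.
have B0 : 0 < B by rewrite !mulr_gt0 ?invr_gt0 // rb_gt0.
exists ((al - 1) * (expR 1 / (al - 1)) * B * (expR 1 * expR 1)).
  by do !apply: mulr_gt0 => //; rewrite ?invr_gt0.
move=> s x x' hs hx hx'.
have h1 := em_lt hs hx; have h2 := em_lt hs hx'.
have p1 := lt_le_trans e0 h1; have p2 := lt_le_trans e0 h2.
have := ln_taylor p1 p2; set y := 1 + kk s * x in h1 p1 *; set y' := 1 + kk s * x' in h2 p2 *.
have ey : y' - y = kk s * (x' - x) by rewrite /y' /y; ring.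
rewrite ey => ht.
have -> : ml s x' - ml s x - mlx s x * (x' - x) =
  (al - 1) * (ln y' - ln y - kk s * (x' - x) / y).
  by rewrite /ml /mlx -/y -/y'; ring.
rewrite normrM (gtr0_norm be0).
apply: le_trans (ler_wpM2l (ltW be0) ht) _.
have kb := kk_bound hs.
have kB : `|kk s| <= B by apply: le_trans kb _; rewrite ler_wpM2l // divr_ge0 // ltW.
have -> : (al - 1) * ((kk s * (x' - x)) ^+ 2 / (y * y')) =
  (al - 1) * (kk s ^+ 2 * (y^-1 * y'^-1)) * (x' - x) ^+ 2.
  by field; rewrite !gt_eqF.
rewrite ler_wpM2r ?sqr_ge0 //.
have -> : (al - 1) * (expR 1 / (al - 1)) * B * (expR 1 * expR 1) * `|s| =
  (al - 1) * (expR 1 / (al - 1) * `|s| * B * (expR 1 * expR 1)) by ring.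
rewrite ler_wpM2l ?(ltW be0) //; apply: ler_pM.
- exact: sqr_ge0.
- by rewrite mulr_ge0 ?invr_ge0 ?ltW.
- by rewrite -real_normK ?num_real // expr2; apply: ler_pM.
- have inv (z : R) : expR (-1) <= z -> z^-1 <= expR 1.
    by move=> hz; rewrite -[X in _ <= X]invrK -expRN lef_pV2 ?posrE //; lra.
  by apply: ler_pM; rewrite ?invr_ge0 ?inv // ltW.
Qed.

Lemma ml_so : so_family ml mlx mls.
have [K1 p1 h1] := ml_s_quad; have [K2 p2 h2] := mlx_s_lip.
have [K3 p3 h3] := ml_x_quad; exact: so_familyP h1 h2 h3 p1 p2 p3.
Qed.

Lemma mlx_bound s x : `|s| <= rb -> 0 <= x <= 1 -> `|mlx s x| <= expR 1 * expR 1 * `|s|.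
exact: ml_x. Qed.
End SecondOrder.

(** * Zooms of pure maps are pure, and the parameter of a pure map is unique *)

Section Zoom.
Implicit Types s x y w tau : R.

Lemma powR_neq (A B : R) : 0 < A -> 0 < B -> A != B -> A `^ al != B `^ al.
move=> A0 B0; apply: contra => /eqP e; apply/eqP.
by apply: (powR_injective al0) e; rewrite nnegrE ltW.
Qed.

(** Pure maps are exactly the normalized restrictions of the power [al] to intervals away from 0,
    with parameter (al - 1) ln (B / A). This explains why zooms of Q and of pure maps are pure
    again. *)
Lemma pow_zoom (A B t : R) : 0 < A -> 0 < B -> A != B -> 0 <= t <= 1 ->
  ((A + (B - A) * t) `^ al - A `^ al) / (B `^ al - A `^ al) =
  mu al ((al - 1) * (ln B - ln A)) t.
move=> A0 B0 AB /andP[t0 t1]; set s := _ * (_ - _).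
have lAB : ln B - ln A != 0.
  by rewrite subr_eq0; apply: contra AB => /eqP /ln_inj ->; rewrite ?posrE.
have s0 : s != 0 by rewrite mulf_neq0 // gt_eqF.
have ek : 1 + kk s = B / A.
  rewrite one_kk /s mulrAC divff ?gt_eqF // mul1r expRB !lnK ?posrE //.
have ek' : kk s = B / A - 1 by rewrite -ek addrAC subrr add0r.
have P0 : 0 < A `^ al by rewrite powR_gt0.
have div X : 0 <= X -> (X / A) `^ al = X `^ al / A `^ al.
  move=> X0; have := @powRM R A (X / A) al (ltW A0) (divr_ge0 X0 (ltW A0)).
  have -> : A * (X / A) = X by field; rewrite gt_eqF.
  by move=> ->; field; rewrite gt_eqF.
have X0 : 0 <= A + (B - A) * t.
  have -> : A + (B - A) * t = A * (1 - t) + B * t by ring.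
  by rewrite addr_ge0 // mulr_ge0 ?subr_ge0 // ltW.
rewrite muE // ek ek' (_ : 1 + (B / A - 1) * t = (A + (B - A) * t) / A); last first.
  by field; rewrite gt_eqF.
rewrite !div ?(ltW B0) //.
have h (X Y : R) : X / Y - 1 = (X - Y) / Y \/ Y = 0.
  by have [->|y0] := eqVneq Y 0; [right | left; field].
have pn := lt0r_neq0 P0.
have [->|/eqP] := h ((A + (B - A) * t) `^ al) (A `^ al); last by rewrite (negbTE pn).
have [->|/eqP] := h (B `^ al) (A `^ al); last by rewrite (negbTE pn).
by rewrite invfM mulrACA mulfV ?invr_eq0 // mulr1.
Qed.

Lemma zoom_mu s x y t : 0 <= x -> x < y -> y <= 1 -> 0 <= t <= 1 ->
  zoom (mu al s) (x, y) t = mu al (ml s y - ml s x) t.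
move=> x0 xy y1 ht; rewrite /zoom /zeta_inv /zeta /imI /ilen /=.
have [->|s0] := eqVneq s 0.
  by rewrite !mu0 /ml kk0 !mul0r subrr mu0; field; rewrite subr_eq0 gt_eqF.
have hx : 0 <= x <= 1 by andlra.
have hy : 0 <= y <= 1 by andlra.
have A0 := kk_gtN1 s hx; have B0 := kk_gtN1 s hy.
have k0 : kk s != 0 by rewrite kk_eq0.
have AB : 1 + kk s * x != 1 + kk s * y.
  by rewrite (inj_eq (addrI _)) (inj_eq (mulfI k0)) lt_eqF.
rewrite /ml -mulrBr -pow_zoom //.
rewrite !muE // (_ : 1 + kk s * (x + (y - x) * t) =
  1 + kk s * x + (1 + kk s * y - (1 + kk s * x)) * t); last by ring.
have h : (1 + kk s * y) `^ al - (1 + kk s * x) `^ al != 0.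
  by rewrite subr_eq0 eq_sym powR_neq.
have d := kk_pow_neq0 s0.
have e : ((1 + kk s * y) `^ al - 1) / ((1 + kk s) `^ al - 1) -
   ((1 + kk s * x) `^ al - 1) / ((1 + kk s) `^ al - 1) =
   ((1 + kk s * y) `^ al - (1 + kk s * x) `^ al) / ((1 + kk s) `^ al - 1).
  by field.
rewrite e; field; by rewrite h d.
Qed.

Lemma powR_cross (A B A' B' w w' : R) : 0 < A -> 0 < B -> 0 < A' -> 0 < B' ->
  w != 0 -> w' != 0 -> al * A `^ (al - 1) / w = al * A' `^ (al - 1) / w' ->
  al * B `^ (al - 1) / w = al * B' `^ (al - 1) / w' -> A * B' = A' * B.
move=> A0 B0 A0' B0' w1 w2 e1 e2.
have nA := ltW A0; have nB := ltW B0; have nA' := ltW A0'; have nB' := ltW B0'.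
apply: (powR_injective be0); rewrite ?nnegrE ?mulr_ge0 //.
rewrite (powRM _ nA nB') (powRM _ nA' nB).
have a0 : al != 0 by rewrite gt_eqF.
have -> : A `^ (al - 1) = A' `^ (al - 1) / w' * w.
  by apply: (mulfI a0); rewrite !mulrA -e1; field.
have -> : B `^ (al - 1) = B' `^ (al - 1) / w' * w.
  by apply: (mulfI a0); rewrite !mulrA -e2; field.
by ring.
Qed.

(** Comparing derivatives at 1/3 and 2/3 and eliminating the normalizing factor leaves a bilinear
    equation in [kk s] and [kk s'] whose only content is [kk s = kk s']. It makes the choice in
    [pure_param] unambiguous. *)
Lemma mu_inj s s' : (forall x, 0 <= x <= 1 -> mu al s x = mu al s' x) -> s = s'.
move=> e.
have mx x : 0 < x < 1 -> mux s x = mux s' x.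
  move=> /andP[x0 x1]; have hx : 0 <= x <= 1 by rewrite !ltW.
  have h : \near x, mu al s x = mu al s' x.
    have n0 : \near x, 0 < x by exact: lt_nbhsr.
    have n1 : \near x, x < 1 by exact: lt_nbhsl.
    near=> z; apply: e; apply/andP; split; apply: ltW; near: z; [exact: n0|exact: n1].
  have d1 := near_eq_is_derive h (mu_derive s hx).
  by have := @derive_val _ _ _ _ _ _ _ d1; have := @derive_val _ _ _ _ _ _ _ (mu_derive s' hx) => -> ->.
have wn u : W (kk u) != 0.
  have [c hc ec] := mvt ler01 (fun t => @mu_derive u t).
  have [m0 m1] := mu_end u.
  move: ec; rewrite m0 m1 !subr0 mulr1 /mux => ec.
  by apply/eqP => w0; move: ec; rewrite w0 invr0 mulr0 => /eqP; rewrite oner_eq0.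
have h1 : 0 < (1 / 3 : R) < 1 by andlra.
have h2 : 0 < (2 / 3 : R) < 1 by andlra.
have h1' : 0 <= (1 / 3 : R) <= 1 by andlra.
have h2' : 0 <= (2 / 3 : R) <= 1 by andlra.
have e1 := mx _ h1; have e2 := mx _ h2; move: e1 e2; rewrite /mux.
have A0 := kk_gtN1 s h1'; have B0 := kk_gtN1 s h2'.
have A0' := kk_gtN1 s' h1'; have B0' := kk_gtN1 s' h2'.
move=> e1 e2; have E := powR_cross A0 B0 A0' B0' (wn s) (wn s') e1 e2.
have ek : kk s = kk s'.
  apply/eqP; rewrite -subr_eq0; apply/eqP.
  have -> : kk s - kk s' = 3 * ((1 + kk s' * (1 / 3)) * (1 + kk s * (2 / 3)) -
    (1 + kk s * (1 / 3)) * (1 + kk s' * (2 / 3))) by field.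
  by rewrite E subrr mulr0.
have : expR (s / (al - 1)) = expR (s' / (al - 1)) by rewrite -!one_kk ek.
move/expR_inj => h; rewrite -[s](divfK (lt0r_neq0 be0)) h divfK //.
by rewrite gt_eqF.
Unshelve. all: by end_near. Qed.

Lemma pure_paramE (g : R -> R) s : (forall x, 0 <= x <= 1 -> g x = mu al s x) ->
  pure_param al g = s.
move=> h; rewrite /pure_param.
have P : [set s | {in `[0, 1], g =1 mu al s}] s.
  by move=> x; rewrite in_itv /= => hx; exact: h.
have := @xgetI _ 0 _ _ P; set s' := xget _ _ => h'.
apply: mu_inj => x hx; rewrite -h //; apply/esym/h'.
by rewrite in_itv.
Qed.
End Zoom.

(** * Finite ordered compositions of pure maps *)

Section FiniteComposition.
Variable T : Type.
Implicit Types (s h : T -> R) (l : seq T) (x y : R).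

Definition cl s l x := foldl (fun y t => mu al (s t) y) x l.
Definition lsum s l : R := \sum_(t <- l) `|s t|.

Lemma lsum_ge0 s l : 0 <= lsum s l.
by apply: sumr_ge0. Qed.

Lemma lsum_cons s t l : lsum s (t :: l) = `|s t| + lsum s l.
by rewrite /lsum big_cons. Qed.

Lemma sl_comp (d d' : R) (g h : R -> R) : sl d g -> sl d' h -> sl (d + d') (h \o g).
move=> hg hh; have [g0 g1 gs] := hg; have [h0 h1 hs] := hh.
split; rewrite /= ?g0 ?g1 // => x y x0 xy y1.
have [a1 a2] := gs _ _ x0 xy y1.
have gx : 0 <= g x <= 1 by apply: (sl_in hg); andlra.
have gy : 0 <= g y <= 1 by apply: (sl_in hg); andlra.
have [b1 b2] := hs (g x) (g y) (proj1 (andP gx)) (sl_le hg x0 xy y1) (proj2 (andP gy)).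
rewrite opprD !expRD; split.
  apply: le_trans b1; rewrite mulrC mulrA mulrC ler_wpM2l ?expR_ge0 //.
  by rewrite mulrC.
apply: le_trans b2 _; rewrite (mulrC (expR d)) -mulrA ler_wpM2l ?expR_ge0 //.
Qed.

Lemma cl_sl s l : sl (lsum s l) (cl s l).
elim: l => [|t l IH].
  rewrite /lsum big_nil /cl /=; split => // x y _ _ _.
  by rewrite oppr0 expR0 mul1r.
by rewrite lsum_cons; exact: sl_comp (mu_sl (s t)) IH.
Qed.

Definition mu_lip_const (K : R) := 0 < K /\ forall s s' x : R, `|s| <= rb -> `|s'| <= rb ->
  0 <= x <= 1 -> `|mu al s' x - mu al s x| <= K * `|s' - s| * x /\
    `|mu al s' x - mu al s x| <= K * `|s' - s| * (1 - x).

(** The error made at one time is amplified by later maps at most by the exponential of their total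
    distortion. The factors [x] and [1 - x] persist because each map distorts the distances to the
    end points by a bounded factor. *)
Lemma cl_lip K : mu_lip_const K -> forall s s' l x,
  (forall t, `|s t| <= rb) -> (forall t, `|s' t| <= rb) -> 0 <= x <= 1 ->
  `|cl s' l x - cl s l x| <=
     K * expR (lsum s l + lsum s' l) * lsum (fun t => s' t - s t) l * x /\
  `|cl s' l x - cl s l x| <=
     K * expR (lsum s l + lsum s' l) * lsum (fun t => s' t - s t) l * (1 - x).
move=> [K0 hK] s s' l x hs hs'.
elim: l x => [|t l IH] x hx.
  by rewrite /lsum !big_nil /cl /= subrr normr0 !mulr0 !mul0r.
case/andP: (hx) => x0 x1.
rewrite !lsum_cons /= -/(cl s l _) -/(cl s' l _).
have [a1 a2] := hK _ _ _ (hs t) (hs' t) hx.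
set y := mu al (s t) x in a1 a2 *; set y' := mu al (s' t) x in a1 a2 *.
have hm := mu_sl (s t); have hm' := mu_sl (s' t).
have hy : 0 <= y <= 1 by exact: sl_in hm hx.
have hy' : 0 <= y' <= 1 by exact: sl_in hm' hx.
have [b1 b2] := IH _ hy.
have yx : y <= expR `|s t| * x by have [] := sl_bound hm hx.
have yx' : 1 - y <= expR `|s t| * (1 - x).
  by have [_ m1 hh] := hm; have [_] := hh _ _ x0 x1 (lexx 1); rewrite m1.
have c := sl_lip (cl_sl s' l) hy hy'.
set S := lsum s l in b1 b2 *; set S' := lsum s' l in b1 b2 c *.
set D := lsum _ l in b1 b2 *.
have S0 : 0 <= S by exact: lsum_ge0.
have S0' : 0 <= S' by exact: lsum_ge0.
have D0 : 0 <= D by exact: lsum_ge0.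
have tri : `|cl s' l y' - cl s l y| <= expR S' * `|y' - y| + `|cl s' l y - cl s l y|.
  have -> : cl s' l y' - cl s l y = (cl s' l y' - cl s' l y) + (cl s' l y - cl s l y) by ring.
  exact: normD_le.
have key (B z z' : R) : 0 <= z -> 0 <= z' -> z' <= expR `|s t| * z ->
   `|y' - y| <= K * `|s' t - s t| * z -> B <= K * expR (S + S') * D * z' ->
   expR S' * `|y' - y| + B <=
   K * expR (`|s t| + S + (`|s' t| + S')) * (`|s' t - s t| + D) * z.
  move=> z0 z0' h1 h2 h3.
  rewrite mulrDr mulrDl; apply: lerD.
    apply: le_trans (ler_wpM2l (expR_ge0 _) h2) _.
    have -> : expR S' * (K * `|s' t - s t| * z) = K * `|s' t - s t| * z * expR S' by ring.
    rewrite (_ : K * expR (_ + _) * `|s' t - s t| * z = K * `|s' t - s t| * z *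
      expR (`|s t| + S + (`|s' t| + S'))); last by ring.
    rewrite ler_wpM2l ?mulr_ge0 ?(ltW K0) // ler_expR.
    by have := normr_ge0 (s t); have := normr_ge0 (s' t); lrc S0.
  apply: le_trans h3 _.
  have KD : 0 <= K * expR (S + S') * D by rewrite !mulr_ge0 ?expR_ge0 // ltW.
  apply: le_trans (ler_wpM2l KD h1) _.
  have -> : K * expR (S + S') * D * (expR `|s t| * z) =
     K * D * z * (expR (S + S') * expR `|s t|) by ring.
  have -> : K * expR (`|s t| + S + (`|s' t| + S')) * D * z =
     K * D * z * expR (`|s t| + S + (`|s' t| + S')) by ring.
  rewrite -expRD ler_wpM2l ?ler_expR ?mulr_ge0 ?(ltW K0) //.
  by have := normr_ge0 (s' t); lrc.
case/andP: hy => y0 y1.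
split; apply: le_trans tri _.
  exact: key b1.
by apply: (key _ _ (1 - y)) => //; rewrite subr_ge0.
Qed.

(** Transport of a tangent vector [xi] along the composition, where the parameter at each time
    contributes [mus * h t]. *)
Fixpoint cD s l x h (xi : R) := if l is t :: l' then
  cD s l' (mu al (s t) x) h (mus (s t) x * h t + mux (s t) x * xi) else xi.

Lemma cD_lin s l x r h h' xi xi' :
  cD s l x (fun t => r * h t + h' t) (r * xi + xi') = r * cD s l x h xi + cD s l x h' xi'.
elim: l x xi xi' => //= t l IH x xi xi'; rewrite -IH; congr (cD _ _ _ _); ring.
Qed.

(** The constant does not depend on the length of the list: only the sums of [|s t|] and of the
    parameter changes enter. *)
Lemma cl_quad : exists2 K, 0 < K & forall s s' l x x',
  (forall t, `|s t| <= rb) -> (forall t, `|s' t| <= rb) ->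
  lsum s l <= 1 -> lsum s' l <= 1 -> 0 <= x <= 1 -> 0 <= x' <= 1 ->
  `|cl s' l x' - cl s l x - cD s l x (fun t => s' t - s t) (x' - x)| <=
    K * (lsum (fun t => s' t - s t) l + `|x' - x|) ^+ 2.
have [K1 K10 hK1] := mu_so; have [K2 K20 hK2] := mux_s_lip.
have [K3 K30 hK3] := mu_param_lip.
pose K := K1 + K2 + K3 + 1.
have kk1 : K1 <= K by rewrite /K; lra.
have g1 : 1 <= K by rewrite /K; lra.
have kk3 : K3 <= K by rewrite /K; lra.
have rb0 := @rb_gt0.
have mux0 (x : R) : mux 0 x = 1.
  by rewrite /mux kk0 mul0r addr0 powR1 W0 mulr1 divff // gt_eqF //; have := al1; lra.
have muxb (s x : R) : `|s| <= rb -> 0 <= x <= 1 -> `|mux s x| <= expR (K * `|s|).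
  have r0 : `|0 : R| <= rb by rewrite normr0 ltW.
  move=> hs hx; have [_ h] := hK2 0 s x r0 hs hx.
  rewrite mux0 subr0 in h.
  apply: le_trans (expR_ge1Dx _); rewrite -{1}(subrK 1 (mux s x)) addrC.
  apply: le_trans (ler_normD _ _) _; rewrite normr1 lerD2l; apply: le_trans h _.
  by rewrite ler_wpM2r // /K; lra.
(* [Wd] is an a priori bound for all later displacements, and [eta] an arbitrary approximation of
   [x' - x]. Separating [eta] from the true displacement makes the induction pass: each step only
   adds its own quadratic error. *)
have main s s' : (forall t, `|s t| <= rb) -> (forall t, `|s' t| <= rb) ->
  forall (Wd : R) l x x' eta, 0 <= x <= 1 -> 0 <= x' <= 1 ->
  expR (lsum s' l) * (`|x' - x| + K * lsum (fun t => s' t - s t) l) <= Wd ->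
  `|cl s' l x' - cl s l x - cD s l x (fun t => s' t - s t) eta| <=
  expR (K * lsum s l) * (`|x' - x - eta| + 2 * K * lsum (fun t => s' t - s t) l * Wd
    + K * lsum s l * Wd ^+ 2).
  move=> hs hs' Wd; elim=> [|t l IH] x x' eta hx hx' hW.
    by rewrite /= /lsum !big_nil !mulr0 !mul0r !addr0 expR0 mul1r.
  rewrite /= -/(cl s l _) -/(cl s' l _).
  move: hW; rewrite !lsum_cons.
  set sg := s' t - s t; set H := lsum (fun t => s' t - s t) l; set S := lsum s l; set S' := lsum s' l => hW.
  have hm := mu_sl (s t); have hm' := mu_sl (s' t).
  set y := mu al (s t) x; set y' := mu al (s' t) x'.
  have hy : 0 <= y <= 1 by exact: sl_in hm hx.
  have hy' : 0 <= y' <= 1 by exact: sl_in hm' hx'.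
  set xi := x' - x in hW *.
  have K0 : 0 < K by rewrite /K; lrc K10 K20 K30.
  have S0' : 0 <= S' by exact: lsum_ge0.
  have S0 : 0 <= S by exact: lsum_ge0.
  have H0 : 0 <= H by exact: lsum_ge0.
  have n1 := normr_ge0 sg; have n2 := normr_ge0 xi.
  have KH0 : 0 <= K * H by rewrite mulr_ge0 // ltW.
  have Ks0 : 0 <= K * `|sg| by rewrite mulr_ge0 // ltW.
  have xiW : `|xi| + K * (`|sg| + H) <= Wd.
    apply: le_trans hW; rewrite ler_peMl //; first by rewrite mulrDr !addr_ge0.
    by rewrite -expR0 ler_expR addr_ge0.
  have W0 : 0 <= Wd by move: xiW; rewrite mulrDr; lra.
  have yy : `|y' - y| <= expR `|s' t| * `|xi| + K * `|sg|.
    have -> : y' - y = (y' - mu al (s' t) x) + (mu al (s' t) x - y) by ring.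
    apply: normD_le; first exact: sl_lip hm' hx hx'.
    have [a _] := hK3 _ _ _ (hs t) (hs' t) hx; apply: le_trans a _.
    case/andP: hx => x0 x1; apply: (@le_trans _ _ (K3 * `|sg|)).
      by rewrite ler_piMr // mulr_ge0 // ltW.
    by rewrite ler_wpM2r.
  have hW' : expR S' * (`|y' - y| + K * H) <= Wd.
    apply: le_trans hW; rewrite expRD (mulrC (expR `|s' t|)) -mulrA.
    rewrite ler_wpM2l ?expR_ge0 // mulrDr.
    have e1 : 1 <= expR `|s' t| by rewrite -expR0 ler_expR.
    have := ler_peMl (addr_ge0 Ks0 KH0) e1; rewrite -mulrDr; lrc yy.
  have E1 : `|y' - y - (mus (s t) x * sg + mux (s t) x * eta)| <=
     expR (K * `|s t|) * `|xi - eta| + 2 * K * `|sg| * Wd + K * `|s t| * Wd ^+ 2.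
    have -> : y' - y - (mus (s t) x * sg + mux (s t) x * eta) =
      mux (s t) x * (xi - eta) + (y' - y - (mus (s t) x * sg + mux (s t) x * xi)) by ring.
    have [_ _ b] := hK1 _ _ _ _ (hs t) (hs' t) hx hx'.
    apply: le_trans (normD_le (normM_le (muxb _ _ (hs t) hx) (lexx _)) b) _.
    rewrite -[X in _ <= X]addrA lerD2l -/sg -/xi.
    have q1 : sg ^+ 2 * K <= `|sg| * Wd.
      rewrite -real_normK ?num_real // expr2 -mulrA ler_wpM2l // mulrC.
      by move: xiW; rewrite mulrDr; lrd al1 al0 be0 K10 K20 K30 kk1 g1 kk3 rb0 hx hx' hy hy' hW K0 S0' S0 H0 n1 hW' b Ks0 W0 yy.
    have q2 : xi ^+ 2 <= Wd ^+ 2.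
      rewrite -real_normK ?num_real // lerXn2r ?nnegrE //.
      by move: xiW; rewrite mulrDr; lrd al1 al0 be0 K10 K20 K30 kk1 g1 kk3 rb0 hx hx' hy hy' q1 hW K0 S0' S0 H0 n1 n2 W0 yy hW' b.
    have q3 : `|sg| * `|xi| <= `|sg| * Wd.
      by rewrite ler_wpM2l //; move: xiW; rewrite mulrDr; lra.
    have q4 := ler_wpM2l (normr_ge0 (s t)) q2.

    apply: (@le_trans _ _ (K * (sg ^+ 2 + `|s t| * xi ^+ 2 + `|sg| * `|xi|))).
      rewrite ler_wpM2r //; apply: addr_ge0; last exact: mulr_ge0.
      by apply: addr_ge0; [exact: sqr_ge0 | exact: mulr_ge0 (normr_ge0 _) (sqr_ge0 _)].
    have sW : 0 <= `|sg| * Wd by rewrite mulr_ge0.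
    have := ler_wpM2l (ltW K0) q3; have := ler_wpM2l (ltW K0) q4.
    have := ler_peMl sW g1; clear - q1; lra.

  apply: le_trans (IH y y' (mus (s t) x * sg + mux (s t) x * eta) hy hy' hW') _.
  have eK : expR (K * (`|s t| + S)) = expR (K * S) * expR (K * `|s t|).
    by rewrite -expRD; congr expR; ring.
  rewrite -/S -/H eK -[X in _ <= X]mulrA ler_wpM2l ?expR_ge0 //.
  have e1 : 1 <= expR (K * `|s t|).
    by rewrite -expR0 ler_expR mulr_ge0 // ltW.
  set Z := 2 * K * H * Wd + K * S * Wd ^+ 2 + 2 * K * `|sg| * Wd + K * `|s t| * Wd ^+ 2.
  have Z0 : 0 <= Z.
    have q := sqr_ge0 Wd; have k2 : 0 <= 2 * K by lrc K0.
    have Kn := ltW K0.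
    by rewrite /Z; do 3?[apply: addr_ge0]; apply: mulr_ge0 => //; apply: mulr_ge0.
  have := ler_peMl Z0 e1.
  set X := expR (K * `|s t|) in E1 *.
  have -> : X * (`|xi - eta| + 2 * K * (`|sg| + H) * Wd + K * (`|s t| + S) * Wd ^+ 2) =
    X * `|xi - eta| + X * Z by rewrite /Z; ring.
  rewrite /Z; lrc E1.
pose C := expR 1 * (K + 1).
exists (expR K * (2 * K * C + K * C ^+ 2)).
  have K0 : 0 < K by rewrite /K; lrc K10 K20 K30.
  have C0 : 0 < C by rewrite mulr_gt0 ?expR_gt0 //; lrc K0.
  have q := exprn_gt0 2 C0; have h1 := mulr_gt0 K0 C0; have h2 := mulr_gt0 K0 q.
  by apply: mulr_gt0; [exact: expR_gt0 | rewrite -(mulrA 2); lrc h1 h2].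
move=> s s' l x x' hs hs' S1 S1' hx hx'.
set H := lsum _ l; set xi := x' - x.
have K0 : 0 < K by rewrite /K; lrc K10 K20 K30.
have H0 : 0 <= H by exact: lsum_ge0.
have n2 := normr_ge0 xi.
have hW : expR (lsum s' l) * (`|xi| + K * H) <= C * (H + `|xi|).
  rewrite /C -mulrA; apply: ler_pM; rewrite ?expR_ge0 ?addr_ge0 ?mulr_ge0 ?(ltW K0) //.
    by rewrite ler_expR.
  have := mulr_ge0 (ltW K0) n2; lrc H0.
apply: le_trans (main s s' hs hs' _ l x x' xi hx hx' hW) _.
rewrite subrr normr0 add0r -/H -/xi.
set N := H + `|xi|.
have N0 : 0 <= N by rewrite addr_ge0.
have C0 : 0 < C by rewrite mulr_gt0 ?expR_gt0 //; lrc K0.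
rewrite -[X in _ <= X]mulrA; apply: ler_pM; rewrite ?expR_ge0 //.
- have q := sqr_ge0 (C * N); have CN : 0 <= C * N by rewrite mulr_ge0 // ltW.
  have k2 : 0 <= 2 * K by rewrite mulr_ge0 // ltW.
  apply: addr_ge0; first by apply: mulr_ge0 => //; exact: mulr_ge0.
  by apply: mulr_ge0 => //; apply: mulr_ge0; [exact: ltW | exact: lsum_ge0].
- by rewrite ler_expR ler_piMr // ltW.
rewrite [X in _ <= X]mulrDl; apply: lerD.
  have -> : 2 * K * H * (C * N) = 2 * K * C * (H * N) by ring.
  have k2 : 0 <= 2 * K * C by apply: mulr_ge0; [apply: mulr_ge0 => //|]; exact: ltW.
  by apply: ler_wpM2l => //; rewrite expr2; apply: ler_wpM2r => //; rewrite /N lerDl.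
rewrite exprMn mulrA; apply: ler_wpM2r; first exact: sqr_ge0.
by apply: ler_wpM2r; [exact: sqr_ge0 | rewrite ler_piMr // ltW].
Qed.
End FiniteComposition.

(** * Summable families and limits over finite sets of times *)

Section L1.
Context {d : Order.disp_t} {T : orderType d}.
Implicit Types (s h : T -> R) (l : seq T) (m e : R).

(** The bound on the extended norm, rephrased by duplicate-free lists, so that sums stay real and
    finite. *)
Definition l1_le s m := forall l, uniq l -> lsum s l <= m.

Lemma l1_leP s m : (l1norm s <= m%:E)%E <-> l1_le s m.
split=> [h l ul|h].
  rewrite -lee_fin; apply: le_trans h; rewrite /l1norm; apply: esum_ge.
  exists [set` l]; first by split => //; exact: finite_seq.
  by rewrite -fsbig_seq //= sumEFin.
apply: ge_ereal_sup => _ [A [fA _] <-].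
by rewrite fsbig_finite //= sumEFin lee_fin; apply: h; exact: fset_uniq.
Qed.

Lemma l1_le_ge0 s m : l1_le s m -> 0 <= m.
by move=> h; have := h [::] isT; rewrite /lsum big_nil. Qed.

Lemma l1_le_pt s m t : l1_le s m -> `|s t| <= m.
by move=> h; have := h [:: t] isT; rewrite /lsum big_seq1. Qed.

Lemma l1_le_weak s m m' : m <= m' -> l1_le s m -> l1_le s m'.
by move=> mm h l ul; exact: le_trans (h l ul) mm. Qed.

Lemma l1_le_eq s s' m : (forall t, `|s t| = `|s' t|) -> l1_le s m -> l1_le s' m.
by move=> e h l ul; have := h l ul; rewrite /lsum (eq_bigr _ (fun t _ => e t)). Qed.

Lemma l1_le_dom s s' m : (forall t, `|s' t| <= `|s t|) -> l1_le s m -> l1_le s' m.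
by move=> e h l ul; apply: le_trans (h l ul); apply: ler_sum. Qed.

Lemma l1_le0 : l1_le (fun=> 0) 0.
by move=> l _; rewrite /lsum big1 // => t _; rewrite normr0. Qed.

Lemma l1_leZ s m r : l1_le s m -> l1_le (fun t => r * s t) (`|r| * m).
move=> h l ul; rewrite /lsum; under eq_bigr do rewrite normrM.
by rewrite -mulr_sumr ler_wpM2l // h.
Qed.

Lemma l1_leD s s' m m' : l1_le s m -> l1_le s' m' -> l1_le (fun t => s t + s' t) (m + m').
move=> h h' l ul; apply: le_trans (lerD (h l ul) (h' l ul)).
by rewrite /lsum -big_split; apply: ler_sum => t _; exact: ler_normD.
Qed.

Lemma l1_leB s s' m m' : l1_le s m -> l1_le s' m' -> l1_le (fun t => s t - s' t) (m + m').
move=> h h'; have : l1_le (fun t => - s' t) m'.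
  by apply: l1_le_eq h' => t; rewrite normrN.
exact: l1_leD.
Qed.

(** A finite sum within [e] of the supremum leaves at most [e] for any list of further times. *)
Lemma l1_tail s m e : l1_le s m -> 0 < e -> exists A : {fset T},
  forall l, uniq l -> (forall t, t \in l -> t \notin A) -> lsum s l <= e.
move=> h e0; pose S := [set x | exists2 l, uniq l & x = lsum s l].
have hS : has_sup S.
  by split; [exists (lsum s [::]); exists [::] | exists m => x [l ul ->]; exact: h].
have [x [l0 ul0 ->] hx] := sup_adherent e0 hS.
exists [fset t | t in l0]%fset => l ul hl.
have : lsum s (l0 ++ l) <= sup S.
  apply: (ub_le_sup (proj2 hS)); exists (l0 ++ l) => //.
  rewrite cat_uniq ul0 ul andbT /=; apply/hasPn => t tl.
  by have := hl t tl; rewrite inE.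
rewrite /lsum big_cat /= -/(lsum s l0) -/(lsum s l); lra.
Qed.
End L1.

Section FinSets.
Context {T : choiceType}.
Implicit Types (X : {fset T} -> R).

#[global] Instance finsets_proper : ProperFilter (finsets T).
apply: filter_from_proper; last by move=> A _; exists A; exact: fsubset_refl.
apply: filter_from_filter; first by exists fset0.
move=> A B _ _; exists (A `|` B)%fset => // C AC; split.
  exact: fsubset_trans (fsubsetUl _ _) AC.
exact: fsubset_trans (fsubsetUr _ _) AC.
Qed.

Lemma fsB X Y (x y : R) : X A @[A --> finsets T] --> x -> Y A @[A --> finsets T] --> y ->
  X A - Y A @[A --> finsets T] --> x - y.
by move=> h k; apply: cvgB. Qed.

Lemma fsD X Y (x y : R) : X A @[A --> finsets T] --> x -> Y A @[A --> finsets T] --> y ->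
  X A + Y A @[A --> finsets T] --> x + y.
by move=> h k; apply: cvgD. Qed.

Lemma fsZ X (x y : R) : X A @[A --> finsets T] --> x -> y * X A @[A --> finsets T] --> y * x.
by move=> h; apply: cvgM => //; exact: cvg_cst. Qed.

Lemma finsets_cauchy X : (forall e : R, 0 < e -> exists A, forall B, (A `<=` B)%fset ->
  `|X B - X A| <= e) -> cvg (X A @[A --> finsets T]).
move=> h; apply: cauchy_cvg; apply: cauchy_exP => e e0.
have e2 : 0 < e / 2 by rewrite divr_gt0.
have [A hA] := h _ e2; exists (X A); exists A => // B AB /=.
rewrite /ball /= distrC; apply: le_lt_trans (hA _ AB) _; lra.
Qed.

Lemma finsets_le X (x y e : R) : X A @[A --> finsets T] --> x ->
  (exists A, forall B, (A `<=` B)%fset -> `|X B - y| <= e) -> `|x - y| <= e.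
move=> /cvgrPdist_lt hx [A hA]; apply/ler_addgt0Pr => r r0.
have [A' _ hA'] := hx _ r0.
have h1 := hA (A `|` A')%fset (fsubsetUl _ _).
have h2 : `|x - X (A `|` A')%fset| < r by apply: hA'; exact: fsubsetUr.
have -> : x - y = (X (A `|` A')%fset - y) + (x - X (A `|` A')%fset) by ring.
exact: normD_le h1 (ltW h2).
Qed.
End FinSets.

Lemma le_small (a b c r0 : R) : 0 < r0 ->
  (forall r, 0 < r -> r <= r0 -> a <= b + r * c) -> a <= b.
move=> r00 h; apply/ler_addgt0Pr => e e0.
have c0 : 0 < `|c| + 1 by rewrite ltr_wpDl.
pose r := Num.min r0 (e / (`|c| + 1)).
have r1 : 0 < r by rewrite /r lt_min r00 divr_gt0.
have r2 : r <= r0 by rewrite /r ge_min lexx.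
apply: le_trans (h r r1 r2) _; rewrite lerD2l.
apply: (@le_trans _ _ (r * (`|c| + 1))).
  by rewrite ler_wpM2l ?(ltW r1) // (le_trans (ler_norm _)) // lerDl.
by rewrite -ler_pdivlMr // /r ge_min lexx orbT.
Qed.

(** * Infinite compositions: existence, distortion and derivative *)

Section Composition.
Notation cl := (@cl _).
Notation cD := (@cD _).

Lemma rb_le1 : rb <= 1.
by rewrite /rb ge_min; apply/orP; right; lra. Qed.

Section FixedTimes.
Context {d : Order.disp_t} {T : orderType d}.
Implicit Types (s h : T -> R) (P : pred T) (A B : {fset T}) (x y : R).

Definition times P A := [seq t <- sort <=%O (enum_fset A) | P t].

Lemma times_uniq P A : uniq (times P A).
by rewrite filter_uniq // sort_uniq fset_uniq. Qed.

Lemma times_sub P A B : (A `<=` B)%fset -> [seq t <- times P B | t \in A] = times P A.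
move=> AB; rewrite /times -filter_predI.
transitivity [seq t <- [seq t <- sort <=%O (enum_fset B) | t \in A] | P t].
  by rewrite -filter_predI; apply: eq_filter => t /=; rewrite andbC.
congr [seq t <- _ | P t].
rewrite filter_sort; [|exact: le_total|exact: le_trans].
apply/perm_sort_leP/uniq_perm; rewrite ?filter_uniq ?fset_uniq // => t.
by rewrite mem_filter; case: (boolP (t \in A)) => //= /(fsubsetP AB) ->.
Qed.

Definition restr s A t := if t \in A then s t else 0.

Lemma cl_restr s A l x : cl (restr s A) l x = cl s [seq t <- l | t \in A] x.
elim: l x => // t l IH x; rewrite /= -/(cl (restr s A) l _) IH /restr.
by case: ifP => //= _; rewrite mu0.
Qed.

Lemma l1_rb s m t : l1_le s m -> m <= rb -> `|s t| <= rb.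
by move=> h hm; exact: le_trans (l1_le_pt t h) hm. Qed.

(** Dropping a time amounts to setting its parameter to 0, since [mu 0] is the identity. The change
    is thus a parameter perturbation of the size of a tail, estimated by [cl_lip]. *)
Lemma cl_restr_close s P e : l1_le s rb -> 0 < e -> exists A, forall B x,
  0 <= x <= 1 -> (A `<=` B)%fset -> `|cl s (times P B) x - cl s (times P A) x| <= e.
move=> hs e0; have [K K0 hK0] := mu_param_lip.
have hK := cl_lip (T := T) (conj K0 hK0).
pose C := K * expR 2.
have C0 : 0 < C by rewrite mulr_gt0 ?expR_gt0.
have [A hA] := l1_tail hs (divr_gt0 e0 C0); exists A => B x hx AB.
have hsA : l1_le (restr s A) rb.
  by apply: l1_le_dom hs => t; rewrite /restr; case: ifP => //; rewrite normr0.
rewrite -(times_sub P AB) -cl_restr.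
have [h _] := hK (restr s A) s (times P B) x (fun t => l1_rb t hsA (lexx _))
  (fun t => l1_rb t hs (lexx _)) hx.
apply: le_trans h _.
have h1 := le_trans (hs _ (times_uniq P B)) rb_le1.
have h2 := le_trans (hsA _ (times_uniq P B)) rb_le1.
have h3 : lsum (fun t => s t - restr s A t) (times P B) <= e / C.
  have -> : lsum (fun t => s t - restr s A t) (times P B) =
      lsum s [seq t <- times P B | t \notin A].
    rewrite /lsum [RHS]big_filter (bigID (fun t => t \in A)) /= big1 ?add0r; last first.
      by move=> t tA; rewrite /restr tA subrr normr0.
    by apply: eq_bigr => t /negbTE tA; rewrite /restr tA subr0.
  apply: hA; first by rewrite filter_uniq // times_uniq.
  by move=> t; rewrite mem_filter => /andP[].
case/andP: hx => x0 x1.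
have D0 := @lsum_ge0 T (fun t => s t - restr s A t) (times P B).
have E0 : 0 <= K * expR (lsum (restr s A) (times P B) + lsum s (times P B)).
  by rewrite mulr_ge0 ?expR_ge0 ?ltW.
apply: (@le_trans _ _ (C * (e / C))); last by rewrite mulrCA divff ?gt_eqF // mulr1.
apply: (@le_trans _ _ (K * expR (lsum (restr s A) (times P B) + lsum s (times P B)) *
   lsum (fun t => s t - restr s A t) (times P B))); first by rewrite ler_piMr // mulr_ge0.
apply: ler_pM => //; rewrite /C ler_wpM2l ?(ltW K0) // ler_expR; lra.
Qed.

Lemma comp_cvg s P x : l1_le s rb -> 0 <= x <= 1 ->
  cl s (times P A) x @[A --> finsets T] --> comp_on al s P x.
move=> hs hx; apply: finsets_cauchy => e e0.
by have [A hA] := cl_restr_close P hs e0; exists A => B; exact: hA.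
Qed.

Lemma comp_in s P x : l1_le s rb -> 0 <= x <= 1 -> 0 <= comp_on al s P x <= 1.
move=> hs hx; have h := comp_cvg (P := P) hs hx.
have [e1 e2] : 0 - comp_on al s P x <= 0 /\ comp_on al s P x - 1 <= 0; last first.
  by andlra.
have b B : 0 <= cl s (times P B) x <= 1 := sl_in (cl_sl s _) hx.
have : `|comp_on al s P x - 1 / 2| <= 1 / 2.
  apply: finsets_le h _; exists fset0 => B _; have /andP[b1 b2] := b B.
  by rewrite ler_norml; andlra.
by rewrite ler_norml => /andP[h1 h2]; split; lra.
Qed.

Lemma comp_sl s P S : l1_le s rb -> l1_le s S -> sl S (comp_on al s P).
move=> hs hS.
have c (x : R) : 0 <= x <= 1 -> cl s (times P A) x @[A --> finsets T] --> comp_on al s P x.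
  exact: comp_cvg.
have ends z : 0 <= z <= 1 -> (forall l, cl s l z = z) -> comp_on al s P z = z.
  move=> hz e; apply/eqP; rewrite -subr_eq0 -normr_le0; apply: finsets_le (c z hz) _.
  by exists fset0 => B _; rewrite e subrr normr0.
split.
- by apply: ends; [exact: in01_0 | move=> l; have [] := cl_sl s l].
- by apply: ends; [exact: in01_1 | move=> l; have [] := cl_sl s l].
move=> x y x0 xy y1.
have hx : 0 <= x <= 1 by rewrite x0 (le_trans xy).
have hy : 0 <= y <= 1 by rewrite y1 (le_trans x0).
have cc : cl s (times P A) y - cl s (times P A) x @[A --> finsets T] -->
    comp_on al s P y - comp_on al s P x by have := cvgB (c _ hy) (c _ hx); exact.
pose u := expR (- S) * (y - x); pose v := expR S * (y - x).
have b B : u <= cl s (times P B) y - cl s (times P B) x <= v.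
  have [_ _ h] := cl_sl s (times P B); have [b1 b2] := h _ _ x0 xy y1.
  have hB := hS _ (times_uniq P B).
  have yx : 0 <= y - x by rewrite subr_ge0.
  apply/andP; split.
    by apply: le_trans b1; rewrite ler_wpM2r // ler_expR lerN2.
  by apply: le_trans b2 _; rewrite ler_wpM2r // ler_expR.
have : `|(comp_on al s P y - comp_on al s P x) - (u + v) / 2| <= (v - u) / 2.
  apply: finsets_le cc _; exists fset0 => B _; have /andP[b1 b2] := b B.
  by rewrite ler_norml; andlra.
by rewrite ler_norml => /andP[h1 h2]; split; rewrite -/u -/v; lra.
Qed.

Lemma cD00 s l x : cD s l x (fun=> 0) 0 = 0.
by elim: l x => //= t l IH x; rewrite !mulr0 addr0 IH. Qed.

Definition cds s P x h := lim (cD s (times P A) x h 0 @[A --> finsets T]).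
Definition cdx s P x := lim (cD s (times P A) x (fun=> 0) 1 @[A --> finsets T]).

(** The finite derivatives need no summation argument: by [cl_quad] they differ from difference
    quotients of step [r] by O(r), uniformly in the finite set. One fixes [r] first and then uses
    the convergence of the two compositions in the quotient. *)
Lemma cD_cvg s P x h xi m r0 : 0 < r0 -> l1_le s (rb / 2) -> l1_le h m ->
  0 <= x <= 1 -> (forall r, 0 < r -> r <= r0 -> 0 <= x + r * xi <= 1) ->
  cvg (cD s (times P A) x h xi @[A --> finsets T]).
move=> r00 hs hh hx hxi; have [K K0 hK] := cl_quad T.
have rb0 := @rb_gt0; have m0 := l1_le_ge0 hh.
apply: finsets_cauchy => e e0.
pose M := K * (m + `|xi|) ^+ 2.
have M0 : 0 <= M by rewrite mulr_ge0 ?sqr_ge0 ?ltW.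
pose r := Num.min r0 (Num.min (rb / 2 / (m + 1)) (e / (4 * (M + 1)))).
have r1 : 0 < r.
  rewrite /r !lt_min r00 /=; apply/andP; split; apply: divr_gt0; lrc rb0 m0 e0 M0.
have rr0 : r <= r0 by rewrite /r ge_min lexx.
have rm : r * m <= rb / 2.
  apply: (@le_trans _ _ (r * (m + 1))); first by rewrite ler_wpM2l ?ltW //; lra.
  rewrite -ler_pdivlMr; last by lra.
  by rewrite /r !ge_min lexx orbT.
have rM : r * M <= e / 4.
  apply: (@le_trans _ _ (r * (M + 1))); first by rewrite ler_wpM2l ?ltW //; lra.
  rewrite -ler_pdivlMr; last by lra.
  apply: (@le_trans _ _ (e / (4 * (M + 1)))); first by rewrite /r !ge_min lexx !orbT.
  by rewrite invfM mulrA.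
pose s' t := s t + r * h t.
have hs2 : l1_le s rb by apply: l1_le_weak hs; lra.
have hs' : l1_le s' rb.
  have := l1_leD hs (l1_leZ r hh); apply: l1_le_weak.
  by rewrite gtr0_norm //; lra.
have hx' := hxi r r1 rr0.
(* Four comparisons of compositions cost [r * e / 8] each and two quadratic remainders [r * e / 4]
   each; together this is [r * e]. *)
have er : 0 < r * e / 8 by rewrite divr_gt0 // mulr_gt0.
have [A1 hA1] := cl_restr_close P hs2 er; have [A2 hA2] := cl_restr_close P hs' er.
have c1 := @comp_cvg s P x hs2 hx; have c2 := @comp_cvg s' P _ hs' hx'.
exists (A1 `|` A2)%fset => B AB.
have quad C : `|cl s' (times P C) (x + r * xi) - cl s (times P C) x -
    r * cD s (times P C) x h xi| <= r * (r * M).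
  have := hK s s' (times P C) x (x + r * xi) (fun t => l1_rb t hs2 (lexx _))
    (fun t => l1_rb t hs' (lexx _)) (le_trans (hs2 _ (times_uniq P C)) rb_le1)
    (le_trans (hs' _ (times_uniq P C)) rb_le1) hx hx'.
  have -> : (x + r * xi - x) = r * xi + 0 by ring.
  have e1 : (fun t => s' t - s t) = (fun t => r * h t + 0).
    by apply/funext => t; rewrite /s'; ring.
  have z0 := cD00 s (times P C) x.
  rewrite e1 (cD_lin s (times P C) x r h (fun=> 0) xi 0) z0 !addr0 => hq.
  apply: le_trans hq _.
  have -> : r * (r * M) = K * (r * (m + `|xi|)) ^+ 2 by rewrite /M; ring.
  rewrite ler_wpM2l ?(ltW K0) //.
  have hl : lsum (fun t => r * h t + 0) (times P C) <= r * m.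
    have := l1_leZ r hh; rewrite gtr0_norm // => /(_ _ (times_uniq P C)).
    by rewrite /lsum; under [in X in _ -> X <= _]eq_bigr do rewrite addr0.
  rewrite lerXn2r ?nnegrE ?addr_ge0 ?lsum_ge0 ?mulr_ge0 ?addr_ge0 ?(ltW r1) //.
  by rewrite mulrDr normrM (gtr0_norm r1) lerD2r.
have d1 := hA1 _ x hx (fsubset_trans (fsubsetUl A1 A2) AB).
have d1' := hA1 _ x hx (fsubsetUl A1 A2).
have d2 := hA2 _ _ hx' (fsubset_trans (fsubsetUr A1 A2) AB).
have d2' := hA2 _ _ hx' (fsubsetUr A1 A2).
have q1 := quad B; have q2 := quad (A1 `|` A2)%fset.
have rM' : r * (r * M) <= r * (e / 4) by rewrite ler_wpM2l // ltW.
rewrite -(ler_pM2l r1) -{1}(gtr0_norm r1) -normrM.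
move: d1 d1' d2 d2' q1 q2; rewrite !ler_norml.
by do 6 (move=> /andP[? ?]); andlra.
Qed.

Lemma cds_cvg s P x h m : l1_le s (rb / 2) -> l1_le h m -> 0 <= x <= 1 ->
  cD s (times P A) x h 0 @[A --> finsets T] --> cds s P x h.
move=> hs hh hx; apply: (cD_cvg ltr01 hs hh hx) => r _ _.
by rewrite mulr0 addr0.
Qed.

Lemma cdx_cvg s P x : l1_le s (rb / 2) -> 0 <= x <= 1 ->
  cD s (times P A) x (fun=> 0) 1 @[A --> finsets T] --> cdx s P x.
move=> hs hx; case/andP: (hx) => x0 x1.
have h2 : 0 < 1 / 2 :> R by lra.
have [xl|xg] := leP x (1 / 2).
  apply: (cD_cvg h2 hs l1_le0 hx) => r r0 r1; andlra.
(* Near the right end a step in the direction +1 would leave [[0, 1]]; the direction -1 is used and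
   the sign restored by linearity. *)
have c : cvg (cD s (times P A) x (fun=> 0) (-1) @[A --> finsets T]).
  apply: (cD_cvg h2 hs l1_le0 hx) => r r0 r1; andlra.
have e : (fun A => cD s (times P A) x (fun=> 0) 1) =
    fun A => -1 * cD s (times P A) x (fun=> 0) (-1).
  apply/funext => A; have := cD_lin s (times P A) x (-1) (fun=> 0) (fun=> 0) (-1) 0.
  have z0 := cD00 s (times P A) x.
  rewrite z0 !addr0 mulrNN mulr1 => <-; congr (cD _ _ _ _ _).
  by apply/funext => t; rewrite mulr0.
by rewrite /cdx e; apply: is_cvgM => //; exact: is_cvg_cst.
Qed.

Lemma cds_lin s P x r h h' m m' : l1_le s (rb / 2) -> 0 <= x <= 1 -> l1_le h m ->
  l1_le h' m' -> cds s P x (fun t => r * h t + h' t) = r * cds s P x h + cds s P x h'.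
move=> hs hx hh hh'; apply: cvg_lim; first exact: Rhausdorff.
have e : (fun A => cD s (times P A) x (fun t => r * h t + h' t) 0) =
    fun A => r * cD s (times P A) x h 0 + cD s (times P A) x h' 0.
  apply/funext => A; rewrite -(cD_lin); congr (cD _ _ _ _ _); ring.
rewrite e; apply: cvgD; last exact: cds_cvg hs hh' hx.
by apply: cvgM; [exact: cvg_cst | exact: cds_cvg hs hh hx].
Qed.
(** Limit of [cl_quad], whose constant is the same for all finite sets of times. The constant is
    also uniform in the predicate [P], hence valid for all initial segments of the time set. *)
Lemma comp_second : exists2 K, 0 < K & forall s s' P x x' m,
  l1_le s (rb / 2) -> l1_le s' rb -> l1_le (fun t => s' t - s t) m ->
  0 <= x <= 1 -> 0 <= x' <= 1 ->
  `|comp_on al s' P x' - comp_on al s P x -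
    (cds s P x (fun t => s' t - s t) + cdx s P x * (x' - x))| <= K * (m + `|x' - x|) ^+ 2.
have [K K0 hK] := cl_quad T; exists K => // s s' P x x' m hs hs' hh hx hx'.
have rb0 := @rb_gt0.
have hs2 : l1_le s rb by apply: l1_le_weak hs; lra.
have c1 := comp_cvg (P := P) hs2 hx; have c2 := comp_cvg (P := P) hs' hx'.
have c3 := cds_cvg (P := P) hs hh hx; have c4 := cdx_cvg (P := P) hs hx.
have c := fsB (fsB c2 c1) (fsD c3 (fsZ (y := x' - x) c4)).
rewrite (mulrC (cdx s P x)) -[X in `|X|]subr0.
apply: finsets_le c _; exists fset0 => B _; rewrite subr0 /=.
have m0 := l1_le_ge0 hh.
have := hK s s' (times P B) x x' (fun t => l1_rb t hs2 (lexx _))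
    (fun t => l1_rb t hs' (lexx _)) (le_trans (hs2 _ (times_uniq P B)) rb_le1)
    (le_trans (hs' _ (times_uniq P B)) rb_le1) hx hx'.
have -> : cD s (times P B) x (fun t => s' t - s t) (x' - x) =
  cD s (times P B) x (fun t => s' t - s t) 0 + (x' - x) * cD s (times P B) x (fun=> 0) 1.
  rewrite [RHS]addrC -(cD_lin); congr (cD _ _ _ _ _); last by ring.
  by apply/funext => t; rewrite mulr0 add0r.
move=> h; apply: le_trans h _; rewrite ler_wpM2l ?(ltW K0) //.
have hB := hh _ (times_uniq P B).
by rewrite lerXn2r ?nnegrE ?addr_ge0 ?lsum_ge0 // lerD2r.
Qed.

Lemma comp_lip K s s' P x m : mu_lip_const K -> l1_le s rb -> l1_le s' rb ->
  l1_le (fun t => s' t - s t) m -> 0 <= x <= 1 ->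
  `|comp_on al s' P x - comp_on al s P x| <= K * expR 2 * m * x /\
  `|comp_on al s' P x - comp_on al s P x| <= K * expR 2 * m * (1 - x).
move=> hK hs hs' hh hx; have [K0 _] := hK; case/andP: (hx) => x0 x1.
have c1 := comp_cvg (P := P) hs hx; have c2 := comp_cvg (P := P) hs' hx.
have c := fsB c2 c1; have m0 := l1_le_ge0 hh.
have key B : K * expR (lsum s (times P B) + lsum s' (times P B)) *
    lsum (fun t => s' t - s t) (times P B) <= K * expR 2 * m.
  apply: ler_pM; rewrite ?lsum_ge0 ?mulr_ge0 ?expR_ge0 ?(ltW K0) //; last exact: hh (times_uniq P B).
  rewrite ler_wpM2l ?(ltW K0) // ler_expR.
  have := le_trans (hs _ (times_uniq P B)) rb_le1.
  by have := le_trans (hs' _ (times_uniq P B)) rb_le1; lra.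
have hK' := cl_lip (T := T) hK.
have b B := hK' s s' (times P B) x (fun t => l1_rb t hs (lexx _))
    (fun t => l1_rb t hs' (lexx _)) hx.
split; rewrite -[X in `|X|]subr0; apply: finsets_le c _; exists fset0 => B _;
  rewrite subr0 /=; have [b1 b2] := b B.
  by apply: le_trans b1 _; rewrite ler_wpM2r.
by apply: le_trans b2 _; rewrite ler_wpM2r // subr_ge0.
Qed.

(** The Lipschitz bound in the parameters passes to the derivative through difference quotients, and
    keeps its factors [x] and [1 - x]. *)
Lemma cds_bound K s P x h m : mu_lip_const K -> l1_le s (rb / 2) -> l1_le h m ->
  0 <= x <= 1 -> `|cds s P x h| <= K * expR 2 * m * x /\
  `|cds s P x h| <= K * expR 2 * m * (1 - x).
move=> hK hs hh hx; have [C C0 hC] := comp_second; have m0 := l1_le_ge0 hh.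
have rb0 := @rb_gt0.
have hs2 : l1_le s rb by apply: l1_le_weak hs; lra.
have m1 : 0 < m + 1 by lra.
pose r0 := rb / 2 / (m + 1).
have r00 : 0 < r0 by rewrite !divr_gt0.
have key r : 0 < r -> r <= r0 ->
    r * `|cds s P x h| <= `|comp_on al (fun t => r * h t + s t) P x - comp_on al s P x| +
      r * (r * (C * m ^+ 2)) /\
    [/\ l1_le (fun t => r * h t + s t) rb & l1_le (fun t => (r * h t + s t) - s t) (r * m)].
  move=> rp rr.
  have hm : l1_le (fun t => (r * h t + s t) - s t) (r * m).
    have := l1_leZ r hh; rewrite gtr0_norm //; apply: l1_le_eq => t.
    by congr (`|_|); ring.
  have hs' : l1_le (fun t => r * h t + s t) rb.
    have := l1_leD (l1_leZ r hh) hs; apply: l1_le_weak; rewrite gtr0_norm //.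
    have : r * (m + 1) <= rb / 2 by rewrite -ler_pdivlMr.
    by lra.
  split; last by split.
  have := hC _ _ P _ _ _ hs hs' hm hx hx; rewrite !subrr mulr0 normr0 !addr0.
  have -> : cds s P x (fun t => r * h t + s t - s t) = r * cds s P x h.
    rewrite -[RHS]addr0.
    have <- : cds s P x (fun=> 0) = 0.
      have := cds_lin P (- 1) hs hx (l1_le0 (T := T)) (l1_le0 (T := T)).
      rewrite (_ : (fun t => _) = fun=> 0); last by apply/funext => t; rewrite mulr0 addr0.
      by rewrite mulN1r addNr.
    rewrite -(cds_lin P r hs hx hh (l1_le0 (T := T))); congr cds.
    by apply/funext => t; ring.
  move=> h1; rewrite -{1}(gtr0_norm rp) -normrM.
  have -> : r * cds s P x h = (comp_on al (fun t => r * h t + s t) P x - comp_on al s P x)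
    - (comp_on al (fun t => r * h t + s t) P x - comp_on al s P x - r * cds s P x h) by ring.
  apply: normB_le => //; apply: le_trans h1 _.
  by rewrite exprMn expr2 mulrCA -!mulrA.
split; apply: (le_small (c := C * m ^+ 2) r00) => r rp rr;
  have [h1 [h2 h3]] := key r rp rr; have [l1 l2] := comp_lip P hK hs2 h2 h3 hx;
  rewrite -(ler_pM2l rp); apply: le_trans h1 _; rewrite [X in _ <= X]mulrDr lerD2r.
  by apply: le_trans l1 _; rewrite le_eqVlt; apply/orP; left; apply/eqP; ring.
by apply: le_trans l2 _; rewrite le_eqVlt; apply/orP; left; apply/eqP; ring.
Qed.

(** The derivative is a limit of chord slopes, taken forward for [x <= 1 / 2] and backward otherwise
    in order to stay inside [[0, 1]]. *)
Lemma cdx_bound s P x S : l1_le s (rb / 2) -> l1_le s S -> 0 <= x <= 1 ->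
  expR (- S) <= cdx s P x <= expR S.
move=> hs hS hx; have [C C0 hC] := comp_second.
have rb0 := @rb_gt0; case/andP: (hx) => x0 x1.
have hs2 : l1_le s rb by apply: l1_le_weak hs; lra.
have hh : l1_le (fun t => s t - s t) 0.
  by apply: l1_le_eq (l1_le0 (T := T)) => t; rewrite subrr.
have z0 : cds s P x (fun t => s t - s t) = 0.
  have [K K0 hK0] := mu_param_lip.
  have [b _] := cds_bound P (conj K0 hK0) hs hh hx.
  by apply/eqP; rewrite -normr_le0; move: b; rewrite mulr0 mul0r.
have [_ _ slp] := comp_sl P hs2 hS.
have h2 : 0 < 1 / 2 :> R by lra.
have [xl|xg] := leP x (1 / 2); apply/andP; split.
- apply: (le_small (c := C) h2) => r rp rr.
  have hx' : 0 <= x + r <= 1 by andlra.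
  have := hC _ _ P _ _ _ hs hs2 hh hx hx'; rewrite z0.
  have [a _] := slp x (x + r) x0 (ltac:(lra)) (ltac:(lra)).
  have ex : x + r - x = r by ring.
  move: a; rewrite ex !add0r => a; rewrite (gtr0_norm rp) ler_norml => /andP[b1 b2].
  rewrite -(ler_pM2r rp); have -> : (cdx s P x + r * C) * r = cdx s P x * r + C * r ^+ 2 by ring.
  lra.
- apply: (le_small (c := C) h2) => r rp rr.
  have hx' : 0 <= x + r <= 1 by andlra.
  have := hC _ _ P _ _ _ hs hs2 hh hx hx'; rewrite z0.
  have [_ a] := slp x (x + r) x0 (ltac:(lra)) (ltac:(lra)).
  have ex : x + r - x = r by ring.
  move: a; rewrite ex !add0r => a; rewrite (gtr0_norm rp) ler_norml => /andP[b1 b2].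
  rewrite -(ler_pM2r rp); have -> : (expR S + r * C) * r = expR S * r + C * r ^+ 2 by ring.
  lra.
- apply: (le_small (c := C) h2) => r rp rr.
  have hx' : 0 <= x - r <= 1 by andlra.
  have := hC _ _ P _ _ _ hs hs2 hh hx hx'; rewrite z0.
  have [a _] := slp (x - r) x (ltac:(lra)) (ltac:(lra)) x1.
  have e : x - r - x = - r by ring.
  have e' : x - (x - r) = r by ring.
  move: a; rewrite e e' !add0r normrN => a; rewrite (gtr0_norm rp) ler_norml => /andP[b1 b2].
  rewrite -(ler_pM2r rp); have -> : (cdx s P x + r * C) * r = cdx s P x * r + C * r ^+ 2 by ring.
  lra.
- apply: (le_small (c := C) h2) => r rp rr.
  have hx' : 0 <= x - r <= 1 by andlra.
  have := hC _ _ P _ _ _ hs hs2 hh hx hx'; rewrite z0.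
  have [_ a] := slp (x - r) x (ltac:(lrc xg rp rr)) (ltac:(lrc xg rp rr)) x1.
  have e : x - r - x = - r by ring.
  have e' : x - (x - r) = r by ring.
  move: a; rewrite e e' !add0r normrN => a; rewrite (gtr0_norm rp) ler_norml => /andP[b1 b2].
  rewrite -(ler_pM2r rp); have -> : (expR S + r * C) * r = expR S * r + C * r ^+ 2 by ring.
  lra.
Qed.
End FixedTimes.
End Composition.

(** * Geometry of one branch of a Lorenz map *)

Section Branch.
Implicit Types u c d x y z r : R.

Lemma powR_in01 r : 0 <= r <= 1 -> 0 <= r `^ al <= r.
move=> /andP[r0 r1]; rewrite powR_ge0 /=; have [->|rn] := eqVneq r 0.
  by rewrite powR0 // gt_eqF.
by rewrite ge1r_powR // ?(ltW al1) // r1 andbT lt_neqAle eq_sym rn.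
Qed.

Lemma powR_mvt r1 r2 : 0 < r1 -> r1 <= r2 ->
  al * r1 `^ (al - 1) * (r2 - r1) <= r2 `^ al - r1 `^ al /\
  r2 `^ al - r1 `^ al <= al * r2 `^ (al - 1) * (r2 - r1).
move=> r0 r12.
have [|c /andP[c1 c2] ->] := @mvt R (fun t => t `^ al) (fun t => al * t `^ (al - 1)) r1 r2 r12.
  by move=> t /andP[t1 _]; apply: is_derive1_powR; lra.
have r21 : 0 <= r2 - r1 by rewrite subr_ge0.
by split; rewrite ler_wpM2r // ler_wpM2l ?(ltW al0) // ge0_ler_powR ?nnegrE ?(ltW be0) //; lra.
Qed.

Lemma powR_split r : 0 < r -> r `^ al = r * r `^ (al - 1).
by move=> r0; rewrite mulr_powRB1 // ltW. Qed.

Lemma powR_lip r1 r2 : 0 <= r1 -> r1 <= r2 -> r2 <= 1 ->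
  r2 `^ al - r1 `^ al <= al * (r2 - r1).
move=> r0 r12 r21; have [e|rn] := eqVneq r1 0.
  have /andP[_ h] := @powR_in01 r2 (introT andP (conj (le_trans r0 r12) r21)).
  rewrite e powR0 ?gt_eqF // !subr0; apply: le_trans h _.
  by rewrite ler_peMl ?(ltW al1) //; lra.
have r10 : 0 < r1 by rewrite lt_neqAle eq_sym rn.
have [_ h] := powR_mvt r10 r12; apply: le_trans h _.
have r20 : 0 <= r2 - r1 by rewrite subr_ge0.
rewrite -mulrA ler_wpM2l ?(ltW al0) // ler_piMl //.
have e1 : 1 `^ (al - 1) = 1 :> R by rewrite powR1.
rewrite -[X in _ <= X]e1 ge0_ler_powR ?nnegrE ?(ltW be0) //; lra.
Qed.

Definition rr c x := (c - x) / c.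
Definition qf u c x := u * (1 - (rr c x) `^ al).
Definition br (ph : R -> R) u c x := ph (qf u c x).
(** Derivative of the branch, with [D] in the role of the derivative of [ph]. Only bounds on [D] are
    ever used, so that the constant 1 is an admissible substitute. *)
Definition brd (D : R -> R) u c x := D (qf u c x) * (u * al * (rr c x) `^ (al - 1) / c).

Section Fixed.
Variables (u c : R).
Hypothesis u01 : 0 < u <= 1.
Hypothesis c01 : 0 < c <= 1.
Let u0 : 0 < u. by case/andP: u01. Qed.
Let u1 : u <= 1. by case/andP: u01. Qed.
Let c0 : 0 < c. by case/andP: c01. Qed.
Let c1 : c <= 1. by case/andP: c01. Qed.

Lemma rr_in x : 0 <= x <= c -> 0 <= rr c x <= 1.
move=> /andP[x0 xc]; rewrite /rr divr_ge0 ?subr_ge0 ?(ltW c0) //=.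
by rewrite ler_pdivrMr // mul1r lerBlDr lerDl.
Qed.

Lemma rr_gt0 x : x < c -> 0 < rr c x.
by move=> xc; rewrite divr_gt0 ?subr_gt0. Qed.

Lemma rr_lt x y : x < y -> rr c y < rr c x.
by move=> xy; rewrite ltr_pM2r ?invr_gt0 // ltrD2l ltrN2. Qed.

Lemma rrM x : c * rr c x = c - x.
by rewrite /rr mulrCA divff ?mulr1 // gt_eqF. Qed.

Lemma qf0 : qf u c 0 = 0.
by rewrite /qf /rr subr0 divff ?gt_eqF // powR1 subrr mulr0. Qed.

Lemma qfc : qf u c c = u.
by rewrite /qf /rr subrr mul0r powR0 ?gt_eqF // subr0 mulr1. Qed.

Lemma qf_lt x y : x < y -> y <= c -> qf u c x < qf u c y.
move=> xy yc; rewrite /qf ltr_pM2l // ltrD2l ltrN2 gt0_ltr_powR ?nnegrE ?rr_lt //.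
  by rewrite /rr divr_ge0 ?subr_ge0 ?(ltW c0).
by rewrite /rr divr_ge0 ?subr_ge0 ?(ltW c0) //; lra.
Qed.

Lemma qf_le x y : x <= y -> y <= c -> qf u c x <= qf u c y.
by rewrite le_eqVlt => /predU1P[-> //|xy yc]; rewrite ltW // qf_lt. Qed.

Lemma qf_in x : 0 <= x <= c -> 0 <= qf u c x <= u.
move=> /andP[x0 xc]; have h1 := qf_le x0 xc; have h2 := qf_le xc (lexx c).
by rewrite qf0 in h1; rewrite qfc in h2; rewrite h1 h2.
Qed.

Lemma qf_in1 x : 0 <= x <= c -> 0 <= qf u c x <= 1.
by move=> /qf_in/andP[-> h]; exact: le_trans h u1. Qed.

Lemma qf_diff x y : qf u c y - qf u c x = u * ((rr c x) `^ al - (rr c y) `^ al).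
by rewrite /qf; ring. Qed.

Lemma rr_diff x y : rr c x - rr c y = (y - x) / c.
by rewrite /rr -mulrBl; congr (_ / _); ring. Qed.

Lemma qf_lip x y : 0 <= x -> x <= y -> y <= c -> qf u c y - qf u c x <= al / c * (y - x).
move=> x0 xy yc; rewrite qf_diff.
have /andP[ry0 _] := rr_in (introT andP (conj (le_trans x0 xy) yc)).
have /andP[rx0 rx1] := rr_in (introT andP (conj x0 (le_trans xy yc))).
have rxy : rr c y <= rr c x by rewrite -subr_ge0 rr_diff divr_ge0 ?subr_ge0 ?(ltW c0).
have h := powR_lip ry0 rxy rx1; rewrite rr_diff in h.
have -> : al / c * (y - x) = al * ((y - x) / c) by ring.
apply: le_trans h; rewrite ler_piMl // subr_ge0 ge0_ler_powR ?nnegrE ?(ltW al0) //.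
Qed.

Lemma qf_slopes a b x : 0 <= a -> a <= x <= b -> b < c ->
  slopes ((al - 1) * (ln (c - a) - ln (c - b))) (qf u c) a b (u * al * (rr c x) `^ (al - 1) / c).
move=> a0 /andP[ax xb] bc z w h1 h2 h3.
have rb0 := rr_gt0 bc.
have mono s t : s <= t -> rr c t <= rr c s.
  by move=> st; rewrite -subr_ge0 rr_diff divr_ge0 ?subr_ge0 ?(ltW c0).
have hx : rr c b <= rr c x <= rr c a by rewrite !mono.
have := @pow_slope R al (rr c b) (rr c a) (rr c x) al1 rb0 hx (rr c w) (rr c z)
  (mono _ _ h3) (mono _ _ h2) (mono _ _ h1).
rewrite rr_diff qf_diff.
have -> : ln (rr c a) - ln (rr c b) = ln (c - a) - ln (c - b).
  rewrite /rr !ln_div ?posrE //; try lra.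
set E := expR _; set P := _ `^ (al - 1); set A := _ - _ `^ al => -[p1 p2].
have e : u * al * P / c * (w - z) = u * (al * P * ((w - z) / c)) by ring.
rewrite e; split.
  by rewrite (mulrCA E) ler_wpM2l // ltW.
by rewrite (mulrCA E) ler_wpM2l // ltW.
Qed.

(* Chord slopes of the branch dominate the slope towards the critical point. *)
Lemma qf_concave x y : 0 <= x -> x <= y -> y < c ->
  al * (u - qf u c y) * (y - x) <= (qf u c y - qf u c x) * (c - y).
move=> x0 xy yc; have r0 := rr_gt0 yc.
have rxy : rr c y <= rr c x by rewrite -subr_ge0 rr_diff divr_ge0 ?subr_ge0 ?(ltW c0).
have [h _] := powR_mvt r0 rxy; rewrite rr_diff in h.
rewrite qf_diff -(rrM y) -{1}qfc qf_diff.
have -> : (rr c c) `^ al = 0 by rewrite /rr subrr mul0r powR0 // gt_eqF.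
have q := ler_wpM2l (ltW (mulr_gt0 u0 (mulr_gt0 c0 r0))) h.
have e : u * (c * rr c y) * (al * rr c y `^ (al - 1) * ((y - x) / c)) =
   al * (u * (rr c y * rr c y `^ (al - 1))) * (y - x) by field; rewrite gt_eqF.
rewrite e -powR_split // in q.
by rewrite subr0; lra.
Qed.

(** The left branch of Q is concave and vanishes at 0, so the chord from 0 is steeper than the
    tangent. Relative changes of a point are therefore not increased by Q. *)
Lemma qf_star x : 0 <= x -> x < c -> x * (u * al * (rr c x) `^ (al - 1) / c) <= qf u c x.
move=> x0 xc; have r0 := rr_gt0 xc.
have /andP[_ r1] := rr_in (introT andP (conj x0 (ltW xc))).
have [h _] := powR_mvt r0 r1; rewrite powR1 in h.
rewrite /qf (_ : x * _ = u * (al * rr c x `^ (al - 1) * (1 - rr c x))).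
  by rewrite ler_wpM2l // ltW.
by rewrite /rr; field; rewrite gt_eqF.
Qed.

Section Phi.
Variables (d : R) (ph D : R -> R).
Hypothesis d0 : 0 <= d.
Hypothesis hph : sl d ph.
Hypothesis hD : forall x, 0 <= x <= 1 -> expR (- d) <= D x <= expR d.
Let A := ph u.

Lemma br_lt x y : 0 <= x -> x < y -> y <= c -> br ph u c x < br ph u c y.
move=> x0 xy yc; apply: (sl_lt hph); last 2 first.
- exact: qf_lt.
- by have /andP[] := qf_in1 (introT andP (conj (ltW (le_lt_trans x0 xy)) yc)).
- by have /andP[] := qf_in1 (introT andP (conj x0 (ltW (lt_le_trans xy yc)))).
Qed.

Lemma br_le x y : 0 <= x -> x <= y -> y <= c -> br ph u c x <= br ph u c y.
by move=> x0; rewrite le_eqVlt => /predU1P[-> //|xy yc]; rewrite ltW // br_lt.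
Qed.

Lemma br0 : br ph u c 0 = 0.
by rewrite /br qf0; case: hph. Qed.

Lemma brc : br ph u c c = A.
by rewrite /br qfc. Qed.

Lemma br_in x : 0 <= x <= c -> 0 <= br ph u c x <= A.
move=> /andP[x0 xc]; have h1 := br_le (lexx 0) x0 xc; have h2 := br_le x0 xc (lexx c).
by rewrite br0 in h1; rewrite brc in h2; rewrite h1 h2.
Qed.

Lemma A_le1 : 0 < A <= 1.
have [p0 p1 _] := hph; have h1 := sl_lt hph (lexx 0) u0 u1.
have h2 := sl_le hph (ltW u0) u1 (lexx 1).
by rewrite p0 in h1; rewrite p1 in h2; rewrite /A h1 h2.
Qed.

Lemma br_lip x y : 0 <= x <= c -> 0 <= y <= c ->
  `|br ph u c y - br ph u c x| <= expR d * (al / c) * `|y - x|.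
wlog xy : x y / x <= y.
  move=> H xab yab; have [xy|/ltW yx] := leP x y; first exact: H.
  by rewrite distrC (distrC y); exact: H.
move=> hx hy; case/andP: (hx) => x0 xc; case/andP: (hy) => y0 yc.
apply: le_trans (sl_lip hph (qf_in1 hx) (qf_in1 hy)) _.
rewrite -mulrA ler_wpM2l ?expR_ge0 //.
rewrite !ger0_norm ?subr_ge0 ?qf_le //; exact: qf_lip.
Qed.

Lemma br_gap x : 0 <= x <= c ->
  expR (- d) * (u * rr c x `^ al) <= A - br ph u c x /\
  A - br ph u c x <= expR d * (u * rr c x `^ al).
move=> hx; have [_ _ h] := hph.
have /andP[q0 q1] := qf_in hx.
have := h _ _ q0 q1 u1.
by have -> : u - qf u c x = u * rr c x `^ al by rewrite /qf; ring.
Qed.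

Lemma brd_gt0 x : 0 <= x -> x < c -> 0 < brd D u c x.
move=> x0 xc; have /andP[h _] := hD (qf_in1 (introT andP (conj x0 (ltW xc)))).
rewrite /brd mulr_gt0 ?(lt_le_trans (expR_gt0 _) h) // !mulr_gt0 ?invr_gt0 //.
by rewrite powR_gt0 // rr_gt0.
Qed.

Lemma br_slopes a b x : 0 <= a -> a <= x <= b -> b < c ->
  slopes ((al - 1) * (ln (c - a) - ln (c - b)) + (d + d)) (br ph u c) a b (brd D u c x).
move=> a0 hx bc; case/andP: (hx) => ax xb.
have qx : 0 <= qf u c x <= 1 by apply: qf_in1; andlra.
have qa : 0 <= qf u c a <= 1 by apply: qf_in1; andlra.
have qb : 0 <= qf u c b <= 1 by apply: qf_in1; andlra.
have hd := hD qx; have Dx0 : 0 <= D (qf u c x).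
  by case/andP: hd => h _; exact: le_trans (expR_ge0 _) h.
apply: (slopes_comp Dx0) (qf_slopes a0 hx bc) _.
  by move=> z w h1 h2 h3; apply: qf_le => //; lra.
case/andP: qa => qa0 _; case/andP: qb => _ qb1.
exact: slopes_sub qa0 qb1 (sl_slopes hph hd).
Qed.

Lemma br_star x : 0 <= x -> x < c -> x * brd D u c x <= expR (d + d) * br ph u c x.
move=> x0 xc; have hq := qf_in1 (introT andP (conj x0 (ltW xc))).
have /andP[_ h] := hD hq; have [h1 _] := sl_bound hph hq.
have s := qf_star x0 xc; case/andP: hq => q0 _.
have e1 := expR_gt0 d; rewrite /brd.
have -> : x * (D (qf u c x) * (u * al * rr c x `^ (al - 1) / c)) =
  D (qf u c x) * (x * (u * al * rr c x `^ (al - 1) / c)) by ring.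
have p0 : 0 <= x * (u * al * rr c x `^ (al - 1) / c).
  by rewrite !mulr_ge0 ?invr_ge0 ?powR_ge0 ?(ltW u0) ?(ltW al0) ?(ltW c0).
apply: (@le_trans _ _ (expR d * qf u c x)).
  by apply: ler_pM => //; apply: le_trans (expR_ge0 (- d)) _; have /andP[] := hD (qf_in1 (introT andP (conj x0 (ltW xc)))).
rewrite expRD -mulrA ler_wpM2l ?(ltW e1) //.
have := ler_wpM2l (ltW e1) h1; rewrite mulrA -expRD subrr expR0 mul1r; exact.
Qed.

Hypothesis cA : c <= A.

(** The gap [A - br x] is of the form constant times (c - x) ^ al up to distortion, so the
    derivative is about [al] times this gap divided by [c - x]; and [c - x <= A - x] by [cA]. In
    this form the inequality telescopes along an orbit. *)
Lemma brd_low x : 0 <= x -> x < c ->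
  al * expR (- (d + d)) * (A - br ph u c x) <= brd D u c x * (A - x).
move=> x0 xc; have r0 := rr_gt0 xc.
have hx : 0 <= x <= c by rewrite x0 ltW.
have [_ h] := br_gap hx; have /andP[hd _] := hD (qf_in1 hx).
have crA : c * rr c x <= A - x by rewrite rrM lerD2r.
have Pp : 0 < rr c x `^ (al - 1) by rewrite powR_gt0.
apply: (@le_trans _ _ (al * expR (- (d + d)) * (expR d * (u * rr c x `^ al)))).
  by rewrite ler_wpM2l // mulr_ge0 ?expR_ge0 ?(ltW al0).
have -> : al * expR (- (d + d)) * (expR d * (u * rr c x `^ al)) =
   expR (- d) * (u * al * rr c x `^ (al - 1) / c) * (c * rr c x).
  rewrite powR_split // opprD expRD.
  have e : expR (- d) * expR d = 1 by rewrite -expRD addrC subrr expR0.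
  have -> : al * (expR (- d) * expR (- d)) * (expR d * (u * (rr c x * rr c x `^ (al - 1)))) =
     (expR (- d) * expR d) * (al * expR (- d) * (u * (rr c x * rr c x `^ (al - 1)))) by ring.
  by rewrite e mul1r; field; rewrite gt_eqF.
apply: ler_pM => //.
- by rewrite !mulr_ge0 ?expR_ge0 ?invr_ge0 ?(ltW u0) ?(ltW al0) ?(ltW c0) ?(ltW Pp).
- by rewrite mulr_ge0 ?(ltW c0) ?(ltW r0).
- by rewrite /brd ler_wpM2r // !mulr_ge0 ?invr_ge0 ?(ltW u0) ?(ltW al0) ?(ltW c0) ?(ltW Pp).
Qed.

(* One step of the distortion estimate: the logarithmic gap to the critical value
   expands by the factor al, up to the distortion of ph. *)
Lemma br_loggap x y : 0 <= x -> x <= y -> y < c ->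
  ln (A - x) - ln (A - y) <= ln (c - x) - ln (c - y) /\
  al * (ln (c - x) - ln (c - y)) <=
    ln (A - br ph u c x) - ln (A - br ph u c y) + (d + d).
move=> x0 xy yc.
have p1 : 0 < c - y by lra.
have p2 : 0 < c - x by lra.
have hcA := cA.
have p3 : 0 < A - y by lra.
have p4 : 0 < A - x by lra.
split.
  rewrite -!ln_div ?posrE // ler_ln ?posrE ?divr_gt0 //.
  rewrite ler_pdivrMr // mulrAC ler_pdivlMr //; nra.
have hx : 0 <= x <= c by andlra.
have hy : 0 <= y <= c by andlra.
have [g1 _] := br_gap hx; have [_ g2] := br_gap hy.
have rx := rr_gt0 (le_lt_trans xy yc); have ry := rr_gt0 yc.
have q1 : 0 < expR (- d) * (u * rr c x `^ al) by rewrite !mulr_gt0 ?expR_gt0 ?powR_gt0.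
have q2 : 0 < A - br ph u c y.
  have [g _] := br_gap hy; apply: lt_le_trans g.
  by rewrite !mulr_gt0 ?expR_gt0 ?powR_gt0.
have l1 : ln (expR (- d) * (u * rr c x `^ al)) <= ln (A - br ph u c x).
  by rewrite ler_ln ?posrE //; lra.
have l2 : ln (A - br ph u c y) <= ln (expR d * (u * rr c y `^ al)).
  by rewrite ler_ln ?posrE //; lra.
have L s z : 0 < rr c z -> 0 < c - z ->
    ln (expR s * (u * rr c z `^ al)) = s + (ln u + al * (ln (c - z) - ln c)).
  move=> z0 z1; rewrite lnM ?posrE ?expR_gt0 ?mulr_gt0 ?powR_gt0 // expRK.
  by rewrite lnM ?posrE ?powR_gt0 // ln_powR /rr ln_div ?posrE.
rewrite !L // in l1 l2; lra.
Qed.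
End Phi.
End Fixed.
End Branch.

(** * Orbits that stay on the left branch: distortion, expansion, relative position *)

Section Chain.
Variables (u c d : R) (ph Dph ps Dps : R -> R).
Hypothesis u01 : 0 < u <= 1.
Hypothesis c01 : 0 < c <= 1.
Hypothesis d0 : 0 <= d.
Hypothesis hph : sl d ph.
Hypothesis hps : sl d ps.
Hypothesis hDph : forall x, 0 <= x <= 1 -> expR (- d) <= Dph x <= expR d.
Hypothesis hDps : forall x, 0 <= x <= 1 -> expR (- d) <= Dps x <= expR d.
Hypothesis cA : c <= ph u.
Implicit Types y z : R.
Let c1 : c <= 1. by case/andP: c01. Qed.
Let A := ph u.

Definition KK n y := iter n (br ph u c) (ps y).
Fixpoint Dn n y : R :=
  if n is m.+1 then brd Dph u c (KK m y) * Dn m y else Dps y.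

Definition itin n y := 0 <= y <= 1 /\ forall j, (j < n)%N -> KK j y < c.

Lemma itinS n m y : (m <= n)%N -> itin n y -> itin m y.
by move=> mn [y01 h]; split => // j jm; apply: h; exact: leq_trans mn. Qed.

Lemma KK_in n y : itin n y -> 0 <= KK n y <= 1.
move=> [y01 h]; elim: n h => [|n IH] h; first exact: sl_in hps y01.
have zc := h n (ltnSn n); have /andP[z0 _] := IH (fun j jn => h j (ltnW jn)).
have /andP[b0 bA] := br_in u01 c01 hph (introT andP (conj z0 (ltW zc))).
by rewrite /KK iterS b0 (le_trans bA) //; have /andP[] := A_le1 u01 hph.
Qed.

Lemma KK_mono n y y' : 0 <= y -> y <= y' -> itin n y' ->
  itin n y /\ (KK n y <= KK n y') /\ (y < y' -> KK n y < KK n y').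
move=> y0 yy hi; have [/andP[y0' y1'] h] := hi.
have y01 : 0 <= y <= 1 by andlra.
elim: n h hi => [|n IH] h hi.
  split; first by split.
  by split=> [|e]; [exact: sl_le hps _ _ _ | exact: sl_lt hps _ _ _].
have hn := itinS (leqnSn n) hi.
have [[_ hh] [le lt]] := IH (fun j jn => h j (ltnW jn)) hn.
have zc := h n (ltnSn n).
have /andP[z0 _] := KK_in (conj y01 hh : itin n y).
split; last split.
- split=> // j; rewrite ltnS leq_eqVlt => /predU1P[->|]; last exact: hh.
  exact: le_lt_trans zc.
- by rewrite /KK !iterS; apply: (br_le u01 c01 hph) => //; exact: ltW.
- by move=> e; rewrite /KK !iterS; apply: (br_lt u01 c01 hph) (lt e) _ => //; exact: ltW.
Qed.

Lemma Dn_gt0 n y : itin n y -> 0 < Dn n y.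
elim: n => [|n IH] hi /=.
  by have [y01 _] := hi; have /andP[h _] := hDps y01; exact: lt_le_trans (expR_gt0 _) h.
have hn := itinS (leqnSn n) hi; rewrite mulr_gt0 ?IH //.
have /andP[z0 _] := KK_in hn; have [_ h] := hi.
exact: (brd_gt0 u01 c01 hDph z0 (h n (ltnSn n))).
Qed.

(** With G_n the logarithmic gap to [A] at step n and g the one to [c], [br_loggap] gives G_n <= g
    and al g <= G_(n+1) + 2d. A step adds (al - 1) g + 2d to the distortion, so G_n + (al - 1) g is
    replaced by G_(n+1): only the last gap and the terms in [d] survive. *)
Lemma KK_slopes n y1 y y2 : 0 <= y1 -> y1 <= y <= y2 -> itin n y2 -> KK n y2 < A ->
  slopes (ln (A - KK n y1) - ln (A - KK n y2) + 4 * d * n%:R + 2 * d) (KK n) y1 y2 (Dn n y).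
move=> y10 /andP[y1y yy2]; elim: n => [|n IH] hi hA.
  have [/andP[q0 q1] _] := hi.
  have hy : 0 <= y <= 1 by andlra.
  have hs := sl_slopes hps (hDps hy).
  have m12 : KK 0 y1 <= KK 0 y2 by apply: (sl_le hps) => //; lra.
  have D0 : 0 <= Dps y by have /andP[h _] := hDps hy; exact: le_trans (expR_ge0 _) h.
  apply: (slopes_weak (eta := d + d)) => //; last exact: slopes_sub hs.
    rewrite mulr0 addr0; have : ln (A - KK 0 y2) <= ln (A - KK 0 y1).
      by rewrite ler_ln ?posrE; lra.
    lra.
  by move=> z w h1 h2 h3; apply: (sl_le hps) => //; lra.
have hn := itinS (leqnSn n) hi; have [_ hit] := hi; have zc := hit n (ltnSn n).
have hA' : KK n y2 < A by exact: lt_le_trans zc cA.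
have y1y2 : y1 <= y2 by lra.
have [i1 [m12 _]] := KK_mono y10 y1y2 hn.
have y0 : 0 <= y by lra.
have [iy [my _]] := KK_mono y0 yy2 hn.
have [_ [my1 _]] := KK_mono y10 y1y iy.
have /andP[z0 _] := KK_in i1.
have hz : KK n y1 <= KK n y <= KK n y2 by rewrite my1 my.
have hb := br_slopes u01 c01 hph hDph z0 hz zc.
have [l1 l2] := br_loggap u01 c01 hph cA z0 m12 zc.
have /andP[zy0 _] := KK_in iy.
have B0 := brd_gt0 u01 c01 hDph zy0 (le_lt_trans my zc).
have mono z w : y1 <= z -> z <= w -> w <= y2 -> KK n z <= KK n w.
  move=> h1 h2 h3; have w0 : 0 <= w by lra.
  have [iw _] := KK_mono w0 h3 hn.
  by have [_ []] := KK_mono (le_trans y10 h1) h2 iw.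
have := slopes_comp (ltW B0) mono (IH hn hA') hb.
apply: slopes_weak.
- by rewrite mulr_ge0 ?(ltW B0) //; exact: ltW (Dn_gt0 iy).
- rewrite -[n.+1%:R]natr1; move: l1 l2; rewrite -/A -!iterS -!/(KK n.+1 _) => l1 l2.
  by move: l1 l2; lra.
- move=> z w h1 h2 h3; have w0 : 0 <= w by lra.
  have [iw _] := KK_mono w0 h3 hi.
  by have [_ []] := KK_mono (le_trans y10 h1) h2 iw.
Qed.

(** Telescoping [brd_low]: the derivative times the initial gap dominates the final gap times the
    n-th power of [al], up to distortion, and the initial gap is at most 1. *)
Lemma Dn_low n y : itin n y ->
  expR (- d) * (al * expR (- (d + d))) ^+ n * (A - KK n y) <= Dn n y.
set E := al * expR _ => hi.
have E0 : 0 < E by rewrite mulr_gt0 ?expR_gt0.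
have /andP[A0 A1] := A_le1 u01 hph.
have [hy hit0] := hi; have /andP[D1 D2] := hDps hy.
have k1 : A - KK 0 y <= 1.
  by have /andP[z0 _] := sl_in hps hy; rewrite /KK /= /A; lra.
(* A negative initial gap can occur only for [n = 0], since otherwise the first point is left of
   [c <= A]; then the left-hand side is not positive. *)
have [k0|k0] := ltP (A - KK 0 y) 0.
  case: n hi hit0 => [|n] hi hit0; last by have := hit0 0%N isT; have := cA; rewrite -/A; lra.
  rewrite expr0 mulr1 /=; apply: (@le_trans _ _ 0).
    by rewrite pmulr_rle0 ?expR_gt0 // ltW.
  exact: le_trans (expR_ge0 _) D1.
suff h : expR (- d) * E ^+ n * (A - KK n y) <= Dn n y * (A - KK 0 y).
  apply: le_trans h _; rewrite ler_piMr //; exact: ltW (Dn_gt0 hi).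
elim: n hi {hit0} => [|n IH] hi; first by rewrite expr0 mulr1 ler_wpM2r.
have hn := itinS (leqnSn n) hi; have [_ hit] := hi; have zc := hit n (ltnSn n).
have /andP[z0 _] := KK_in hn.
have Az : 0 < A - KK n y by rewrite subr_gt0 (lt_le_trans zc cA).
have b := brd_low u01 c01 hph hDph cA z0 zc.
have B0 := brd_gt0 u01 c01 hDph z0 zc.
have e0 : 0 <= expR (- d) * E ^+ n by rewrite mulr_ge0 ?expR_ge0 ?exprn_ge0 ?ltW.
have := ler_wpM2l e0 b; have := ler_wpM2l (ltW B0) (IH hn).
rewrite -/A -/E -iterS -/(KK n.+1 y) => h1 h2.
rewrite exprS -[Dn n.+1 y]/(brd Dph u c (KK n y) * Dn n y).
by move: h1 h2; lra.
Qed.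

(** [br_star] along the orbit: the quotient of the j-th point by the derivative up to time j does
    not decrease in j, up to distortion. A perturbation proportional to the j-th point thus ends up
    at most proportional to the last point. *)
Lemma KK_star n j y : itin n y -> (j <= n)%N ->
  KK j y * Dn n y <= expR ((d + d) * n%:R) * KK n y * Dn j y.
elim: n => [|n IH] hi.
  by rewrite leqn0 => /eqP->; rewrite mulr0 expR0 mul1r.
have hn := itinS (leqnSn n) hi; have [_ hit] := hi; have zc := hit n (ltnSn n).
have /andP[z0 _] := KK_in hn; have /andP[w0 _] := KK_in hi.
have dn0 : 0 <= (d + d) * n.+1%:R by rewrite mulr_ge0 ?addr_ge0.
rewrite leq_eqVlt => /predU1P[->|]; last rewrite ltnS => jn.
  have e1 : 1 <= expR ((d + d) * n.+1%:R).
    by have := expR_ge1Dx ((d + d) * n.+1%:R); lra.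
  by rewrite -mulrA; exact: ler_peMl (mulr_ge0 w0 (ltW (Dn_gt0 hi))) e1.
have B0 := brd_gt0 u01 c01 hDph z0 zc.
have s := br_star u01 c01 hph hDph z0 zc.
have h := ler_wpM2l (ltW B0) (IH hn jn); have Dj := Dn_gt0 (itinS jn hn).
rewrite /= -natr1 mulrDr mulr1 expRD /=.
have q : 0 <= expR ((d + d) * n%:R) * Dn j y by rewrite mulr_ge0 ?expR_ge0 ?(ltW Dj).
have := ler_wpM2l q s; rewrite -iterS -/(KK n.+1 y); lra.
Qed.

Lemma KK_star0 n y : itin n y -> y * Dn n y <= expR ((d + d) * n.+1%:R) * KK n y.
move=> hi; have [hy _] := hi; have := KK_star hi (leq0n n).
have /andP[D1 D2] := hDps hy; have [s _] := sl_bound hps hy.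
have Dp : 0 < Dps y by exact: lt_le_trans (expR_gt0 _) D1.
have e : expR d * expR (- d) = 1 by rewrite -expRD subrr expR0.
have /andP[w0 _] := KK_in hi; have Dn0 := Dn_gt0 hi.
have h1 : y <= expR d * KK 0 y.
  have := ler_wpM2l (expR_ge0 d) s; rewrite mulrA e mul1r; exact.
move=> /= h2.
apply: (@le_trans _ _ (expR d * (expR ((d + d) * n%:R) * KK n y * Dps y))).
  apply: (@le_trans _ _ (expR d * KK 0 y * Dn n y)); first by rewrite ler_wpM2r // ltW.
  by rewrite -mulrA ler_wpM2l ?expR_ge0.
rewrite -natr1 mulrDr mulr1 expRD (expRD d d).
have -> : expR d * (expR ((d + d) * n%:R) * KK n y * Dps y) =
  expR ((d + d) * n%:R) * KK n y * (expR d * Dps y) by ring.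
have -> : expR ((d + d) * n%:R) * (expR d * expR d) * KK n y =
  expR ((d + d) * n%:R) * KK n y * (expR d * expR d) by ring.
by rewrite ler_wpM2l ?mulr_ge0 ?expR_ge0 // ler_wpM2l ?expR_ge0.
Qed.

Lemma KK_lip n y2 : itin n y2 -> forall x y, 0 <= x <= y2 -> 0 <= y <= y2 ->
  `|KK n y - KK n x| <= (expR d * (al / c)) ^+ n * expR d * `|y - x|.
elim: n => [|n IH] hi x y hx hy.
  have [/andP[_ y21] _] := hi; rewrite expr0 mul1r; apply: (sl_lip hps).
    by case/andP: hx => -> h; exact: le_trans h y21.
  by case/andP: hy => -> h; exact: le_trans h y21.
have hn := itinS (leqnSn n) hi; have [_ hit] := hi; have zc := hit n (ltnSn n).
have key z : 0 <= z <= y2 -> 0 <= KK n z <= c.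
  move=> /andP[z0 z2]; have [iz [m _]] := KK_mono z0 z2 hn.
  by have /andP[-> _] := KK_in iz; rewrite (le_trans m) // ltW.
rewrite /KK !iterS; apply: le_trans (br_lip u01 c01 hph (key _ hx) (key _ hy)) _.
rewrite exprS -!mulrA ler_wpM2l ?expR_ge0 // ler_wpM2l ?(ltW al0) //.
rewrite ler_wpM2l //; first by case/andP: c01 => /ltW; rewrite invr_ge0.
by rewrite mulrA; exact: IH.
Qed.

Lemma KK_surj n y2 v : itin n y2 -> 0 <= v <= KK n y2 ->
  exists2 y, 0 <= y <= y2 & KK n y = v.
move=> hi hv; have [/andP[y20 _] _] := hi.
apply: lip_IVT (KK_lip hi) _ => //.
suff -> : KK n 0 = 0 by [].
elim: n {hi hv} => [|n IH]; first by case: hps.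
by rewrite /KK iterS -/(KK n 0) IH; apply: br0; eauto.
Qed.
End Chain.

Section ConcaveFix.

(** The graph of [G] after Q rises from below the diagonal at [x2] to above it at [c], so its mean
    slope on [[x2, c]] is at least 1. By concavity of the power the mean slope on [[x1, x2]] exceeds
    this by the factor [al], up to [expR (eta + eta)], hence is larger than 1, and the graph lies
    strictly below the diagonal at [x1]. *)
Lemma concave_fix (u c eta D : R) (G : R -> R) x1 x2 : 0 < u <= 1 -> 0 < c <= 1 ->
  expR (eta + eta) < al -> 0 < D -> 0 <= x1 -> x1 < x2 -> x2 < c ->
  slopes eta G (qf u c x1) u D -> c <= G u ->
  G (qf u c x2) <= x2 -> G (qf u c x1) < x1.
move=> u01 c01 hal D0 x10 x12 x2c hG cG h2.
have k := qf_concave u01 c01 x10 (ltW x12) x2c.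
have y12 := qf_lt u01 c01 x12 (ltW x2c).
have y2u := qf_lt u01 c01 x2c (lexx c); rewrite (qfc) in y2u.
set y1 := qf u c x1 in k y12 hG *; set y2 := qf u c x2 in k y12 y2u h2 *.
have [a _] := hG _ _ (lexx _) (ltW y12) (ltW y2u).
have [_ b] := hG _ _ (ltW y12) (ltW y2u) (lexx _).
have E0 := expR_gt0 eta.
have cx : 0 < c - x2 by rewrite subr_gt0.
have xx : 0 < x2 - x1 by rewrite subr_gt0.
have D1 := ltW D0; have E1 := ltW E0.
have s1 := ler_wpM2r (ltW cx) a.
have s2 := ler_wpM2l (mulr_ge0 E1 D1) k.
have s3 := ler_wpM2r (ltW xx) b.
have s4 := ler_wpM2l (ltW al0) s3.
have s5 := ler_wpM2l E1 s1.
have EE : expR (eta + eta) = expR eta * expR eta by rewrite expRD.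
have GG : c - x2 <= G u - G y2 by lrc cG h2.
have s6 := ler_wpM2l (mulr_ge0 (ltW al0) (ltW xx)) GG.
have key : al * (x2 - x1) * (c - x2) <= expR (eta + eta) * ((G y2 - G y1) * (c - x2)).
  rewrite EE; lrc s2 s4 s5 s6.
have : expR (eta + eta) * (x2 - x1) < expR (eta + eta) * (G y2 - G y1).
  apply: (@lt_le_trans _ _ (al * (x2 - x1))); first by rewrite ltr_pM2r.
  by rewrite -(ler_pM2r cx) -(mulrA _ (G y2 - G y1)).
rewrite ltr_pM2l ?expR_gt0 //; lrc h2.
Qed.
End ConcaveFix.

(** * Zoom parameters of a decomposition as a differentiable map into l^1 *)

Section ZoomParam.
Context {d : Order.disp_t} {T : orderType d}.
Implicit Types (s h : T -> R) (x y : R) (t : T).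
Notation cb := (comp_before al).
Notation cds s t := (@cds d T s (fun t' => (t' < t)%O)).
Notation cdx s t := (@cdx d T s (fun t' => (t' < t)%O)).

Lemma zoom_paramE s x y t : l1_le s rb -> 0 <= x -> x < y -> y <= 1 ->
  zoom_param al s (x, y) t = ml (s t) (cb s t y) - ml (s t) (cb s t x).
move=> hs x0 xy y1; have hsl := comp_sl (fun t' => (t' < t)%O) hs hs.
have hx : 0 <= x <= 1 by andlra.
have hy : 0 <= y <= 1 by andlra.
apply: (pure_paramE) => z hz; apply: (zoom_mu) => //.
- by have /andP[] := sl_in hsl hx.
- exact: sl_lt hsl x0 xy y1.
- by have /andP[] := sl_in hsl hy.
Qed.

Definition mlc s x t := ml (s t) (cb s t x).
(** Derivative of [mlc] in the direction ([h], [xi]): the parameter at time [t] itself, and the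
    motion of the point that earlier times carry to time [t]. *)
Definition dmlc s x h (xi : R) t :=
  mls (s t) (cb s t x) * h t + mlx (s t) (cb s t x) * (cds s t x h + cdx s t x * xi).

Lemma dmlc_lin s x r h h' xi xi' m m' t : l1_le s (rb / 2) -> 0 <= x <= 1 ->
  l1_le h m -> l1_le h' m' ->
  dmlc s x (fun t => r * h t + h' t) (r * xi + xi') t = r * dmlc s x h xi t + dmlc s x h' xi' t.
by move=> hs hx hh hh'; rewrite /dmlc (cds_lin _ r hs hx hh hh'); ring. Qed.

(** [ml_so] bounds only the product of [mls] with a parameter difference, so a parameter different
    from [s] is supplied in order to divide by that difference. *)
Lemma mls_bound : exists2 K, 0 < K & forall (s x : R), `|s| <= rb -> 0 <= x <= 1 ->
  `|mls s x| <= K.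
have [K K0 hK] := ml_so; exists K => // s x hs hx.
have rb0 := @rb_gt0.
have [s' hs' sn] : exists2 s', `|s'| <= rb & s' != s.
  have [->|s0] := eqVneq s 0; last by exists 0; rewrite ?normr0 ?ltW // eq_sym.
  by exists rb; rewrite ?gtr0_norm // gt_eqF.
have [h _ _] := hK _ _ _ _ hs hs' hx hx.
by move: h; rewrite normrM ler_pM2r // normr_gt0 subr_eq0.
Qed.

(** Summability in [t]: the first term is a bounded multiple of [h t], and in the second [mlx]
    supplies a factor [|s t|]. *)
Lemma dmlc_bound : exists2 K, 0 < K & forall s x h m xi, l1_le s (rb / 2) -> l1_le h m ->
  0 <= x <= 1 -> l1_le (dmlc s x h xi) (K * (m + `|xi|)).
have [K1 K10 hK1] := mls_bound; have [K2 K20 hK2] := mu_param_lip.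
have rb0 := @rb_gt0.
pose C := expR 1 * expR 1 * (K2 * expR 2 + expR 1).
have C0 : 0 < C by rewrite !mulr_gt0 ?expR_gt0 // addr_gt0 ?mulr_gt0 ?expR_gt0.
exists (K1 + C); first by lra.
move=> s x h m xi hs hh hx; have m0 := l1_le_ge0 hh.
have hs2 : l1_le s rb by apply: l1_le_weak hs; lra.
have N0 : 0 <= m + `|xi| by rewrite addr_ge0.
have key t : `|dmlc s x h xi t| <= `|K1 * h t| + `|C * (m + `|xi|) * s t|.
  have hc := comp_in (fun t' => (t' < t)%O) hs2 hx.
  have st := l1_rb t hs2 (lexx _).
  apply: normD_le.
    by rewrite normrM [X in _ <= X]normrM (gtr0_norm K10) ler_wpM2r //; exact: hK1 st hc.
  rewrite normrM; apply: le_trans (ler_wpM2r (normr_ge0 _) (mlx_bound st hc)) _.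
  rewrite [X in _ <= X]normrM (ger0_norm (mulr_ge0 (ltW C0) N0)) mulrAC ler_wpM2r //.
  rewrite /C -!mulrA ler_wpM2l ?expR_ge0 // ler_wpM2l ?expR_ge0 //.
  have [b _] := cds_bound (fun t' => (t' < t)%O) (conj K20 hK2) hs hh hx.
  have /andP[e1 e2] := cdx_bound (fun t' => (t' < t)%O) hs hs2 hx.
  case/andP: hx => x0 x1; have Kn := ltW K20; have En := @expR_ge0 R 2.
  have b' : `|cds s t x h| <= K2 * expR 2 * m.
    by apply: le_trans b _; rewrite ler_piMr ?mulr_ge0.
  have c' : `|cdx s t x * xi| <= expR 1 * `|xi|.
    rewrite normrM ler_wpM2r // ger0_norm; last exact: le_trans (expR_ge0 _) e1.
    by apply: le_trans e2 _; rewrite ler_expR (@rb_le1).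
  apply: le_trans (normD_le b' c') _.
  have := mulr_ge0 (mulr_ge0 Kn En) (normr_ge0 xi); have := mulr_ge0 (@expR_ge0 R 1) m0.
  by rewrite mulrDr !mulrDl; lrc.
apply: l1_le_weak (l1_le_dom (s := fun t => `|K1 * h t| + `|C * (m + `|xi|) * s t|) _
   (l1_leD (l1_le_eq _ (l1_leZ K1 hh)) (l1_le_eq _ (l1_leZ (C * (m + `|xi|)) hs2)))).
- rewrite (gtr0_norm K10) (ger0_norm (mulr_ge0 (ltW C0) N0)).
  have h1 : C * (m + `|xi|) * rb <= C * (m + `|xi|).
    by rewrite ler_piMr ?(@rb_le1) // mulr_ge0 // ltW.
  have := mulr_ge0 (ltW K10) (normr_ge0 xi); rewrite mulrDl !mulrDr; rewrite mulrDr in h1; lra.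
- by move=> t; rewrite [X in _ <= X]ger0_norm ?addr_ge0.
- by move=> t; rewrite normr_id.
- by move=> t; rewrite normr_id.
Qed.

(** At each time the remainder has a factor [|s t|] or [|s' t - s t|], by [so_family] and
    [mlx_bound]; summing these factors gives an l^1 remainder of second order. *)
Lemma mlc_second : exists2 K, 0 < K & forall s s' x x' m,
  l1_le s (rb / 2) -> l1_le s' rb -> l1_le (fun t => s' t - s t) m -> m <= 1 ->
  0 <= x <= 1 -> 0 <= x' <= 1 ->
  l1_le (fun t => mlc s' x' t - mlc s x t - dmlc s x (fun t => s' t - s t) (x' - x) t)
    (K * (m + `|x' - x|) ^+ 2).
have [K0 K00 hK0] := ml_so; have [K1 K10 hK1] := mu_param_lip.
have [K2 K20 hK2] := comp_second (T := T).
have rb0 := @rb_gt0; have rb1 := @rb_le1.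
pose L := K1 * expR 2 + expR 1.
have L0 : 0 < L by rewrite addr_gt0 ?mulr_gt0 ?expR_gt0.
pose E := expR 1 * expR 1 : R.
have E0 : 0 < E by rewrite mulr_gt0 ?expR_gt0.
exists (K0 * (1 + L) + (K0 * L ^+ 2 + E * K2)).
  have := mulr_gt0 K00 L0; have := mulr_gt0 K00 (exprn_gt0 2 L0).
  by have := mulr_gt0 E0 K20; lra.
move=> s s' x x' m hs hs' hh m1 hx hx'; have m0 := l1_le_ge0 hh.
have hs2 : l1_le s rb by apply: l1_le_weak hs; lra.
set N := m + `|x' - x|; have N0 : 0 <= N by rewrite addr_ge0.
have NN : 0 <= N ^+ 2 by exact: sqr_ge0.
pose A := K0 * (1 + L) * N; pose B := (K0 * L ^+ 2 + E * K2) * N ^+ 2.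
have A0 : 0 <= A by rewrite !mulr_ge0 ?(ltW K00) //; lrc L0.
have B0 : 0 <= B.
  rewrite mulr_ge0 //; have := mulr_gt0 K00 (exprn_gt0 2 L0).
  by have := mulr_gt0 E0 K20; lrc.
have key t : `|mlc s' x' t - mlc s x t - dmlc s x (fun t => s' t - s t) (x' - x) t| <=
    `|A * (s' t - s t)| + `|B * s t|.
  pose P t' := (t' < t)%O.
  have hc := comp_in P hs2 hx; have hc' := comp_in P hs' hx'.
  have st := l1_rb t hs2 (lexx _); have st' := l1_rb t hs' (lexx _).
  have sg : `|s' t - s t| <= N.
    by apply: le_trans (l1_le_pt t hh) _; rewrite lerDl.
  have Xi : `|cb s' t x' - cb s t x| <= L * N.
    have -> : cb s' t x' - cb s t x = (cb s' t x' - cb s' t x) + (cb s' t x - cb s t x) by ring.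
    have c1 := sl_lip (comp_sl P hs' hs') hx hx'.
    have [c2 _] := comp_lip P (conj K10 hK1) hs2 hs' hh hx.
    have c1' : `|cb s' t x' - cb s' t x| <= expR 1 * `|x' - x|.
      by apply: le_trans c1 _; rewrite ler_wpM2r // ler_expR.
    have c2' : `|cb s' t x - cb s t x| <= K1 * expR 2 * m.
      apply: le_trans c2 _; case/andP: hx => x0 x1.
      by rewrite ler_piMr ?mulr_ge0 ?expR_ge0 // ltW.
    apply: le_trans (normD_le c1' c2') _; rewrite /L /N.
    have := mulr_ge0 (mulr_ge0 (ltW K10) (@expR_ge0 R 2)) (normr_ge0 (x' - x)).
    by have := mulr_ge0 (@expR_ge0 R 1) m0; rewrite mulrDr !mulrDl; lrc.
  set dX := cds s t x (fun t => s' t - s t) + cdx s t x * (x' - x).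
  have q : `|cb s' t x' - cb s t x - dX| <= K2 * N ^+ 2.
    exact: (hK2 _ _ P _ _ _ hs hs' hh hx hx').
  have [_ _ k] := hK0 _ _ _ _ st st' hc hc'.
  rewrite /mlc /dmlc.
  rewrite -/(cb s t x) -/(cb s' t x') in k.
  set X := cb s t x in hc Xi q k *; set X' := cb s' t x' in hc' Xi q k *.
  rewrite -/dX.
  have -> : ml (s' t) X' - ml (s t) X - (mls (s t) X * (s' t - s t) + mlx (s t) X * dX) =
    (ml (s' t) X' - ml (s t) X - (mls (s t) X * (s' t - s t) + mlx (s t) X * (X' - X))) +
     mlx (s t) X * (X' - X - dX).
    by move: (ml (s' t) X') (ml (s t) X) (mls (s t) X) (mlx (s t) X) => ? ? ? ?; ring.
  apply: le_trans (normD_le k (normM_le (mlx_bound st hc) q)) _.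
  rewrite (normrM A) (normrM B) (ger0_norm A0) (ger0_norm B0) -/E.
  have n1 := normr_ge0 (s' t - s t); have n2 := normr_ge0 (s t); have n3 := normr_ge0 (X' - X).
  have q1 : (s' t - s t) ^+ 2 <= `|s' t - s t| * N.
    by rewrite -real_normK ?num_real // expr2 ler_wpM2l.
  have q2 : `|s t| * (X' - X) ^+ 2 <= `|s t| * (L ^+ 2 * N ^+ 2).
    rewrite ler_wpM2l // -exprMn -real_normK ?num_real // lerXn2r ?nnegrE ?mulr_ge0 // ltW //.
  have q3 : `|s' t - s t| * `|X' - X| <= `|s' t - s t| * (L * N) by rewrite ler_wpM2l.
  have K0n := ltW K00.
  have := ler_wpM2l K0n q1; have := ler_wpM2l K0n q2; have := ler_wpM2l K0n q3.
  by rewrite /A /B; lrc.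
apply: l1_le_weak (l1_le_dom (s := fun t => `|A * (s' t - s t)| + `|B * s t|) _
   (l1_leD (l1_le_eq _ (l1_leZ A hh)) (l1_le_eq _ (l1_leZ B hs2)))).
- rewrite (ger0_norm A0) (ger0_norm B0).
  have h1 : B * rb <= B by rewrite ler_piMr.
  have h2 : A * m <= A * N by rewrite ler_wpM2l // /N lerDl.
  have -> : (K0 * (1 + L) + (K0 * L ^+ 2 + E * K2)) * N ^+ 2 = A * N + B by rewrite /A /B; ring.
  lrc h1 h2.
- by move=> t; rewrite [X in _ <= X]ger0_norm ?addr_ge0.
- by move=> t; rewrite normr_id.
- by move=> t; rewrite normr_id.
Qed.
End ZoomParam.

(** * Lorenz maps, the structure of the return interval, and its uniqueness *)

Section LorenzMap.
Implicit Types (x y z p q P Q d : R).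

(* The right branch is stored conjugated by x |-> 1 - x, so that both branches
   have the same form and [lflip] exchanges them. *)
Record lmap := LM { lp : R -> R; lq : R -> R; lu : R; lv : R; lc : R }.
Implicit Types m : lmap.

Definition lflip m := LM (lq m) (lp m) (lv m) (lu m) (1 - lc m).
Definition lf0 m := br (lp m) (lu m) (lc m).
Definition lF m x := if x < lc m then lf0 m x else 1 - lf0 (lflip m) (1 - x).

Lemma subKr x : 1 - (1 - x) = x. by ring. Qed.

Lemma lflipK m : lflip (lflip m) = m.
by case: m => *; rewrite /lflip /= subKr. Qed.

(** As [lq] is the flipped psi, the last two fields say c_1^+ <= c <= c_1^-, with equality
    allowed. *)
Record wf d m : Prop := Wf {
  wf_d : 0 <= d;
  wf_u : 0 < lu m <= 1;
  wf_v : 0 < lv m <= 1;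
  wf_c : 0 < lc m < 1;
  wf_p : sl d (lp m);
  wf_q : sl d (lq m);
  wf_A : lc m <= lp m (lu m);
  wf_B : 1 - lc m <= lq m (lv m) }.

Lemma wf_flip d m : wf d m -> wf d (lflip m).
case=> *; split; rewrite /lflip //= ?subKr //.
by match goal with h : is_true (0 < lc m < 1) |- _ => case/andP: h => *; andlra end.
Qed.

Lemma wf_c1 d m : wf d m -> 0 < lc m <= 1.
by case=> _ _ _ /andP[-> /ltW ->]. Qed.

Lemma lF_flip m x : x != lc m -> lF (lflip m) (1 - x) = 1 - lF m x.
move=> xc; rewrite /lF lflipK /= subKr ltrD2l ltrN2.
case: (ltgtP x (lc m)) xc => // h _; by rewrite ?subKr.
Qed.

(* [lV m x] is the value at x > c of the standard right branch, and
   [lK m n (lV m x)] the point of the orbit of x reached after n further steps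
   on the left. *)
Definition lV m x := 1 - qf (lv m) (1 - lc m) (1 - x).
Definition lK m n y := KK (lu m) (lc m) (lp m) (flip (lq m)) n y.
Definition litin m n y := itin (lu m) (lc m) (lp m) (flip (lq m)) n y.

Section WF.
Variables (d : R) (m : lmap).
Hypothesis hw : wf d m.
Let hp := wf_p hw.
Let hq := sl_flip (wf_q hw).
Let c1 := wf_c1 hw.
Let u1 := wf_u hw.
Let hwf := wf_flip hw.
Let c1' : 0 < 1 - lc m <= 1 := wf_c1 hwf.
Let v1 := wf_v hw.

Lemma lK_mono n y y' : 0 <= y -> y <= y' -> litin m n y' ->
  litin m n y /\ (lK m n y <= lK m n y' /\ (y < y' -> lK m n y < lK m n y')).
exact: (KK_mono u1 c1 hp hq). Qed.

Lemma lK_in n y : litin m n y -> 0 <= lK m n y <= 1.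
exact: (KK_in u1 c1 hp hq). Qed.

Lemma lV_in x : lc m <= x <= 1 -> 1 - lv m <= lV m x <= 1.
move=> /andP[x0 x1]; have h : 0 <= 1 - x <= 1 - lc m by andlra.
by have /andP[h1 h2] := qf_in v1 c1' h; apply/andP; split; rewrite /lV; lra.
Qed.

Lemma lV_ge0 x : lc m <= x <= 1 -> 0 <= lV m x.
by move=> /lV_in/andP[h _]; case/andP: v1 => v0 v2; lra. Qed.

Lemma lV_c : lV m (lc m) = 1 - lv m.
by rewrite /lV (qfc). Qed.

Lemma lV_lt x y : lc m <= x -> x < y -> lV m x < lV m y.
move=> xc xy; have h : 1 - y < 1 - x by lra.
have h' : 1 - x <= 1 - lc m by lra.
have := qf_lt v1 c1' h h'; rewrite /lV; lra.
Qed.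

Lemma lV_le x y : lc m <= x -> x <= y -> lV m x <= lV m y.
by move=> xc; rewrite le_eqVlt => /predU1P[->//|xy]; rewrite ltW // lV_lt. Qed.

Lemma lV_lip x y : lc m <= x -> x <= y -> y <= 1 -> lV m y - lV m x <= al / (1 - lc m) * (y - x).
move=> xc xy y1; have h1 : 0 <= 1 - y by lra.
have h2 : 1 - y <= 1 - x by lra.
have h3 : 1 - x <= 1 - lc m by lra.
have := qf_lip v1 c1' h1 h2 h3; rewrite /lV.
have e : 1 - x - (1 - y) = y - x by ring.
by rewrite e; lra.
Qed.

Lemma lKV_mono n x y : lc m <= x -> x <= y -> y <= 1 -> litin m n (lV m y) ->
  litin m n (lV m x) /\ (lK m n (lV m x) <= lK m n (lV m y) /\
   (x < y -> lK m n (lV m x) < lK m n (lV m y))).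
move=> cx xy y1 hi.
have x0 : 0 <= lV m x by apply: lV_ge0; andlra.
have [i [h1 h2]] := lK_mono x0 (lV_le cx xy) hi; split=> //; split=> // xy'.
by apply: h2; exact: lV_lt.
Qed.

Lemma lKV_surj n x y w : lc m <= x -> x <= y -> y <= 1 -> litin m n (lV m y) ->
  lK m n (lV m x) <= w <= lK m n (lV m y) -> exists2 z, x <= z <= y & lK m n (lV m z) = w.
move=> cx xy y1 hi hwv.
pose L := (expR d * (al / lc m)) ^+ n * expR d.
have L0 : 0 <= L.
  by rewrite mulr_ge0 ?expR_ge0 // exprn_ge0 // mulr_ge0 ?expR_ge0 // divr_ge0 ?(ltW al0) //; case/andP: c1 => /ltW.
apply: (@lip_IVT _ (fun z => lK m n (lV m z)) (L * (al / (1 - lc m)))) => //.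
move=> s t; wlog st : s t / s <= t.
  move=> H hs ht; have [st|/ltW st] := leP s t; first exact: H.
  by rewrite distrC (distrC t); exact: H.
move=> /andP[s1 s2] /andP[t1 t2].
have hs : 0 <= lV m s <= lV m y.
  by apply/andP; split; [apply: lV_ge0; andlra | apply: lV_le; lra].
have ht : 0 <= lV m t <= lV m y.
  by apply/andP; split; [apply: lV_ge0; andlra | apply: lV_le; lra].
have k : `|lK m n (lV m t) - lK m n (lV m s)| <= L * `|lV m t - lV m s|.
  exact: (KK_lip u1 c1 hp hq hi hs ht).
have cs : lc m <= s by lrd xy y1 hwv L0 t2 hs ht k al1 al0 s2 t1 be0 st.
apply: le_trans k _; rewrite -[X in _ <= X]mulrA ler_wpM2l //.
have ts : lV m s <= lV m t by exact: lV_le.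
rewrite (ger0_norm (x := lV m t - lV m s)) ?subr_ge0 // (ger0_norm (x := t - s)) ?subr_ge0 //.
by apply: lV_lip => //; lrd ts al1 al0 be0 cx st s1 s2 t1 hwv L0 ht cs xy hs.
Qed.

Lemma iter_right n x : lc m <= x -> (forall j, (j < n)%N -> lK m j (lV m x) < lc m) ->
  iter n.+1 (lF m) x = lK m n (lV m x).
move=> cx; elim: n => [|n IH] h.
  by rewrite /= /lF ltNge cx /= /lf0 /br /lK /KK /= /flip /lV subKr.
rewrite iterS IH; last by move=> j jn; apply: h; exact: ltnW.
by rewrite /lF (h n (ltnSn n)).
Qed.

Lemma right_itin n x : lc m <= x <= 1 ->
  (forall i, (0 < i <= n)%N -> iter i (lF m) x < lc m) -> litin m n (lV m x).
move=> cx; elim: n => [|n IH] h.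
  by split=> //; have /andP[_ ->] := lV_in cx; rewrite lV_ge0.
have [h1 h2] : litin m n (lV m x).
  by apply: IH => i /andP[i0 im]; apply: h; rewrite i0 (leq_trans im).
split=> // j; rewrite ltnS leq_eqVlt => /predU1P[->|]; last exact: h2.
have := h n.+1; rewrite iter_right //; first by apply; rewrite ltnSn.
by case/andP: cx.
Qed.
End WF.

(* The half of the renormalization structure on the right of c: the orbit of q
   stays on the left of p for n steps and returns to q. *)
Definition half m n p q := [/\ lc m < q <= 1, forall j, (j < n)%N -> lK m j (lV m q) < p,
  lK m n (lV m q) = q, p <= lK m n (1 - lv m) & lK m n (1 - lv m) < lc m].

Definition ren m a b p q := half m b p q /\ half (lflip m) a (1 - q) (1 - p).

Lemma ren_flip m a b p q : ren m a b p q -> ren (lflip m) b a (1 - q) (1 - p).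
by case=> h1 h2; split => //; rewrite lflipK !subKr. Qed.

Lemma ren_bd m a b p q : ren m a b p q -> [/\ 0 <= p, p < lc m, lc m < q & q <= 1].
by case=> [[/andP[h1 h2] _ _ _ _] [/andP[/= h3 h4] _ _ _ _]]; split => //; lra.
Qed.

(** The condition [lK m n (lV m x) <= x] admits every candidate for a fixed point of the return
    branch, not only the end point of C; this is what a uniqueness proof needs. *)
Definition dist eta m n := forall x, lc m < x <= 1 -> litin m n (lV m x) ->
  lK m n (lV m x) <= x -> exists2 D, 0 < D & slopes eta (lK m n) (1 - lv m) (lV m x) D.

(** All that the comparison with other return intervals uses: the map is a first return map, fixes
    the ends and is increasing on both sides. [ri_ne] excludes the whole interval. *)
Record RI (f : R -> R) c P Q (g : R -> R) : Prop := MkRI {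
  ri_P : 0 <= P < c;
  ri_Q : c < Q <= 1;
  ri_ne : ~ (P = 0 /\ Q = 1);
  ri_ret : forall x, P <= x <= Q -> x != c -> exists2 n, first_return f (P, Q) x n & g x = iter n f x;
  ri_gP : g P = P;
  ri_gQ : g Q = Q;
  ri_incl : forall x y, P <= x -> x < y -> y < c -> g x < g y;
  ri_incr : forall x y, c < x -> x < y -> y <= Q -> g x < g y }.

Lemma first_return_uniq (f : R -> R) C x n n' : first_return f C x n -> first_return f C x n' -> n = n'.
move=> [n0 nI nO] [n0' nI' nO']; apply/eqP; case: ltngtP => // h.
  by have := nO' n; rewrite n0 h nI => /(_ isT).
by have := nO n'; rewrite n0' h nI' => /(_ isT).
Qed.

(** The flip conjugates the maps only away from [c]. An orbit before its return never meets [c],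
    because [c] lies inside [[P, Q]]. *)
Lemma first_return_flip m P Q x n : P < lc m < Q -> x != lc m ->
  first_return (lF m) (P, Q) x n ->
  first_return (lF (lflip m)) (1 - Q, 1 - P) (1 - x) n /\
  forall i, (i <= n)%N -> iter i (lF (lflip m)) (1 - x) = 1 - iter i (lF m) x.
move=> /andP[Pc cQ] xc [n0 nI nO].
have it i : (i <= n)%N -> iter i (lF (lflip m)) (1 - x) = 1 - iter i (lF m) x.
  elim: i => // i IH im; rewrite !iterS IH ?(ltnW im) // lF_flip //.
  case: i im {IH} => // i im; apply/eqP => e.
  have := nO i.+1; rewrite im /= => /(_ isT).
  by rewrite -iterS e in_itv /= !ltW.
have inE z : (1 - z \in `[1 - Q, 1 - P]) = (z \in `[P, Q]).
  by rewrite !in_itv /= !lerD2l !lerN2 andbC.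
split=> //; split=> //; first by rewrite it //= inE.
by move=> i /andP[i0 im]; rewrite it ?(ltnW im) //= inE; apply: nO; rewrite i0.
Qed.

Lemma RI_flip m P Q g : RI (lF m) (lc m) P Q g ->
  RI (lF (lflip m)) (lc (lflip m)) (1 - Q) (1 - P) (fun x => 1 - g (1 - x)).
case=> /andP[P0 Pc] /andP[cQ Q1] ne ret gP gQ il ir; split; rewrite /= ?subKr ?gP ?gQ //.
- by andlra.
- by andlra.
- by move=> [h1 h2]; apply: ne; split; lra.
- move=> x /andP[x0 x1] xc.
  have hx : P <= 1 - x <= Q by andlra.
  have xc' : 1 - x != lc m by apply: contra xc => /eqP <-; rewrite subKr.
  have [n hn e] := ret _ hx xc'; exists n.
    have [] := first_return_flip (introT andP (conj Pc cQ)) xc' hn.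
    by rewrite subKr.
  have [_] := first_return_flip (introT andP (conj Pc cQ)) xc' hn.
  by rewrite subKr => -> //; rewrite e.
- move=> x y h1 h2 h3; rewrite ltrD2l ltrN2; apply: ir; lra.
- move=> x y h1 h2 h3; rewrite ltrD2l ltrN2; apply: il; lra.
Qed.

(** In flipped coordinates [concave_fix] applies with [1 - Q < 1 - q]: a fixed point at [1 - q] puts
    the graph strictly below the diagonal at [1 - Q]. The hypothesis on [1 - lv m] supplies the
    value at the critical point. *)
Lemma right_fix_unique d eta m n q Q : wf d m -> dist eta m n -> expR (eta + eta) < al ->
  lc m < q -> q < Q -> Q <= 1 -> litin m n (lV m Q) ->
  lK m n (1 - lv m) <= lc m ->
  lK m n (lV m q) = q -> lK m n (lV m Q) = Q -> False.
move=> hw hd he cq qQ Q1 hi h0 eq eQ; have hwf := wf_flip hw.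
have hQ : lc m < Q <= 1 by andlra.
have hQ' : lc m <= Q <= 1 by andlra.
have /andP[V1 V2] := lV_in hw hQ'.
have [D D0 hs] : exists2 D, 0 < D & slopes eta (lK m n) (1 - lv m) (lV m Q) D.
  by apply: hd => //; rewrite eQ.
have hs' := slopes_flip hs; rewrite subKr in hs'.
have c1 : 0 < 1 - lc m <= 1 := wf_c1 hwf.
have x10 : 0 <= 1 - Q by lra.
have x12 : 1 - Q < 1 - q by lra.
have x2c : 1 - q < 1 - lc m by lra.
rewrite /lV !subKr in hs'.
have hG : 1 - lc m <= 1 - lK m n (1 - lv m) by lra.
have := concave_fix (wf_v hw) c1 he D0 x10 x12 x2c hs' hG.
rewrite -[1 - qf _ _ (1 - q)]/(lV m q) -[1 - qf _ _ (1 - Q)]/(lV m Q) eq eQ lexx ltxx.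
by move=> /(_ isT).
Qed.

(** If [[P, Q]] extends beyond [q], then [q] returns to it through [n] left steps, and up to that
    time the whole interval [[q, Q]] follows the orbit of [q]. Hence [Q] is a fixed point of the
    same composition. *)
Lemma RI_right d eta m a b p q P Q g : wf d m -> dist eta m b -> expR (eta + eta) < al ->
  ren m a b p q -> RI (lF m) (lc m) P Q g -> q < Q ->
  exists n, [/\ (n < b)%N, P <= lK m n (lV m q) <= Q, lK m n (lV m q) < p,
    lK m n (lV m Q) = Q /\ litin m n (lV m Q) &
    forall x, q <= x <= Q -> (0 < n)%N -> lF m x < P].
move=> hw hd he hr ri qQ; have [p0 pc cq q1] := ren_bd hr.
case: hr => -[hq gap eq hp1 hp2] _.
case: ri => /andP[P0 Pc] /andP[cQ Q1] ne ret gP gQ il ir.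
have cQ' : lc m <= Q by exact: ltW.
have gapc j : (j < b)%N -> lK m j (lV m q) < lc m by move=> jb; exact: lt_trans (gap j jb) pc.

have hqPQ : P <= q <= Q by andlra.
have qc : q != lc m by rewrite gt_eqF.
have [n hn gqE] := ret q hqPQ qc.
have [n0 nI nO] := hn; case: n n0 hn gqE nI nO => // n _ hn gqE nI nO.
have itq j : (j <= b)%N -> iter j.+1 (lF m) q = lK m j (lV m q).
  by move=> jb; apply: iter_right (ltW cq) _ => i ij; apply: gapc; exact: leq_trans ij jb.
have nb : (n <= b)%N.
  rewrite leqNgt; apply/negP => bn; have := nO b.+1; rewrite /= ltnS bn => /(_ isT).
  by rewrite -iterS itq // eq in_itv /= hqPQ.
have gqP : P <= g q <= Q by move: nI; rewrite -gqE in_itv.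
have gqQ : g q < Q by rewrite -[X in _ < X]gQ; apply: ir.
(* avoidance of [P, Q] propagates from q to [q, Q] by the intermediate value
   theorem, since g is injective on the right of c *)
have avoid j : (j < n)%N -> litin m j (lV m Q) /\ forall x, q <= x <= Q -> lK m j (lV m x) < P.
  elim/ltn_ind: j => j IH jn.
  have hi : litin m j (lV m Q).
    split=> [|i ij].
      have hQ : lc m <= Q <= 1 by rewrite cQ'.
      by have /andP[_ ->] := lV_in hw hQ; rewrite (lV_ge0 hw).
    have [_ h] := IH i ij (ltn_trans ij jn).
    by apply: lt_trans (h Q _) Pc; rewrite lexx ltW.
  split=> // x /andP[qx xQ].
  have jb : (j < b)%N by exact: leq_trans jn nb.
  have cx : lc m <= x by lra.
  have [hix _] := lKV_mono hw cx xQ Q1 hi.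
  rewrite ltNge; apply/negP => Px.
  have qP : lK m j (lV m q) < P.
    have := nO j.+1; rewrite /= ltnS jn => /(_ isT).
    rewrite -iterS itq ?(ltnW jb) // in_itv /= negb_and -!ltNge => /orP[//|].
    by have g0 := gapc j jb; lrc g0 cQ.
  have x1 : x <= 1 by lrc xQ Q1.
  have [z /andP[z1 z2] ez] := lKV_surj hw (ltW cq) qx x1 hix (introT andP (conj (ltW qP) Px)).
  have qz : q < z.
    by rewrite lt_neqAle z1 andbT; apply/eqP => e; move: qP; rewrite e ez ltxx.
  have zQ : z <= Q by lrc z2 xQ.
  have cz : lc m <= z by lrc cq z1.
  have itz i : (i <= j)%N -> iter i.+1 (lF m) z = lK m i (lV m z).
    move=> ij; apply: iter_right cz _ => k ki.
    have [_ h] := IH k (leq_trans ki ij) (ltn_trans (leq_trans ki ij) jn).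
    by apply: lt_trans (h z _) Pc; rewrite (ltW qz) zQ.
  have fz : first_return (lF m) (P, Q) z j.+1.
    split=> //; first by rewrite /= -iterS itz // ez in_itv /= lexx (le_trans (ltW Pc)).
    move=> [|i] // /andP[_ ij]; rewrite ltnS in ij.
    rewrite itz ?(ltnW ij) // in_itv /= negb_and -!ltNge.
    have [_ h] := IH i ij (ltn_trans ij jn).
    by rewrite (h z) // (ltW qz) zQ.
  have hz : P <= z <= Q by rewrite zQ andbT; lrc Pc cz.
  have zc : z != lc m by rewrite gt_eqF //; lrc cq z1.
  have [k fk ek] := ret z hz zc.
  have := ir _ _ cq qz zQ; rewrite ek (first_return_uniq fk fz) itz // ez.
  by case/andP: gqP => h _; lrc h.
have hiQ : litin m n (lV m Q).
  split=> [|i ij].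
    have hQ : lc m <= Q <= 1 by rewrite cQ'.
    by have /andP[_ ->] := lV_in hw hQ; rewrite (lV_ge0 hw).
  have [_ h] := avoid i ij; by apply: lt_trans (h Q _) Pc; rewrite lexx ltW.
have fr x : q <= x <= Q -> P <= lK m n (lV m x) <= Q -> g x = lK m n (lV m x).
  move=> /andP[qx xQ] hx; have cx : lc m <= x by lra.
  have itx i : (i <= n)%N -> iter i.+1 (lF m) x = lK m i (lV m x).
    move=> ij; apply: iter_right cx _ => k ki.
    have [_ h] := avoid k (leq_trans ki ij).
    by apply: lt_trans (h x _) Pc; rewrite qx xQ.
  have fx : first_return (lF m) (P, Q) x n.+1.
    split=> //; first by rewrite itx // in_itv.
    move=> [|i] // /andP[_ ij]; rewrite ltnS in ij.
    rewrite itx ?(ltnW ij) // in_itv /= negb_and -!ltNge.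
    have [_ h] := avoid i ij.
    by rewrite (h x) // qx xQ.
  have hx' : P <= x <= Q by rewrite xQ andbT; lrc Pc cx.
  have xc : x != lc m by rewrite gt_eqF //; lrc cq qx.
  have [k fk ek] := ret x hx' xc.
  by rewrite ek (first_return_uniq fk fx) itx.
have gqK : g q = lK m n (lV m q) by rewrite gqE itq.
have [_ [qleQ _]] := lKV_mono hw (ltW cq) (ltW qQ) Q1 hiQ.
have KQ : lK m n (lV m Q) = Q.
  have [h|h] := leP (lK m n (lV m Q)) Q.
    rewrite -fr ?gQ //; first by rewrite lexx ltW.
    by rewrite h andbT (le_trans _ qleQ) // -gqK; case/andP: gqP.
  have hv : lK m n (lV m q) <= Q <= lK m n (lV m Q) by rewrite -gqK (ltW gqQ) ltW.
  have [z /andP[z1 z2] ez] := lKV_surj hw (ltW cq) (ltW qQ) Q1 hiQ hv.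
  have zQ : z < Q.
    by rewrite lt_neqAle z2 andbT; apply/eqP => e; move: h; rewrite -{2}e ez ltxx.
  have := ir z Q (lt_le_trans cq z1) zQ (lexx _).
  rewrite gQ (fr z) ?ez ?ltxx //; first by rewrite z1.
  by rewrite lexx andbT; lrc Pc cQ.
(* With [n = b] both [q] and [Q] would be fixed by one return branch, against [right_fix_unique]. *)
have nbs : (n < b)%N.
  move: nb; rewrite leq_eqVlt => /predU1P[e|//].
  exfalso; rewrite e in hiQ KQ.
  exact: (right_fix_unique hw hd he cq qQ Q1 hiQ (ltW hp2) eq KQ).
exists n; split=> //; [by rewrite -gqK | exact: gap |].
move=> x hx n0; have [_ h] := avoid 0%N n0; have := h x hx.
have cx : lc m <= x by case/andP: hx => h1 _; lra.
by rewrite -(iter_right (n := 0) cx).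
Qed.

(** A fixed point in (0, c) would force [lf0 m 0 < 0] by [concave_fix] with [x1 = 0]. *)
Lemma f0_fix d m P : wf d m -> expR (d + d + (d + d)) < al -> 0 <= P -> P < lc m ->
  lf0 m P = P -> P = 0.
move=> hw he P0 Pc eP; apply/eqP; rewrite eq_le P0 andbT leNgt; apply/negP => P1.
have c1 := wf_c1 hw.
have hD : expR (- d) <= 1 <= expR d.
  by have d0 := wf_d hw; apply/andP; split; rewrite -expR0 ler_expR; lra.
have hs := sl_slopes (wf_p hw) hD.
have q0 : qf (lu m) (lc m) 0 = 0 by apply: qf0; eauto.
have hs' : slopes (d + d) (lp m) (qf (lu m) (lc m) 0) (lu m) 1.
  by apply: slopes_sub hs; [rewrite q0 | case/andP: (wf_u hw)].
have := concave_fix (wf_u hw) c1 he ltr01 (lexx 0) P1 Pc hs' (wf_A hw).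
rewrite -[lp m (qf _ _ P)]/(lf0 m P) eP lexx q0; have [-> _ _] := wf_p hw.
by rewrite ltxx => /(_ isT).
Qed.

(** Extending [[p, q]] on one side forces an extension on the other, as the first return of [q] then
    lands left of [p]. If both sides are extended, the early returns contradict each other unless
    both take a single step; then [P] and [Q] are fixed by the two branches, so they are 0 and 1,
    which is excluded. *)
Lemma RI_nested d eta m a b p q P Q g : wf d m -> dist eta m b -> dist eta (lflip m) a ->
  expR (eta + eta) < al -> expR (d + d + (d + d)) < al ->
  ren m a b p q -> RI (lF m) (lc m) P Q g -> p <= P /\ Q <= q.
move=> hw hd hd' he hdd hr ri.
have hwf := wf_flip hw; have hrf := ren_flip hr; have rif := RI_flip ri.
have R1 := RI_right hw hd he hr ri; have R2 := RI_right hwf hd' he hrf rif.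
have [p0 pc cq q1] := ren_bd hr.
have [/andP[P0 Pc] /andP[cQ Q1] ne _ _ _ _ _] := ri.
have [h|qQ] := leP Q q.
  have [//|Pp] := leP p P.
  have [|n [_ /andP[h1 h2] h3 _ _]] := R2; first by lra.
  lra.
exfalso; have [n [nb /andP[a1 a2] a3 [a4 a5] a6]] := R1 qQ.
have [|n' [nb' /andP[b1 b2] b3 [b4 b5] b6]] := R2; first by lrc a1 a3.
have [[_ gap eq _ _] [_ gap' eq' _ _]] := hr.
(* z = f^(n+1)(q) lies in [P, p), and its image is on the left of q or q itself *)
have z1 : lF m (lK m n (lV m q)) <= q.
  have e : lF m (lK m n (lV m q)) = lK m n.+1 (lV m q).
    by rewrite /lF (lt_trans a3 pc).
  rewrite e; move: nb; rewrite -ltnS ltnS leq_eqVlt => /predU1P[->|nb]; first by rewrite eq.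
  by apply: ltW; apply: lt_trans (gap _ nb) _; lrc pc cq.
have z2 : p <= lF m (1 - lK (lflip m) n' (lV (lflip m) (1 - p))).
  set w := lK _ n' _ in b1 b2 b3 *.
  have e : lF m (1 - w) = 1 - lK (lflip m) n'.+1 (lV (lflip m) (1 - p)).
    rewrite -[m in LHS]lflipK lF_flip; last by rewrite lt_eqF //=; lrc b3 cq.
    by rewrite /lF (_ : w < lc (lflip m)) //=; lrc b3 cq.
  rewrite e; move: nb'; rewrite -ltnS ltnS leq_eqVlt => /predU1P[->|nb']; first by rewrite eq'; lrc m.
  by have g0 := gap' _ nb'; lrc g0 pc cq.
have n0 : n = 0%N.
  case: (posnP n) => // n0; exfalso.
  have := a6 (1 - lK (lflip m) n' (lV (lflip m) (1 - p))) _ n0.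
  have -> : q <= 1 - lK (lflip m) n' (lV (lflip m) (1 - p)) <= Q.
    by apply/andP; split; lrc b1 b3.
  move=> /(_ isT) g0; lrc g0 z2 a1 a3.
have n0' : n' = 0%N.
  case: (posnP n') => // n0'; exfalso.
  have := b6 (1 - lK m n (lV m q)) _ n0'.
  have -> : 1 - p <= 1 - lK m n (lV m q) <= 1 - P by apply/andP; split; lrc a1 a3.
  rewrite lF_flip; last by rewrite lt_eqF //; lrc a3 pc.
  move=> /(_ isT) g0; lrc g0 z1 b1 b3.
subst n n'; apply: ne.
have f1 : lf0 (lflip m) (1 - Q) = 1 - Q.
  have := a4; rewrite /lK /KK /= /flip /lV subKr => e.
  by rewrite /lf0 /br /=; lrc e.
have f2 : lf0 m P = P.
  have := b4; rewrite /lK /KK /= /flip /lV /= !subKr => e.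
  by rewrite /lf0 /br; lrc e.
split; first exact: (f0_fix hw hdd P0 Pc f2).
have Q0 : 0 <= 1 - Q by lrc Q1.
have Qc : 1 - Q < lc (lflip m) by rewrite /=; lrc cQ.
have g0 := f0_fix hwf hdd Q0 Qc f1; lrc g0.
Qed.
End LorenzMap.

(** * Consequences of the definition of a return interval *)

Section LorenzProps.
Implicit Types (f g : R -> R) (u v c x y : R).

Lemma diffeo01_lt phi x y : diffeo01 phi -> 0 <= x -> x < y -> y <= 1 -> phi x < phi y.
case=> _ _ [g [dg _ e g0]] x0 xy y1.
have hx : x \in `[0, 1] by rewrite in_itv /= x0 (le_trans (ltW xy)).
have hy : y \in `[0, 1] by rewrite in_itv /= y1 (le_trans x0 (ltW xy)).
rewrite !e //; have [z|z hz k] := @mvt _ g (g^`())%classic x y (ltW xy).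
  by move=> _; rewrite derive1E; exact: derivableP.
rewrite -subr_gt0 k mulr_gt0 ?subr_gt0 // g0 // in_itv /=.
by case/andP: hz => h1 h2; rewrite (le_trans x0 h1) (le_trans h2 y1).
Qed.

Lemma diffeo01_le phi x y : diffeo01 phi -> 0 <= x -> x <= y -> y <= 1 -> phi x <= phi y.
by move=> h x0; rewrite le_eqVlt => /predU1P[->//|xy y1]; rewrite ltW // diffeo01_lt.
Qed.

Lemma stdQ_left u v c x : x < c -> stdQ al u v c x = qf u c x.
by rewrite /stdQ => ->. Qed.

Lemma stdQ_right u v c x : c <= x -> stdQ al u v c x = 1 - qf v (1 - c) (1 - x).
rewrite /stdQ ltNge => -> /=; rewrite /qf /rr.
have -> : 1 - c - (1 - x) = x - c by ring.
ring.
Qed.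

(** Strict monotonicity is the point: the definition allows [u = 0] or [v = 0], and nontriviality
    excludes these by forcing both branches across [c]. *)
Lemma lorenz_props f c : is_lorenz al f c -> nontrivial f c ->
  [/\ f 0 = 0, f 1 = 1,
     forall x y, 0 <= x -> x < y -> y < c -> f x < f y,
     forall x y, c < x -> x < y -> y <= 1 -> f x < f y
   & (exists2 x, 0 <= x < c & c < f x) /\ (exists2 x, c < x <= 1 & f x < c)].
move=> [c01 [u [v [phi [psi [hu hv hphi hpsi hf]]]]]] [ntr ntl].
case/andP: (c01) => c0 c1; case/andP: hu => u0 u1; case/andP: hv => v0 v1.
have [f0 f1 _] := hphi; have [g0 g1 _] := hpsi.
have c1' : 0 < 1 - c by lra.
have fl x : 0 <= x -> x < c -> f x = phi (qf u c x).
  move=> x0 xc; rewrite hf ?lt_eqF //; last by rewrite in_itv /= x0 ltW // (lt_trans xc).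
  by rewrite /lorenz xc stdQ_left.
have fr x : c < x -> x <= 1 -> f x = psi (1 - qf v (1 - c) (1 - x)).
  move=> cx x1; rewrite hf ?gt_eqF //; last by rewrite in_itv /= x1 ltW // (lt_trans c0).
  by rewrite /lorenz ltNge (ltW cx) /= stdQ_right // ltW.
have pw (w : R) : 0 <= w <= 1 -> 0 <= 1 - w `^ al <= 1.
  move=> hw; have /andP[p0 p1] := powR_in01 hw; case/andP: hw => w0 w1.
  by apply/andP; split; lrc p0 p1 w1.
have ql x : 0 <= x -> x <= c -> 0 <= qf u c x <= 1.
  move=> x0 xc; have := pw (rr c x); rewrite /rr divr_ge0 ?subr_ge0 ?(ltW c0) //=.
  rewrite ler_pdivrMr // mul1r lerBlDr lerDl x0 => /(_ isT)/andP[p0 p1].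
  by rewrite /qf mulr_ge0 ?mulr_ile1 ?subr_ge0.
have qr x : c <= x -> x <= 1 -> 0 <= 1 - qf v (1 - c) (1 - x) <= 1.
  move=> cx x1; have := pw (rr (1 - c) (1 - x)); rewrite /rr.
  have -> : 1 - c - (1 - x) = x - c by ring.
  rewrite divr_ge0 ?subr_ge0 ?(ltW c1) //=.
  rewrite ler_pdivrMr // mul1r lerD2r x1 => /(_ isT)/andP[p0 p1].
  rewrite /qf /rr; have -> : 1 - c - (1 - x) = x - c by ring.
  by apply/andP; split; rewrite ?subr_ge0 ?lerBlDr ?lerDl ?mulr_ile1 ?mulr_ge0 ?subr_ge0.

have ex1 : exists2 x, 0 <= x < c & c < f x.
  (* A limit that does not exist has the default value 0, which is not larger than [c]; so the left
     limit exists. *)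
  have [h|h] := pselect (cvg (f x @[x --> c^'-])); last first.
    by move: ntl; rewrite /crit_left dvgP //; rewrite ltNge (ltW c0).
  have n1 : \forall t \near c^'-, c < f t by exact: (cvgr_gt _ h _ ntl).
  have n2 := nbhs_left_gt c0; have n3 := nbhs_left_lt c.
  have [x [x1 [x2 x3]]] := @filter_ex _ _ (at_left_proper_filter c) _ (filterI n1 (filterI n2 n3)).
  by exists x => //; rewrite (ltW x2).
have u0' : 0 < u.
  rewrite lt_neqAle u0 andbT; apply/eqP => e; case: ex1 => x /andP[x0 xc].
  by rewrite fl // -e /qf mul0r f0 ltNge (ltW c0).
have ex2 : exists2 x, c < x <= 1 & f x < c.
  have mono x y : c < x -> x <= y -> y <= 1 -> f x <= f y.
    move=> cx xy y1; have cy := lt_le_trans cx xy; have x1 := le_trans xy y1.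
    have /andP[q0 _] := qr x (ltW cx) x1; have /andP[_ q1] := qr y (ltW cy) y1.
    rewrite !fr //; apply: (diffeo01_le hpsi) => //.
    rewrite lerD2l lerN2 /qf ler_wpM2l // lerD2l lerN2 /rr.
    have c2 := ltW c1'; apply: ge0_ler_powR; rewrite ?nnegrE.
    - by have := al1; lra.
    - by apply: divr_ge0 c2; lrc cx.
    - by apply: divr_ge0 c2; lrc cy.
    - by rewrite ler_pM2r ?invr_gt0 //; lrc xy.
  (* Here the default value 0 would satisfy the condition, so that convergence has to be proved, by
     monotonicity. *)
  have h : cvg (f x @[x --> c^'+]).
    apply: nondecreasing_at_right_is_cvgr.
      have := nbhs_right_lt c1; apply: filterS => z z1 x y; rewrite !in_itv /=.
      by move=> /andP[cx xz] /andP[cy yz] xy; apply: mono => //; lra.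
    have := nbhs_right_lt c1; apply: filterS => z z1; exists 0 => _ [x /= + <-].
    rewrite in_itv /= => /andP[cx xz]; have x1 : x <= 1 by lra.
    have /andP[q0 q1] := qr x (ltW cx) x1.
    by rewrite fr // -g0 (diffeo01_le hpsi).
  have n1 : \forall t \near c^'+, f t < c by exact: (cvgr_lt _ h _ ntr).
  have n2 := nbhs_right_lt c1; have n3 := nbhs_right_gt c.
  have [x [x1 [x2 x3]]] := @filter_ex _ _ (at_right_proper_filter c) _ (filterI n1 (filterI n2 n3)).
  by exists x => //; rewrite x3 (ltW x2).
have v0' : 0 < v.
  rewrite lt_neqAle v0 andbT; apply/eqP => e; case: ex2 => x /andP[x0 xc].
  by rewrite fr // -e /qf mul0r subr0 g1 ltNge (ltW c1).
have hu : 0 < u <= 1 by rewrite u0' u1.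
have hv : 0 < v <= 1 by rewrite v0' v1.
have hc : 0 < c <= 1 by rewrite c0 ltW.
have hc' : 0 < 1 - c <= 1 by rewrite c1' lerBlDr lerDl ltW.
split=> //.
- by rewrite fl // qf0.
- by rewrite fr // subrr qf0 // subr0.
- move=> x y x0 xy yc; have xc := lt_trans xy yc; have y0 := le_trans x0 (ltW xy).
  have /andP[q0 _] := ql x x0 (ltW xc); have /andP[_ q1] := ql y y0 (ltW yc).
  by rewrite !fl // (diffeo01_lt hphi) // (qf_lt hu hc xy (ltW yc)).
- move=> x y cx xy y1; have cy := lt_trans cx xy; have x1 := le_trans (ltW xy) y1.
  have /andP[q0 _] := qr x (ltW cx) x1; have /andP[_ q1] := qr y (ltW cy) y1.
  rewrite !fr // (diffeo01_lt hpsi) // ltrD2l ltrN2.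
  by apply: (qf_lt hv hc'); lrc cx xy.
Qed.

Lemma return_interval_RI f c C : return_interval al f c C -> exists g, RI f c C.1 C.2 g /\
  (exists2 x, C.1 <= x < c & c < g x) /\ (exists2 x, c < x <= C.2 & g x < c).
case: C => P Q [/= P0 /andP[Pc cQ] Q1 ne [g [ret hl nt]]].
have [] := lorenz_props hl nt; set l := ilen (P, Q).
have l0 : 0 < l by rewrite /l /ilen /=; lra.
have zI y : zeta_inv (P, Q) y = (y - P) / l by [].
have zz x : zeta (P, Q) ((x - P) / l) = x by rewrite /zeta -/l /= mulrC divfK ?gt_eqF // addrC subrK.
have lt_z x y : x < y -> (x - P) / l < (y - P) / l by rewrite ltr_pM2r ?invr_gt0 // ltrD2r.
have z0 x : P <= x -> 0 <= (x - P) / l by move=> h; apply: divr_ge0 (ltW l0); lrc h.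
have z1 x : x <= Q -> (x - P) / l <= 1.
  by move=> h; rewrite ler_pdivrMr // mul1r /l /ilen /=; lra.
have ge x : ((zeta_inv (P, Q) \o g) \o zeta (P, Q)) ((x - P) / l) = (g x - P) / l.
  by rewrite /= zz.
move=> e0 e1 il ir [[x /andP[x0 xc] hx] [y /andP[cy y1] hy]].
have inv_lt x' y' : (x' - P) / l < (y' - P) / l -> x' < y'.
  by rewrite ltr_pM2r ?invr_gt0 // ltrD2r.
have zx w : w = (P + l * w - P) / l by rewrite addrC addKr mulrC mulKf // gt_eqF.
have gP : g P = P.
  have e := ge P; rewrite subrr mul0r e0 in e; apply/eqP; rewrite -subr_eq0.
  by move/esym/eqP: e; rewrite mulf_eq0 invr_eq0 (gt_eqF l0) orbF.
have gQ : g Q = Q.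
  have e := ge Q; have le : Q - P = l by []; rewrite le divff ?gt_eqF // e1 in e.
  by move/(congr1 ( *%R^~ l)): e; rewrite mul1r divfK ?gt_eqF // -le => e; lra.
exists g; split; [split=> //|split].
- by rewrite P0.
- by rewrite cQ.
- by move=> [h1 h2]; apply: ne; rewrite h1 h2.

- move=> s t Ps st tc; apply: inv_lt; rewrite -!ge; apply: il; [exact: z0|exact: lt_z|].
  by rewrite zI; exact: lt_z.
- move=> s t cs st tQ; apply: inv_lt; rewrite -!ge; apply: ir; [|exact: lt_z|exact: z1].
  by rewrite zI; exact: lt_z.
- exists (P + l * x).
    rewrite lerDl mulr_ge0 ?(ltW l0) //=; apply: inv_lt; rewrite -zx; move: xc; by rewrite zI.
  by apply: inv_lt; rewrite -ge -zx; move: hx; rewrite zI.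
- exists (P + l * y).
    apply/andP; split; first by apply: inv_lt; rewrite -zx; move: cy; rewrite zI.
    have : l * y <= l * 1 by rewrite ler_pM2l.
    by rewrite mulr1 {2}/l /ilen /=; lra.
  by apply: inv_lt; rewrite -ge -zx; move: hy; rewrite zI.
Qed.
End LorenzProps.

(** * From renormalizability to the two half structures *)

Section Bridge.
Implicit Types (m : lmap) (p q x : R).

(* The part of the return structure of [p, q] on the right of c that implies [half]. *)
Definition rhalf m n p q := [/\ 0 <= p < lc m, lc m < q <= 1,
  forall x, lc m < x <= q -> first_return (lF m) (p, q) x n.+1,
  forall x j, lc m < x <= q -> (1 <= j <= n)%N -> iter j (lF m) x < lc m &
  iter n.+1 (lF m) q = q /\ exists2 x, lc m < x <= q & iter n.+1 (lF m) x < lc m].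

Lemma half_of d m n p q : wf d m -> rhalf m n p q -> half m n p q.
move=> hw [/andP[p0 pc] hq fr itc [eq [z hz ez]]]; case/andP: (hq) => cq q1.
have c1 := wf_c1 hw.
have itx x j : lc m < x <= q -> (j <= n)%N -> iter j.+1 (lF m) x = lK m j (lV m x).
  move=> hx; elim: j => [|j IH] jn.
    by apply: iter_right => //; case/andP: hx => /ltW.
  rewrite iterS IH ?(ltnW jn) // /lF.
  by rewrite -(IH (ltnW jn)) itc // (IH (ltnW jn)).
have qq : lc m < q <= q by rewrite cq lexx.
have hi x : lc m < x <= q -> litin m n (lV m x).
  move=> hx; apply: (right_itin hw).
    by case/andP: hx => h1 h2; rewrite ltW //= (le_trans h2).
  by move=> i hi; exact: itc.
have inc : litin m n (lV m (lc m)) /\ (lK m n (lV m (lc m)) <= lK m n (lV m z)).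
  case/andP: (hz) => z1 z2.
  have [h1 [h2 _]] := lKV_mono hw (lexx _) (ltW z1) (le_trans z2 q1) (hi z hz).
  by split.
have Vc := lV_c m; rewrite Vc in inc.
have lt_p j : (j < n)%N -> lK m j (lV m q) < p.
  move=> jn; have := fr q qq; case=> _ _ /(_ j.+1); rewrite /= ltnS jn => /(_ isT).
  have l1 : lK m j (lV m q) < lc m by rewrite -itx ?(ltnW jn) // itc // ltnS.
  rewrite -iterS itx ?(ltnW jn) // in_itv /= negb_and -!ltNge => /orP[//|].
  by rewrite ltNge (ltW (lt_trans l1 cq)).
split=> //.
- by rewrite -itx.
- case/andP: (hz) => cz zq.
  pose L := (expR d * (al / lc m)) ^+ n * expR d * (al / (1 - lc m)).
  (* The bound at the critical value is a limit from the right, since the return conditions say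
     nothing at [c] itself. The Lipschitz constant [L] of the return branch controls the error of a
     point at distance [r]. *)
  apply: (@le_small _ _ L (q - lc m)); first by rewrite subr_gt0.
  move=> r r0 rq; set x := lc m + r.
  have hx : lc m < x <= q by rewrite /x ltrDl r0; lra.
  case/andP: (hx) => cx xq; have x1 := le_trans xq q1.
  have Px : p <= lK m n (lV m x).
    have [_ + _] := fr x hx; rewrite itx // in_itv /= => /andP[h _]; exact: h.
  have [hq0 hqi] := hi x hx.
  have v0 := lV_ge0 hw (introT andP (conj (lexx (lc m)) (ltW (lt_le_trans cq q1)))).
  have vx : lV m (lc m) <= lV m x by apply: (lV_le hw) => //; exact: ltW.
  have k : `|lK m n (lV m x) - lK m n (lV m (lc m))| <=
      (expR d * (al / lc m)) ^+ n * expR d * `|lV m x - lV m (lc m)|.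
    apply: (KK_lip (wf_u hw) c1 (wf_p hw) (sl_flip (wf_q hw)) (hi x hx)).
      by rewrite v0 vx.
    by rewrite lexx (le_trans v0 vx).
  have k2 := lV_lip hw (lexx (lc m)) (ltW cx) x1.
  rewrite (ger0_norm (x := lV m x - _)) ?subr_ge0 // in k.
  have L0 : 0 <= (expR d * (al / lc m)) ^+ n * expR d.
    rewrite mulr_ge0 ?expR_ge0 // exprn_ge0 // mulr_ge0 ?expR_ge0 // divr_ge0 //.
      exact: le_trans ler01 (ltW al1).
    by case/andP: c1 => /ltW.
  have k3 := le_trans k (ler_wpM2l L0 k2).
  have xr : x - lc m = r by rewrite /x addrC addKr.
  rewrite xr [X in _ <= X]mulrA -/L Vc in k3; rewrite mulrC.
  have k4 := le_trans (ler_norm _) k3; lrc k4 Px.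
- case: inc => _ h; apply: le_lt_trans h _; by rewrite -itx.
Qed.
End Bridge.

Section Coords.
Context {d0 d1 : Order.disp_t} {T0 : orderType d0} {T1 : orderType d1}.
Implicit Types (f : coords R T0 T1) (C : R * R).

Definition mof f : lmap := LM (comp_all al (co_s f)) (flip (comp_all al (co_t f)))
  (co_u f) (co_v f) (co_c f).

Lemma mapOE f : mapO al f = lF (mof f).
apply/funext => x; rewrite /mapO /lorenz /lF /=; case: ltP => h.
  by rewrite stdQ_left.
by rewrite stdQ_right // /lf0 /br /= /flip; ring.
Qed.

(** Positivity of [a] and [b] gives f(p) > c and f(q) < c, from which [u > 0], [v > 0] and the
    position of the critical values follow; with these the map satisfies [wf]. *)
Lemma Lset_ren f a b dl : Lset al a b f -> l1_le (co_s f) dl -> l1_le (co_t f) dl -> dl <= rb ->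
  (0 < a)%N -> (0 < b)%N ->
  wf dl (mof f) /\ ren (mof f) a b (retC al f).1 (retC al f).2.
move=> [dec ren0] hs ht hdl a0 b0; have [hu hv hc _] := dec.
have sls : sl dl (comp_all al (co_s f)) by apply: comp_sl => //; exact: l1_le_weak hs.
have slt : sl dl (comp_all al (co_t f)) by apply: comp_sl => //; exact: l1_le_weak ht.
case: ren0; rewrite -/(retC al f) mapOE; case: (retC al f) => p q /= [hri _] frl frr itl itr.
have [g [ri [[xl hxl egl] [xr hxr egr]]]] := return_interval_RI hri.
have [/andP[p0 pc] /andP[cq q1] ne ret gp gq _ _] := ri; rewrite /= in p0 pc cq q1 ne ret gp gq hxl hxr.
case/andP: (hc) => c0 c1; set c := co_c f in pc cq hxl egl hxr egr c0 c1 ret frl frr itl itr *.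
have ec : lc (mof f) = c by [].
have inl x : p <= x -> x < c -> x \in `[p, c[ by rewrite in_itv /= => -> ->.
have inr x : c < x -> x <= q -> x \in `]c, q] by rewrite in_itv /= => -> ->.
have gl x : p <= x -> x < c -> g x = iter a.+1 (lF (mof f)) x.
  move=> px xc; have [|//|n fr ->] := ret x; first by rewrite px ltW // (lt_trans xc).
    by rewrite lt_eqF.
  by rewrite (first_return_uniq fr (frl x (inl x px xc))).
have gr x : c < x -> x <= q -> g x = iter b.+1 (lF (mof f)) x.
  move=> cx xq; have [|//|n fr ->] := ret x; first by rewrite xq ltW // (lt_trans pc).
    by rewrite gt_eqF.
  by rewrite (first_return_uniq fr (frr x (inr x cx xq))).
have fp : c < lF (mof f) p.
  by have := itl p 1%N (inl p (lexx _) pc); rewrite a0 in_itv /= => /(_ isT)/andP[].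
have fq : lF (mof f) q < c.
  by have := itr q 1%N (inr q cq (lexx _)); rewrite b0 in_itv /= => /(_ isT)/andP[].
have cl : 0 < c <= 1 by rewrite c0 ltW.
have cr : 0 < 1 - c <= 1 by rewrite subr_gt0 c1 lerBlDr lerDl ltW.
case/andP: hu => u0 u1; case/andP: hv => v0 v1.
have [ps0 ps1 _] := sls; have [pt0 pt1 _] := slt.
have u0' : 0 < co_u f.
  rewrite lt_neqAle u0 andbT; apply/eqP => e; move: fp.
  by rewrite /lF ec pc /lf0 /br /= /qf -e mul0r ps0 ltNge (ltW c0).
have v0' : 0 < co_v f.
  rewrite lt_neqAle v0 andbT; apply/eqP => e; move: fq.
  rewrite /lF ec [q < _]ltNge (ltW cq) /= /lf0 /br /= /qf -e mul0r /flip subr0 pt1 subrr subr0.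
  by rewrite ltNge (ltW c1).
have hu : 0 < co_u f <= 1 by rewrite u0' u1.
have hv : 0 < co_v f <= 1 by rewrite v0' v1.
have hw : wf dl (mof f).
  split=> //=.
  - exact: l1_le_ge0 hs.
  - exact: sl_flip.
  - move: fp; rewrite /lF ec pc /lf0 /br /= => fp.
    have h0 : 0 <= p <= c by rewrite p0 ltW.
    have /andP[q0 qu] := qf_in hu cl h0.
    by apply: le_trans (ltW fp) _; apply: (sl_le sls).
  - move: fq; rewrite /lF ec [q < _]ltNge (ltW cq) /= /lf0 /br /= => fq.
    have h0 : 0 <= 1 - q <= 1 - c by rewrite subr_ge0 q1 lerD2l lerN2 ltW.
    have /andP[q0 qu] := qf_in hv cr h0.
    have := sl_le (sl_flip slt) q0 qu v1; rewrite -/c; lrc T0 T1 fq.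
split=> //.
have hr : rhalf (mof f) b p q.
  split; rewrite ?ec ?p0 ?cq //.

  - move=> x j /andP[cx xq] hj; have := itr x j (inr x cx xq) hj.
    by rewrite in_itv /= => /andP[].
  - rewrite -(gr q cq (lexx q)); split; [exact: gq|exists xr; first exact: hxr].
    by case/andP: hxr => h1 h2; rewrite -(gr xr h1 h2); exact: egr.
have c2 : p < lc (mof f) < q by rewrite ec pc cq.
have fl x : p <= x -> x < c -> first_return (lF (lflip (mof f))) (1 - q, 1 - p) (1 - x) a.+1 /\
    forall j, (j <= a.+1)%N -> iter j (lF (lflip (mof f))) (1 - x) = 1 - iter j (lF (mof f)) x.
  move=> px xc; have h := frl x (inl x px xc).
  by apply: first_return_flip c2 _ h; rewrite ec lt_eqF.
have hl : rhalf (lflip (mof f)) a (1 - q) (1 - p).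
  split; rewrite /= -/c.
  - by rewrite subr_ge0 q1 ltrD2l ltrN2.
  - by rewrite lerBlDr lerDl p0 ltrD2l ltrN2 pc.
  - move=> x /andP[h1 h2]; have [] := fl (1 - x); [lrc T0 T1 h2|lrc T0 T1 h1|]; by rewrite subKr.
  - move=> x j /andP[h1 h2] /andP[j1 ja].
    have px : p <= 1 - x by lrc T0 T1 h2.
    have xc : 1 - x < c by lrc T0 T1 h1.
    have [_ /(_ j (leqW ja))] := fl (1 - x) px xc; rewrite subKr => ->.
    have := itl (1 - x) j (inl _ px xc); rewrite j1 ja in_itv /= => /(_ isT)/andP[h _].
    by rewrite ltrD2l ltrN2.
  - have [_ /(_ _ (leqnn a.+1)) e] := fl p (lexx _) pc; rewrite -(gl p (lexx _) pc) gp /= in e.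
    split; first exact: e.
    case/andP: hxl => px xc; exists (1 - xl).
      by apply/andP; split; [lrc T0 T1 xc|lrc T0 T1 px].
    have [_ /(_ _ (leqnn a.+1)) e'] := fl xl px xc; rewrite -(gl xl px xc) /= in e'.
    by rewrite e' ltrD2l ltrN2.
split; [exact: half_of hw hr | exact: half_of (wf_flip hw) hl].
Qed.
End Coords.

(** * Tangent vectors along orbits and expansions of orbits *)

Section TangentChain.
Implicit Types (m t : lmap) (x y dx dy r : R) (px qx : R -> R) (n : nat).

(* Tangent vectors at a point of [lmap] are stored in the same record; [px] and
   [qx] are the derivatives of the two diffeomorphisms at the base point. *)
Definition tflip t := LM (lq t) (lp t) (lv t) (lu t) (- lc t).

Definition qfd m x := lu m * al * (rr (lc m) x) `^ (al - 1) / lc m.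
(** Q depends on [x] and [c] only through [x / c], so that moving [c] acts like the displacement
    [- x / c * lc t] of the point. *)
Definition dqf m t x dx :=
  (1 - (rr (lc m) x) `^ al) * lu t + qfd m x * (dx - x / lc m * lc t).
Definition dlV m t x dx := - dqf (lflip m) (tflip t) (1 - x) (- dx).
Fixpoint dlK m px qx t n y dy := if n is k.+1 then
    lp t (qf (lu m) (lc m) (lK m k y)) + px (qf (lu m) (lc m) (lK m k y)) *
      dqf m t (lK m k y) (dlK m px qx t k y dy)
  else - lq t (1 - y) + qx (1 - y) * dy.

End TangentChain.

Section ChainJets.
Context {I : Type} (F : set_system I) (nu : I -> R).
Hypothesis hj : jctx F nu.
#[local] Instance hjF : Filter F := proj1 hj.
Implicit Types (X Y dX dY : I -> R) (px qx : R -> R) (m : lmap).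
Local Tactic Notation "lrj" hyp_list(h) := clear - hj al1 h; lra.
Notation jet := (jet F nu).

(** Expansion of a map jointly in its parameters and its argument. It is stated as an action on
    jets, so composing maps is composing statements. *)
Definition mjet (ph_ : I -> R -> R) (ph : R -> R) (ph1 : I -> R -> R) (phx : R -> R) :=
  forall X X0 dX, jet X X0 dX -> F [set i | 0 <= X i <= 1 /\ 0 <= X0 i <= 1] ->
  jet (fun i => ph_ i (X i)) (fun i => ph (X0 i)) (fun i => ph1 i (X0 i) + phx (X0 i) * dX i).

Lemma mjet_flip ph_ ph ph1 phx : mjet ph_ ph ph1 phx ->
  mjet (fun i => flip (ph_ i)) (flip ph) (fun i x => - ph1 i (1 - x)) (fun x => phx (1 - x)).
move=> h X X0 dX hX hr; rewrite /flip.
have h1 : jet (fun i => 1 - X i) (fun i => 1 - X0 i) (fun i => 0 - dX i).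
  exact: (jetB hj (jet_const hj 1) hX).
have h2 : F [set i | 0 <= 1 - X i <= 1 /\ 0 <= 1 - X0 i <= 1].
  by apply: filterS hr => i [/andP[h1' h2'] /andP[h3 h4]]; split; andlra.
by apply: (jet_ext hj) (jetB hj (jet_const hj 1) (h _ _ _ h1 h2)); apply: filterE => i; split=> //; ring.
Qed.

Record lj (d : R) (m_ : I -> lmap) m (t_ : I -> lmap) px qx := Lj {
  lj_wf : F [set i | wf d (m_ i)] /\ wf d m;
  lj_u : jet (fun i => lu (m_ i)) (fun=> lu m) (fun i => lu (t_ i));
  lj_v : jet (fun i => lv (m_ i)) (fun=> lv m) (fun i => lv (t_ i));
  lj_c : jet (fun i => lc (m_ i)) (fun=> lc m) (fun i => lc (t_ i));
  lj_p : mjet (fun i => lp (m_ i)) (lp m) (fun i => lp (t_ i)) px;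
  lj_q : mjet (fun i => lq (m_ i)) (lq m) (fun i => lq (t_ i)) qx }.

Lemma lj_flip d (m_ : I -> lmap) m (t_ : I -> lmap) px qx : lj d m_ m t_ px qx ->
  lj d (fun i => lflip (m_ i)) (lflip m) (fun i => tflip (t_ i)) qx px.
case=> [[h1 h2] hu hv hc hp hq]; split=> //=.
  by split; [apply: filterS h1 => i; exact: wf_flip | exact: wf_flip].
by apply: (jet_ext hj) (jetB hj (jet_const hj 1) hc); apply: filterE => i; split=> //; ring.
Qed.

Section Fixed.
Variables (d : R) (m : lmap) (m_ t_ : I -> lmap) (px qx : R -> R).
Hypothesis hl : lj d m_ m t_ px qx.
Local Tactic Notation "lrl" hyp_list(h) := clear - hl al1 h; lra.

Lemma qf_jet e X X0 dX : 0 < e -> jet X X0 dX ->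
  F [set i | 0 <= X i <= lc (m_ i) - e /\ 0 <= X0 i <= lc m - e] ->
  jet (fun i => qf (lu (m_ i)) (lc (m_ i)) (X i))
      (fun i => qf (lu m) (lc m) (X0 i)) (fun i => dqf m (t_ i) (X0 i) (dX i)).
move=> e0 hX hr; have [[hwf hm] hu _ hc _ _] := hl.
have c0 := wf_c1 hm; case/andP: (c0) => c00 c01.
have fc : F [set i | [/\ e <= `|lc (m_ i)|, e <= `|lc m|,
    e <= rr (lc (m_ i)) (X i) & e <= rr (lc m) (X0 i)]].
  apply: filterS2 hr hwf => i [/andP[x0 x1] /andP[y0 y1]] hi.
  have /andP[ci0 ci1] := wf_c1 hi; rewrite /rr /= (gtr0_norm ci0) (gtr0_norm c00).
  split; [lrl x0 x1|lrl y0 y1| |].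
    by rewrite ler_pdivlMr // (le_trans (ler_piMr (ltW e0) ci1)) // lerBrDl; lrl x1.
  by rewrite ler_pdivlMr // (le_trans (ler_piMr (ltW e0) c01)) // lerBrDl; lrl y1.
have hV := jetV hj e0 (filterS _ fc) (filterS _ fc) hc.
have {}hV : jet (fun i => (lc (m_ i))^-1) (fun=> (lc m)^-1) (fun i => - lc (t_ i) / lc m ^+ 2).
  by apply: hV => i [].
have hrr : jet (fun i => rr (lc (m_ i)) (X i)) (fun i => rr (lc m) (X0 i))
    (fun i => (lc m - X0 i) * (- lc (t_ i) / lc m ^+ 2) + (lc (t_ i) - dX i) * (lc m)^-1).
  exact: (jetM hj (jetB hj hc hX) hV).
have f1 : F [set i | e <= rr (lc m) (X0 i)] by apply: filterS fc => i [].
have f2 : F [set i | e <= rr (lc (m_ i)) (X i)] by apply: filterS fc => i [].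
have hp := jet_pow hj al e0 f1 f2 hrr.
apply: (jet_ext hj _ (jetM hj hu (jetB hj (jet_const hj 1) hp))).
apply: filterE => i; split=> //; rewrite /dqf /qfd.
set P := _ `^ (al - 1); set P' := _ `^ al.
by field; rewrite gt_eqF.
Qed.

(** The margin [e] keeps the orbit away from [c], where a power with base 0 cannot be expanded by
    [jet_pow]. *)
Lemma lK_jet e n Y Y0 dY : 0 < e -> jet Y Y0 dY -> F [set i | 0 <= Y i <= 1 /\ 0 <= Y0 i <= 1] ->
  F [set i | forall j, (j < n)%N -> lK (m_ i) j (Y i) <= lc (m_ i) - e /\ lK m j (Y0 i) <= lc m - e] ->
  jet (fun i => lK (m_ i) n (Y i)) (fun i => lK m n (Y0 i))
    (fun i => dlK m px qx (t_ i) n (Y0 i) (dY i)).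
move=> e0 hY h01; have [[hwf hm] hu _ hc hp hq] := hl.
elim: n => [_|n IH h]; first exact: (mjet_flip hq hY h01).
have hX : jet (fun i => lK (m_ i) n (Y i)) (fun i => lK m n (Y0 i))
    (fun i => dlK m px qx (t_ i) n (Y0 i) (dY i)).
  by apply: IH; apply: filterS h => i h j jn; apply: h; exact: leqW.
have hr : F [set i | 0 <= lK (m_ i) n (Y i) <= lc (m_ i) - e /\ 0 <= lK m n (Y0 i) <= lc m - e].
  apply: filterS3 hwf h01 h => i hi [y1 y2] h; have [k1 k2] := h n (ltnSn n).
  rewrite /= k1 k2 !andbT; split; apply: proj1; apply/andP; [apply: (lK_in hi)|apply: (lK_in hm)]; split=> // j jn.
    by have [k _] := h j (leqW jn); apply: le_lt_trans k _; lrl e0.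
  by have [_ k] := h j (leqW jn); apply: le_lt_trans k _; lrl e0.
have hQ := qf_jet e0 hX hr; apply: (hp _ _ _ hQ).
apply: filterS2 hwf hr => i hi [/andP[x0 x1] /andP[y0 y1]].
have h1 : 0 <= lK (m_ i) n (Y i) <= lc (m_ i) by rewrite x0; lrl x1 e0.
have h2 : 0 <= lK m n (Y0 i) <= lc m by rewrite y0; lrl y1 e0.
split; first exact: (qf_in1 (wf_u hi) (wf_c1 hi) h1).
exact: (qf_in1 (wf_u hm) (wf_c1 hm) h2).
Qed.
End Fixed.

Lemma lV_jet d (m_ : I -> lmap) m (t_ : I -> lmap) px qx e X X0 dX : lj d m_ m t_ px qx -> 0 < e -> jet X X0 dX ->
  F [set i | lc (m_ i) + e <= X i <= 1 /\ lc m + e <= X0 i <= 1] ->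
  jet (fun i => lV (m_ i) (X i)) (fun i => lV m (X0 i)) (fun i => dlV m (t_ i) (X0 i) (dX i)).
move=> hl e0 hX hr.
have h1 : jet (fun i => 1 - X i) (fun i => 1 - X0 i) (fun i => 0 - dX i).
  exact: (jetB hj (jet_const hj 1) hX).
have h2 : F [set i | 0 <= 1 - X i <= lc (lflip (m_ i)) - e /\ 0 <= 1 - X0 i <= lc (lflip m) - e].
  apply: filterS hr => i [/andP[x0 x1] /andP[y0 y1]] /=.
  by split; apply/andP; split; [lrj x1|lrj x0|lrj y1|lrj y0].
apply: (jet_ext hj) (jetB hj (jet_const hj 1) (qf_jet (lj_flip hl) e0 h1 h2)).
by apply: filterE => i; split=> //; rewrite /dlV !sub0r.
Qed.
End ChainJets.

(** * Roots that depend on the perturbation *)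

Section Implicit.
Context {I : Type} (F : set_system I) (nu : I -> R).
Hypothesis hj : jctx F nu.
Hypothesis hs : forall e : R, 0 < e -> F [set i | nu i <= e].
#[local] Instance hjF2 : Filter F := proj1 hj.
Implicit Types (X dX E : I -> R) (r D : R).
Notation jet := (jet F nu).
Local Tactic Notation "lrj" hyp_list(h) := clear - hj hs h; lra.

Lemma jet_close X x0 dX e : jet X (fun=> x0) dX -> 0 < e -> F [set i | `|X i - x0| <= e].
move=> /(jet_near hj)[K K0 hK] e0; have e1 : 0 < e / K by rewrite divr_gt0.
apply: filterS2 hK (hs e1) => i [_ _ h1] h2; apply: le_trans h1 _.
by rewrite mulrC -ler_pdivlMr.
Qed.

(** Only an intermediate value argument for each index: on a window of width proportional to [nu i]
    the linear term dominates both the perturbation and the quadratic error. The expansion of the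
    root is then read off from [G i (X i) = 0]. *)
Lemma implicit (G : I -> R -> R) (x0 : R) D E : 0 < D ->
  (forall K, 0 < K -> F [set i | exists L, forall x y, x0 - K * nu i <= x <= x0 + K * nu i ->
    x0 - K * nu i <= y <= x0 + K * nu i -> `|G i y - G i x| <= L * `|y - x|]) ->
  (forall X dX, jet X (fun=> x0) dX ->
     jet (fun i => G i (X i)) (fun=> 0) (fun i => E i + D * dX i)) ->
  exists X, jet X (fun=> x0) (fun i => - E i / D) /\ F [set i | G i (X i) = 0].
move=> D0 hL hG; have [_ nu01] := hj.
have [C [hE]] : exists C, F [set i | `|E i| <= C * nu i] /\ True.
  have [C _ hC] := jetE hj (hG _ _ (jet_const hj x0)); exists C; split=> //.
  by apply: filterS hC => i /= [_ _ +]; rewrite mulr0 addr0.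
move=> _.
(* With [D * K = |C| + 1] the values at the ends of the window have opposite signs with slack
   [nu i], which covers the quadratic error once [K1 * nu i <= 1]. *)
pose K := (`|C| + 1) / D; have K0 : 0 < K by rewrite divr_gt0 // ltr_wpDl.
have KD : D * K = `|C| + 1 by rewrite /K mulrC divfK // gt_eqF.
have hx (s : R) : `|s| <= 1 -> jet (fun i => x0 + s * (K * nu i)) (fun=> x0) (fun i => s * (K * nu i)).
  move=> s1; have h i : 0 <= nu i <= 1 -> `|x0 + s * (K * nu i) - x0| <= K * nu i.
    move=> /andP[n0 _]; rewrite addrC addKr normrM (ger0_norm (mulr_ge0 (ltW K0) n0)).
    by rewrite ler_piMl // mulr_ge0 // ltW.
  apply: (jet_ext hj) (jet_lip hj (K := K + `|x0|) _ : jet (fun i => x0 + s * (K * nu i)) (fun=> x0) _).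
    by apply: filterE => i; split=> //; rewrite addrC addKr.
  apply: filterS nu01 => i hi; split; first by rewrite lerDr ltW.
  apply: le_trans (h i hi) _; case/andP: hi => n0 _.
  by rewrite ler_wpM2r // lerDl.
have jp : jet (fun i => x0 + 1 * (K * nu i)) (fun=> x0) (fun i => 1 * (K * nu i)).
  by apply: hx; rewrite normr1.
have jm : jet (fun i => x0 + -1 * (K * nu i)) (fun=> x0) (fun i => -1 * (K * nu i)).
  by apply: hx; rewrite normrN normr1.
have [K1 [K11 h1]] : exists K1, 1 <= K1 /\ F [set i | [/\ 0 <= nu i <= 1, `|E i| <= C * nu i,
    `|G i (x0 + 1 * (K * nu i)) - 0 - (E i + D * (1 * (K * nu i)))| <= K1 * nu i ^+ 2 &
    `|G i (x0 + -1 * (K * nu i)) - 0 - (E i + D * (-1 * (K * nu i)))| <= K1 * nu i ^+ 2]].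
  have [K1 k1 h1] := jet2E hj (hG _ _ jp) (hG _ _ jm); exists K1; split=> //.
  by apply: filterS2 h1 hE => i [? [_ _ ?] [_ _ ?]] ?; split.
have K10 : 0 < K1 by exact: lt_le_trans K11.
have e0 : 0 < K1^-1 by rewrite invr_gt0.
have near : F [set i | exists x, `|x - x0| <= K * nu i /\ G i x = 0].
  apply: filterS3 h1 (hL K K0) (hs e0).
  move=> i [/andP[n0 n1] hEi g1 g2] [L hLi] k1 /=.
  have q : K1 * nu i ^+ 2 <= nu i.
    rewrite expr2 mulrA ler_piMl // mulrC -ler_pdivlMr // div1r //.
  have hEi' : `|E i| <= `|C| * nu i by apply: le_trans hEi _; rewrite ler_wpM2r // ler_norm.
  have Kn0 : 0 <= K * nu i by rewrite mulr_ge0 // ltW.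

  have eD : D * (K * nu i) = `|C| * nu i + nu i by rewrite mulrA KD mulrDl mul1r.
  have ab : x0 - K * nu i <= x0 + K * nu i by lrj Kn0.
  have [x hx' gx] : exists2 x, x0 - K * nu i <= x <= x0 + K * nu i & G i x = 0.
    apply: (@lip_IVT _ (G i) L) => //.
    move: g1 g2; rewrite mul1r mulN1r mulrN eD !ler_norml => /andP[g1 _] /andP[_ g2].
    move: hEi'; rewrite ler_norml => /andP[E1 E2].
    by apply/andP; split; [lrj g2 E2 q|lrj g1 E1 q].
  case/andP: hx' => x1 x2; have h : `|x - x0| <= K * nu i.
    by rewrite ler_norml; apply/andP; split; [lrj x1|lrj x2].
  by exists x.
have [X hX] : exists X, F [set i | `|X i - x0| <= K * nu i /\ G i (X i) = 0].
  have /choice[X hX] : forall i, exists x, (exists x, `|x - x0| <= K * nu i /\ G i x = 0) ->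
      `|x - x0| <= K * nu i /\ G i x = 0.
    move=> i; have [[x hx']|h] := pselect (exists x, `|x - x0| <= K * nu i /\ G i x = 0).
      by exists x.
    by exists 0 => /h.
  by exists X; apply: filterS near => i; exact: hX.
have jX : jet X (fun=> x0) (fun i => X i - x0).
  apply: (jet_lip hj (K := K + `|x0|)); apply: filterS2 hX nu01 => i [h _] /andP[n0 _].
  by rewrite lerDr ltW //; split=> //; apply: le_trans h _; rewrite ler_wpM2r // lerDl.
have [K2 K21 h2] := jetE hj (hG _ _ jX).
have K20 : 0 < K2 by exact: lt_le_trans K21.
exists X; split; last by apply: filterS hX => i [].
exists (`|x0| + `|C| / D + K2 / D); apply: filterS3 h2 hX hE => i [/andP[n0 n1] _ _ h] [k1 k3] hEi.
rewrite k3 subrr sub0r in h.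
have hEi' : `|E i| <= `|C| * nu i by apply: le_trans hEi _; rewrite ler_wpM2r // ler_norm.
have CD : 0 <= `|C| / D by rewrite divr_ge0 // ltW.
have KD0 : 0 <= K2 / D by rewrite divr_ge0 // ltW.
have x00 := normr_ge0 x0; have xD := mulr_ge0 x00 (ltW D0).
have eD : (`|x0| + `|C| / D + K2 / D) * D = `|x0| * D + `|C| + K2 by field; rewrite gt_eqF.
have nC := normr_ge0 C; split.
- by lrj CD KD0.
- rewrite normrM normrN normfV (gtr0_norm D0) ler_pdivrMr //; apply: le_trans hEi' _.
  by rewrite [X in _ <= X]mulrAC ler_wpM2r // eD; lrj xD K20.
- have -> : X i - x0 - - E i / D = (E i + D * (X i - x0)) / D by field; rewrite gt_eqF.
  rewrite normrM normfV (gtr0_norm D0) ler_pdivrMr // -normrN; apply: le_trans h _.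
  by rewrite [X in _ <= X]mulrAC ler_wpM2r ?sqr_ge0 // eD; lrj xD nC.
Qed.
End Implicit.

Section CompJets.
Context {I : Type} (F : set_system I) (nu : I -> R).
Hypothesis hj : jctx F nu.
#[local] Instance hjF3 : Filter F := proj1 hj.
Implicit Types (X dX : I -> R).
Notation jet := (jet F nu).
Context {d : Order.disp_t} {T : orderType d}.

Lemma mjet_comp (s : T -> R) (s_ : I -> T -> R) : l1_le s (rb / 2) ->
  F [set i | l1_le (s_ i) rb /\ l1_le (fun t => s_ i t - s t) (nu i)] ->
  mjet F nu (fun i => comp_all al (s_ i)) (comp_all al s)
    (fun i x => cds s predT x (fun t => s_ i t - s t)) (cdx s predT).
move=> hs0 hs X X0 dX hX h01; have [K K1 hK] := jetE hj hX.
have [K0 K00 hK0] := mu_param_lip; have [K2 K20 hK2] := comp_second (T := T).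
have rb0 := @rb_gt0; have rb1 := @rb_le1.
have hs1 : l1_le s rb by apply: l1_le_weak hs0; lra.
pose Lx := expR 1 : R; have Lx0 : 0 <= Lx by exact: expR_ge0.
pose Ls := K0 * expR 2; have Ls0 : 0 <= Ls by rewrite mulr_ge0 ?expR_ge0 // ltW.
have K0' : 0 <= K by exact: le_trans K1.
pose M := 1 + (Ls + Lx * K) + (K2 * (1 + (K + K)) ^+ 2 + Lx * K).
exists M; apply: filterS3 hK hs h01 => i [/andP[n0 n1] k1 k2 k3] [hsi hd] [x01 y01].
have LK := mulr_ge0 Lx0 K0'; have sq := sqr_ge0 (1 + (K + K)).
have K2s := mulr_ge0 (ltW K20) sq; have n2 := sqr_ge0 (nu i).
have st := cdx_bound predT hs0 hs1 y01; have := cds_bound predT (conj K00 hK0) hs0 hd y01.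
set a := cds _ _ _ _; case=> ha _; set b := cdx _ _ _ in st *.
have hb : `|b| <= Lx.
  case/andP: st => st1 st2; rewrite ger0_norm; last exact: le_trans (expR_ge0 _) st1.
  by apply: le_trans st2 _; rewrite /Lx ler_expR.
have ha' : `|a| <= Ls * nu i.
  by apply: le_trans ha _; case/andP: y01 => y0 y1; rewrite -/Ls ler_piMr // mulr_ge0.
split.
- have /andP[p0 p1] := comp_in predT hs1 y01; rewrite ger0_norm //.
  by apply: le_trans p1 _; rewrite /M; lra.
- apply: le_trans (normD_le ha' (normM_le hb k2)) _.
  rewrite mulrA -mulrDl ler_wpM2r // /M; lrc LK K2s.
- have Xd : `|X i - X0 i| <= (K + K) * nu i.
    have -> : X i - X0 i = dX i + (X i - X0 i - dX i) by ring.
    apply: le_trans (normD_le k2 k3) _; rewrite mulrDl lerD2l ler_wpM2l //.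
    by rewrite expr2 ler_piMl.
  have q := hK2 s (s_ i) predT (X0 i) (X i) (nu i) hs0 hsi hd y01 x01.
  rewrite -/a -/b in q.
  have e : comp_all al (s_ i) (X i) - comp_all al s (X0 i) - (a + b * dX i) =
    (comp_on al (s_ i) predT (X i) - comp_on al s predT (X0 i) - (a + b * (X i - X0 i))) +
    b * (X i - X0 i - dX i) by rewrite /comp_all; ring.
  rewrite e; apply: le_trans (normD_le q (normM_le hb k3)) _.
  have q2 : (nu i + `|X i - X0 i|) ^+ 2 <= (1 + (K + K)) ^+ 2 * nu i ^+ 2.
    rewrite -exprMn lerXn2r ?nnegrE ?addr_ge0 // ?mulr_ge0 // ?mulrDl ?mul1r.
      by rewrite addr_ge0 // ?addr_ge0 // mulr_ge0.
    by rewrite lerD2l -mulrDl.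
  apply: le_trans (lerD (ler_wpM2l (ltW K20) q2) (lexx _)) _.
  set q3 := (1 + (K + K)) ^+ 2 in sq K2s *; rewrite (mulrA K2) (mulrA Lx) -mulrDl ler_wpM2r // /M -/q3.
  by clear - hj al1 T Ls0 LK K2s; lra.
Qed.
End CompJets.

Section Near.
Context {I : Type} (F : set_system I) (nu : I -> R).
Hypothesis hj : jctx F nu.
Hypothesis hs : forall e : R, 0 < e -> F [set i | nu i <= e].
#[local] Instance hjF4 : Filter F := proj1 hj.
Implicit Types (Y dY X dX : I -> R) (n : nat).
Notation jet := (jet F nu).
Variables (d : R) (m : lmap) (m_ t_ : I -> lmap) (px qx : R -> R).
Hypothesis hl : lj F nu d m_ m t_ px qx.
Local Tactic Notation "lrj" hyp_list(h) := clear - hs hl al1 h; lra.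

Lemma chain_near n Y y dY : jet Y (fun=> y) dY -> F [set i | 0 <= Y i <= 1] ->
  litin m n y -> exists2 e, 0 < e & F [set i | forall j, (j < n)%N ->
    lK (m_ i) j (Y i) <= lc (m_ i) - e /\ lK m j y <= lc m - e].
move=> hY h01 [y01 hi].
have h01' : F [set i | 0 <= Y i <= 1 /\ 0 <= y <= 1] by apply: filterS h01 => i h; split.
elim: n hi => [|n IH] hi; first by exists 1 => //; apply: filterE => i j.
have [e e0 he] := IH (fun j jn => hi j (ltnW jn)).
have k := lK_jet hj hl e0 hY h01' he.
(* One third of the gap for the motion of the point, one for the motion of [c], and one that
   remains. *)
pose g := (lc m - lK m n y) / 3.
have gl : lc m - lK m n y = g + g + g by rewrite /g; field.
have g0 : 0 < g by rewrite divr_gt0 // subr_gt0; exact: hi.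
exists (Num.min e g); first by rewrite lt_min e0 g0.
have [_ _ _ hc _ _] := hl.
apply: filterS3 he (jet_close hj hs k g0) (jet_close hj hs hc g0) => i h1 h2 h3 j.
rewrite ltnS leq_eqVlt => /predU1P[->|jn].
  move: h2 h3; rewrite /= !ler_norml => /andP[a1 a2] /andP[b1 b2].
  have mg : Num.min e g <= g by rewrite ge_min lexx orbT.
  by split; [lrj a2 b1 mg gl|lrj mg gl g0].
have [a1 a2] := h1 j jn; have mg : Num.min e g <= e by rewrite ge_min lexx.
by split; [lrj a1 mg|lrj a2 mg].
Qed.

Definition lD n y := Dn (lu m) (lc m) (lp m) px (flip (lq m)) (fun y => qx (1 - y)) n y.

Lemma dlK_split t n y dy : dlK m px qx t n y dy = dlK m px qx t n y 0 + lD n y * dy.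
elim: n => [|n IH] /=; first by rewrite mulr0 addr0.
rewrite IH /lD /= -/(lD n y) /brd /dqf /qfd /lK; ring.
Qed.

Lemma dlV_split t x dx : dlV m t x dx = dlV m t x 0 +
  qfd (lflip m) (1 - x) * dx.
by rewrite /dlV /dqf; ring. Qed.

Lemma lV_near X x dX : jet X (fun=> x) dX -> lc m < x < 1 ->
  [/\ jet (fun i => lV (m_ i) (X i)) (fun=> lV m x) (fun i => dlV m (t_ i) x (dX i)),
     F [set i | lc (m_ i) < X i < 1] & F [set i | 0 <= lV (m_ i) (X i) <= 1]].
move=> hX /andP[cx x1]; have [[hwf hm] _ _ hc _ _] := hl.
pose e := (x - lc m) / 3; have e0 : 0 < e by rewrite divr_gt0 // subr_gt0.
have ee : x - lc m = e + e + e by rewrite /e; field.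
pose r := (1 - x) / 2; have r0 : 0 < r by rewrite divr_gt0 // subr_gt0.
have er : 1 - x = r + r by rewrite /r; field.
have k1 : F [set i | lc (m_ i) + e <= X i <= 1 - r].
  apply: filterS3 (jet_close hj hs hX e0) (jet_close hj hs hX r0) (jet_close hj hs hc e0) => i.
  rewrite /= !ler_norml => /andP[a1 a2] /andP[b1 b2] /andP[c1 c2].
  by apply/andP; split; [lrj a1 c2 ee|lrj b2 er].
have k2 : F [set i | lc (m_ i) + e <= X i <= 1 /\ lc m + e <= x <= 1].
  apply: filterS k1 => i /andP[a1 a2]; split; apply/andP; split=> //; [lrj a2 r0|lrj ee e0|].
  exact: ltW.
split; first exact: (lV_jet hj hl e0 hX k2).
  by apply: filterS k1 => i /andP[a1 a2]; apply/andP; split; [lrj a1 e0|lrj a2 r0].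
apply: filterS2 k1 hwf => i /andP[a1 a2] hi.
have h : lc (m_ i) <= X i <= 1 by apply/andP; split; [lrj a1 e0|lrj a2 r0].
by have /andP[_ v1] := lV_in hi h; rewrite /= (lV_ge0 hi h) v1.
Qed.

Lemma lK_near n Y y dY : jet Y (fun=> y) dY -> F [set i | 0 <= Y i <= 1] -> litin m n y ->
  jet (fun i => lK (m_ i) n (Y i)) (fun=> lK m n y)
    (fun i => dlK m px qx (t_ i) n y (dY i)) /\ F [set i | litin (m_ i) n (Y i)].
move=> hY h01 hi; have [e e0 he] := chain_near hY h01 hi.
split; last by apply: filterS2 h01 he => i h h'; split=> // j /h'[h1 _]; apply: le_lt_trans h1 _; lrj e0.
apply: (lK_jet hj hl e0 hY) => //; case: hi => y01 _.
by apply: filterS h01.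
Qed.

Lemma lipV i n x y : wf d (m_ i) -> litin (m_ i) n (lV (m_ i) y) -> lc (m_ i) <= x ->
  y <= 1 -> exists L, forall z w, x <= z <= y -> x <= w <= y ->
   `|lK (m_ i) n (lV (m_ i) w) - w - (lK (m_ i) n (lV (m_ i) z) - z)| <= L * `|w - z|.
move=> hi hit cx y1; have c1 := wf_c1 hi; have c2 := wf_c1 (wf_flip hi).
pose L := (expR d * (al / lc (m_ i))) ^+ n * expR d; pose M := al / (1 - lc (m_ i)).
have al0' := ltW al0.
have L0 : 0 <= L.
  rewrite mulr_ge0 ?expR_ge0 // exprn_ge0 // mulr_ge0 ?expR_ge0 // divr_ge0 //.
  by case/andP: c1 => /ltW.
exists (L * M + 1) => z w; wlog zw : z w / z <= w.
  move=> H hz hw; have [h|/ltW h] := leP z w; first exact: H.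
  by rewrite distrC (distrC w); exact: H.
move=> /andP[z1 z2] /andP[w1 w2].
have V0 s : x <= s -> s <= y -> 0 <= lV (m_ i) s <= lV (m_ i) y.
  move=> s1 s2; rewrite (lV_ge0 hi) ?(le_trans s2 y1) ?(le_trans cx s1) //=.
  by apply: (lV_le hi) => //; exact: le_trans s1.
have k1 : `|lK (m_ i) n (lV (m_ i) w) - lK (m_ i) n (lV (m_ i) z)| <= L * `|lV (m_ i) w - lV (m_ i) z|.
  by apply: (KK_lip (wf_u hi) c1 (wf_p hi) (sl_flip (wf_q hi)) hit); apply: V0.
have cz := le_trans cx z1; have w1' := le_trans w2 y1.
have k2 := lV_lip hi cz zw w1'; rewrite -/M in k2.
have k3 := lV_le hi cz zw; rewrite (ger0_norm (x := lV _ w - _)) ?subr_ge0 // in k1.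
have -> : lK (m_ i) n (lV (m_ i) w) - w - (lK (m_ i) n (lV (m_ i) z) - z) =
  lK (m_ i) n (lV (m_ i) w) - lK (m_ i) n (lV (m_ i) z) - (w - z) by ring.
apply: le_trans (ler_normB _ _) _; rewrite mulrDl mul1r lerD2r.
apply: le_trans k1 _; rewrite -[X in _ <= X]mulrA ler_wpM2l // (ger0_norm (x := w - z)) ?subr_ge0 //.
Qed.

(** Derivative of the return branch at [x]; at the fixed point [q] it is the multiplier F'(q). *)
Definition lkap n x := lD n (lV m x) * qfd (lflip m) (1 - x).

(** The function return minus identity has slope [lkap n q - 1 > 0] at [q], so that [implicit]
    applies although [Lset] is not a neighbourhood. *)
Lemma q_exists n q : lc m < q < 1 -> litin m n (lV m q) -> lK m n (lV m q) = q ->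
  1 < lkap n q -> exists X,
  jet X (fun=> q) (fun i => - dlK m px qx (t_ i) n (lV m q)
     (dlV m (t_ i) q 0) / (lkap n q - 1)) /\
  F [set i | [/\ lc (m_ i) < X i < 1, litin (m_ i) n (lV (m_ i) (X i)) &
     lK (m_ i) n (lV (m_ i) (X i)) = X i]].
move=> hq hit eq hk; have [[hwf hm] _ _ hc _ _] := hl.
have main X dX : jet X (fun=> q) dX -> [/\ F [set i | lc (m_ i) < X i < 1],
    F [set i | litin (m_ i) n (lV (m_ i) (X i))] &
    jet (fun i => lK (m_ i) n (lV (m_ i) (X i)) - X i) (fun=> 0) (fun i =>
      dlK m px qx (t_ i) n (lV m q) (dlV m (t_ i) q 0) + (lkap n q - 1) * dX i)].
  move=> hX; have [v1 v2 v3] := lV_near hX hq; have [k1 k2] := lK_near v1 v3 hit.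
  split=> //; apply: (jet_ext hj) (jetB hj k1 hX); apply: filterE => i; split=> //.
    by rewrite eq subrr.
  rewrite dlK_split dlV_split [in RHS]dlK_split /lkap; ring.
have [|||X [jX fX]] := implicit hj hs (G := fun i x => lK (m_ i) n (lV (m_ i) x) - x) (x0 := q) (D := lkap n q - 1)
  (E := fun i => dlK m px qx (t_ i) n (lV m q) (dlV m (t_ i) q 0)).
- by rewrite subr_gt0.
- move=> K K0; have jp (s : R) : jet (fun i => q + s * (K * nu i)) (fun=> q) (fun i => s * (K * nu i)).
    apply: (jet_ext hj) (jet_lip hj (K := `|s| * K + `|q|) _ : jet (fun i => q + s * (K * nu i)) (fun=> q) _).
      by apply: filterE => i; split=> //; rewrite addrC addKr.
    have [_ nu01] := hj; apply: filterS nu01 => i /andP[n0 n1].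
    have Ks : 0 <= `|s| * K by rewrite mulr_ge0 // ltW.
    split; first by rewrite lerDr.
    rewrite addrC addKr !normrM (ger0_norm n0) (gtr0_norm K0) mulrA ler_wpM2r //.
    by rewrite lerDl.
  have [p1 p2 _] := main _ _ (jp 1); have [r1 _ _] := main _ _ (jp (-1)).
  apply: filterS2 hwf (filterI p1 (filterI p2 r1)) => i hi [/= h1 [h2 h3]].
  rewrite mul1r in h1 h2; rewrite mulN1r in h3.
  case/andP: h1 => _ h1; case/andP: h3 => h3 _.
  exact: lipV hi h2 (ltW h3) (ltW h1).
- by move=> X dX /main[].
exists X; split=> //; have [m1 m2 _] := main _ _ jX.
apply: filterS3 fX m1 m2 => i h1 h2 h3; split=> //.
by apply/eqP; rewrite -subr_eq0; apply/eqP.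
Qed.

Lemma V_exists n y P dP : 0 < y < 1 -> litin m n y -> 0 < lD n y ->
  jet P (fun=> lK m n y) dP -> exists Y,
  jet Y (fun=> y) (fun i => (dP i - dlK m px qx (t_ i) n y 0) / lD n y) /\
  F [set i | litin (m_ i) n (Y i) /\ lK (m_ i) n (Y i) = P i].
move=> hy hit hD hP; have [[hwf hm] _ _ hc _ _] := hl; case/andP: hy => y0 y1.
have main Y dY : jet Y (fun=> y) dY -> [/\ F [set i | 0 <= Y i <= 1],
    F [set i | litin (m_ i) n (Y i)] &
    jet (fun i => lK (m_ i) n (Y i) - P i) (fun=> 0) (fun i =>
      (dlK m px qx (t_ i) n y 0 - dP i) + lD n y * dY i)].
  move=> hY; have h01 : F [set i | 0 <= Y i <= 1].
    pose r := Num.min y (1 - y); have r0 : 0 < r by rewrite lt_min y0 subr_gt0.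
    apply: filterS (jet_close hj hs hY r0) => i; rewrite /= ler_norml => /andP[a1 a2].
    have r1 : r <= y by rewrite ge_min lexx.
    have r2 : r <= 1 - y by rewrite ge_min lexx orbT.
    by apply/andP; split; [lrj a1 r1|lrj a2 r2].
  have [k1 k2] := lK_near hY h01 hit; split=> //.
  apply: (jet_ext hj) (jetB hj k1 hP); apply: filterE => i; split=> //; first by rewrite subrr.
  by rewrite dlK_split; ring.
have [||X [jX fX]] := implicit hj hs (G := fun i x => lK (m_ i) n x - P i) (x0 := y) (D := lD n y)
  (E := fun i => dlK m px qx (t_ i) n y 0 - dP i) hD.
- move=> K K0; have jp (s : R) : jet (fun i => y + s * (K * nu i)) (fun=> y) (fun i => s * (K * nu i)).
    apply: (jet_ext hj) (jet_lip hj (K := `|s| * K + `|y|) _ : jet (fun i => y + s * (K * nu i)) (fun=> y) _).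
      by apply: filterE => i; split=> //; rewrite addrC addKr.
    have [_ nu01] := hj; apply: filterS nu01 => i /andP[n0 n1].
    have Ks : 0 <= `|s| * K by rewrite mulr_ge0 // ltW.
    split; first by rewrite lerDr.
    rewrite addrC addKr !normrM (ger0_norm n0) (gtr0_norm K0) mulrA ler_wpM2r //.
    by rewrite lerDl.
  have [p1 p2 _] := main _ _ (jp 1); have [r1 _ _] := main _ _ (jp (-1)).
  apply: filterS2 hwf (filterI p1 (filterI p2 r1)) => i hi [/= h1 [h2 h3]].
  rewrite mul1r in h1 h2; rewrite mulN1r in h3; case/andP: h3 => h3 _.
  exists ((expR d * (al / lc (m_ i))) ^+ n * expR d) => z w /andP[z1 z2] /andP[w1 w2].
  have -> : lK (m_ i) n w - P i - (lK (m_ i) n z - P i) = lK (m_ i) n w - lK (m_ i) n z by ring.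
  apply: (KK_lip (wf_u hi) (wf_c1 hi) (wf_p hi) (sl_flip (wf_q hi)) h2).
    by rewrite z2 (le_trans h3).
  by rewrite w2 (le_trans h3).
- by move=> X dX /main[].
exists X; split.
  by apply: (jet_eq hj jX) => // i; rewrite opprB.
have [m1 m2 _] := main _ _ jX; apply: filterS2 fX m2 => i h1 h2; split=> //.
by apply/eqP; rewrite -subr_eq0; apply/eqP.
Qed.
End Near.

(** * Extension of maps with quadratic Taylor bounds to C^1 diffeomorphisms *)

Section C1.
Implicit Types (h dh g : R -> R) (x y K D : R).

Lemma quad_is_derive g x D K : (forall y, `|g y - g x - D * (y - x)| <= K * (y - x) ^+ 2) ->
  is_derive x 1 g D.
move=> hq.
have lm : h^-1 *: ((g \o shift x) (h *: (1 : R)) - g x) @[h --> 0^'] --> D.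
  apply/cvgrPdist_le => e e0; pose K' := `|K| + 1; have K0 : 0 < K' by rewrite ltr_wpDl.
  have eK : 0 < e / K' by rewrite divr_gt0.
  near=> h; have hn : h != 0 by near: h; exact: nbhs_dnbhs_neq.
  have hs : `|h| <= e / K'.
    near: h; apply: nbhs_dnbhs; apply: filterS (nbhsx_ballx (0 : R) _ eK) => z.
    by rewrite /ball /= sub0r normrN => /ltW.
  have := hq (x + h); have -> : x + h - x = h by rewrite addrC addKr.
  move=> q; have -> : D - h^-1 *: ((g \o shift x) (h *: (1 : R)) - g x) =
      - (h^-1 * (g (x + h) - g x - D * h)).
    by rewrite /= /GRing.scale /= mulr1 (addrC h x); field.
  rewrite normrN normrM normfV ler_pdivrMl ?normr_gt0 //; apply: le_trans q _.
  rewrite -real_normK ?num_real // expr2 mulrA mulrC ler_wpM2l //.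
  apply: le_trans (ler_wpM2r (normr_ge0 h) (_ : K <= K')) _.
    by apply: le_trans (ler_norm K) _; rewrite lerDl.
  by rewrite mulrC -ler_pdivlMr.
apply: DeriveDef; first by apply/cvg_ex; exists D.
exact: (cvg_lim (@Rhausdorff R) lm).
Unshelve. all: by end_near. Qed.

(** [diffeo01] asks for a C^1 function on the line, so [h] is continued linearly with the slopes
    [dh 0] and [dh 1]. *)
Lemma quad_diffeo01 h dh K : (forall x y, 0 <= x <= 1 -> 0 <= y <= 1 ->
  `|h y - h x - dh x * (y - x)| <= K * (y - x) ^+ 2) ->
  (forall x, 0 <= x <= 1 -> 0 < dh x) -> h 0 = 0 -> h 1 = 1 -> diffeo01 h.
move=> hq hd h0 h1; split=> //; pose cl x := Num.max 0 (Num.min x 1).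
have cl01 x : 0 <= cl x <= 1.
  by rewrite /cl le_max lexx /= ge_max ler01 ge_min lexx orbT.
have clE x : 0 <= x <= 1 -> cl x = x.
  by move=> /andP[x0 x1]; rewrite /cl (min_idPl x1) (max_idPr x0).
have clP x : [\/ cl x = 0 /\ x <= 0, cl x = x /\ 0 <= x <= 1 | cl x = 1 /\ 1 <= x].
  have [x1|x1] := leP 1 x; first by constructor 3; rewrite /cl (min_idPr x1) (max_idPr ler01).
  have [x0|x0] := leP x 0; last by constructor 2; rewrite clE ?(ltW x0) ?(ltW x1).
  by constructor 1; rewrite /cl (min_idPl (ltW x1)) (max_idPl x0).
have cllip x y : `|cl y - cl x| <= `|y - x|.
  wlog xy : x y / x <= y.
    move=> H; have [l|/ltW l] := leP x y; first exact: H.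
    by rewrite distrC (distrC y); exact: H.
  rewrite (ger0_norm (x := y - x)) ?subr_ge0 // ler_norml.
  by case: (clP x) => -[-> a1]; case: (clP y) => -[-> a2]; clear - xy a1 a2; andlra.
have K0 : 0 <= K.
  have := hq 0 1; rewrite !lexx ler01 subr0 expr1n !mulr1 => /(_ isT isT); exact: (le_trans (normr_ge0 _)).
(* Adding the Taylor bounds based at [x] and at [y] leaves the difference of the derivatives; hence
   [dh] is Lipschitz. *)
have dlip x y : 0 <= x <= 1 -> 0 <= y <= 1 -> `|dh y - dh x| <= 2 * K * `|y - x|.
  move=> hx hy; have [->|n] := eqVneq x y; first by rewrite !subrr normr0 mulr0.
  have n0 : 0 < `|y - x| by rewrite normr_gt0 subr_eq0 eq_sym.
  rewrite -(ler_pM2r n0) -normrM.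
  have -> : (dh y - dh x) * (y - x) = (h y - h x - dh x * (y - x)) + (h x - h y - dh y * (x - y)) by ring.
  apply: le_trans (normD_le (hq x y hx hy) (hq y x hy hx)) _.
  have e : `|y - x| * `|y - x| = (y - x) ^+ 2 by rewrite -expr2 real_normK ?num_real.
  by rewrite -[X in _ <= X]mulrA e -[(x - y) ^+ 2]sqrrN opprB; clear; lra.
pose g x := h (cl x) + dh (cl x) * (x - cl x).
have gq x y : `|g y - g x - dh (cl x) * (y - x)| <= 3 * K * (y - x) ^+ 2.
  have -> : g y - g x - dh (cl x) * (y - x) = (h (cl y) - h (cl x) - dh (cl x) * (cl y - cl x)) +
    (dh (cl y) - dh (cl x)) * (y - cl y) by rewrite /g; ring.
  have s1 : (cl y - cl x) ^+ 2 <= (y - x) ^+ 2.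
    by rewrite -real_normK ?num_real // -[X in _ <= X]real_normK ?num_real // lerXn2r ?nnegrE.
  have a1 := le_trans (hq _ _ (cl01 x) (cl01 y)) (ler_wpM2l K0 s1).
  have a2 : `|(dh (cl y) - dh (cl x)) * (y - cl y)| <= 2 * K * (y - x) ^+ 2.
    have [e|n] := eqVneq (cl y) (cl x).
      by rewrite e subrr mul0r normr0 mulr_ge0 ?sqr_ge0 // mulr_ge0.
    have k : `|y - cl y| <= `|y - x|.
      have w1 := ler_norm (y - x); have w2 := ler_norm (- (y - x)); rewrite normrN in w2.
      by move: n; case: (clP x) => -[-> b1]; case: (clP y) => -[-> b2];
        rewrite ?eqxx // => _; rewrite ler_norml; clear - b1 b2 w1 w2; andlra.
    rewrite normrM -real_normK ?num_real // expr2 mulrA ler_pM //.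
    apply: le_trans (dlip _ _ (cl01 x) (cl01 y)) _; rewrite ler_wpM2l // mulr_ge0 //.
  by apply: le_trans (normD_le a1 a2) _; lra.
have gd x : is_derive x 1 g (dh (cl x)) by apply: quad_is_derive (gq x).
have gE : (g^`())%classic = dh \o cl.
  apply/funext => x; rewrite derive1E /=; have hx := gd x; exact: derive_val.
exists g; split.
- by move=> x; exact: ex_derive.
- rewrite gE => x; apply/cvgrPdist_le => e e0; pose M := 2 * K + 1.
  have M0 : 0 < M by rewrite /M; lra.
  have eM : 0 < e / M by rewrite divr_gt0.
  apply: filterS (nbhsx_ballx x _ eM) => y; rewrite /ball /= => hy.
  apply: le_trans (dlip _ _ (cl01 y) (cl01 x)) _.
  have k : 2 * K * `|cl x - cl y| <= M * `|x - y|.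
    apply: ler_pM => //; first by rewrite mulr_ge0.
    by rewrite /M; lra.
  apply: le_trans k _; rewrite mulrC -ler_pdivlMr //; exact: ltW.
- by move=> x; rewrite in_itv /= => hx; rewrite /g clE // subrr mulr0 addr0.
- by move=> x; rewrite in_itv /= => hx; rewrite gE /= clE //; exact: hd.
Qed.

Lemma diffeo01_flip h : diffeo01 h -> diffeo01 (flip h).
case=> h0 h1 [g [dg cg eg g0]]; split; rewrite /flip ?subr0 ?subrr ?h0 ?h1 ?subr0 ?subrr //.
have gd (x : R) : is_derive x 1 (fun z => 1 - g (1 - z)) ((g^`())%classic (1 - x)).
  have k1 : is_derive x 1 (fun z : R => 1 + -1 * z) (-1 : R) by apply: dv_aff.
  have k2 : is_derive (1 + -1 * x) 1 g ((g^`())%classic (1 - x)).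
    by rewrite mulN1r derive1E; exact: derivableP.
  have k3 := @is_derive1_comp _ g (fun z : R => 1 + -1 * z) x _ _ k2 k1.
  have k4 : is_derive x 1 (fun z : R => 1 - (g \o (fun z => 1 + -1 * z)) z) ((g^`())%classic (1 - x)).
    by apply: dv_sub (dv_cst x 1 erefl) k3 _; rewrite mulrN1 sub0r opprK.
  by move: k4; congr is_derive; apply/funext => z /=; rewrite mulN1r.
have gE : ((fun z => 1 - g (1 - z))^`())%classic = (fun x => (g^`())%classic (1 - x)).
  apply/funext => x; rewrite derive1E; have hx := gd x; exact: derive_val.
exists (fun z => 1 - g (1 - z)); split.
- by move=> x; exact: ex_derive.
- rewrite gE => x; apply: (continuous_comp (f := fun x => 1 - x)); last exact: cg.
  apply: cvgB; [exact: cvg_cst | exact: cvg_id].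
- move=> x; rewrite in_itv /= => /andP[x0 x1]; rewrite eg // in_itv /=.
  by andlra.
- move=> x; rewrite in_itv /= => /andP[x0 x1]; rewrite gE g0 // in_itv /=.
  by andlra.
Qed.
End C1.

(** * The renormalized branches as standard branches followed by diffeomorphisms *)

Section Zoom.
Implicit Types (m : lmap) (x y p q d : R) (px qx : R -> R) (n : nat).
Notation lD m px qx := (lD m px qx).

(** [px] and [qx] are the derivatives of [lp m] and [lq m]. The expansions are required along every
    filter, since they serve both near one map and globally on an interval. *)
Definition reg d m px qx := [/\ forall x, 0 <= x <= 1 -> expR (- d) <= px x <= expR d,
  forall x, 0 <= x <= 1 -> expR (- d) <= qx x <= expR d &
  forall (I : Type) (F : set_system I) nu, jctx F nu ->
    mjet F nu (fun=> lp m) (lp m) (fun _ _ => 0) px /\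
    mjet F nu (fun=> lq m) (lq m) (fun _ _ => 0) qx].

Lemma reg_flip d m px qx : reg d m px qx -> reg d (lflip m) qx px.
by case=> h1 h2 h3; split=> // I F nu /h3[]. Qed.

Lemma lD_gt0 d m px qx n y : wf d m -> reg d m px qx -> litin m n y -> 0 < lD m px qx n y.
move=> hw [h1 h2 _] hi.
have h3 x : 0 <= x <= 1 -> expR (- d) <= qx (1 - x) <= expR d.
  by move=> /andP[x0 x1]; apply: h2; andlra.
exact: (Dn_gt0 (wf_u hw) (wf_c1 hw) (wf_p hw) (sl_flip (wf_q hw)) h1 h3 hi).
Qed.

Lemma lK_gap d m n y2 : wf d m -> litin m n y2 -> exists2 e, 0 < e &
  forall j y, (j < n)%N -> 0 <= y <= y2 -> lK m j y <= lc m - e.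
move=> hw; elim: n => [|n IH] hi; first by exists 1.
have [e e0 he] := IH (itinS (leqnSn n) hi).
have g0 : 0 < lc m - lK m n y2 by rewrite subr_gt0; case: hi => _; apply.
exists (Num.min e (lc m - lK m n y2)); first by rewrite lt_min e0 g0.
move=> j y; rewrite ltnS leq_eqVlt => /predU1P[->|jn] hy.
  have m1 : Num.min e (lc m - lK m n y2) <= lc m - lK m n y2 by rewrite ge_min lexx orbT.
  case/andP: hy => y0 yy; have [_ [h _]] := lK_mono hw y0 yy (itinS (leqnSn n) hi).
  lra.
have m1 : Num.min e (lc m - lK m n y2) <= e by rewrite ge_min lexx.
have := he j y jn hy; lra.
Qed.

(** The jet calculus over all pairs of points of the interval, with the distance of the pair as
    scale and a zero tangent vector in the parameters. *)
Lemma lK_quad d m px qx n y2 : wf d m -> reg d m px qx -> litin m n y2 ->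
  exists K, forall x y, 0 <= x <= y2 -> 0 <= y <= y2 ->
    `|lK m n y - lK m n x - lD m px qx n x * (y - x)| <= K * (y - x) ^+ 2.
move=> hw hr hi; have [e e0 he] := lK_gap hw hi; have [/andP[y20 y21] _] := hi.
pose A : set (R * R) := [set i | 0 <= i.1 <= y2 /\ 0 <= i.2 <= y2].
pose nu (i : R * R) := `|i.2 - i.1|.
have sub (z : R) : 0 <= z <= y2 -> 0 <= z <= 1 by case/andP=> -> z1; exact: le_trans z1 y21.
have hj : jctx (globally A) nu.
  split; first exact: globally_filter.
  move=> [x y] [/= /sub/andP[x0 x1] /sub/andP[z0 z1]]; rewrite /nu /= normr_ge0 /= ler_norml.
  by andlra.
pose t0 : lmap := LM (fun=> 0) (fun=> 0) 0 0 0.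
have hl : lj (globally A) nu d (fun=> m) m (fun=> t0) px qx.
  have [_ _ /(_ _ _ _ hj)[mp mq]] := hr.
  by split; rewrite //=; try exact: jet_const.
have jY : jet (globally A) nu (fun i => i.2) (fun i => i.1) (fun i => i.2 - i.1).
  apply: (jet_lip hj (K := 1)) => i [/sub/andP[x0 x1] _] /=; rewrite mul1r; split=> //.
  by rewrite ger0_norm.
have [||K _ hK] := jetE hj (lK_jet hj hl (n := n) e0 jY _ _).
- by move=> i [/sub h1 /sub h2].
- by move=> i [h1 h2] j jn; split; exact: he.
exists K => x y hx hy; have [_ _ _] := hK (x, y) (conj hx hy).
rewrite /nu /= real_normK ?num_real // dlK_split.
have z k w : dlK m px qx t0 k w 0 = 0.
  by elim: k => [|k IH] /=; rewrite ?IH /dqf /=; ring.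
by rewrite z add0r.
Qed.

Lemma zoom_diffeo d m px qx n y1 y2 : wf d m -> reg d m px qx -> litin m n y2 ->
  0 <= y1 -> y1 < y2 ->
  diffeo01 (fun t => (lK m n (y1 + t * (y2 - y1)) - lK m n y1) / (lK m n y2 - lK m n y1)).
move=> hw hr hi y10 y12; have [K hK] := lK_quad hw hr hi.
have l0 : 0 < y2 - y1 by rewrite subr_gt0.
have [_ [_ /(_ y12) hk]] := lK_mono hw y10 (ltW y12) hi.
have k0 : 0 < lK m n y2 - lK m n y1 by rewrite subr_gt0.
have iny t : 0 <= t <= 1 -> 0 <= y1 + t * (y2 - y1) <= y2.
  move=> /andP[t0 t1]; have h1 := mulr_ge0 t0 (ltW l0).
  have h2 : t * (y2 - y1) <= y2 - y1 by rewrite ler_piMl // ltW.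
  by andlra.
apply: (@quad_diffeo01 _ (fun t => lD m px qx n (y1 + t * (y2 - y1)) * (y2 - y1) / (lK m n y2 - lK m n y1))
  (K * (y2 - y1) ^+ 2 / (lK m n y2 - lK m n y1))).
- move=> s t hs ht; have := hK _ _ (iny s hs) (iny t ht).
  set a := lK m n (y1 + t * _); set b := lK m n (y1 + s * _); set D := lD _ _ _ _ _.
  set k := lK m n y1 in k0 *; set k' := lK m n y2 in k0 *.
  have -> : y1 + t * (y2 - y1) - (y1 + s * (y2 - y1)) = (y2 - y1) * (t - s) by ring.
  have -> : (a - k) / (k' - k) - (b - k) / (k' - k) - D * (y2 - y1) / (k' - k) * (t - s) =
    (a - b - D * ((y2 - y1) * (t - s))) / (k' - k) by field; rewrite gt_eqF.
  rewrite normrM normfV (gtr0_norm k0) ler_pdivrMr // => h; apply: le_trans h _.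
  rewrite exprMn le_eqVlt; apply/orP; left; apply/eqP; field; rewrite gt_eqF //.
- move=> t /iny ht; have hD : 0 < lD m px qx n (y1 + t * (y2 - y1)).
    apply: (lD_gt0 hw hr); case/andP: ht => t0 t1.
    by have [] := lK_mono hw t0 t1 hi.
  by rewrite divr_gt0 // mulr_gt0.
- by rewrite mul0r addr0 subrr mul0r.
- have -> : y1 + 1 * (y2 - y1) = y2 by ring.
  by rewrite divff // gt_eqF.
Qed.

(* The right half of the renormalization, written in the coordinates of [p, q]. *)
Lemma half_lorenz d m px qx n p q : wf d m -> reg d m px qx -> half m n p q ->
  0 <= p < lc m -> exists v' ps, [/\ 0 <= v' <= 1, diffeo01 ps &
   forall x, (lc m - p) / (q - p) <= x -> x <= 1 ->
     (lK m n (lV m (p + (q - p) * x)) - p) / (q - p) =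
     ps (1 - qf v' ((q - lc m) / (q - p)) (1 - x))].
move=> hw hr [/andP[cq q1] gap eq hp hc] /andP[p0 pc].
have l0 : 0 < q - p by lra.
have c1 := wf_c1 (wf_flip hw); have v1 := wf_v hw.
have hV2 : litin m n (lV m q).
  have hq : lc m <= q <= 1 by rewrite q1 ltW.
  split; first by have /andP[_ ->] := lV_in hw hq; rewrite (lV_ge0 hw hq).
  by move=> j jn; apply: lt_trans (gap j jn) pc.
have Vcq := lV_lt hw (lexx (lc m)) cq; rewrite (lV_c) in Vcq.
have v0 : 0 <= 1 - lv m by case/andP: v1 => _ h; rewrite subr_ge0.
have hV1 : litin m n (1 - lv m) by have [] := lK_mono hw v0 (ltW Vcq) hV2.
have [|y1 /andP[y10 y1v] ey1] := KK_surj (wf_u hw) (wf_c1 hw) (wf_p hw) (sl_flip (wf_q hw)) hV1 (v := p).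
  by rewrite p0.
have yV : y1 < lV m q by exact: le_lt_trans Vcq.
set V2 := lV m q in hV2 Vcq yV *.
have L0 : 0 < V2 - y1 by rewrite subr_gt0.
(* The witnesses are |Q(R)| / |V| and the zoom to V of what follows the first Q; [y1] is the left
   end of V, the preimage of [p]. *)
exists ((V2 - (1 - lv m)) / (V2 - y1)), (fun t => (lK m n (y1 + t * (V2 - y1)) - p) / (q - p)).
split.
- rewrite divr_ge0 ?subr_ge0 ?(ltW Vcq) ?(ltW yV) //= ler_pdivrMr // mul1r; lra.
- by have := zoom_diffeo hw hr hV2 y10 yV; rewrite eq -[lK m n y1]/(KK _ _ _ _ _ _) ey1.
move=> x hx x1; congr ((lK m n _ - p) / _).
have qc0 : 0 < q - lc m by rewrite subr_gt0.
have r0 : 0 < 1 - lc m by case/andP: c1.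
have c1' : lc m <= 1 by rewrite -subr_ge0 ltW.
rewrite /V2 /lV /qf /rr; set y := p + (q - p) * x.
have cy : lc m <= y by move: hx; rewrite ler_pdivrMr // /y => hx; lra.
have e1 : ((q - lc m) / (q - p) - (1 - x)) / ((q - lc m) / (q - p)) = (y - lc m) / (q - lc m).
  by rewrite /y; field; rewrite !gt_eqF.
have e2 : (1 - lc m - (1 - y)) / (1 - lc m) = (y - lc m) / (q - lc m) * ((q - lc m) / (1 - lc m)).
  by field; rewrite !gt_eqF.
have e3 : 1 - lc m - (1 - q) = q - lc m by ring.
rewrite e1 e2 e3 powRM ?divr_ge0 ?subr_ge0 ?(ltW qc0) ?(ltW cq) ?(ltW r0) //.
set A := (_ / (q - lc m)) `^ al; set B := (_ / (1 - lc m)) `^ al.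
have eV : V2 = 1 - lv m * (1 - B) by rewrite /V2 /lV /qf /rr e3.
rewrite -[1 - lv m * (1 - B)]eV; have -> : B = (V2 - (1 - lv m)) / lv m.
  by rewrite eV; field; case/andP: v1 => v1 _; rewrite gt_eqF.
by rewrite eV; field; rewrite -eV subr_eq0 gt_eqF //=; case/andP: v1 => v1 _; rewrite gt_eqF.
Qed.
End Zoom.

(** * From the two half structures back to renormalizability *)

Section Renormalizable.
Implicit Types (m : lmap) (x y p q d eta : R) (px qx : R -> R) (n a b : nat).

Lemma half_orbit d m n p q : wf d m -> half m n p q -> 0 <= p < lc m ->
  forall x, lc m < x <= q -> [/\ first_return (lF m) (p, q) x n.+1,
    iter n.+1 (lF m) x = lK m n (lV m x), p <= lK m n (lV m x) <= q &
    forall j, (1 <= j <= n)%N -> 0 < iter j (lF m) x < lc m].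
move=> hw [/andP[cq q1] gap eq hp hc] /andP[p0 pc] x /andP[cx xq].
have hV2 : litin m n (lV m q).
  have hq : lc m <= q <= 1 by rewrite q1 ltW.
  split; first by have /andP[_ ->] := lV_in hw hq; rewrite (lV_ge0 hw hq).
  by move=> j jn; apply: lt_trans (gap j jn) pc.
have lt_p j : (j < n)%N -> lK m j (lV m x) < p.
  move=> jn; have [_ [h _]] := lKV_mono hw (ltW cx) xq q1 (itinS (ltnW jn) hV2).
  by apply: le_lt_trans h _; exact: gap.
have it j : (j <= n)%N -> iter j.+1 (lF m) x = lK m j (lV m x).
  move=> jn; apply: iter_right (ltW cx) _ => i ij.
  by apply: lt_trans (lt_p i (leq_trans ij jn)) pc.
have [hx [hxq _]] := lKV_mono hw (ltW cx) xq q1 hV2.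
have v0 : 0 <= 1 - lv m by case/andP: (wf_v hw) => _ h; rewrite subr_ge0.
have Vcx := lV_lt hw (lexx (lc m)) cx; rewrite (lV_c) in Vcx.
have [_ [hcx _]] := lK_mono hw v0 (ltW Vcx) hx.
have inp : p <= lK m n (lV m x) <= q by rewrite (le_trans hp hcx) -[X in _ <= X]eq.
split=> //; last 2 first.
- exact: it.
- case=> // j /andP[_ jn]; rewrite it ?(ltnW jn) // (lt_trans (lt_p j jn) pc) andbT.
  have V0 : 0 < lV m x by exact: le_lt_trans Vcx.
  have [_ [_ /(_ V0) h]] := lK_mono hw (lexx 0) (ltW V0) (itinS (ltnW jn) hx).
  apply: le_lt_trans h; have h0 : litin m j 0.
    by have [] := lK_mono hw (lexx 0) (ltW V0) (itinS (ltnW jn) hx).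
  by have /andP[] := lK_in hw h0.
- split=> //; first by rewrite it // in_itv.
  case=> // j /andP[_]; rewrite ltnS => jn; rewrite it ?(ltnW jn) // in_itv /= negb_and -!ltNge.
  by rewrite (lt_p j jn).
Qed.

(** The point 1 is fixed by the right branch, so the orbit of [q = 1] would not reach the left of
    [p]. *)
Lemma half_lt1 d m n p q : wf d m -> half m n p q -> p < lc m -> (0 < n)%N -> q < 1.
move=> hw [/andP[cq q1] gap _ _ _] pc n0; rewrite lt_neqAle q1 andbT; apply/eqP => e1.
have := gap 0%N n0; rewrite e1 /lK /KK /= /flip.
have c1 := wf_c1 (wf_flip hw); rewrite /lV subrr qf0 // subr0 subrr.
have [-> _ _] := wf_q hw; rewrite subr0; case/andP: (wf_c1 hw) => _ h.
by rewrite ltNge (le_trans (ltW pc) h).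
Qed.

Lemma half_below d m n p q : wf d m -> half m n p q -> 0 <= p < lc m ->
  exists2 x, lc m < x <= q & lK m n (lV m x) < lc m.
move=> hw [/andP[cq q1] gap eq hp hc] /andP[p0 pc].
have hq : lc m <= q <= 1 by rewrite q1 ltW.
have hV2 : litin m n (lV m q).
  split; first by have /andP[_ ->] := lV_in hw hq; rewrite (lV_ge0 hw hq).
  by move=> j jn; apply: lt_trans (gap j jn) pc.
have Vc := lV_le hw (lexx (lc m)) (ltW cq).
have e : lK m n (lV m (lc m)) = lK m n (1 - lv m) by rewrite (lV_c).
pose w := (lK m n (1 - lv m) + lc m) / 2.
have [h1 h2] : lK m n (1 - lv m) < w /\ w < lc m by rewrite /w; lra.
have wq : w <= lK m n (lV m q) by rewrite eq; lra.
have w1 : lK m n (lV m (lc m)) <= w by rewrite e ltW.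
have [z /andP[z1 z2] ez] := lKV_surj hw (lexx _) (ltW cq) q1 hV2 (introT andP (conj w1 wq)).
exists z; last by rewrite ez.
rewrite z2 andbT lt_neqAle z1 andbT; apply/eqP => ec.
by move: h1; rewrite -ez -ec e ltxx.
Qed.

(** Each half yields one branch by [half_lorenz]; nontriviality comes from [half_below] on both
    sides, and [b > 0] gives [q < 1], so that C is a proper interval. *)
Lemma ren_return_interval d m px qx a b p q : wf d m -> reg d m px qx ->
  ren m a b p q -> (0 < b)%N -> return_interval al (lF m) (lc m) (p, q).
move=> hw hr hren b0; have [p0 pc cq q1] := ren_bd hren.
have hwf := wf_flip hw; have hrf := reg_flip hr.
have [hR hL] := hren.
have pp : 0 <= p < lc m by rewrite p0.
have qq : 0 <= 1 - q < lc (lflip m) by rewrite /= subr_ge0 q1 ltrD2l ltrN2.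
have oR := half_orbit hw hR pp; have oL := half_orbit hwf hL qq.
have [v' [ps [hv hps ev]]] := half_lorenz hw hr hR pp.
have [u' [ph [hu hph eu]]] := half_lorenz hwf hrf hL qq.
have [xr hxr rlow] := half_below hw hR pp; have [xl hxl llow] := half_below hwf hL qq.
have l0 : 0 < q - p by lra.
have ln0 : q - p != 0 by rewrite gt_eqF.
have ll : 1 - p - (1 - q) = q - p by ring.
pose g x := if x < lc m then 1 - lK (lflip m) a (lV (lflip m) (1 - x)) else lK m b (lV m x).
pose c' := (lc m - p) / (q - p).
have c'1 : 1 - c' = (q - lc m) / (q - p) by rewrite /c'; field.
have c01 : 0 < c' < 1.
  by apply/andP; rewrite /c'; split; [rewrite divr_gt0 // subr_gt0|rewrite ltr_pdivrMr // mul1r; lra].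
pose G := zeta_inv (p, q) \o g \o zeta (p, q).
have Gl x : 0 <= x -> x < c' -> G x = flip ph (qf u' c' x).
  move=> x0 xc; have yc : p + (q - p) * x < lc m by move: xc; rewrite /c' ltr_pdivlMr //; lrc.
  rewrite /G /= /zeta_inv /zeta /ilen /g /= yc.
  have := eu (1 - x); rewrite /= ll.
  have -> : (1 - lc m - (1 - q)) / (q - p) = 1 - c' by rewrite c'1; congr (_ / _); ring.
  have -> : (1 - p - (1 - lc m)) / (q - p) = c' by rewrite /c'; congr (_ / _); ring.
  rewrite subKr lerD2l lerN2 lerBlDr lerDl => /(_ (ltW xc) x0).
  have -> : 1 - q + (q - p) * (1 - x) = 1 - (p + (q - p) * x) by ring.
  rewrite /flip => <-; by field.
have Gr x : c' <= x -> x <= 1 -> G x = ps (1 - qf v' (1 - c') (1 - x)).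
  move=> xc x1; have yc : lc m <= p + (q - p) * x by move: xc; rewrite /c' ler_pdivrMr //; lrc.
  rewrite /G /= /zeta_inv /zeta /ilen /g /= ltNge yc /=.
  by rewrite ev // c'1.
have hphf := diffeo01_flip hph.
have hlor : is_lorenz al G c'.
  split=> //; exists u', v', (flip ph), ps; split=> // x; rewrite in_itv /= => /andP[x0 x1] xc.
  rewrite /lorenz; case: ltP => h; first by rewrite stdQ_left // Gl.
  by rewrite stdQ_right // Gr.
have incv (w : R) : 0 <= w -> w <= 1 -> 0 <= w `^ al <= 1.
  move=> w0 w1; have /andP[h1 h2] := powR_in01 (introT andP (conj w0 w1)).
  by rewrite h1 (le_trans h2 w1).
have qfin (w k x : R) : 0 < k -> 0 <= x <= k -> 0 <= w <= 1 -> 0 <= qf w k x <= 1.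
  move=> k0 /andP[x0 xk] /andP[w0 w1]; rewrite /qf /rr.
  have /andP[h1 h2] : 0 <= ((k - x) / k) `^ al <= 1.
    by apply: incv; [rewrite divr_ge0 ?subr_ge0 ?(ltW k0)|rewrite ler_pdivrMr // mul1r; lrc x0].
  have h3 : 0 <= 1 - ((k - x) / k) `^ al by lrc h2.
  rewrite mulr_ge0 //=; apply: le_trans (_ : 1 * 1 <= 1); last by rewrite mulr1.
  by apply: ler_pM => //; lra.
have qfmono (w k x y : R) : 0 < k -> 0 <= w -> x <= y -> y <= k -> qf w k x <= qf w k y.
  move=> k0 w0 xy yk; rewrite /qf ler_wpM2l // lerD2l lerN2 /rr.
  apply: ge0_ler_powR; rewrite ?nnegrE.
  - by have := al1; lra.
  - by rewrite divr_ge0 ?subr_ge0 ?(ltW k0) //; lra.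
  - by rewrite divr_ge0 ?subr_ge0 ?(ltW k0) //; lra.
  - by rewrite ler_pM2r ?invr_gt0 //; lra.
have [c'0 c'1'] : 0 < c' /\ 0 < 1 - c' by case/andP: c01 => h1 h2; lra.
have u0 : 0 <= u' by case/andP: hu. have v0 : 0 <= v' by case/andP: hv.
have monl x y : 0 <= x -> x <= y -> y < c' -> G x <= G y.
  move=> x0 xy yc; rewrite !Gl ?(le_lt_trans xy) ?(le_trans x0) //.
  have h1 : 0 <= qf u' c' x <= 1 by apply: qfin => //; rewrite x0; lra.
  have h2 : 0 <= qf u' c' y <= 1 by apply: qfin => //; lra.
  case/andP: h1 => h1 _; case/andP: h2 => _ h2.
  by apply: (diffeo01_le hphf) => //; apply: qfmono => //; exact: ltW.
have monr x y : c' <= x -> x <= y -> y <= 1 -> G x <= G y.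
  move=> cx xy y1; have x1 := le_trans xy y1; have cy := le_trans cx xy.
  have h1 : 0 <= qf v' (1 - c') (1 - x) <= 1.
    by apply: qfin => //; rewrite subr_ge0 x1 lerD2l lerN2.
  have h2 : 0 <= qf v' (1 - c') (1 - y) <= 1.
    by apply: qfin => //; rewrite subr_ge0 y1 lerD2l lerN2.
  case/andP: h1 => _ h1; case/andP: h2 => h2 _; rewrite (Gr x cx x1) (Gr y cy y1).
  apply: (diffeo01_le hps); [by rewrite subr_ge0| |by rewrite lerBlDr lerDl].
  by rewrite lerD2l lerN2; apply: qfmono => //; rewrite lerD2l lerN2.
have nt : nontrivial G c'.
  have zz y : G ((y - p) / (q - p)) = (g y - p) / (q - p).
    rewrite /G /= /zeta_inv /zeta /ilen /=.
    by have -> : p + (q - p) * ((y - p) / (q - p)) = y by field.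
  split.
    (* If the limit does not exist, its default value 0 is below [c'], so this case is harmless. *)
    have [h|h] := pselect (cvg (G x @[x --> c'^'+])); last by rewrite /crit_right dvgP.
    case/andP: hxr => cx xq.
    have cx' : c' < (xr - p) / (q - p) by rewrite /c' ltr_pM2r ?invr_gt0 // ltrD2r.
    have x1' : (xr - p) / (q - p) <= 1 by rewrite ler_pdivrMr // mul1r; lra.
    apply: (@le_lt_trans _ _ (G ((xr - p) / (q - p)))).
      apply: limr_le => //; have n1 := nbhs_right_lt cx'; have n2 := nbhs_right_gt c'.
      by apply: filterS2 n1 n2 => z z1 z2; apply: monr => //; exact: ltW.
    rewrite zz /g [xr < _]ltNge (ltW cx) /= /c' ltr_pM2r ?invr_gt0 // ltrD2r //.
  have hb : cvg (G x @[x --> c'^'-]).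
    apply: nondecreasing_at_left_is_cvgr.
      have := nbhs_left_gt c'0; apply: filterS => z z1 x y; rewrite !in_itv /=.
      by move=> /andP[cx xz] /andP[cy yz] xy; apply: monl => //; lra.
    have := nbhs_left_gt c'0; apply: filterS => z z1; exists 1 => _ [x /= + <-].
    rewrite in_itv /= => /andP[zx xc]; rewrite Gl //; last by lra.
    have /andP[h1 h2] : 0 <= qf u' c' x <= 1.
      by apply: qfin => //; andlra.
    have := diffeo01_le hphf h1 h2 (lexx _); by have [_ -> _] := hphf.
  case/andP: hxl => cx xq; rewrite /= in cx xq.
  have cx' : (1 - xl - p) / (q - p) < c' by rewrite /c' ltr_pM2r ?invr_gt0 // ltrD2r; lra.
  have x1' : 0 <= (1 - xl - p) / (q - p) by rewrite divr_ge0 ?(ltW l0) //; lra.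
  apply: (@lt_le_trans _ _ (G ((1 - xl - p) / (q - p)))); last first.
    apply: limr_ge => //; have n1 := nbhs_left_gt cx'; have n2 := nbhs_left_lt c'.
    by apply: filterS2 n1 n2 => z z1 z2; apply: monl => //; exact: ltW.
  rewrite zz /g; have -> : 1 - xl < lc m by lra.
  by rewrite subKr /c' ltr_pM2r ?invr_gt0 // ltrD2r; move: llow => /=; lra.
split; rewrite //= ?pc ?cq //.
  by move=> [_ e1]; have := half_lt1 hw hR pc b0; rewrite e1 ltxx.
exists g; split=> //.
move=> x; rewrite in_itv /= => /andP[px' xq] xc; case: (ltgtP x (lc m)) xc => // h _.
  have hx : lc (lflip m) < 1 - x <= 1 - p by rewrite /= ltrD2l ltrN2 h lerD2l lerN2.
  have [fr it _ _] := oL (1 - x) hx.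
  have c2 : 1 - q < lc (lflip m) < 1 - p by rewrite /= !ltrD2l !ltrN2 pc cq.
  have ne : 1 - x != lc (lflip m) by rewrite gt_eqF //; case/andP: hx.
  have := first_return_flip c2 ne fr; rewrite lflipK !subKr => -[fr' /(_ _ (leqnn _)) it'].
  by exists a.+1 => //; rewrite it' it /g h.
have hx : lc m < x <= q by rewrite h.
have [fr it _ _] := oR x hx; exists b.+1 => //.
by rewrite it /g ltNge (ltW h).
Qed.
End Renormalizable.

Section RenLset.
Context {d0 d1 : Order.disp_t} {T0 : orderType d0} {T1 : orderType d1}.
Implicit Types (f : coords R T0 T1).

(** [RI_nested] puts every return interval inside [[p, q]]; hence [[p, q]] is the only maximal one,
    and the choice made in [retint] must return it. *)
Lemma ren_Lset f dl eta px qx a b p q : decomposed f -> wf dl (mof f) ->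
  reg dl (mof f) px qx ->
  dist eta (mof f) b -> dist eta (lflip (mof f)) a ->
  expR (eta + eta) < al -> expR (dl + dl + (dl + dl)) < al ->
  ren (mof f) a b p q -> (0 < a)%N -> (0 < b)%N ->
  Lset al a b f /\ retC al f = (p, q).
move=> dec hw hr hd hd' he he' hren a0 b0; set m := mof f in hw hr hd hd' hren.
have hri := ren_return_interval hw hr hren b0.
have hsub C : return_interval al (lF m) (lc m) C -> p <= C.1 /\ C.2 <= q.
  by move=> /(return_interval_RI)[g [ri _]]; exact: (RI_nested hw hd hd' he he' hren ri).
have hmax : maximal_return_interval al (lF m) (lc m) (p, q).
  split=> // -[P Q] /hsub[/= h1 h2] h3 h4; congr (_, _); apply/eqP; rewrite eq_le.
    by rewrite h1 h3.
  by rewrite h2 h4.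
have hret : retint al (lF m) (lc m) = (p, q).
  apply: xget_unique => // -[P Q] [hPQ hm]; have [/= h1 h2] := hsub _ hPQ.
  by have := hm _ hri h1 h2.
have ec : co_c f = lc m by [].
have eR : retC al f = (p, q) by rewrite /retC mapOE -/m ec.
split=> //; split=> //; rewrite mapOE -/m ec /renormalizable hret /=.
have [p0 pc cq q1] := ren_bd hren; have [hR hL] := hren.
have pp : 0 <= p < lc m by rewrite p0.
have qq : 0 <= 1 - q < lc (lflip m) by rewrite /= subr_ge0 q1 ltrD2l ltrN2.
have oR := half_orbit hw hR pp; have oL := half_orbit (wf_flip hw) hL qq.
have fl x : p <= x -> x < lc m -> first_return (lF m) (p, q) x a.+1 /\
   forall j, (1 <= j <= a)%N -> lc m < iter j (lF m) x < 1.
  move=> px' xc; have hx : lc (lflip m) < 1 - x <= 1 - p by rewrite /= ltrD2l ltrN2 xc lerD2l lerN2.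
  have [fr _ _ hj] := oL (1 - x) hx.
  have c2 : 1 - q < lc (lflip m) < 1 - p by rewrite /= !ltrD2l !ltrN2 pc cq.
  have ne : 1 - x != lc (lflip m) by rewrite gt_eqF //; case/andP: hx.
  have [fr' it'] := first_return_flip c2 ne fr; rewrite lflipK !subKr in fr' it'.
  split=> // j hj'; have /andP[_ ja] := hj'; rewrite it' ?(leqW ja) //.
  by have := hj j hj'; rewrite /= => /andP[h1 h2]; andlra.
split=> //.
- by move=> x; rewrite in_itv /= => /andP[h1 h2]; have [] := fl x h1 h2.
- by move=> x; rewrite in_itv /= => hx; have [] := oR x hx.
- move=> x i; rewrite in_itv /= => /andP[h1 h2] hi; have [_ /(_ i hi)] := fl x h1 h2.
  by rewrite in_itv.
- move=> x j; rewrite in_itv /= => hx hj; have [_ _ _ /(_ j hj)] := oR x hx.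
  by rewrite in_itv.
Qed.
End RenLset.

(** * The intervals U and V, and zooms of Q *)

Section Hulls.
Implicit Types (m : lmap) (x y p q d : R) (n : nat).

(* [V1, lV q] is the set of points that n steps on the left bring back to [p, q]. *)
Definition preimage m n p q V1 := [/\ 0 <= V1 <= 1 - lv m, lK m n V1 = p &
  litin m n (lV m q)].

Lemma preimage_exists d m n p q : wf d m -> half m n p q -> 0 <= p < lc m ->
  exists V1, preimage m n p q V1.
move=> hw [/andP[cq q1] gap eq hp hc] /andP[p0 pc].
have hV2 : litin m n (lV m q).
  have hq : lc m <= q <= 1 by rewrite q1 ltW.
  split; first by have /andP[_ ->] := lV_in hw hq; rewrite (lV_ge0 hw hq).
  by move=> j jn; apply: lt_trans (gap j jn) pc.
have Vcq := lV_le hw (lexx (lc m)) (ltW cq); rewrite (lV_c) in Vcq.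
have v0 : 0 <= 1 - lv m by case/andP: (wf_v hw) => _ h; rewrite subr_ge0.
have hV1 : litin m n (1 - lv m) by have [] := lK_mono hw v0 Vcq hV2.
have [|y1 hy1 ey1] := KK_surj (wf_u hw) (wf_c1 hw) (wf_p hw) (sl_flip (wf_q hw)) hV1 (v := p).
  by rewrite p0.
by exists y1.
Qed.

Lemma preimage_lt d m n p q V1 : wf d m -> lc m < q -> preimage m n p q V1 -> V1 < lV m q.
move=> hw cq [/andP[_ h] _ _]; apply: le_lt_trans h _.
by rewrite -(lV_c); exact: (lV_lt hw).
Qed.

Lemma preimage_set d m n p q V1 : wf d m -> half m n p q -> preimage m n p q V1 ->
  [set y | litin m n y /\ p <= lK m n y <= q] = [set` `[V1, lV m q]].
move=> hw [/andP[cq q1] gap eq hp hc] hP; have [/andP[V0 V1v] eV hV2] := hP.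
have VV := preimage_lt hw cq hP; have [hV1 _] := lK_mono hw V0 (ltW VV) hV2.
apply/seteqP; split=> y /=; rewrite in_itv /=.
  move=> [hy /andP[py yq]]; have /andP[y0 y1] := proj1 hy; apply/andP; split; rewrite leNgt; apply/negP => h.
    have [_ [_ /(_ h)]] := lK_mono hw y0 (ltW h) hV1; by rewrite eV ltNge py.
  have [/andP[V20 _] _] := hV2.
  have [_ [_ /(_ h)]] := lK_mono hw V20 (ltW h) hy; by rewrite eq ltNge yq.
move=> /andP[Vy yV]; have y0 := le_trans V0 Vy.
have [hy [k1 _]] := lK_mono hw y0 yV hV2.
have [_ [k2 _]] := lK_mono hw V0 Vy hy.
by split=> //; rewrite -{1}eV k2 -[X in _ <= X]eq.
Qed.

Lemma iter_lK m n y : (forall j, (j < n)%N -> lK m j y < lc m) ->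
  iter n (lF m) (flip (lq m) y) = lK m n y.
by elim: n => [|n IH] h //; rewrite iterS IH => [|j jn]; [rewrite /lF h | apply: h; exact: leqW].
Qed.

Lemma iter_itin m n y : 0 <= y <= 1 -> (forall j, (j < n)%N -> iter j (lF m) (flip (lq m) y) < lc m) ->
  litin m n y.
move=> y01 h; split=> // j; elim/ltn_ind: j => j IH jn.
by have := h j jn; rewrite iter_lK // => i ij; apply: IH => //; exact: ltn_trans jn.
Qed.

Lemma lV_image d m q : wf d m -> lc m < q -> q <= 1 ->
  [set lV m x | x in [set` `]lc m, q]]] = [set` `](1 - lv m), (lV m q)]].
move=> hw cq q1; apply/seteqP; split=> [_ [x /= + <-]|w] /=; rewrite !in_itv /=.
  move=> /andP[cx xq]; rewrite -(lV_c) (lV_lt hw) //=.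
  by apply: (lV_le hw) => //; exact: ltW.
move=> /andP[w1 w2]; rewrite -(lV_c) in w1.
have [||x /andP[x1 x2] ex] := @lip_IVT _ (lV m) (al / (1 - lc m)) (lc m) q w (ltW cq).
- move=> x y; wlog xy : x y / x <= y.
    move=> H hx hy; have [l|/ltW l] := leP x y; first exact: H.
    by rewrite distrC (distrC y); exact: H.
  move=> /andP[x1 x2] /andP[y1 y2].
  rewrite !ger0_norm ?subr_ge0 ?(lV_le hw) //; apply: (lV_lip hw) => //.
  exact: le_trans q1.
- by rewrite (ltW w1) w2.
exists x => //=; rewrite in_itv /= x2 andbT lt_neqAle x1 andbT; apply/eqP => e.
by move: w1; rewrite -ex -e ltxx.
Qed.
End Hulls.

Section ZoomParams.
Implicit Types (x y p q d : R).

Lemma conv_ge0 (A B t : R) : 0 < A -> 0 < B -> 0 <= t <= 1 -> 0 <= A + (B - A) * t.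
move=> A0 B0 /andP[t0 t1]; have h : 0 <= 1 - t by lra.
have -> : A + (B - A) * t = A * (1 - t) + B * t by ring.
by rewrite addr_ge0 // mulr_ge0 // ltW.
Qed.

(* The parameter of the zoom of the left branch of Q to [x, y]; on the right
   branch the flipped formula holds with the opposite sign. *)
Lemma zoom_left u c x y : 0 < u -> 0 < c -> x < y -> y < c ->
  pure_param al (zoom (qf u c) (x, y)) = (al - 1) * (ln (c - y) - ln (c - x)).
move=> u0 c0 xy yc; apply: (pure_paramE) => t ht.
have A0 : 0 < c - x by lra.
have B0 : 0 < c - y by lra.
have nAB : c - x != c - y by rewrite gt_eqF //; lra.
rewrite -(pow_zoom A0 B0 nAB ht) /zoom /zeta_inv /zeta /imI /ilen /qf /rr /=.
have -> : c - (x + (y - x) * t) = c - x + (c - y - (c - x)) * t by ring.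
have C0 : 0 <= c - x + (c - y - (c - x)) * t by exact: conv_ge0.
rewrite !powRM ?invr_ge0 ?(ltW A0) ?(ltW B0) ?(ltW c0) //.
set P := c^-1 `^ al; have P0 : 0 < P by rewrite powR_gt0 // invr_gt0.
have h := powR_neq A0 B0 nAB; set X := (_ + _ * t) `^ al; set A := (c - x) `^ al in h *.
set B := (c - y) `^ al in h *.
have -> : u * (1 - X * P) - u * (1 - A * P) = u * P * (A - X) by ring.
have -> : u * (1 - B * P) - u * (1 - A * P) = u * P * (A - B) by ring.
rewrite -mulf_div divff ?mul1r; last by rewrite mulf_neq0 ?gt_eqF.
by rewrite -(opprB X) -(opprB B) invrN mulrNN.
Qed.

Lemma zoom_right v c x y : 0 < v -> 0 < c -> x < y -> y < c ->
  pure_param al (zoom (fun z => 1 - qf v c (1 - z)) (1 - y, 1 - x)) =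
  - ((al - 1) * (ln (c - y) - ln (c - x))).
move=> u0 c0 xy yc; rewrite -mulrN opprB; apply: (pure_paramE) => t ht.
have A0 : 0 < c - y by lra.
have B0 : 0 < c - x by lra.
have nAB : c - y != c - x by rewrite lt_eqF //; lra.
rewrite -(pow_zoom A0 B0 nAB ht) /zoom /zeta_inv /zeta /imI /ilen /qf /rr /=.
have -> : c - (1 - (1 - y + (1 - x - (1 - y)) * t)) = c - y + (c - x - (c - y)) * t by ring.
have C0 : 0 <= c - y + (c - x - (c - y)) * t by exact: conv_ge0.
rewrite !subKr !powRM ?invr_ge0 ?(ltW A0) ?(ltW B0) ?(ltW c0) //.
set P := c^-1 `^ al; have P0 : 0 < P by rewrite powR_gt0 // invr_gt0.
have h := powR_neq A0 B0 nAB; set X := (_ + _ * t) `^ al; set A := (c - y) `^ al in h *.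
set B := (c - x) `^ al in h *.
have -> : 1 - v * (1 - X * P) - (1 - v * (1 - A * P)) = v * P * (X - A) by ring.
have -> : 1 - v * (1 - B * P) - (1 - v * (1 - A * P)) = v * P * (B - A) by ring.
by rewrite -mulf_div divff ?mul1r //; rewrite mulf_neq0 ?gt_eqF.
Qed.

Lemma pure_zoom_ext g g' x y : x < y -> (forall z, x <= z <= y -> g z = g' z) ->
  pure_param al (zoom g (x, y)) = pure_param al (zoom g' (x, y)).
move=> xy h; have e t : t \in `[0, 1] -> zoom g (x, y) t = zoom g' (x, y) t.
  rewrite in_itv /= => /andP[t0 t1]; rewrite /zoom /zeta_inv /imI /zeta /ilen /=.
  have l0 : 0 < y - x by lra.
  have h1 := mulr_ge0 (ltW l0) t0; have h2 := ler_piMr (ltW l0) t1.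
  by rewrite !h //; andlra.
rewrite /pure_param; congr (xget 0 _); apply/seteqP.
by split=> s /= hs' t ht'; rewrite -hs' // e.
Qed.

End ZoomParams.

(** * Explicit formulas for all coordinates of the renormalization *)

Section RenormFormulas.
Context {d0 d1 : Order.disp_t} {T0 : orderType d0} {T1 : orderType d1}.
Implicit Types (f : coords R T0 T1) (x y p q d : R).
Variables (f : coords R T0 T1) (d : R) (a b : nat) (p q V1 W1 : R).
Let m := mof f.
Let m' := lflip m.
Hypothesis hw : wf d m.
Hypothesis hren : ren m a b p q.
Hypothesis hret : retC al f = (p, q).
Hypothesis hV : preimage m b p q V1.
Hypothesis hW : preimage m' a (1 - q) (1 - p) W1.
Notation V2 := (lV m q).
Notation W2 := (lV m' (1 - p)).
Let hw' : wf d m' := wf_flip hw.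

Lemma intVE : intV al b f = (V1, V2).
have [p0 pc cq q1] := ren_bd hren; have [hR _] := hren.
have VV := preimage_lt hw cq hV.
rewrite /intV hret mapOE -/m.
have -> : pullback (comp_all al (co_t f)) (lF m) `[0, (co_c f)[ b (p, q) = [set` `[V1, V2]].
  rewrite -(preimage_set hw hR hV); apply/seteqP; split=> y /=.
    move=> [+ h1 +]; rewrite !in_itv /= => y01 h2; have hy : litin m b y.
      apply: iter_itin => // j jb; have := h1 j jb; rewrite in_itv /= /m /= flipK => /andP[_]; exact.
    split=> //; move: h2; rewrite -[comp_all _ _ y]flipK -/(lq m) iter_lK //; by case: hy.
  move=> [[y01 hy] h]; split; first by rewrite in_itv.
    move=> j jb; have hj : litin m j y by split=> // i ij; apply: hy; exact: ltn_trans jb.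
    rewrite -[comp_all _ _ y]flipK -/(lq m) iter_lK; last by case: hj.
    by rewrite in_itv /= (hy j jb) andbT; have /andP[] := lK_in hw hj.
  by rewrite -[comp_all _ _ y]flipK -/(lq m) iter_lK // in_itv.
by rewrite /hull inf_itvcc ?sup_itvcc // ltW.
Qed.

Lemma iter_left j y : (forall i, (i < j)%N -> lK m' i y < lc m') ->
  iter j (lF m) (comp_all al (co_s f) (1 - y)) = 1 - lK m' j y.
elim: j => [|j IH] h; first by rewrite /= /lK /KK /= /flip subKr.
rewrite iterS IH; last by move=> i ij; apply: h; exact: leqW.
have := h j (ltnSn j); set z := lK m' j y => hz.
have hz' : lc m <= 1 - z by move: hz; rewrite /m' /=; lra.
rewrite /lF ltNge hz'; transitivity (1 - lf0 m' z); last exact: erefl.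
by congr (1 - lf0 m' _); rewrite opprB addrC subrK.
Qed.

Lemma intUE : intU al a f = (1 - W2, 1 - W1).
have [p0 pc cq q1] := ren_bd hren; have [_ hL] := hren.
have cp : lc m' < 1 - p by rewrite /m' /= ltrD2l ltrN2.
have WW := preimage_lt hw' cp hW.
rewrite /intU hret mapOE -/m.
have -> : pullback (comp_all al (co_s f)) (lF m) `](co_c f), 1] a (p, q) =
    [set` `[1 - W2, 1 - W1]].
  have e y : (y \in `[1 - W2, 1 - W1]) = (1 - y \in `[W1, W2]).
    by rewrite !in_itv /=; apply/andP/andP => -[h1 h2]; split; lra.
  have st y : [set y | litin m' a y /\ 1 - q <= lK m' a y <= 1 - p] (1 - y) <->
     [set` `[1 - W2, 1 - W1]] y by rewrite (preimage_set hw' hL hW) /= e.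
  apply/seteqP; split=> y.
    move=> [y01 h1 h2]; apply/st; have y01' : 0 <= 1 - y <= 1.
      by move: y01; rewrite in_itv /= => /andP[h3 h4]; andlra.
    have hj j : (j < a)%N -> lK m' j (1 - y) < lc m'.
      elim/ltn_ind: j => j IH ja; have := h1 j ja.
      rewrite -[y in comp_all _ _ y]subKr iter_left; last by move=> i ij; apply: IH => //; exact: ltn_trans ja.
      by rewrite in_itv /= /m' /= => /andP[h3 _]; move: h3; rewrite /m /=; lra.
    split; first by split.
    move: h2; rewrite -[y in comp_all _ _ y]subKr iter_left // in_itv /= => /andP[h3 h4].
    by andlra.
  move=> /st[[/andP[y0 y1] hy] /andP[h1 h2]]; split.
  - by rewrite in_itv /=; andlra.
  - move=> j ja; rewrite -[y in comp_all _ _ y]subKr iter_left; last by move=> i ij; apply: hy; exact: ltn_trans ja.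
    have hj : litin m' j (1 - y).
      by split=> [|i ij]; [rewrite y0 y1 | apply: hy; exact: ltn_trans ja].
    have := hy j ja; have /andP[k0 _] := lK_in hw' hj.
    rewrite in_itv /= -/(lK m' j (1 - y)) /m' /= -/m' => k1.
    apply/andP; split; last by rewrite lerBlDr lerDl.
    by rewrite ltrBrDr addrC -ltrBrDr.
  - rewrite -[y in comp_all _ _ y]subKr iter_left // in_itv /=.
    by andlra.
rewrite /hull inf_itvcc ?sup_itvcc //; lra.
Qed.

Lemma renorm_v : co_v (renorm al a b f) = (lv m - 1 + V2) / (V2 - V1).
have [p0 pc cq q1] := ren_bd hren; have VV := preimage_lt hw cq hV.
have Vcq := lV_lt hw (lexx (lc m)) cq; rewrite (lV_c) in Vcq.
rewrite /co_v /renorm /= intVE hret /= [ilen (V1, V2)]/ilen /=; congr (_ / _).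
have -> : mapQ al f @` `](co_c f), q] = [set lV m x | x in [set` `]lc m, q]]].
  apply/seteqP; split=> _ [x /= hx <-]; exists x => //; move: hx; rewrite in_itv /= => /andP[cx _];
    by rewrite /mapQ stdQ_right // ltW.
rewrite (lV_image hw cq q1) /hull inf_itv ?sup_itv ?bnd_simp // /ilen /=; ring.
Qed.

Lemma renorm_u : co_u (renorm al a b f) = (lu m - 1 + W2) / (W2 - W1).
have [p0 pc cq q1] := ren_bd hren; have [_ hL] := hren.
have cp : lc m' < 1 - p by rewrite /m' /= ltrD2l ltrN2.
have p1 : 1 - p <= 1 by rewrite lerBlDr lerDl.
have WW := preimage_lt hw' cp hW.
have Vcq := lV_lt hw' (lexx (lc m')) cp; rewrite (lV_c) in Vcq.
rewrite /co_u /renorm /= intUE hret /= /ilen /=.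
have -> : mapQ al f @` `[p, (co_c f)[ = [set` `[1 - W2, lu m[].
  have im := lV_image hw' cp p1; apply/seteqP; split=> y /=.
    move=> [x hx <-]; move: hx; rewrite in_itv /= => /andP[px xc].
    have : [set lV m' x | x in [set` `]lc m', (1 - p)]]] (lV m' (1 - x)).
      by exists (1 - x) => //=; rewrite in_itv /= /m' /= ltrD2l ltrN2 lerD2l lerN2 xc px.
    rewrite im /= in_itv /= /mapQ stdQ_left // /m' /lV /= !subKr /m /= => /andP[h1 h2].
    by rewrite in_itv /=; andlra.
  rewrite in_itv /= => /andP[y1 y2].
  have : [set` `](1 - lv m'), (lV m' (1 - p))]] (1 - y).
    by rewrite /= in_itv /=; apply/andP; split; [move: y2; rewrite /m' /= | ]; lra.
  rewrite -im => -[x /=]; rewrite in_itv /= => /andP[x1 x2] ex; exists (1 - x).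
    by rewrite /= in_itv /=; move: x1; rewrite /m' /= /m /= => x1; apply/andP; split; lrd al1 al0 be0 hret p0 pc cq q1 ex cp p1 WW Vcq y1 y2.
  have xc : 1 - x < co_c f by move: x1; rewrite /m' /= /m /=; lra.
  rewrite /mapQ stdQ_left //; move: ex; rewrite /m' /lV /= subKr /m /=; lra.
rewrite /hull inf_itv ?sup_itv ?bnd_simp //=; last first.
- by move: Vcq; rewrite /m' /=; lra.
- by move: Vcq; rewrite /m' /=; lra.
congr (_ / _); ring.
Qed.

Lemma renorm_c : co_c (renorm al a b f) = (lc m - p) / (q - p).
by rewrite /co_c /renorm /= hret. Qed.
Hypothesis hs : l1_le (co_s f) rb.
Hypothesis ht : l1_le (co_t f) rb.
Let pc : p < lc m. by have [] := ren_bd hren. Qed.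
Let cq : lc m < q. by have [] := ren_bd hren. Qed.
Let cp : lc m' < 1 - p. by rewrite /m' /= ltrD2l ltrN2. Qed.
Let VV : V1 < V2. exact: (preimage_lt hw cq hV). Qed.
Let WW : W1 < W2. exact: (preimage_lt hw' cp hW). Qed.
Let V10 : 0 <= V1. by case: hV => /andP[]. Qed.
Let W10 : 0 <= W1. by case: hW => /andP[]. Qed.
Let V21 : V2 <= 1. by case: hV => _ _ [/andP[]]. Qed.
Let W21 : W2 <= 1. by case: hW => _ _ [/andP[]]. Qed.

Lemma renorm_t_inl t : co_t (renorm al a b f) (inl t) = mlc (co_t f) V2 t - mlc (co_t f) V1 t.
rewrite /co_t /renorm /= intVE.
by apply: (zoom_paramE); [exact: ht|exact: V10|exact: VV|exact: V21].
Qed.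

Lemma renorm_s_inl t : co_s (renorm al a b f) (inl t) =
  mlc (co_s f) (1 - W1) t - mlc (co_s f) (1 - W2) t.
rewrite /co_s /renorm /= intUE.
apply: (zoom_paramE); [exact: hs|rewrite subr_ge0; exact: W21| |].
  by rewrite ltrD2l ltrN2; exact: WW.
by rewrite lerBlDr lerDl; exact: W10.
Qed.

Lemma right_orbit i : (i < b)%N -> imI (iter i (mapO al f)) (imI (comp_all al (co_t f)) (V1, V2)) =
  (lK m i V1, lK m i V2) /\
  [/\ 0 <= lK m i V1, lK m i V1 < lK m i V2 & lK m i V2 < lc m].
move=> ib; have [_ _ hV2] := hV; have [h1 [h2 h3]] := lK_mono hw V10 (ltW VV) (itinS (ltnW ib) hV2).
have /andP[k0 _] := lK_in hw h1; have [_ k1] := hV2.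
split; last by split=> //; [apply: h3; exact: VV | exact: k1].
rewrite /imI mapOE -/m /=; congr (_, _).
  by rewrite -[comp_all _ _ V1]flipK -/(lq m) iter_lK //; case: h1.
by rewrite -[comp_all _ _ V2]flipK -/(lq m) iter_lK // => j ji; apply: k1; exact: ltn_trans ib.
Qed.

Lemma left_orbit i : (i < a)%N -> imI (iter i (mapO al f)) (imI (comp_all al (co_s f)) (1 - W2, 1 - W1)) =
  (1 - lK m' i W2, 1 - lK m' i W1) /\
  [/\ 0 <= lK m' i W1, lK m' i W1 < lK m' i W2 & lK m' i W2 < lc m'].
move=> ia; have [_ _ hW2] := hW; have [h1 [h2 h3]] := lK_mono hw' W10 (ltW WW) (itinS (ltnW ia) hW2).
have /andP[k0 _] := lK_in hw' h1; have [_ k1] := hW2.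
split; last by split=> //; [apply: h3; exact: WW | exact: k1].
rewrite /imI mapOE -/m /=; congr (_, _).
  by rewrite iter_left // => j ji; apply: k1; exact: ltn_trans ia.
by rewrite iter_left //; case: h1.
Qed.

Lemma renorm_t_q (i : 'I_b) o : co_t (renorm al a b f) (inr (i, inl o)) =
  (al - 1) * (ln (lc m - lK m i V2) - ln (lc m - lK m i V1)).
rewrite /co_t /renorm /= intVE.
have [-> [k0 k1 k2]] := right_orbit (ltn_ord i).
rewrite -(@zoom_left (lu m)) //; [|by case/andP: (wf_u hw)|by case/andP: (wf_c1 hw)].
apply: pure_zoom_ext => // z /andP[_ z2]; rewrite /mapQ stdQ_left //.
exact: le_lt_trans k2.
Qed.

Lemma renorm_s_q (i : 'I_a) o : co_s (renorm al a b f) (inr (i, inl o)) =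
  - ((al - 1) * (ln (lc m' - lK m' i W2) - ln (lc m' - lK m' i W1))).
rewrite /co_s /renorm /= intUE.
have [-> [k0 k1 k2]] := left_orbit (ltn_ord i).
rewrite -(@zoom_right (lu m')) //; [|by case/andP: (wf_u hw')|by case/andP: (wf_c1 hw')].
have k3 : 1 - lK m' i W2 < 1 - lK m' i W1 by rewrite ltrD2l ltrN2.
apply: pure_zoom_ext => // z /andP[z1 z2]; rewrite /mapQ stdQ_right //.
by move: k2 z1; rewrite /m' /= /m /=; lra.
Qed.

Lemma qf01 c u x : 0 < u <= 1 -> 0 < c <= 1 -> 0 <= x -> x < c -> 0 <= qf u c x <= 1.
by move=> hu hc x0 xc; apply: (qf_in1 hu hc); rewrite x0 ltW. Qed.

Lemma renorm_t_s (i : 'I_b) t : co_t (renorm al a b f) (inr (i, inr t)) =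
  mlc (co_s f) (qf (lu m) (lc m) (lK m i V2)) t - mlc (co_s f) (qf (lu m) (lc m) (lK m i V1)) t.
rewrite /co_t /renorm /= intVE.
have [-> [k0 k1 k2]] := right_orbit (ltn_ord i).
rewrite /imI /= /mapQ !stdQ_left //; last exact: lt_trans k2.
have hu := wf_u hw; have hc := wf_c1 hw; have k3 := lt_trans k1 k2.
have /andP[h1 _] := qf01 hu hc k0 k3; have /andP[_ h2] := qf01 hu hc (ltW (le_lt_trans k0 k1)) k2.
have h3 := qf_lt hu hc k1 (ltW k2).
exact: (zoom_paramE t hs h1 h3 h2).
Qed.

Lemma renorm_s_t (i : 'I_a) t : co_s (renorm al a b f) (inr (i, inr t)) =
  mlc (co_t f) (1 - qf (lu m') (lc m') (lK m' i W1)) t -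
  mlc (co_t f) (1 - qf (lu m') (lc m') (lK m' i W2)) t.
rewrite /co_s /renorm /= intUE.
have [-> [k0 k1 k2]] := left_orbit (ltn_ord i); have k3 := lt_trans k1 k2.
rewrite /imI /= /mapQ !stdQ_right.
- rewrite !subKr; have hu := wf_u hw'; have hc := wf_c1 hw'.
  have /andP[h1 _] := qf01 hu hc k0 k3; have /andP[_ h2] := qf01 hu hc (ltW (le_lt_trans k0 k1)) k2.
  have h3 := qf_lt hu hc k1 (ltW k2); rewrite -subr_ge0 in h2.
  rewrite -(ltrN2) -(ltrD2l 1) in h3; rewrite -lerN2 -(lerD2l 1) subr0 in h1.
  exact: (zoom_paramE t ht h2 h3 h1).
- by move: k3; rewrite /m' /= /m /=; lra.
- by move: k2; rewrite /m' /= /m /=; lra.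
Qed.

End RenormFormulas.

(** * Bounded linear maps on tangent vectors and expansions in l^1 *)

Section L1Sums.

Lemma normZD_le (r x y N M : R) : `|x| <= N -> `|y| <= M -> `|r * x + y| <= `|r| * N + M.
by move=> h1 h2; apply: normD_le => //; rewrite normrM ler_wpM2l. Qed.

Lemma l1_le_ordsum {d d' : Order.disp_t} {T : orderType d} {T' : orderType d'}
  (f : ordsum T T' -> R) m m' : l1_le (fun t => f (inl t)) m -> l1_le (fun t => f (inr t)) m' ->
  l1_le f (m + m').
move=> h h' l ul; pose gl (x : ordsum T T') := if x is inl t then Some t else None.
pose gr (x : ordsum T T') := if x is inr t then Some t else None.
have -> : lsum f l = lsum (fun t => f (inl t)) (pmap gl l) + lsum (fun t => f (inr t)) (pmap gr l).
  elim: l {ul} => [|[t|t] l IH]; first by rewrite /lsum !big_nil addr0.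
    by rewrite /= !lsum_cons IH addrA.
  by rewrite /= !lsum_cons IH addrCA.
apply: lerD; [apply: h | apply: h'].
  by rewrite (@pmap_uniq _ _ gl (@inl T T')) // => -[].
by rewrite (@pmap_uniq _ _ gr (@inr T T')) // => -[].
Qed.

Lemma l1_le_ord_prod {d' : Order.disp_t} {T' : orderType d'} n (f : 'I_n *l T' -> R) m :
  (forall i, l1_le (fun t => f (i, t)) m) -> l1_le f (n%:R * m).
move=> h l ul; pose g i (x : 'I_n *l T') := if x.1 == i then Some x.2 else None.
have -> : lsum f l = \sum_(i < n) lsum (fun t => f (i, t)) (pmap (g i) l).
  elim: l {ul} => [|[j t] l IH].
    by rewrite /lsum big_nil big1 // => i _; rewrite big_nil.
  have gE i : pmap (g i) ((j, t) :: l) = if j == i then t :: pmap (g i) l else pmap (g i) l.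
    by rewrite /= /g /=; case: (j == i).
  under eq_bigr do rewrite gE.
  rewrite lsum_cons IH (bigD1 j) // [RHS](bigD1 j) //= eqxx lsum_cons addrA.
  by congr (_ + _); apply: eq_bigr => i /negbTE ij; rewrite eq_sym ij.
apply: le_trans (_ : \sum_(i < n) m <= _); last by rewrite sumr_const card_ord mulr_natl.
apply: ler_sum => i _; apply: h.
rewrite (@pmap_uniq _ _ (g i) (fun t => (i, t))) // => -[j t]; rewrite /oapp /g /=.
by case: eqP => // ->.
Qed.

Lemma l1_le_rtime {d d' : Order.disp_t} {T : orderType d} {T' : orderType d'} n
  (f : rtime T T' n -> R) m m1 m2 : l1_le (fun t => f (inl t)) m ->
  (forall (i : 'I_n) o, `|f (inr (i, inl o))| <= m1) ->
  (forall i : 'I_n, l1_le (fun t => f (inr (i, inr t))) m2) ->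
  l1_le f (m + n%:R * (m1 + m2)).
move=> h h1 h2; apply: l1_le_ordsum => //; apply: l1_le_ord_prod => i.
apply: l1_le_ordsum => // l ul.
have : (size l <= 1)%N by have := max_card (mem l); rewrite (card_uniqP ul) card_ord.
case: l ul => [|o [|o' l]] // _ _; first by rewrite /lsum big_nil; exact: le_trans (h1 i ord0).
by rewrite /lsum big_seq1.
Qed.
End L1Sums.

Section BoundedLinear.
Context {d0 d1 : Order.disp_t} {T0 : orderType d0} {T1 : orderType d1}.
Notation coords := (coords R T0 T1).
Implicit Types (z w : coords) (r N K : R) (L : coords -> R).

Record nle z N : Prop := Nle { nle_u : `|co_u z| <= N; nle_v : `|co_v z| <= N;
  nle_c : `|co_c z| <= N; nle_s : l1_le (co_s z) N; nle_t : l1_le (co_t z) N }.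

Lemma normP z N : (norm z <= N%:E)%E <-> nle z N.
rewrite /norm /normX /normY !ge_max lee_fin ge_max lee_fin; split.
  by move=> /andP[/andP[h1 h2] /andP[/andP[h3 /l1_leP h4] /l1_leP h5]].
by case=> -> -> -> /l1_leP -> /l1_leP ->.
Qed.

Lemma nle_ge0 z N : nle z N -> 0 <= N.
by case=> h _ _ _ _; exact: le_trans h. Qed.

Lemma nle_weak z N N' : N <= N' -> nle z N -> nle z N'.
by move=> h [h1 h2 h3 h4 h5]; split; try exact: le_trans h; exact: l1_le_weak h _.
Qed.

Lemma norm_ge0 z : (0 <= norm z)%E.
by rewrite /norm le_max /normX lee_fin le_max normr_ge0. Qed.

Lemma tangentP z : tangent z <-> exists N, nle z N.
rewrite /tangent /=; split=> [h|[N /normP h]]; last exact: le_lt_trans h (ltry N).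
have h0 := norm_ge0 z; exists (fine (norm z)); apply/normP; rewrite fineK //.
by rewrite fin_numE; case: (norm z) h h0.
Qed.

Lemma co_lin r z w : [/\ co_u (r *: z + w) = r * co_u z + co_u w,
  co_v (r *: z + w) = r * co_v z + co_v w, co_c (r *: z + w) = r * co_c z + co_c w,
  co_s (r *: z + w) = (fun t => r * co_s z t + co_s w t) &
  co_t (r *: z + w) = (fun t => r * co_t z t + co_t w t)].
by split; rewrite /co_u /co_v /co_c /co_s /co_t; cbn. Qed.

Lemma co_sub z w : [/\ co_u (z - w) = co_u z - co_u w, co_v (z - w) = co_v z - co_v w,
  co_c (z - w) = co_c z - co_c w, co_s (z - w) = (fun t => co_s z t - co_s w t) &
  co_t (z - w) = (fun t => co_t z t - co_t w t)].
by split; rewrite /co_u /co_v /co_c /co_s /co_t; cbn. Qed.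

Lemma nle_lin r z w N M : nle z N -> nle w M -> nle (r *: z + w) (`|r| * N + M).
case=> a1 a2 a3 a4 a5 [b1 b2 b3 b4 b5]; have [e1 e2 e3 e4 e5] := co_lin r z w.
split; [rewrite e1; exact: normZD_le|rewrite e2; exact: normZD_le|rewrite e3; exact: normZD_le| |].
  by rewrite e4; exact: (l1_leD (l1_leZ r a4) b4).
by rewrite e5; exact: (l1_leD (l1_leZ r a5) b5).
Qed.

(** Linearity is asked only on vectors of finite norm: [coords] also contains families that are not
    summable, where the limits defining the derivatives carry no information. *)
Definition bl L := (forall r z w, tangent z -> tangent w -> L (r *: z + w) = r * L z + L w) /\
  exists2 K, 0 <= K & forall z N, nle z N -> `|L z| <= K * N.

Lemma bl_ext L L' : (forall z, tangent z -> L z = L' z) -> bl L -> bl L'.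
move=> e [h [K K0 hK]]; split=> [r z w hz hw|].
  rewrite -!e //; first exact: h.
  by have [[N hN] [M hM]] := (proj1 (tangentP z) hz, proj1 (tangentP w) hw);
     apply/tangentP; exists (`|r| * N + M); exact: nle_lin.
by exists K => // z N hz; rewrite -e; [exact: hK | apply/tangentP; exists N].
Qed.

Lemma bl0 : bl (fun=> 0).
split=> [r z w _ _|]; first by rewrite mulr0 addr0.
by exists 0 => // z N _; rewrite normr0 mul0r.
Qed.

Lemma blD L L' : bl L -> bl L' -> bl (fun z => L z + L' z).
move=> [h [K K0 hK]] [h' [K' K0' hK']]; split=> [r z w hz hw|].
  by rewrite h // h' //; ring.
exists (K + K'); first exact: addr_ge0.
by move=> z N hz; rewrite mulrDl; apply: normD_le; [exact: hK|exact: hK'].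
Qed.

Lemma blZ k L : bl L -> bl (fun z => k * L z).
move=> [h [K K0 hK]]; split=> [r z w hz hw|]; first by rewrite h //; ring.
exists (`|k| * K); first exact: mulr_ge0.
by move=> z N hz; rewrite normrM -mulrA ler_wpM2l // hK.
Qed.

Lemma blB L L' : bl L -> bl L' -> bl (fun z => L z - L' z).
move=> h h'; apply: bl_ext (blD h (blZ (-1) h')) => z _; ring.
Qed.

Lemma blM k L : bl L -> bl (fun z => L z * k).
by move=> h; apply: bl_ext (blZ k h) => z _; rewrite mulrC. Qed.

Lemma bl_u : bl (@co_u R _ _ T0 T1).
by split=> [r z w _ _|]; [have [] := co_lin r z w | exists 1 => // z N []; rewrite mul1r].
Qed.

Lemma bl_v : bl (@co_v R _ _ T0 T1).
by split=> [r z w _ _|]; [have [] := co_lin r z w | exists 1 => // z N []; rewrite mul1r].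
Qed.

Lemma bl_c : bl (@co_c R _ _ T0 T1).
by split=> [r z w _ _|]; [have [] := co_lin r z w | exists 1 => // z N []; rewrite mul1r].
Qed.

Section L1Valued.
Context {d : Order.disp_t} {T : orderType d}.
Implicit Types (M : coords -> T -> R).

Definition bll M := (forall r z w t, tangent z -> tangent w ->
    M (r *: z + w) t = r * M z t + M w t) /\
  exists2 K, 0 <= K & forall z N, nle z N -> l1_le (M z) (K * N).

Lemma bllB M M' : bll M -> bll M' -> bll (fun z t => M z t - M' z t).
move=> [h [K K0 hK]] [h' [K' K0' hK']]; split=> [r z w t hz hw|].
  by rewrite h // h' //; ring.
exists (K + K'); first exact: addr_ge0.
by move=> z N hz; rewrite mulrDl; apply: l1_leB; [exact: hK|exact: hK'].
Qed.
End L1Valued.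
End BoundedLinear.

Section L1Jets.
Context {I : Type} (F : set_system I) (nu : I -> R).
Hypothesis hj : jctx F nu.
#[local] Instance hjF5 : Filter F := proj1 hj.
Context {d : Order.disp_t} {T : orderType d}.
Implicit Types (X Y dX dY : I -> T -> R).

Definition ljet X (X0 : T -> R) dX := exists K, F [set i | l1_le (fun t => X i t - X0 t - dX i t) (K * nu i ^+ 2)].

Lemma ljetB X (X0 : T -> R) dX Y (Y0 : T -> R) dY : ljet X X0 dX -> ljet Y Y0 dY ->
  ljet (fun i t => X i t - Y i t) (fun t => X0 t - Y0 t) (fun i t => dX i t - dY i t).
move=> [K hK] [K' hK']; exists (K + K'); apply: filterS2 hK hK' => i h h'.
by rewrite /= mulrDl; apply: l1_le_eq (l1_leB h h') => t; congr (`|_|); ring.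
Qed.

Lemma mlc_jet (s : T -> R) (s_ : I -> T -> R) (X : I -> R) (x : R) (dX : I -> R) :
  l1_le s (@rb / 2) -> jet F nu X (fun=> x) dX -> 0 <= x <= 1 -> F [set i | 0 <= X i <= 1] ->
  F [set i | l1_le (s_ i) (@rb) /\ l1_le (fun t => s_ i t - s t) (nu i)] ->
  ljet (fun i => mlc (s_ i) (X i)) (mlc s x)
    (fun i => dmlc s x (fun t => s_ i t - s t) (dX i)).
move=> hs hX x01 hX01 hs_; have [K K1 hK] := jetE hj hX.
have [C C0 hC] := mlc_second (T := T); have [D D0 hD] := dmlc_bound (T := T).
have K0 : 0 <= K by exact: le_trans K1.
exists (C * (1 + (K + K)) ^+ 2 + D * K).
apply: filterS3 hK hX01 hs_ => i [/andP[n0 n1] k1 k2 k3] h01 [h1 h2].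
have a1 := hC s (s_ i) x (X i) (nu i) hs h1 h2 n1 x01 h01.
have z0 : l1_le (fun t => s t - s t) 0.
  by apply: l1_le_eq (l1_le0 (T := T)) => t; rewrite subrr.
have a2 := hD s x _ 0 (X i - x - dX i) hs z0 x01; rewrite add0r in a2.
have Xd : `|X i - x| <= (K + K) * nu i.
  have -> : X i - x = dX i + (X i - x - dX i) by ring.
  apply: le_trans (normD_le k2 k3) _; rewrite mulrDl lerD2l ler_wpM2l //.
  by rewrite expr2 ler_piMl.
have q2 : (nu i + `|X i - x|) ^+ 2 <= (1 + (K + K)) ^+ 2 * nu i ^+ 2.
  have KK : 0 <= K + K by exact: addr_ge0.
  rewrite -exprMn lerXn2r ?nnegrE ?addr_ge0 // ?mulrDl ?mul1r.
    by rewrite addr_ge0 // -mulrDl mulr_ge0.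
  by rewrite lerD2l -mulrDl.
apply: l1_le_weak (l1_le_eq _ (l1_leD a1 a2)).
  rewrite [X in _ <= X]mulrDl; apply: lerD.
    by rewrite -[X in _ <= X]mulrA ler_wpM2l // ltW.
  by rewrite -[X in _ <= X]mulrA ler_wpM2l // ltW.
move=> t; congr (`|_|); rewrite /dmlc.
have -> : cds s (fun t' => (t' < t)%O) x (fun t => s t - s t) = 0.
  have [L L0 hL] := mu_param_lip.
  have [b _] := cds_bound (fun t' => (t' < t)%O) (conj L0 hL) hs z0 x01.
  by apply/eqP; rewrite -normr_le0; move: b; rewrite mulr0 mul0r.
move: (mlc s x t) (mlc _ _ t) (mls _ _) (mlx _ _) (cdx _ _ _) (cds _ _ _ _) => x1 x2 x3 x4 x5 x6.
by ring.
Qed.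
End L1Jets.

Section TangentMap.
Context {d0 d1 : Order.disp_t} {T0 : orderType d0} {T1 : orderType d1}.
Implicit Types (f z w : coords R T0 T1) (x y N : R).

(** The component for [lq] belongs to the flipped psi; hence the sign and the argument [1 - x]. For
    fixed [f] all components are linear in [z]. *)
Definition tof f z : lmap := LM (fun x => cds (co_s f) predT x (co_s z))
  (fun x => - cds (co_t f) predT (1 - x) (co_t z)) (co_u z) (co_v z) (co_c z).
Definition pxo f x := cdx (co_s f) predT x.
Definition qxo f x := cdx (co_t f) predT (1 - x).

Definition small f e := l1_le (co_s f) e /\ l1_le (co_t f) e.

Lemma small_rb f : small f (rb / 2) -> l1_le (co_s f) rb /\ l1_le (co_t f) rb.
by case=> h h'; split; [apply: l1_le_weak h | apply: l1_le_weak h'];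
  have := @rb_gt0; lra.
Qed.

(** The third condition is [mjet_comp] for a constant family of parameters, whose parameter
    derivative vanishes. *)
Lemma reg_mof f dl : small f (rb / 2) -> small f dl -> reg dl (mof f) (pxo f) (qxo f).
move=> [hs ht] [hs' ht']; split.
- by move=> x hx; exact: cdx_bound.
- move=> x /andP[x0 x1]; apply: (cdx_bound) => //; andlra.
- move=> I F nu hj; have [hs2 ht2] := small_rb (conj hs ht).
  have flt : Filter F := proj1 hj.
  have z (d : Order.disp_t) (T : orderType d) (s : T -> R) : l1_le s (rb / 2) -> l1_le s rb ->
      mjet F nu (fun=> comp_all al s) (comp_all al s) (fun _ _ => 0) (cdx s predT).
    move=> h1 h2; have z0 : l1_le (fun t => s t - s t) 0.
      by apply: l1_le_eq (l1_le0 (T := T)) => t; rewrite subrr.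
    have [_ nu01] := hj.
    have k : F [set i | l1_le s rb /\ l1_le (fun t => s t - s t) (nu i)].
      by apply: filterS nu01 => i /andP[n0 _]; split=> //; exact: l1_le_weak z0.
    have hm := mjet_comp hj h1 k.
    move=> X X0 dX hX h01; apply: (jet_ext hj _ (hm X X0 dX hX h01)).
    apply: filterS h01 => i [_ y01]; split=> //; congr (_ + _).
    have [L L0 hL] := mu_param_lip.
    have [b _] := cds_bound predT (conj L0 hL) h1 z0 y01.
    by apply/eqP; rewrite -normr_le0; move: b; rewrite mulr0 mul0r.
  split; first exact: z.
  move=> X X0 dX hX h01; apply: (jet_ext hj _ (mjet_flip hj (z _ _ _ ht ht2) hX h01)).
  by apply: filterE => i; split=> //; rewrite oppr0.
Qed.

Lemma bl_lp f x : small f (rb / 2) -> 0 <= x <= 1 -> bl (fun z => lp (tof f z) x).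
move=> [hs ht] hx; split=> [r z w /tangentP[N hN] /tangentP[M hM]|].
  have [_ _ _ e _] := co_lin r z w; rewrite /= e.
  exact: (cds_lin _ r hs hx (nle_s hN) (nle_s hM)).
have [L L0 hL] := mu_param_lip; exists (L * expR 2); first by rewrite mulr_ge0 ?expR_ge0 // ltW.
move=> z N hN; have [b _] := cds_bound predT (conj L0 hL) hs (nle_s hN) hx.
apply: le_trans b _; case/andP: hx => x0 x1.
by rewrite ler_piMr // mulr_ge0 ?(nle_ge0 hN) // mulr_ge0 ?expR_ge0 // ltW.
Qed.

Lemma bl_lq f x : small f (rb / 2) -> 0 <= x <= 1 -> bl (fun z => lq (tof f z) x).
move=> [hs ht] hx0; have hx : 0 <= 1 - x <= 1 by case/andP: hx0 => h1 h2; andlra.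
suff h : bl (fun z => cds (co_t f) predT (1 - x) (co_t z)).
  by apply: bl_ext (blZ (-1) h) => z _; rewrite mulN1r.
split=> [r z w /tangentP[N hN] /tangentP[M hM]|].
  have [_ _ _ _ e] := co_lin r z w; rewrite /= e.
  exact: (cds_lin _ r ht hx (nle_t hN) (nle_t hM)).
have [L L0 hL] := mu_param_lip; exists (L * expR 2); first by rewrite mulr_ge0 ?expR_ge0 // ltW.
move=> z N hN; have [b _] := cds_bound predT (conj L0 hL) ht (nle_t hN) hx.
apply: le_trans b _; case/andP: hx => x0 x1.
by rewrite ler_piMr // mulr_ge0 ?(nle_ge0 hN) // mulr_ge0 ?expR_ge0 // ltW.
Qed.

(* A tangent map depending on z, together with the base map, in a form stable under the flip. *)
Definition blt (t : coords R T0 T1 -> lmap) := [/\ bl (fun z => lu (t z)), bl (fun z => lv (t z)),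
  bl (fun z => lc (t z)), forall x, 0 <= x <= 1 -> bl (fun z => lp (t z) x) &
  forall x, 0 <= x <= 1 -> bl (fun z => lq (t z) x)].

Lemma blt_tof f : small f (rb / 2) -> blt (tof f).
by move=> h; split; [exact: bl_u|exact: bl_v|exact: bl_c|move=> x; exact: bl_lp|move=> x; exact: bl_lq].
Qed.

Lemma blt_flip t : blt t -> blt (fun z => tflip (t z)).
case=> h1 h2 h3 h4 h5; split=> //.
by apply: bl_ext (blZ (-1) h3) => z _; rewrite mulN1r.
Qed.

Lemma bl_dqf m t (dx : coords R T0 T1 -> R) x : blt t -> bl dx ->
  bl (fun z => dqf m (t z) x (dx z)).
by case=> h1 _ h3 _ _ hx; apply: blD (blZ _ h1) (blZ _ (blB hx (blZ _ h3))). Qed.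

Lemma bl_dlV m t (dx : coords R T0 T1 -> R) x : blt t -> bl dx ->
  bl (fun z => dlV m (t z) x (dx z)).
move=> ht hx; have hx' : bl (fun z => - dx z) by apply: bl_ext (blZ (-1) hx) => z _; rewrite mulN1r.
have h := bl_dqf (lflip m) (1 - x) (blt_flip ht) hx'.
by apply: bl_ext (blZ (-1) h) => z _; rewrite mulN1r.
Qed.

Lemma bl_dlK d m px qx t n y (dy : coords R T0 T1 -> R) : wf d m -> blt t -> bl dy ->
  litin m n y -> bl (fun z => dlK m px qx (t z) n y (dy z)).
move=> hw ht hy; have [_ _ _ h4 h5] := ht; elim: n => [|n IH] hi.
  have [/andP[y0 y1] _] := hi.
  have h1 : 0 <= 1 - y <= 1 by andlra.
  by apply: bl_ext (blB (blZ (qx (1 - y)) hy) (h5 _ h1)) => z _; rewrite /= addrC.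
have hi' := itinS (leqnSn n) hi; have zc : lK m n y < lc m by case: hi => _; apply.
have /andP[z0 _] := lK_in hw hi'.
have hq : 0 <= qf (lu m) (lc m) (lK m n y) <= 1.
  by apply: (qf_in1 (wf_u hw) (wf_c1 hw)); rewrite z0 ltW.
exact: blD (h4 _ hq) (blZ _ (bl_dqf m _ ht (IH hi'))).
Qed.

Lemma bll_dmlc (e : Order.disp_t) (T : orderType e) (s : T -> R) (h : coords R T0 T1 -> T -> R)
  (xi : coords R T0 T1 -> R) x : l1_le s (rb / 2) -> 0 <= x <= 1 -> bl xi ->
  (forall r z w, h (r *: z + w) = fun t => r * h z t + h w t) ->
  (forall z N, nle z N -> l1_le (h z) N) ->
  bll (fun z => dmlc s x (h z) (xi z)).
move=> hs hx [hxi [K K0 hK]] hl hb; split=> [r z w t hz hw|].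
  have [[N hN] [M hM]] := (proj1 (tangentP z) hz, proj1 (tangentP w) hw).
  by rewrite hl hxi // (dmlc_lin r _ _ t hs hx (hb _ _ hN) (hb _ _ hM)).
have [C C0 hC] := dmlc_bound (T := T).
exists (C * (1 + K)); first by rewrite mulr_ge0 ?(ltW C0) // addr_ge0.
move=> z N hN; apply: l1_le_weak (hC s x (h z) N (xi z) hs (hb z N hN) hx).
by rewrite -mulrA ler_wpM2l ?(ltW C0) // mulrDl mul1r lerD2l hK.
Qed.
End TangentMap.

Section NearF.
Context {d0 d1 : Order.disp_t} {T0 : orderType d0} {T1 : orderType d1}.
Context {I : Type} (F : set_system I) (nu : I -> R).
Hypothesis hj : jctx F nu.
#[local] Instance hjF6 : Filter F := proj1 hj.
Variables (f : coords R T0 T1) (g_ : I -> coords R T0 T1) (d : R).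
Hypothesis hf : small f (rb / 2).
Hypothesis hg : F [set i | nle (g_ i - f) (nu i)].
Hypothesis hgs : F [set i | small (g_ i) rb].
Hypothesis hgw : F [set i | wf d (mof (g_ i))].
Hypothesis hw : wf d (mof f).

Lemma coord_jet (L : coords R T0 T1 -> R) : (forall z w, L (z - w) = L z - L w) ->
  F [set i | `|L (g_ i - f)| <= nu i] ->
  jet F nu (fun i => L (g_ i)) (fun=> L f) (fun i => L (g_ i - f)).
move=> hL h; have k : jet F nu (fun i => L (g_ i)) (fun=> L f) (fun i => L (g_ i) - L f).
  apply: (jet_lip hj (K := 1 + `|L f|)).
  apply: filterS2 h (proj2 hj) => i hi /andP[n0 _]; split; first by rewrite lerDr.
  rewrite -hL; apply: le_trans hi _; rewrite mulrDl mul1r lerDl mulr_ge0 //.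
by apply: (jet_ext hj _ k); apply: filterE => i; split=> //; rewrite hL.
Qed.

Lemma lj_mof : lj F nu d (fun i => mof (g_ i)) (mof f) (fun i => tof f (g_ i - f))
  (pxo f) (qxo f).
have [hs ht] := hf.
have hs1 : F [set i | l1_le (co_s (g_ i)) rb /\ l1_le (fun t => co_s (g_ i) t - co_s f t) (nu i)].
  by apply: filterS2 hgs hg => i [h1 _] [_ _ _ h2 _]; split.
have ht1 : F [set i | l1_le (co_t (g_ i)) rb /\ l1_le (fun t => co_t (g_ i) t - co_t f t) (nu i)].
  by apply: filterS2 hgs hg => i [_ h1] [_ _ _ _ h2]; split.
split=> //.
- by apply: (coord_jet (L := @co_u _ _ _ T0 T1)) => [z w|]; [have [] := co_sub z w|apply: filterS hg => i []].
- by apply: (coord_jet (L := @co_v _ _ _ T0 T1)) => [z w|]; [have [] := co_sub z w|apply: filterS hg => i []].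
- by apply: (coord_jet (L := @co_c _ _ _ T0 T1)) => [z w|]; [have [] := co_sub z w|apply: filterS hg => i []].
- move=> X X0 dX hX h01; apply: (jet_ext hj _ (mjet_comp hj hs hs1 hX h01)).
  by apply: filterE => i; split=> //=; have [_ _ _ -> _] := co_sub (g_ i) f.
- move=> X X0 dX hX h01; apply: (jet_ext hj _ (mjet_flip hj (mjet_comp hj ht ht1) hX h01)).
  by apply: filterE => i; split=> //=; have [_ _ _ _ ->] := co_sub (g_ i) f.
Qed.
End NearF.

Section ConstJets.
Context {I : Type} (F : set_system I) (nu : I -> R).
Hypothesis hj : jctx F nu.
Hypothesis hs : forall e : R, 0 < e -> F [set i | nu i <= e].
#[local] Instance hjF7 : Filter F := proj1 hj.
Notation jet := (jet F nu).

Lemma jet_near_gt X (x : R) dX : jet X (fun=> x) dX -> 0 < x -> F [set i | x / 2 <= X i].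
move=> hX x0; have h : 0 < x / 2 by rewrite divr_gt0.
apply: filterS (jet_close hj hs hX h) => i /=; rewrite ler_norml => /andP[h1 _]; lra.
Qed.

Lemma jet_div X (x : R) dX Y (y : R) dY : jet X (fun=> x) dX -> jet Y (fun=> y) dY -> 0 < y ->
  jet (fun i => X i / Y i) (fun=> x / y) (fun i => (dX i - x / y * dY i) / y).
move=> hX hY y0; have h0 : 0 < y / 2 by rewrite divr_gt0.
have n1 : F [set i | y / 2 <= `|y|] by apply: filterE => i; rewrite /= gtr0_norm //; lra.
have n2 : F [set i | y / 2 <= `|Y i|].
  by apply: filterS (jet_near_gt hY y0) => i h; apply: le_trans h _; exact: ler_norm.
apply: (jet_eq hj (jetM hj hX (jetV hj h0 n1 n2 hY))) => // i.
by field; rewrite gt_eqF.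
Qed.

Lemma jet_ln_const X (x : R) dX : jet X (fun=> x) dX -> 0 < x ->
  jet (fun i => ln (X i)) (fun=> ln x) (fun i => dX i / x).
move=> hX x0; have h0 : 0 < x / 2 by rewrite divr_gt0.
have n1 : F [set i : I | x / 2 <= x] by apply: filterE => i /=; lra.
exact: (jet_ln hj h0 n1 (jet_near_gt hX x0) hX).
Qed.
End ConstJets.

(** * Expansions of the end points of C, U and V *)

Section ReturnJets.
Context {I : Type} (F : set_system I) (nu : I -> R).
Hypothesis hj : jctx F nu.
Hypothesis hs : forall e : R, 0 < e -> F [set i | nu i <= e].
#[local] Instance hjF8 : Filter F := proj1 hj.
Notation jet := (jet F nu).
Variables (d : R) (m : lmap) (m_ t_ : I -> lmap) (px qx : R -> R).
Hypothesis hl : lj F nu d m_ m t_ px qx.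
Notation dlK := (dlK m px qx).
Notation dlV := (dlV m).
Notation lkap := (lkap m px qx).
Notation lD := (lD m px qx).
Implicit Types (n : nat) (P Q Y : I -> R).

Lemma half_litin k d' m' n p q : wf d' m' -> half m' n p q -> p < lc m' -> (k <= n)%N ->
  litin m' k (lV m' q).
move=> hw [/andP[cq q1] gap _ _ _] pc kn.
have hq : lc m' <= q <= 1 by rewrite q1 ltW.
split; first by have /andP[_ ->] := lV_in hw hq; rewrite (lV_ge0 hw hq).
by move=> j jk; apply: lt_trans (gap j (leq_trans jk kn)) pc.
Qed.

Definition dQ n q t := - dlK t n (lV m q) (dlV t q 0) / (lkap n q - 1).
Definition dY n y t dp := (dp - dlK t n y 0) / lD n y.

(** [q_exists] produces some fixed point near [q], while [Q i] is the actual end of the return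
    interval and is not known to be near [q]. Uniqueness of the fixed point identifies the two and
    transfers the expansion. *)
Lemma Q_jet eta n p q P Q : half m n p q -> p < lc m -> q < 1 -> 1 < lkap n q ->
  F [set i | half (m_ i) n (P i) (Q i) /\ P i < lc (m_ i)] ->
  F [set i | dist eta (m_ i) n] -> expR (eta + eta) < al ->
  jet Q (fun=> q) (fun i => dQ n q (t_ i)).
move=> hh pc q1 hk hP hd he; have [[hwf hm] _ _ _ _ _] := hl.
have [/andP[cq _] _ eq _ _] := hh; have hq : lc m < q < 1 by rewrite cq q1.
have hi := half_litin hm hh pc (leqnn n).
have [X [jX fX]] := q_exists hj hs hl hq hi eq hk.
apply: (jet_ext hj _ jX); apply: filterS3 hwf fX (filterI hP hd).
move=> i hw [/andP[cX X1] iX eX] [[hhi pci] hdi]; split=> //.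
have [/andP[cQ Q1] gap eQ _ hc] := hhi; have iQ := half_litin hw hhi pci (leqnn n).
apply/eqP; case: ltgtP => // h; exfalso.
  exact: (right_fix_unique hw hdi he cX h Q1 iQ (ltW hc) eX eQ).
exact: (right_fix_unique hw hdi he cQ h (ltW X1) iX (ltW hc) eQ eX).
Qed.

Lemma Y_jet n p q P dP Q Y y : preimage m n p q y -> lc m < q -> 0 < y -> 0 < lD n y ->
  jet P (fun=> p) dP ->
  F [set i | preimage (m_ i) n (P i) (Q i) (Y i) /\ lc (m_ i) < Q i] ->
  jet Y (fun=> y) (fun i => dY n y (t_ i) (dP i)).
move=> hy cq y0 hD hP hY; have [[hwf hm] _ _ _ _ _] := hl.
have VV := preimage_lt hm cq hy; have [/andP[_ yv] eK iV] := hy.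
have [iy _] := lK_mono hm (ltW y0) (ltW VV) iV.
have y1 : y < 1 by apply: lt_le_trans VV _; case: iV => /andP[].
rewrite -eK in hP.
have [|X [jX fX]] := V_exists hj hs hl _ iy hD hP; first by rewrite y0.
apply: (jet_ext hj _ jX); apply: filterS3 hwf fX hY.
move=> i hw [iX eX] [hp cQ]; split=> //.
have V' := preimage_lt hw cQ hp; have [/andP[Y0 Yv] eY iQ] := hp.
have [iY _] := lK_mono hw Y0 (ltW V') iQ; have [/andP[X0 _] _] := iX.
apply/eqP; case: ltgtP => // h; exfalso.
  have [_ [_ /(_ h)]] := lK_mono hw X0 (ltW h) iY; by rewrite eX eY ltxx.
have [_ [_ /(_ h)]] := lK_mono hw Y0 (ltW h) iX; by rewrite eX eY ltxx.
Qed.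

Lemma qf_near X (x : R) dX : jet X (fun=> x) dX -> 0 <= x < lc m -> F [set i | 0 <= X i <= 1] ->
  jet (fun i => qf (lu (m_ i)) (lc (m_ i)) (X i)) (fun=> qf (lu m) (lc m) x)
    (fun i => dqf m (t_ i) x (dX i)) /\
  F [set i | 0 <= qf (lu (m_ i)) (lc (m_ i)) (X i) <= 1].
move=> hX /andP[x0 xc] h01; have [[hwf hm] _ _ hc _ _] := hl.
pose e := (lc m - x) / 3; have e0 : 0 < e by rewrite divr_gt0 // subr_gt0.
have ee : lc m - x = e + e + e by rewrite /e; field.
have k : F [set i | 0 <= X i <= lc (m_ i) - e].
  apply: filterS3 h01 (jet_close hj hs hX e0) (jet_close hj hs hc e0) => i /andP[h1 _] /=.
  by rewrite !ler_norml h1 /= => /andP[a1 a2] /andP[b1 b2]; clear - hl al1 hs a2 b1 ee; lra.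
split.
  apply: (qf_jet hj hl e0 hX); apply: filterS k => i h; split=> //.
  by rewrite x0 /=; clear - hl al1 hs ee e0; lra.
apply: filterS2 hwf k => i hw /andP[h1 h2]; apply: (qf_in1 (wf_u hw) (wf_c1 hw)).
by rewrite h1 /=; clear - hl al1 hs h2 e0; lra.
Qed.

(* All the points that enter the renormalized parameters on one side. *)
Lemma orbit_jet n Y y dYi : jet Y (fun=> y) dYi -> litin m n y ->
  F [set i | 0 <= Y i <= 1] -> forall j, (j < n)%N ->
  [/\ jet (fun i => ln (lc (m_ i) - lK (m_ i) j (Y i))) (fun=> ln (lc m - lK m j y))
       (fun i => (lc (t_ i) - dlK (t_ i) j y (dYi i)) / (lc m - lK m j y)),
     jet (fun i => qf (lu (m_ i)) (lc (m_ i)) (lK (m_ i) j (Y i)))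
       (fun=> qf (lu m) (lc m) (lK m j y))
       (fun i => dqf m (t_ i) (lK m j y) (dlK (t_ i) j y (dYi i))) &
     F [set i | 0 <= qf (lu (m_ i)) (lc (m_ i)) (lK (m_ i) j (Y i)) <= 1]].
move=> hY hi h01 j jn; have [[hwf hm] _ _ hc _ _] := hl.
have hij := itinS (ltnW jn) hi; have [k1 k2] := lK_near hj hs hl hY h01 hij.
have zc : lK m j y < lc m by case: hi => _; apply.
have /andP[z0 _] := lK_in hm hij.
have k3 : F [set i | 0 <= lK (m_ i) j (Y i) <= 1].
  by apply: filterS2 hwf k2 => i hw h; exact: (lK_in hw).
have [q1 q2] := qf_near k1 (introT andP (conj z0 zc)) k3; split=> //.
by apply: (jet_ln_const hj hs (jetB hj hc k1)); rewrite subr_gt0.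
Qed.
End ReturnJets.

(** One constant for finitely many indices, by taking maxima. It also serves with a trivial filter,
    merely to merge constants. *)
Lemma fin_filter {I : Type} (F : set_system I) (hF : Filter F) n (Pr : nat -> R -> I -> Prop) :
  (forall i K K' x, K <= K' -> Pr i K x -> Pr i K' x) ->
  (forall i, (i < n)%N -> exists K, F [set x | Pr i K x]) ->
  exists K, F [set x | forall i, (i < n)%N -> Pr i K x].
move=> mono; elim: n => [|n IH] h; first by exists 0; apply: filterE.
have [i jn|K hK] := IH; first by apply: h; exact: leqW.
have [K' hK'] := h n (ltnSn n); exists (Num.max K K').
apply: filterS2 hK hK' => x h1 h2 i; rewrite ltnS leq_eqVlt => /predU1P[->|ijn].
  by apply: mono h2; rewrite le_max lexx orbT.
by apply: mono (h1 i ijn); rewrite le_max lexx.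
Qed.

Lemma le_sum5 (x1 x2 x3 x4 x5 : R) : 0 <= x1 -> 0 <= x2 -> 0 <= x3 -> 0 <= x4 ->
  0 <= x5 -> let S := x1 + x2 + x3 + x4 + x5 in [/\ x1 <= S, x2 <= S, x3 <= S, x4 <= S & x5 <= S].
by move=> h1 h2 h3 h4 h5 S; rewrite /S; split; lra. Qed.

Lemma lK_0 d (m : lmap) n : wf d m -> lK m n 0 = 0.
move=> hw; have [p0 _ _] := wf_p hw; have [q0 _ _] := sl_flip (wf_q hw).
have /andP[c0 _] := wf_c1 hw; elim: n => [|n IH]; first exact: q0.
have -> : lK m n.+1 0 = lf0 m (lK m n 0) by [].
by rewrite IH /lf0 /br /qf /rr subr0 divff ?gt_eqF // powR1 subrr mulr0 p0.
Qed.

Lemma preimage_gt0 d (m : lmap) n p q y : wf d m -> preimage m n p q y -> 0 < p -> 0 < y.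
move=> h0 [/andP[y0 _] ey _] pp; rewrite lt_neqAle y0 andbT; apply/eqP => e.
by move: pp; rewrite -ey -e (lK_0 n h0) ltxx.
Qed.

Lemma ljet_rtime {I : Type} (F : set_system I) (nu : I -> R) (hj : jctx F nu)
  {e e' : Order.disp_t} {T : orderType e} {T' : orderType e'} n (X dX : I -> rtime T T' n -> R) X0 :
  ljet F nu (fun i t => X i (inl t)) (fun t => X0 (inl t)) (fun i t => dX i (inl t)) ->
  (forall (j : 'I_n) o, jet F nu (fun i => X i (inr (j, inl o))) (fun=> X0 (inr (j, inl o)))
     (fun i => dX i (inr (j, inl o)))) ->
  (forall j : 'I_n, ljet F nu (fun i t => X i (inr (j, inr t))) (fun t => X0 (inr (j, inr t)))
     (fun i t => dX i (inr (j, inr t)))) ->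
  ljet F nu X X0 dX.
have flt : Filter F := proj1 hj.
move=> [K1 hK1] h2 h3.
have [K2 hK2] : exists K, F [set i | forall k, (k < n)%N -> forall (j : 'I_n) o, j = k :> nat ->
    `|X i (inr (j, inl o)) - X0 (inr (j, inl o)) - dX i (inr (j, inl o))| <= K * nu i ^+ 2].
  apply: (@fin_filter I F flt n (fun k K i => forall (j : 'I_n) o, j = k :> nat ->
    `|X i (inr (j, inl o)) - X0 (inr (j, inl o)) - dX i (inr (j, inl o))| <= K * nu i ^+ 2)).
    move=> k K K' i KK h j o jk; apply: le_trans (h j o jk) _.
    by rewrite ler_wpM2r // exprn_even_ge0.
  move=> k kn; have [K hK] := h2 (Ordinal kn) ord0; exists K; apply: filterS hK => i /= [_ _ h] j o jk.
  by rewrite (ord1 o) (_ : j = Ordinal kn) //; exact: val_inj.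
have [K3 hK3] : exists K, F [set i | forall k, (k < n)%N -> forall (j : 'I_n), j = k :> nat ->
    l1_le (fun t => X i (inr (j, inr t)) - X0 (inr (j, inr t)) - dX i (inr (j, inr t))) (K * nu i ^+ 2)].
  apply: (@fin_filter I F flt n (fun k K i => forall (j : 'I_n), j = k :> nat ->
    l1_le (fun t => X i (inr (j, inr t)) - X0 (inr (j, inr t)) - dX i (inr (j, inr t))) (K * nu i ^+ 2))).
    move=> k K K' i KK h j jk; apply: l1_le_weak (h j jk).
    by rewrite ler_wpM2r // exprn_even_ge0.
  move=> k kn; have [K hK] := h3 (Ordinal kn); exists K; apply: filterS hK => i /= h j jk.
  by rewrite (_ : j = Ordinal kn) //; exact: val_inj.
exists (K1 + n%:R * (K2 + K3)); apply: filterS3 hK1 hK2 hK3 => i /= h1 h2' h3'.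
have -> : (K1 + n%:R * (K2 + K3)) * nu i ^+ 2 = K1 * nu i ^+ 2 + n%:R * (K2 * nu i ^+ 2 + K3 * nu i ^+ 2) by ring.
apply: l1_le_rtime => // [j o|j]; first exact: (h2' j (ltn_ord j)).
exact: (h3' j (ltn_ord j)).
Qed.

(** * The candidate derivative of the renormalization operator *)

Section Derivative.
Context {d0 d1 : Order.disp_t} {T0 : orderType d0} {T1 : orderType d1}.
Notation coords := (coords R T0 T1).
Implicit Types (z w : coords).
Variables (f : coords) (dl eta : R) (a b : nat) (p q V1 W1 : R).
Let m := mof f.
Let m' := lflip m.
Let px := pxo f.
Let qx := qxo f.
Let tz z := tof f z.
Let tz' z := tflip (tz z).

(** [V1] is the left end of V, and [W1] that of the flipped U. The two multiplier conditions make
    the end points of C move smoothly. *)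
Record base : Prop := Base {
  b_small : small f (rb / 2);
  b_smalld : small f dl;
  b_wf : wf dl m;
  b_ren : ren m a b p q;
  b_ret : retC al f = (p, q);
  b_V : preimage m b p q V1;
  b_W : preimage m' a (1 - q) (1 - p) W1;
  b_a : (0 < a)%N;
  b_b : (0 < b)%N;
  b_eta : expR (eta + eta) < al;
  b_kR : 1 < lkap m px qx b q;
  b_kL : 1 < lkap m' qx px a (1 - p) }.
Hypothesis hb : base.

(** Derivatives of [q], [p] and of the ends of V and of the flipped U. Everything on the left of [c]
    is computed in flipped coordinates, where the fixed point is [1 - p]; this explains the signs of
    [Dp] and [Dq]. *)
Definition Dq z := dQ m px qx b q (tz z).
Definition Dp z := - dQ m' qx px a (1 - p) (tz' z).
Definition DV2 z := dlV m (tz z) q (Dq z).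
Definition DV1 z := dY m px qx b V1 (tz z) (Dp z).
Definition DW2 z := dlV m' (tz' z) (1 - p) (- Dp z).
Definition DW1 z := dY m' qx px a W1 (tz' z) (- Dq z).
Notation V2 := (lV m q).
Notation W2 := (lV m' (1 - p)).
Definition Dv' z := (co_v z + DV2 z - (co_v f - 1 + V2) / (V2 - V1) * (DV2 z - DV1 z)) / (V2 - V1).
Definition Du' z := (co_u z + DW2 z - (co_u f - 1 + W2) / (W2 - W1) * (DW2 z - DW1 z)) / (W2 - W1).
Definition Dc' z := (co_c z - Dp z - (co_c f - p) / (q - p) * (Dq z - Dp z)) / (q - p).

Definition Dlog m0 px0 qx0 t j y dy := (lc t - dlK m0 px0 qx0 t j y dy) / (lc m0 - lK m0 j y).
Definition Dqf m0 px0 qx0 t j y dy := dqf m0 t (lK m0 j y) (dlK m0 px0 qx0 t j y dy).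

Definition DT z (tau : rtime T1 T0 b) : R := match tau with
  | inl t => dmlc (co_t f) V2 (co_t z) (DV2 z) t - dmlc (co_t f) V1 (co_t z) (DV1 z) t
  | inr (i, inl _) => (al - 1) * (Dlog m px qx (tz z) i V2 (DV2 z) - Dlog m px qx (tz z) i V1 (DV1 z))
  | inr (i, inr t) =>
      dmlc (co_s f) (qf (lu m) (lc m) (lK m i V2)) (co_s z) (Dqf m px qx (tz z) i V2 (DV2 z)) t -
      dmlc (co_s f) (qf (lu m) (lc m) (lK m i V1)) (co_s z) (Dqf m px qx (tz z) i V1 (DV1 z)) t
  end.
Definition DS z (tau : rtime T0 T1 a) : R := match tau with
  | inl t => dmlc (co_s f) (1 - W1) (co_s z) (- DW1 z) t - dmlc (co_s f) (1 - W2) (co_s z) (- DW2 z) t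
  | inr (i, inl _) => - ((al - 1) *
      (Dlog m' qx px (tz' z) i W2 (DW2 z) - Dlog m' qx px (tz' z) i W1 (DW1 z)))
  | inr (i, inr t) =>
      dmlc (co_t f) (1 - qf (lu m') (lc m') (lK m' i W1)) (co_t z) (- Dqf m' qx px (tz' z) i W1 (DW1 z)) t -
      dmlc (co_t f) (1 - qf (lu m') (lc m') (lK m' i W2)) (co_t z) (- Dqf m' qx px (tz' z) i W2 (DW2 z)) t
  end.

Definition DR z : Defs.coords R (rtime T0 T1 a) (rtime T1 T0 b) := ((Du' z, Dv' z), (Dc' z, DS z, DT z)).

Let hw : wf dl m := b_wf hb.
Let hw' : wf dl m' := wf_flip hw.
Let hf := b_small hb.
Let bt : blt tz := blt_tof hf.
Let bt' : blt tz' := blt_flip bt.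
Let pc : p < lc m. by have [] := ren_bd (b_ren hb). Qed.
Let cq : lc m < q. by have [] := ren_bd (b_ren hb). Qed.
Let cp : lc m' < 1 - p. by rewrite /m' /= ltrD2l ltrN2. Qed.
Let iV2 : litin m b V2. by case: (b_V hb). Qed.
Let iW2 : litin m' a W2. by case: (b_W hb). Qed.
Let VV : V1 < V2. exact: (preimage_lt hw cq (b_V hb)). Qed.
Let WW : W1 < W2. exact: (preimage_lt hw' cp (b_W hb)). Qed.
Let V10 : 0 <= V1. by case: (b_V hb) => /andP[]. Qed.
Let W10 : 0 <= W1. by case: (b_W hb) => /andP[]. Qed.
Let iV1 : litin m b V1.
by have [] := lK_mono hw V10 (ltW VV) iV2. Qed.
Let iW1 : litin m' a W1.
by have [] := lK_mono hw' W10 (ltW WW) iW2. Qed.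

Lemma bl_Dq : bl Dq.
have h : bl (fun z => dlK m px qx (tz z) b V2 (dlV m (tz z) q 0)).
  exact: (bl_dlK px qx hw bt (bl_dlV m q bt (bl0 (T0 := T0) (T1 := T1))) iV2).
apply: bl_ext (blM (lkap m px qx b q - 1)^-1 (blZ (-1) h)) => z _.
by rewrite mulN1r.
Qed.

Lemma bl_Dp : bl Dp.
have h : bl (fun z => dlK m' qx px (tz' z) a W2 (dlV m' (tz' z) (1 - p) 0)).
  exact: (bl_dlK qx px hw' bt' (bl_dlV m' (1 - p) bt' (bl0 (T0 := T0) (T1 := T1))) iW2).
apply: bl_ext (blM (lkap m' qx px a (1 - p) - 1)^-1 h) => z _.
by rewrite /Dp /dQ mulNr opprK.
Qed.

Lemma blN L : bl L -> bl (fun z => - L z).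
by move=> h; apply: bl_ext (blZ (-1) h) => z _; rewrite mulN1r. Qed.

Lemma bl_DV2 : bl DV2. exact: (bl_dlV m q bt bl_Dq). Qed.
Lemma bl_DW2 : bl DW2. exact: (bl_dlV m' (1 - p) bt' (blN bl_Dp)). Qed.

Lemma bl_DV1 : bl DV1.
exact: (blM _ (blB bl_Dp (bl_dlK px qx hw bt (bl0 (T0 := T0) (T1 := T1)) iV1))). Qed.

Lemma bl_DW1 : bl DW1.
exact: (blM _ (blB (blN bl_Dq) (bl_dlK qx px hw' bt' (bl0 (T0 := T0) (T1 := T1)) iW1))). Qed.

Lemma bl_Dv' : bl Dv'.
exact: (blM _ (blB (blD bl_v bl_DV2) (blZ _ (blB bl_DV2 bl_DV1)))). Qed.

Lemma bl_Du' : bl Du'.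
exact: (blM _ (blB (blD bl_u bl_DW2) (blZ _ (blB bl_DW2 bl_DW1)))). Qed.

Lemma bl_Dc' : bl Dc'.
exact: (blM _ (blB (blB bl_c bl_Dp) (blZ _ (blB bl_Dq bl_Dp)))). Qed.

Lemma bl_Dlog m0 px0 qx0 t n j y (dy : coords -> R) : wf dl m0 -> blt t -> bl dy ->
  litin m0 n y -> (j < n)%N -> bl (fun z => Dlog m0 px0 qx0 (t z) j y (dy z)).
move=> h0 ht hy hi jn; have [_ _ hc _ _] := ht.
exact: (blM _ (blB hc (bl_dlK px0 qx0 h0 ht hy (itinS (ltnW jn) hi)))).
Qed.

Lemma bl_Dqf m0 px0 qx0 t n j y (dy : coords -> R) : wf dl m0 -> blt t -> bl dy ->
  litin m0 n y -> (j < n)%N -> bl (fun z => Dqf m0 px0 qx0 (t z) j y (dy z)).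
by move=> h0 ht hy hi jn; apply: (bl_dqf m0 _ ht (bl_dlK px0 qx0 h0 ht hy (itinS (ltnW jn) hi))).
Qed.

Lemma orbit_qf01 m0 n j y : wf dl m0 -> litin m0 n y -> (j < n)%N ->
  0 <= qf (lu m0) (lc m0) (lK m0 j y) <= 1.
move=> h0 hi jn; have /andP[z0 _] := lK_in h0 (itinS (ltnW jn) hi).
have zc : lK m0 j y < lc m0 by case: hi => _; apply.
by apply: (qf_in1 (wf_u h0) (wf_c1 h0)); rewrite z0 ltW.
Qed.

Lemma bll_rtime {e e' : Order.disp_t} {T : orderType e} {T' : orderType e'} n
  (L : coords -> rtime T T' n -> R) : bll (fun z t => L z (inl t)) ->
  (forall (i : 'I_n) o, bl (fun z => L z (inr (i, inl o)))) ->
  (forall i : 'I_n, bll (fun z t => L z (inr (i, inr t)))) -> bll L.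
move=> [l1 [K1 K10 hK1]] h2 h3; split.
  move=> r z w [t|[i [ o|t]]] hz hwv; first exact: l1.
    by have [h _] := h2 i o; exact: h.
  by have [h _] := h3 i; exact: h.
(* A filter on the one-point type, used only to extract a common constant for the [n] blocks. *)
have [K2 hK2] : exists K, globally [set: unit] [set _ | forall i, (i < n)%N -> 0 <= K /\ forall (j : 'I_n) o z N,
    j = i :> nat -> nle z N -> `|L z (inr (j, inl o))| <= K * N].
  apply: (@fin_filter unit _ (globally_filter _) n (fun i K _ => 0 <= K /\ forall (j : 'I_n) o z N,
    j = i :> nat -> nle z N -> `|L z (inr (j, inl o))| <= K * N)).
    move=> i K K' _ KK [K0 h]; split=> [|j o z N ji hN]; first exact: le_trans KK.
    by apply: le_trans (h j o z N ji hN) _; rewrite ler_wpM2r // (nle_ge0 hN).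
  move=> i jn; have [_ [K K0 hK]] := h2 (Ordinal jn) ord0; exists K => ? ?; split=> // j o z N ji hN.
  by rewrite (ord1 o) (_ : j = Ordinal jn) ?hK //; exact: val_inj.
have [K3 hK3] : exists K, globally [set: unit] [set _ | forall i, (i < n)%N -> 0 <= K /\ forall (j : 'I_n) z N,
    j = i :> nat -> nle z N -> l1_le (fun t => L z (inr (j, inr t))) (K * N)].
  apply: (@fin_filter unit _ (globally_filter _) n (fun i K _ => 0 <= K /\ forall (j : 'I_n) z N,
    j = i :> nat -> nle z N -> l1_le (fun t => L z (inr (j, inr t))) (K * N))).
    move=> i K K' _ KK [K0 h]; split=> [|j z N ji hN]; first exact: le_trans KK.
    by apply: l1_le_weak (h j z N ji hN); rewrite ler_wpM2r // (nle_ge0 hN).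
  move=> i jn; have [_ [K K0 hK]] := h3 (Ordinal jn); exists K => ? ?; split=> // j z N ji hN.
  by rewrite (_ : j = Ordinal jn) ?hK //; [exact: hK | exact: val_inj].
exists (K1 + n%:R * (`|K2| + `|K3|)); first by rewrite addr_ge0 // mulr_ge0 ?addr_ge0.
move=> z N hN; have N0 := nle_ge0 hN.
have -> : (K1 + n%:R * (`|K2| + `|K3|)) * N = K1 * N + n%:R * (`|K2| * N + `|K3| * N) by ring.
apply: l1_le_rtime => [|i o|i]; first exact: hK1.
  have [k0 h] := hK2 tt I i (ltn_ord i); apply: le_trans (h i o z N erefl hN) _.
  by rewrite ler_wpM2r // ler_norm.
have [k0 h] := hK3 tt I i (ltn_ord i); apply: l1_le_weak (h i z N erefl hN).
by rewrite ler_wpM2r // ler_norm.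
Qed.

Let colin_s r z w : co_s (r *: z + w) = (fun t => r * co_s z t + co_s w t).
by have [] := co_lin r z w. Qed.
Let colin_t r z w : co_t (r *: z + w) = (fun t => r * co_t z t + co_t w t).
by have [] := co_lin r z w. Qed.

Lemma bll_s x (xi : coords -> R) : 0 <= x <= 1 -> bl xi -> bll (fun z => dmlc (co_s f) x (co_s z) (xi z)).
by move=> hx hxi; have [hs _] := hf; apply: (bll_dmlc hs hx hxi) => // z N []. Qed.

Lemma bll_t x (xi : coords -> R) : 0 <= x <= 1 -> bl xi -> bll (fun z => dmlc (co_t f) x (co_t z) (xi z)).
by move=> hx hxi; have [_ ht] := hf; apply: (bll_dmlc ht hx hxi) => // z N []. Qed.

Let sub01 (x : R) : 0 <= x <= 1 -> 0 <= 1 - x <= 1.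
by move=> /andP[h1 h2]; rewrite subr_ge0 h2 lerBlDr lerDl h1. Qed.

Lemma bll_DT : bll DT.
have hV2 : 0 <= V2 <= 1 by case: iV2. have hV1 : 0 <= V1 <= 1 by case: iV1.
apply: bll_rtime => [|i o|i].
- exact: (bllB (bll_t hV2 bl_DV2) (bll_t hV1 bl_DV1)).
- exact: (blZ _ (blB (bl_Dlog px qx hw bt bl_DV2 iV2 (ltn_ord i)) (bl_Dlog px qx hw bt bl_DV1 iV1 (ltn_ord i)))).
- apply: bllB; apply: bll_s; try exact: (orbit_qf01 hw _ (ltn_ord i)).
    exact: (bl_Dqf px qx hw bt bl_DV2 iV2 (ltn_ord i)).
  exact: (bl_Dqf px qx hw bt bl_DV1 iV1 (ltn_ord i)).
Qed.

Lemma bll_DS : bll DS.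
have hV2 : 0 <= W2 <= 1 by case: iW2. have hV1 : 0 <= W1 <= 1 by case: iW1.
apply: bll_rtime => [|i o|i].
- exact: (bllB (bll_s (sub01 hV1) (blN bl_DW1)) (bll_s (sub01 hV2) (blN bl_DW2))).
- exact: (blN (blZ _ (blB (bl_Dlog qx px hw' bt' bl_DW2 iW2 (ltn_ord i)) (bl_Dlog qx px hw' bt' bl_DW1 iW1 (ltn_ord i))))).
- apply: bllB; apply: bll_t; try (apply: sub01; exact: (orbit_qf01 hw' _ (ltn_ord i))).
    exact: (blN (bl_Dqf qx px hw' bt' bl_DW1 iW1 (ltn_ord i))).
  exact: (blN (bl_Dqf qx px hw' bt' bl_DW2 iW2 (ltn_ord i))).
Qed.

Lemma DR_linear (r : R) z w : tangent z -> tangent w -> DR (r *: z + w) = r *: DR z + DR w.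
move=> hz hw0; have [e1 _] := bl_Du'; have [e2 _] := bl_Dv'; have [e3 _] := bl_Dc'.
have [e4 _] := bll_DS; have [e5 _] := bll_DT.
rewrite /DR e1 // e2 // e3 //.
have -> : DS (r *: z + w) = fun t => r * DS z t + DS w t by apply/funext => t; exact: e4.
have -> : DT (r *: z + w) = fun t => r * DT z t + DT w t by apply/funext => t; exact: e5.
by [].
Qed.

Lemma DR_bounded : exists M : R, forall z, tangent z -> (norm (DR z) <= M%:E * norm z)%E.
have [_ [K1 k1 h1]] := bl_Du'; have [_ [K2 k2 h2]] := bl_Dv'; have [_ [K3 k3 h3]] := bl_Dc'.
have [_ [K4 k4 h4]] := bll_DS; have [_ [K5 k5 h5]] := bll_DT.
exists (K1 + K2 + K3 + K4 + K5) => z /tangentP[M hM].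
have hfin : norm z = (fine (norm z))%:E.
  have n0 := norm_ge0 z; have /normP nM := hM.
  by rewrite fineK // fin_numE; case: (norm z) n0 nM.
have hN : nle z (fine (norm z)) by apply/normP; rewrite -hfin.
have N0 := nle_ge0 hN; rewrite hfin -EFinM; apply/normP; set N := fine _ in hN N0 *.
have e : (K1 + K2 + K3 + K4 + K5) * N = K1 * N + K2 * N + K3 * N + K4 * N + K5 * N by ring.
have [n1 n2 n3 n4 n5] : [/\ 0 <= K1 * N, 0 <= K2 * N, 0 <= K3 * N, 0 <= K4 * N & 0 <= K5 * N].
  by split; exact: mulr_ge0.
have l1 := h1 z N hN; have l2 := h2 z N hN; have l3 := h3 z N hN.
have [s1 s2 s3 s4 s5] := le_sum5 n1 n2 n3 n4 n5.
rewrite e; split; [exact: le_trans s1|exact: le_trans s2|exact: le_trans s3| |].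
  exact: l1_le_weak s4 (h4 z N hN).
exact: l1_le_weak s5 (h5 z N hN).
Qed.
Section RenormJets.
Notation renorm := (renorm al).
Context {I : Type} (F : set_system I) (nu : I -> R).
Hypothesis hj : jctx F nu.
Hypothesis hs : forall e : R, 0 < e -> F [set i | nu i <= e].
#[local] Instance hjF9 : Filter F := proj1 hj.
Notation jet := (jet F nu).
Notation ljet := (ljet F nu).
Variables (g_ : I -> coords) (P Q V_ W_ : I -> R).
Hypothesis hg : F [set i | nle (g_ i - f) (nu i)].
Hypothesis hgs : F [set i | small (g_ i) rb].
Hypothesis hgr : F [set i | [/\ wf dl (mof (g_ i)), ren (mof (g_ i)) a b (P i) (Q i),
  retC al (g_ i) = (P i, Q i), preimage (mof (g_ i)) b (P i) (Q i) (V_ i) &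
  preimage (lflip (mof (g_ i))) a (1 - Q i) (1 - P i) (W_ i)]].
Hypothesis hgd : F [set i | dist eta (mof (g_ i)) b /\ dist eta (lflip (mof (g_ i))) a].

Let t_ i := tof f (g_ i - f).
Let reg0 : reg dl m px qx := reg_mof hf (b_smalld hb).
Let reg1 : reg dl m' qx px := reg_flip reg0.
Let qc : 1 - q < lc m'. by rewrite /m' /= ltrD2l ltrN2. Qed.
Let hR : half m b p q. by have [] := b_ren hb. Qed.
Let hL : half m' a (1 - q) (1 - p). by have [] := b_ren hb. Qed.
Let q1 : q < 1. exact: (half_lt1 hw hR pc (b_b hb)). Qed.
Let p1 : 1 - p < 1. exact: (half_lt1 hw' hL qc (b_a hb)). Qed.
Let hgw : F [set i | wf dl (mof (g_ i))].
by apply: filterS hgr => i []. Qed.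
Let hl : lj F nu dl (fun i => mof (g_ i)) m t_ px qx := lj_mof hj hf hg hgs hgw hw.
Let hl' : lj F nu dl (fun i => lflip (mof (g_ i))) m' (fun i => tflip (t_ i)) qx px := lj_flip hj hl.

Lemma jet_Q : jet Q (fun=> q) (fun i => Dq (g_ i - f)).
apply: (Q_jet hj hs hl (P := P) hR pc q1 (b_kR hb) _ _ (b_eta hb)) => //.
  by apply: filterS hgr => i [_ h _ _ _]; have [_ h1 _ _] := ren_bd h; have [] := h.
by apply: filterS hgd => i [].
Qed.

Lemma jet_P' : jet (fun i => 1 - P i) (fun=> 1 - p) (fun i => - Dp (g_ i - f)).
have h : jet (fun i => 1 - P i) (fun=> 1 - p)
    (fun i => dQ m' qx px a (1 - p) (tflip (t_ i))).
  apply: (Q_jet hj hs hl' (P := fun i => 1 - Q i) hL qc p1 (b_kL hb) _ _ (b_eta hb)) => //.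
    apply: filterS hgr => i [_ h _ _ _]; have [_ _ h1 _] := ren_bd h; have [_ h2] := h.
    by split=> //=; rewrite ltrD2l ltrN2.
  by apply: filterS hgd => i [].
by apply: (jet_eq hj h) => // i; rewrite /Dp opprK.
Qed.

Lemma jet_P : jet P (fun=> p) (fun i => Dp (g_ i - f)).
apply: (jet_ext hj _ (jetB hj (jet_const hj 1) jet_P')); apply: filterE => i.
by split; rewrite ?subKr // sub0r opprK.
Qed.

Lemma jet_Q' : jet (fun i => 1 - Q i) (fun=> 1 - q) (fun i => - Dq (g_ i - f)).
apply: (jet_ext hj _ (jetB hj (jet_const hj 1) jet_Q)); apply: filterE => i.
by split=> //; rewrite sub0r.
Qed.

Lemma jet_V2 : jet (fun i => lV (mof (g_ i)) (Q i)) (fun=> V2) (fun i => DV2 (g_ i - f)).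
by have [] := lV_near hj hs hl jet_Q (introT andP (conj cq q1)). Qed.

Lemma jet_W2 : jet (fun i => lV (lflip (mof (g_ i))) (1 - P i)) (fun=> W2)
  (fun i => DW2 (g_ i - f)).
by have [] := lV_near hj hs hl' jet_P' (introT andP (conj cp p1)). Qed.

Let pp : 0 < p. by have := p1; rewrite ltrBlDr ltrDl. Qed.
Let q0 : 0 < 1 - q. by rewrite subr_gt0; exact: q1. Qed.
Let V1p : 0 < V1. exact: (preimage_gt0 hw (b_V hb) pp). Qed.
Let W1p : 0 < W1. exact: (preimage_gt0 hw' (b_W hb) q0). Qed.

Lemma jet_V1 : jet V_ (fun=> V1) (fun i => DV1 (g_ i - f)).
apply: (Y_jet hj hs hl (Q := Q) (b_V hb) cq V1p (lD_gt0 hw reg0 iV1) jet_P).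
by apply: filterS hgr => i [_ h _ h1 _]; have [] := ren_bd h.
Qed.

Lemma jet_W1 : jet W_ (fun=> W1) (fun i => DW1 (g_ i - f)).
apply: (Y_jet hj hs hl' (Q := fun i => 1 - P i) (b_W hb) cp W1p (lD_gt0 hw' reg1 iW1) jet_Q').
apply: filterS hgr => i [_ h _ _ h1]; have [_ h2 _ _] := ren_bd h; split; first exact: h1.
by rewrite /= ltrD2l ltrN2.
Qed.

Let rbf : small f rb. exact: (small_rb hf). Qed.

Let near_formula (Z : coords -> R) (Y : I -> R) (y : R) (dy : I -> R) : jet Y (fun=> y) dy ->
  F [set i | Z (g_ i) = Y i] -> Z f = y -> jet (fun i => Z (g_ i)) (fun=> Z f) dy.
by move=> h1 h2 e; apply: (jet_ext hj _ h1); apply: filterS h2 => i /= ->; rewrite e. Qed.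

Let subgt (x y : R) : x < y -> 0 < y - x. by rewrite subr_gt0. Qed.

Lemma jet_v' : jet (fun i => co_v (renorm a b (g_ i))) (fun=> co_v (renorm a b f))
  (fun i => Dv' (g_ i - f)).
have [_ _ hv _ _ _] := hl; have h := jet_div hj hs (jetD hj (jetB hj hv (jet_const hj 1)) jet_V2)
  (jetB hj jet_V2 jet_V1) (subgt VV).
apply: (near_formula (Z := fun g => co_v (renorm a b g))).
- by apply: (jet_eq hj h) => // i; rewrite [in LHS]subr0.
- by apply: filterS hgr => i [h1 h2 h3 h4 h5]; exact: (renorm_v h1 h2 h3 h4).
- exact: (renorm_v hw (b_ren hb) (b_ret hb) (b_V hb)).
Qed.

Lemma jet_u' : jet (fun i => co_u (renorm a b (g_ i))) (fun=> co_u (renorm a b f))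
  (fun i => Du' (g_ i - f)).
have [_ hu _ _ _ _] := hl; have h := jet_div hj hs (jetD hj (jetB hj hu (jet_const hj 1)) jet_W2)
  (jetB hj jet_W2 jet_W1) (subgt WW).
apply: (near_formula (Z := fun g => co_u (renorm a b g))).
- by apply: (jet_eq hj h) => // i; rewrite [in LHS]subr0.
- by apply: filterS hgr => i [h1 h2 h3 h4 h5]; exact: (renorm_u h1 h2 h3 h5).
- exact: (renorm_u hw (b_ren hb) (b_ret hb) (b_W hb)).
Qed.

Lemma jet_c' : jet (fun i => co_c (renorm a b (g_ i))) (fun=> co_c (renorm a b f))
  (fun i => Dc' (g_ i - f)).
have [_ _ _ hc _ _] := hl; have pq : 0 < q - p by rewrite subr_gt0 (lt_trans pc cq).
have h := jet_div hj hs (jetB hj hc jet_P) (jetB hj jet_Q jet_P) pq.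
apply: (near_formula (Z := fun g => co_c (renorm a b g))).
- exact: h.
- by apply: filterS hgr => i [h1 h2 h3 h4 h5]; exact: (renorm_c a b h3).
- exact: (renorm_c a b (b_ret hb)).
Qed.

Let ljet_near (d : Order.disp_t) (T : orderType d) (Z : coords -> T -> R) (Y : I -> T -> R)
  (y : T -> R) (dy : I -> T -> R) : ljet Y y dy ->
  F [set i | Z (g_ i) =1 Y i] -> Z f =1 y -> ljet (fun i => Z (g_ i)) (Z f) dy.
move=> [K hK] h2 e; exists K; apply: filterS2 hK h2 => i /= h e'.
by apply: l1_le_eq h => t; rewrite e' e.
Qed.

Let hs1 : F [set i | l1_le (co_s (g_ i)) rb /\ l1_le (fun t => co_s (g_ i) t - co_s f t) (nu i)].
by apply: filterS2 hgs hg => i [h1 _] [_ _ _ h2 _]; split. Qed.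
Let ht1 : F [set i | l1_le (co_t (g_ i)) rb /\ l1_le (fun t => co_t (g_ i) t - co_t f t) (nu i)].
by apply: filterS2 hgs hg => i [_ h1] [_ _ _ _ h2]; split. Qed.

Let mls X x dX : jet X (fun=> x) dX -> 0 <= x <= 1 -> F [set i | 0 <= X i <= 1] ->
  ljet (fun i => mlc (co_s (g_ i)) (X i)) (mlc (co_s f) x)
    (fun i => dmlc (co_s f) x (co_s (g_ i - f)) (dX i)).
move=> hX h01 hX01; have [hs0 _] := hf; have [K hK] := mlc_jet hj hs0 hX h01 hX01 hs1.
by exists K; apply: filterS hK => i /=; have [_ _ _ -> _] := co_sub (g_ i) f.
Qed.

Let mlt X x dX : jet X (fun=> x) dX -> 0 <= x <= 1 -> F [set i | 0 <= X i <= 1] ->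
  ljet (fun i => mlc (co_t (g_ i)) (X i)) (mlc (co_t f) x)
    (fun i => dmlc (co_t f) x (co_t (g_ i - f)) (dX i)).
move=> hX h01 hX01; have [_ hs0] := hf; have [K hK] := mlc_jet hj hs0 hX h01 hX01 ht1.
by exists K; apply: filterS hK => i /=; have [_ _ _ _ ->] := co_sub (g_ i) f.
Qed.

Let jflip X x dX : jet X (fun=> x) dX -> jet (fun i => 1 - X i) (fun=> 1 - x) (fun i => - dX i).
move=> h; apply: (jet_ext hj _ (jetB hj (jet_const hj 1) h)); apply: filterE => i.
by split=> //; rewrite sub0r.
Qed.

Let V2n : F [set i | 0 <= lV (mof (g_ i)) (Q i) <= 1].
by have [] := lV_near hj hs hl jet_Q (introT andP (conj cq q1)). Qed.
Let W2n : F [set i | 0 <= lV (lflip (mof (g_ i))) (1 - P i) <= 1].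
by have [] := lV_near hj hs hl' jet_P' (introT andP (conj cp p1)). Qed.
Let V1n : F [set i | 0 <= V_ i <= 1].
apply: filterS hgr => i [h _ _ [/andP[h1 h2] _ _] _] /=; rewrite h1 /=; apply: le_trans h2 _.
by rewrite lerBlDr lerDl ltW //; case/andP: (wf_v h).
Qed.
Let W1n : F [set i | 0 <= W_ i <= 1].
apply: filterS hgr => i [/wf_flip h _ _ _ [/andP[h1 h2] _ _]] /=; rewrite h1 /=; apply: le_trans h2 _.
by rewrite lerBlDr lerDl ltW //; case/andP: (wf_v h).
Qed.
Let V21 : 0 <= V2 <= 1. by case: iV2. Qed.
Let W21 : 0 <= W2 <= 1. by case: iW2. Qed.
Let V11 : 0 <= V1 <= 1. by case: iV1. Qed.
Let W11 : 0 <= W1 <= 1. by case: iW1. Qed.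

Lemma ljet_t : ljet (fun i => co_t (renorm a b (g_ i))) (co_t (renorm a b f))
  (fun i => DT (g_ i - f)).
have [rs rt] := rbf.
have G : F [set i | [/\ small (g_ i) rb, wf dl (mof (g_ i)),
    ren (mof (g_ i)) a b (P i) (Q i), retC al (g_ i) = (P i, Q i) &
    preimage (mof (g_ i)) b (P i) (Q i) (V_ i)]].
  by apply: filterS2 hgs hgr => i h0 [h1 h2 h3 h4 h5]; split.
apply: (ljet_rtime hj) => [|j o|j].
- apply: (@ljet_near _ _ (fun g t => co_t (renorm a b g) (inl t))).
  + exact: (ljetB hj (mlt jet_V2 V21 V2n) (mlt jet_V1 V11 V1n)).
  + by apply: filterS G => i [[_ k] h1 h2 h3 h4] t; exact: (renorm_t_inl h1 h2 h3 h4 k).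
  + by move=> t; exact: (renorm_t_inl hw (b_ren hb) (b_ret hb) (b_V hb) rt).
- have [k1 _ _] := orbit_jet hj hs hl jet_V2 iV2 V2n (ltn_ord j).
  have [k2 _ _] := orbit_jet hj hs hl jet_V1 iV1 V1n (ltn_ord j).
  apply: (near_formula (Z := fun g => co_t (renorm a b g) (inr (j, inl o)))).
  + exact: (jetZ hj (al - 1) (jetB hj k1 k2)).
  + by apply: filterS G => i [[k k'] h1 h2 h3 h4]; exact: (renorm_t_q h1 h2 h3 h4).
  + exact: (renorm_t_q hw (b_ren hb) (b_ret hb) (b_V hb)).
- have [_ k1 n1] := orbit_jet hj hs hl jet_V2 iV2 V2n (ltn_ord j).
  have [_ k2 n2] := orbit_jet hj hs hl jet_V1 iV1 V1n (ltn_ord j).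
  have b1 := orbit_qf01 hw iV2 (ltn_ord j); have b2 := orbit_qf01 hw iV1 (ltn_ord j).
  apply: (@ljet_near _ _ (fun g t => co_t (renorm a b g) (inr (j, inr t)))).
  + exact: (ljetB hj (mls k1 b1 n1) (mls k2 b2 n2)).
  + by apply: filterS G => i [[k k'] h1 h2 h3 h4] t; exact: (renorm_t_s h1 h2 h3 h4 k).
  + by move=> t; exact: (renorm_t_s hw (b_ren hb) (b_ret hb) (b_V hb) rs).
Qed.

Lemma ljet_s : ljet (fun i => co_s (renorm a b (g_ i))) (co_s (renorm a b f))
  (fun i => DS (g_ i - f)).
have [rs rt] := rbf.
have G : F [set i | [/\ small (g_ i) rb, wf dl (mof (g_ i)),
    ren (mof (g_ i)) a b (P i) (Q i), retC al (g_ i) = (P i, Q i) &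
    preimage (lflip (mof (g_ i))) a (1 - Q i) (1 - P i) (W_ i)]].
  by apply: filterS2 hgs hgr => i h0 [h1 h2 h3 h4 h5]; split.
have flip01 (X : I -> R) : F [set i | 0 <= X i <= 1] -> F [set i | 0 <= 1 - X i <= 1].
  by apply: filterS => i; exact: sub01.
apply: (ljet_rtime hj) => [|j o|j].
- apply: (@ljet_near _ _ (fun g t => co_s (renorm a b g) (inl t))).
  + exact: (ljetB hj (mls (jflip jet_W1) (sub01 W11) (flip01 _ W1n)) (mls (jflip jet_W2) (sub01 W21) (flip01 _ W2n))).
  + by apply: filterS G => i [[k _] h1 h2 h3 h4] t; exact: (renorm_s_inl h1 h2 h3 h4 k).
  + by move=> t; exact: (renorm_s_inl hw (b_ren hb) (b_ret hb) (b_W hb) rs).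
- have [k1 _ _] := orbit_jet hj hs hl' jet_W2 iW2 W2n (ltn_ord j).
  have [k2 _ _] := orbit_jet hj hs hl' jet_W1 iW1 W1n (ltn_ord j).
  apply: (near_formula (Z := fun g => co_s (renorm a b g) (inr (j, inl o)))).
  + exact: (jetN hj (jetZ hj (al - 1) (jetB hj k1 k2))).
  + by apply: filterS G => i [[k k'] h1 h2 h3 h4]; exact: (renorm_s_q h1 h2 h3 h4).
  + exact: (renorm_s_q hw (b_ren hb) (b_ret hb) (b_W hb)).
- have [_ k1 n1] := orbit_jet hj hs hl' jet_W2 iW2 W2n (ltn_ord j).
  have [_ k2 n2] := orbit_jet hj hs hl' jet_W1 iW1 W1n (ltn_ord j).
  have b1 := orbit_qf01 hw' iW2 (ltn_ord j); have b2 := orbit_qf01 hw' iW1 (ltn_ord j).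
  apply: (@ljet_near _ _ (fun g t => co_s (renorm a b g) (inr (j, inr t)))).
  + exact: (ljetB hj (mlt (jflip k2) (sub01 b2) (flip01 _ n2)) (mlt (jflip k1) (sub01 b1) (flip01 _ n1))).
  + by apply: filterS G => i [[k k'] h1 h2 h3 h4] t; exact: (renorm_s_t h1 h2 h3 h4 k').
  + by move=> t; exact: (renorm_s_t hw (b_ren hb) (b_ret hb) (b_W hb) rt).
Qed.

(** The five coordinates are expanded separately, the last two with l^1 remainders; the sum of their
    constants serves for the maximum norm. *)
Lemma renorm_expansion : exists K, 0 <= K /\ F [set i |
  nle (renorm a b (g_ i) - renorm a b f - DR (g_ i - f)) (K * nu i ^+ 2)].
have [K1 h1] := jet_u'; have [K2 h2] := jet_v'; have [K3 h3] := jet_c'.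
have [K4 h4] := ljet_s; have [K5 h5] := ljet_t.
exists (`|K1| + `|K2| + `|K3| + `|K4| + `|K5|); split; first by rewrite !addr_ge0.
apply: filterS2 (filterI (filterI h1 h2) h3) (filterI h4 h5) => i [[[_ _ l1] [_ _ l2]] [_ _ l3]] [l4 l5].
have [s1 s2 s3 s4 s5] := le_sum5 (normr_ge0 K1) (normr_ge0 K2) (normr_ge0 K3) (normr_ge0 K4) (normr_ge0 K5).
set S := _ + `|K5| in s1 s2 s3 s4 s5 *.
have n2 : 0 <= nu i ^+ 2 by rewrite exprn_even_ge0.
have up (K : R) : `|K| <= S -> K * nu i ^+ 2 <= S * nu i ^+ 2.
  by move=> h; rewrite ler_wpM2r // (le_trans (ler_norm _) h).
have [e1 e2 e3 e4 e5] := co_sub (renorm a b (g_ i) - renorm a b f) (DR (g_ i - f)).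
have [e1' e2' e3' e4' e5'] := co_sub (renorm a b (g_ i)) (renorm a b f).
split.
- by rewrite e1 e1'; apply: le_trans l1 _; exact: up.
- by rewrite e2 e2'; apply: le_trans l2 _; exact: up.
- by rewrite e3 e3'; apply: le_trans l3 _; exact: up.
- by rewrite e4 e4'; apply: l1_le_weak l4; exact: up.
- by rewrite e5 e5'; apply: l1_le_weak l5; exact: up.
Qed.
End RenormJets.
End Derivative.

(** * The candidate is a derivative relative to [Lset] *)

Section IsDerivative.
Context {d0 d1 : Order.disp_t} {T0 : orderType d0} {T1 : orderType d1}.
Notation coords := (coords R T0 T1).
Implicit Types (g z : coords).

Lemma fine_normP z N : nle z N -> norm z = (fine (norm z))%:E /\ nle z (fine (norm z)).
move=> hN; have h : norm z = (fine (norm z))%:E.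
  have n0 := norm_ge0 z; have /normP nM := hN.
  by rewrite fineK // fin_numE; case: (norm z) n0 nM.
by split=> //; apply/normP; rewrite -h.
Qed.

Lemma ren_preimages d m a b p q : wf d m -> ren m a b p q ->
  (exists V1, preimage m b p q V1) /\
  exists W1, preimage (lflip m) a (1 - q) (1 - p) W1.
move=> hw hr; have [p0 pc cq q1] := ren_bd hr; have [h1 h2] := hr; split.
  by apply: (preimage_exists hw h1); rewrite p0.
apply: (preimage_exists (wf_flip hw) h2).
by rewrite subr_ge0 q1 /= ltrD2l ltrN2.
Qed.

Variables (f : coords) (dl eta : R) (a b : nat) (p q V1 W1 : R).
Hypothesis hb : base f dl eta a b p q V1 W1.
Variables (rho : R).
Hypothesis rho0 : 0 < rho.
Hypothesis near_f : forall g, Lset al a b g -> nle (g - f) rho ->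
  [/\ small g rb, wf dl (mof g), ren (mof g) a b (retC al g).1 (retC al g).2,
   dist eta (mof g) b & dist eta (lflip (mof g)) a].

(** Neighbourhoods of [f] within [Lset]; the jets along this filter are the expansions that
    [is_derivative_within] asks for. *)
Let F : set_system coords := fun S => exists2 e, 0 < e &
  forall g, Lset al a b g -> nle (g - f) e -> S g.
Let nu g := fine (norm (g - f)).

#[local] Instance near_filter : Filter F.
split.
- by exists 1.
- move=> S S' [e e0 h] [e' e0' h']; exists (Num.min e e'); first by rewrite lt_min e0.
  move=> g hg hn; split; [apply: h => // | apply: h' => //]; apply: nle_weak hn;
    by rewrite ge_min lexx ?orbT.
- by move=> S S' SS [e e0 h]; exists e => // g hg hn; apply: SS; exact: h.
Qed.

Let hs e : 0 < e -> F [set g | nu g <= e].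
move=> e0; exists e => // g hg hn; have [h _] := fine_normP hn.
by have := (proj2 (normP (g - f) e)) hn; rewrite h lee_fin.
Qed.

Let hj : jctx F nu.
split; first exact: near_filter.
apply: (filterS _ (hs ltr01)) => g /= n1; apply/andP; split; last exact: n1.
by apply: fine_ge0; exact: norm_ge0.
Qed.

Lemma DR_is_derivative :
  is_derivative_within (renorm al a b) (Lset al a b) f (DR f a b p q V1 W1).
split; [exact: (DR_linear hb) | exact: (DR_bounded hb) | ].
pose P g := (retC al g).1; pose Q g := (retC al g).2.
(* The ends of V and U for nearby maps are chosen without any continuity; [Y_jet] shows afterwards
   that they vary smoothly. *)
pose V_ g := xget 0 [set x | preimage (mof g) b (P g) (Q g) x].
pose W_ g := xget 0 [set x | preimage (lflip (mof g)) a (1 - Q g) (1 - P g) x].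
have nr : F [set g | [/\ small g rb, wf dl (mof g), ren (mof g) a b (P g) (Q g),
    dist eta (mof g) b & dist eta (lflip (mof g)) a]] by exists rho.
have hg : F [set g | nle (g - f) (nu g)].
  by exists 1 => // g _ hn; have [] := fine_normP hn.
have hgs : F [set g | small g rb] by apply: filterS nr => g [].
have hgd : F [set g | dist eta (mof g) b /\ dist eta (lflip (mof g)) a].
  by apply: filterS nr => g [].
have hgr : F [set g | [/\ wf dl (mof g), ren (mof g) a b (P g) (Q g),
    retC al g = (P g, Q g), preimage (mof g) b (P g) (Q g) (V_ g) &
    preimage (lflip (mof g)) a (1 - Q g) (1 - P g) (W_ g)]].
  apply: filterS nr => g [_ h1 h2 _ _]; have [[x hx] [y hy]] := ren_preimages h1 h2.
  split=> //; first by rewrite /P /Q; case: (retC al g).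
    by apply: (@xgetPex _ 0); exists x.
  by apply: (@xgetPex _ 0); exists y.
have [K [K0 [r r0 hr]]] := renorm_expansion hb hj hs hg hgs hgr hgd.
move=> e e0; exists (Num.min r (e / (K + 1))).
  by rewrite lt_min r0 divr_gt0 // ltr_wpDl.
move=> g hL hn; have [N hN] : exists N, nle (g - f) N.
  by apply/tangentP; apply: lt_trans hn (ltry _).
have [en hN'] := fine_normP hN; rewrite en lte_fin lt_min in hn; case/andP: hn => n1 n2.
rewrite en -EFinM; apply/normP; apply: nle_weak (hr g hL (nle_weak (ltW n1) hN')).
rewrite expr2 mulrA -/(nu g); have g0 : 0 <= nu g by apply: fine_ge0; exact: norm_ge0.
apply: ler_wpM2r => //; have k1 : 0 < K + 1 by rewrite ltr_wpDl.
move: n2; rewrite -/(nu g) ltr_pdivlMr // => n2; apply: le_trans (ltW n2).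
by rewrite mulrC ler_wpM2l // lerDl.
Qed.
End IsDerivative.

Lemma sl_expand (d : R) g x y : expR d <= 3 / 2 -> sl d g -> 0 <= x -> x <= y -> y <= 1 ->
  2 / 3 * (y - x) <= g y - g x /\ g y - g x <= 3 / 2 * (y - x).
move=> hd [_ _ h] x0 xy y1; have [h1 h2] := h x y x0 xy y1; have k : 0 <= y - x by rewrite subr_ge0.
have e0 := expR_gt0 d; have e1 : 2 / 3 <= expR (- d).
  rewrite expRN; have -> : (2 / 3 : R) = (3 / 2)^-1 by field.
  by rewrite lef_pV2 // posrE; lra.
split; first by apply: le_trans h1; rewrite ler_wpM2r.
by apply: le_trans h2 _; rewrite ler_wpM2r.
Qed.

Lemma half_low d (m : lmap) n k p q : wf d m ->
  half m n p q -> p < lc m -> (k <= n)%N -> lK m k (1 - lv m) < lc m.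
move=> hw hh pc kn; have [/andP[cq q1] gap _ _ h] := hh.
have V := lV_le hw (lexx _) (ltW cq); rewrite (lV_c) in V.
have w1 : 0 <= 1 - lv m by rewrite subr_ge0; case/andP: (wf_v hw).
move: kn; rewrite leq_eqVlt => /predU1P[-> //|kn].
have [_ [h1 _]] := lK_mono hw w1 V (half_litin hw hh pc (ltnW kn)).
by apply: le_lt_trans h1 _; exact: lt_trans (gap k kn) pc.
Qed.

(** * Size of C, U and V and distortion of the return branches *)

Section Estimates.
Implicit Types (x y z : R).

Lemma lVE (m : lmap) x : lV m x = 1 - lv m + lv m * ((x - lc m) / (1 - lc m)) `^ al.
rewrite /lV /qf /rr; have -> : 1 - lc m - (1 - x) = x - lc m by ring.
by ring.
Qed.

(* Smallness conditions on the distortion d, on 1 - c and on the exponents. *)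
Record tiny (d e ka : R) (a b : nat) : Prop := Tiny {
  t_a : (0 < a)%N; t_b : (0 < b)%N;
  t_d : expR d <= 3 / 2;
  t_db : expR (8 * d * b%:R) <= 2;
  t_e : 0 < e <= 1 / 100;
  t_ka : 0 < ka <= 1 / 32;
  t_e2 : (9 * e) `^ (al - 1) <= 1 / 14;
  t_l : 3 * e + 3 * (3 * e) `^ al^-1 <= 1 / 4;
  t_V : 8 / (e * al ^+ b.-1) <= ka `^ al;
  t_eka : e <= ka;
  t_dab : 4 * d * (a + b)%:R + 2 * d <= ka;
  t_bV : 8 * (a + b)%:R / (e * al ^+ b) <= ka;
  t_bU : 3 / 2 * (a + b)%:R * (4 * e) ^+ a <= ka;
  t_U : 6 * (4 * e) ^+ a <= (ka * e) `^ (al - 1) }.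

Variables (d ka : R) (m : lmap) (a b : nat) (p q : R).
Hypothesis hw : wf d m.
Hypothesis hr : ren m a b p q.
Let m' := lflip m.
Let e := 1 - lc m.
Hypothesis ht : tiny d e ka a b.
Let hw' : wf d m' := wf_flip hw.
Let A := lp m (lu m).

Let d0 : 0 <= d. exact: wf_d hw. Qed.
Let ed : expR d <= 3 / 2. exact: t_d ht. Qed.
Let e0 : 0 < e. by case/andP: (t_e ht). Qed.
Let e1 : e <= 1 / 100. by case/andP: (t_e ht). Qed.
Let u0 : 0 < lu m. by case/andP: (wf_u hw). Qed.
Let u1 : lu m <= 1. by case/andP: (wf_u hw). Qed.
Let v0 : 0 < lv m. by case/andP: (wf_v hw). Qed.
Let v1 : lv m <= 1. by case/andP: (wf_v hw). Qed.
Let pc : p < lc m. by have [] := ren_bd hr. Qed.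
Let cq : lc m < q. by have [] := ren_bd hr. Qed.
Let qc : 1 - q < lc m'. by rewrite /m' /= ltrD2l ltrN2. Qed.
Let cp : lc m' < 1 - p. by rewrite /m' /= ltrD2l ltrN2. Qed.
Let hR : half m b p q. by have [] := hr. Qed.
Let hL : half m' a (1 - q) (1 - p). by have [] := hr. Qed.
Let iR := half_litin hw hR pc (leqnn b).
Let iL := half_litin hw' hL qc (leqnn a).

Lemma est_u : 1 - 2 * e <= lu m.
have [h _] := sl_expand ed (wf_p hw) (ltW u0) u1 (lexx 1).
have [_ p1 _] := wf_p hw; rewrite p1 in h; have := wf_A hw; have := e0.
by rewrite /e; lra.
Qed.

Let c_half : 98 / 100 <= lc m. by have := e1; rewrite /e; lra. Qed.

(** Consequences of the first steps of both halves. With [B = lq m (lv m)] the critical values are A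
    and 1 - B: each lies on the far side of [c], and the next image of each is still on that same
    side. *)
Lemma est_A : [/\ q < A, lq m (lv m * (1 - ((A - lc m) / e) `^ al)) < e,
  e < lq m (lv m) & lp m (lu m * (1 - ((lq m (lv m) - e) / lc m) `^ al)) < lc m].
have h0 := half_low hw' hL qc (leq0n a); have h1 := half_low hw' hL qc (t_a ht).
have k0 := half_low hw hR pc (leq0n b); have k1 := half_low hw hR pc (t_b ht).
have hA : q < A.
  have [_ gap _ _ _] := hL; have := gap 0%N (t_a ht).
    have W := lV_le hw' (lexx _) (ltW cp); rewrite (lV_c) in W.
  have w1 : 0 <= 1 - lv m' by rewrite subr_ge0; case/andP: (wf_v hw').
  have [_ [h _]] := lK_mono hw' w1 W (itinS (leq0n a) iL).
  by move: h; rewrite /lK /KK /= /flip !subKr -/A; move: (lp m _) => t; lra.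
split; first exact: hA.
- move: h1; rewrite /lK /KK /= /flip subKr /br /qf /rr -/A.
  by have -> : 1 - lc m - (1 - A) = A - lc m by ring.
- by move: k0; rewrite /lK /KK /= /flip subKr /e; lra.
- move: k1; rewrite /lK /KK /= /flip subKr /br /qf /rr.
  by have -> : lc m - (1 - lq m (lv m)) = lq m (lv m) - e by rewrite /e; ring.
Qed.

Let A1 : A <= 1.
by have := @A_le1 (lu m) (wf_u hw) d (lp m) (wf_p hw); rewrite -/A => /andP[]. Qed.

Let pow_le z : 0 <= z <= 1 -> 0 <= z `^ al <= z. exact: (powR_in01). Qed.

(* If v were less than 3 e then, with rho = A - c and D the distance of B to c,
   D <= 9/2 rho (the point after A stays right of c) and rho <= 3/2 (2 D)^al (the
   point after B stays left of c), impossible for small e. *)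
Lemma est_v : 3 * e <= lv m.
rewrite leNgt; apply/negP => v3; have [qA hA hB hB'] := est_A.
pose rho := A - lc m; have r0 : 0 < rho by have := cq; rewrite /rho; lra.
have r1 : rho <= e by have := A1; rewrite /rho /e; lra.
pose D := lq m (lv m) - e; have D0 : 0 < D by rewrite subr_gt0.
have hre : 0 <= rho / e <= 1.
  by rewrite divr_ge0 ?(ltW r0) ?(ltW e0) //= ler_pdivrMr ?mul1r.
have /andP[t0 t1] := pow_le hre; rewrite -/rho in hA; set t := (rho / e) `^ al in t0 t1 hA.
have hD : D <= 9 / 2 * rho.
  have w1 : 0 <= lv m * (1 - t) by rewrite mulr_ge0 ?(ltW v0) // subr_ge0 (le_trans t1) //; case/andP: hre.
  have w2 : lv m * (1 - t) <= lv m by rewrite ler_piMr ?(ltW v0) // lerBlDr lerDl.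
  have [_ h] := sl_expand ed (wf_q hw) w1 w2 v1.
  have h2 : lv m * t <= 3 * rho.
    apply: (@le_trans _ _ (3 * e * (rho / e))); first by apply: ler_pM => //; exact: ltW.
    by rewrite -mulrA [e * _]mulrC divfK ?gt_eqF.
  have e9 : lv m * (1 - t) = lv m - lv m * t by ring.
  by move: h2 h hA e9; rewrite /D; lra.
have hr2 : rho <= 3 / 2 * (2 * D) `^ al.
  have D1 : D <= lc m by have := c_half; have := e1; have := hD; have := r1; lra.
  have c0 : 0 < lc m by have := c_half; lra.
  have hd1 : 0 <= D / lc m <= 1 by rewrite divr_ge0 ?(ltW D0) ?(ltW c0) //= ler_pdivrMr ?mul1r.
  have hd2 : D / lc m <= 2 * D.
    rewrite ler_pdivrMr // -mulrA mulrCA ler_peMr ?(ltW D0) //; have := c_half; lra.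
  have k : (D / lc m) `^ al <= (2 * D) `^ al.
    by apply: ge0_ler_powR; rewrite ?nnegrE ?(ltW al0) //; [case/andP: hd1|have := D0; lra].
  have /andP[s0 s1] := pow_le hd1; rewrite -/D in hB'; set s := (D / lc m) `^ al in k s0 s1 hB'.
  have w1 : 0 <= lu m * (1 - s) by rewrite mulr_ge0 ?(ltW u0) // subr_ge0 (le_trans s1) //; case/andP: hd1.
  have w2 : lu m * (1 - s) <= lu m by rewrite ler_piMr ?(ltW u0) // lerBlDr lerDl.
  have [_ h] := sl_expand ed (wf_p hw) w1 w2 u1.
  have h2 : lu m * s <= s by rewrite ler_piMl.
  have e9 : lu m * (1 - s) = lu m - lu m * s by ring.
  by move: h2 h hB' k e9; rewrite /rho /A; lra.
have h3 : (2 * D) `^ al <= 9 * rho * (9 * e) `^ (al - 1).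
  have k9 : 0 < 9 * rho by have := r0; lra.
  apply: (@le_trans _ _ ((9 * rho) `^ al)).
    by apply: ge0_ler_powR; rewrite ?nnegrE ?(ltW al0) //; have := D0; have := hD; lra.
  rewrite powR_split // ler_wpM2l ?(ltW k9) //.
  by apply: ge0_ler_powR; rewrite ?nnegrE; have := al1; have := r1; have := r0; have := e0; lra.
have h4 : 9 * rho * (9 * e) `^ (al - 1) <= 9 * rho * (1 / 14).
  by apply: ler_wpM2l (t_e2 ht); have := r0; lra.
by have := r0; move: hr2 h3 h4; set X := _ `^ al; set Y := _ * _ `^ _; lra.
Qed.

(** If A were closer to [c], its image under the right branch would be near the right critical value
    and fall left of [c]: [v >= 3 * e] and the second part of [est_A] give ((A - c) / e) ^ al >=
    1/2. *)
Lemma est_rho : e / 2 <= A - lc m.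
have [qA hA _ _] := est_A; have hv := est_v.
pose rho := A - lc m; have r0 : 0 < rho by have := cq; rewrite /rho; lra.
have r1 : rho <= e by have := A1; rewrite /rho /e; lra.
have hre : 0 <= rho / e <= 1.
  by rewrite divr_ge0 ?(ltW r0) ?(ltW e0) //= ler_pdivrMr ?mul1r.
have /andP[t0 t1] := pow_le hre; rewrite -/rho in hA *; set t := (rho / e) `^ al in t0 t1 hA.
have t2 : t <= 1 by apply: le_trans t1 _; case/andP: hre.
have w1 : 0 <= lv m * (1 - t) by rewrite mulr_ge0 ?(ltW v0) // subr_ge0.
have w2 : lv m * (1 - t) <= 1 by rewrite (@le_trans _ _ (lv m)) // ler_piMr ?(ltW v0) // lerBlDr lerDl.
have [h _] := sl_expand ed (wf_q hw) (lexx 0) w1 w2.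
have [q0 _ _] := wf_q hw; rewrite q0 in h.
have h2 : lv m * (1 - t) < 3 / 2 * e by move: h hA; set x := lv m * _; lra.
have h3 : 3 * e * (1 - t) <= lv m * (1 - t) by rewrite ler_wpM2r // subr_ge0.
have h4 : 1 - t < 1 / 2.
  rewrite -(@ltr_pM2l _ (3 * e)); last by have := e0; lra.
  by apply: le_lt_trans h3 _; move: h2; set x := lv m * _; lra.
have : 1 / 2 <= rho / e by move: h4 t1; lra.
by rewrite ler_pdivlMr //; lra.
Qed.

(* Every point on the right of c whose orbit follows that of q for b steps. *)
Lemma est_V x : lc m < x <= 1 -> litin m b (lV m x) -> lV m x <= ka `^ al / 2.
move=> hx hi; have hb := t_b ht; have hi' := itinS (leq_pred b) hi.
have D1 (y : R) : 0 <= y <= 1 -> expR (- d) <= 1 <= expR d.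
  by move=> _; apply/andP; split; rewrite -expR0 ler_expR; have := d0; lra.
have zc : lK m b.-1 (lV m x) < lc m by case: hi => _; apply; rewrite ltn_predL.
have /andP[z0 z1] := lK_in hw hi'.
have hs := sl_flip (wf_q hw).
have low := Dn_low (wf_u hw) (wf_c1 hw) (wf_p hw) hs D1 D1 (wf_A hw) hi'.
have star := KK_star0 (wf_u hw) (wf_c1 hw) (wf_d hw) (wf_p hw) hs D1 D1 hi'.
have hr2 := est_rho.
move: low star; rewrite -/(lK m b.-1 (lV m x)) -/A; set D := Dn _ _ _ _ _ _ _ _; set z := lK _ _ _ in zc z0 z1 *.
rewrite prednK // exprMn mulrA => low star.
have Y0 : 0 <= lV m x by case: hi => /andP[].
have P0 : 0 < al ^+ b.-1 by rewrite exprn_gt0.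
have ex : expR (- d) * expR (- (d + d)) ^+ b.-1 = expR (- (d + (d + d) * b.-1%:R)).
  by rewrite -expRM_natr -expRD; congr expR; ring.
(* Only [b - 1] steps are used: the point at that time is still left of [c], so that its gap to A is
   at least [e / 2] by [est_rho], as [Dn_low] requires. [KK_star0] then converts the large
   derivative into a small [lV m x]. *)
have k1 : expR (- (d + (d + d) * b.-1%:R)) * al ^+ b.-1 * (e / 2) <= D.
  apply: le_trans low.
  have -> : expR (- (d + (d + d) * b.-1%:R)) * al ^+ b.-1 =
     expR (- d) * al ^+ b.-1 * expR (- (d + d)) ^+ b.-1 by rewrite -ex; ring.
  apply: ler_wpM2l; last by move: zc hr2; rewrite /A; lra.
  by rewrite !mulr_ge0 ?exprn_ge0 ?expR_ge0 ?(ltW al0).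
have k2 : lV m x * (al ^+ b.-1 * (e / 2)) <= 2.
  apply: le_trans (t_db ht).
  have e3 : expR (d + (d + d) * b.-1%:R) * expR (- (d + (d + d) * b.-1%:R)) = 1 by rewrite -expRD subrr expR0.
  have -> : lV m x * (al ^+ b.-1 * (e / 2)) = expR (d + (d + d) * b.-1%:R) *
     (lV m x * (expR (- (d + (d + d) * b.-1%:R)) * al ^+ b.-1 * (e / 2))).
    set x1 := expR _ in e3 *; set x2 := expR _ in e3 *.
    by transitivity (x1 * x2 * (lV m x * (al ^+ b.-1 * (e / 2)))); [rewrite e3 mul1r | ring].
  apply: (@le_trans _ _ (expR (d + (d + d) * b.-1%:R) * (lV m x * D))).
    by rewrite ler_wpM2l ?expR_ge0 // ler_wpM2l.
  apply: (@le_trans _ _ (expR (d + (d + d) * b.-1%:R) * expR ((d + d) * b%:R))).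
    by rewrite ler_wpM2l ?expR_ge0 // (le_trans star) // ler_piMr ?expR_ge0.
  rewrite -expRD ler_expR; have eb : b%:R = b.-1%:R + 1 :> R by rewrite natr1 prednK.
  have n0 : 0 <= d * b.-1%:R :> R by rewrite mulr_ge0.
  by rewrite eb; have := d0; move: n0; rewrite !mulrDr !mulrDl -!mulrA; set t := d * _; lra.
have k3 := t_V ht; have pe : 0 < e * al ^+ b.-1 by rewrite mulr_gt0.
rewrite -/e ler_pdivrMr // in k3; rewrite -(ler_pM2r pe).
move: k2 k3; have -> : lV m x * (al ^+ b.-1 * (e / 2)) = lV m x * (e * al ^+ b.-1) / 2 by field.
by set X := lV m x * _; set Y := _ `^ _; rewrite [Y / 2 * _]mulrAC; lra.
Qed.

Let ka_pow : 0 < ka `^ al <= 1 / 16.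
have /andP[k0 k1] := t_ka ht; rewrite powR_gt0 //=.
have h : 0 <= ka <= 1 by andlra.
by have /andP[_ h1] := pow_le h; apply: le_trans h1 _; lra.
Qed.

Lemma est_v2 : 1 / 2 <= lv m.
have hq : lc m < q <= 1 by rewrite cq; case: hR => /andP[].
have h := est_V hq iR; have Vq : lc m <= q <= 1 by case/andP: hq => /ltW -> ->.
have /andP[h1 _] := lV_in hw Vq; have /andP[_ k] := ka_pow; lra.
Qed.

(** By [lVE], [lV m x] contains [lv m * ((x - c) / e) ^ al] with [lv m >= 1 / 2]; so [est_V] bounds
    the power by [ka ^ al]. *)
Lemma est_r x : lc m < x <= 1 -> litin m b (lV m x) -> x - lc m <= ka * e.
move=> hx hi; have h := est_V hx hi; have hv := est_v2; rewrite lVE -/e in h.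
case/andP: hx => cx x1; have r0 : 0 <= (x - lc m) / e by rewrite divr_ge0 ?(ltW e0) // subr_ge0 ltW.
have k0 : 0 < ka by case/andP: (t_ka ht).
have k : ((x - lc m) / e) `^ al <= ka `^ al.
  move: h; set X := _ `^ al; set Y := ka `^ al => h; have X0 : 0 <= X by exact: powR_ge0.
  have : 1 / 2 * X <= lv m * X by rewrite ler_wpM2r.
  by have := v1; move: h; set Z := lv m * X; lra.
rewrite -ler_pdivrMr //; rewrite leNgt; apply/negP => hlt; move: k; rewrite leNgt => /negP; apply.
by apply: gt0_ltr_powR; rewrite ?nnegrE ?(ltW k0).
Qed.
Lemma lnB_le (x y k : R) : 0 < y -> y <= x -> x - y <= k * y -> ln x - ln y <= k.
move=> y0 xy h; have x0 : 0 < x by lra.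
rewrite -ln_div ?posrE //; have -> : x / y = 1 + (x - y) / y by field; rewrite gt_eqF.
have r0 : 0 <= (x - y) / y by rewrite divr_ge0 ?subr_ge0 // ltW.
apply: (@le_trans _ _ ((x - y) / y)); first by apply: le_ln1Dx; lra.
by rewrite ler_pdivrMr.
Qed.

Let k0 : 0 < ka. by case/andP: (t_ka ht). Qed.
Let k1' : ka <= 1 / 32. by case/andP: (t_ka ht). Qed.
Let k1 : ka <= 1 / 16. by have := k1'; lra. Qed.
Let v2 : 1 / 2 <= lv m. exact: est_v2. Qed.
Let u2 : 1 / 2 <= lu m. by have := est_u; have := e1; rewrite /e; lra. Qed.
Let rho2 : e / 2 <= A - lc m. exact: est_rho. Qed.
Let r2 : q - lc m <= ka * e.
by apply: est_r iR; rewrite cq; case: hR => /andP[]. Qed.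

(* The points on the left of c, in flipped coordinates, whose orbit follows that of p. *)
Section LeftOrbit.
Variable x : R.
Hypothesis hx : lc m' < x <= 1.
Hypothesis hi : litin m' a (lV m' x).
Hypothesis hax : lK m' a (lV m' x) <= x.
Let l := x - e.
Let Y := lV m' x.

Let l0 : 0 <= l. by case/andP: hx => h _; rewrite subr_ge0 ltW. Qed.
Let Y0 : 0 <= Y. by case: hi => /andP[]. Qed.
Let Y1 : Y <= 1. by case: hi => /andP[]. Qed.
Let YE : Y = 1 - lu m + lu m * (l / lc m) `^ al.
by rewrite /Y lVE /m' /= subKr. Qed.

(** The first image already has to lie on the right of [c], that is, within [e] of 0 in flipped
    coordinates. This keeps [Y], and with it the power of [l], below a multiple of [e]. *)
Lemma left_l : (l / lc m) `^ al <= 3 * e /\ l <= (3 * e) `^ al^-1.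
have z0 : lK m' 0 Y < e by case: hi => _; apply; exact: t_a ht.
have hs := sl_flip (wf_q hw'); have [h _] := sl_expand ed hs (lexx 0) Y0 Y1.
have [f0 _ _] := hs; rewrite f0 in h.
have hY : Y <= 3 / 2 * e by move: h z0; rewrite /lK /KK /=; lra.
have P0 : 0 <= (l / lc m) `^ al by exact: powR_ge0.
have k : (l / lc m) `^ al <= 3 * e.
  have : 1 / 2 * (l / lc m) `^ al <= lu m * (l / lc m) `^ al by rewrite ler_wpM2r.
  by move: hY; rewrite YE; set X := lu m * _; have := u1; lra.
split=> //; have c0 : 0 < lc m by have := c_half; lra.
have q0 : 0 <= l / lc m by rewrite divr_ge0 // ltW.
apply: (@le_trans _ _ (l / lc m)).
  by rewrite ler_pdivlMr // ler_piMr // ltW //; case/andP: (wf_c hw).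
have -> : l / lc m = ((l / lc m) `^ al) `^ al^-1 by rewrite -powRrM divff ?gt_eqF // powRr1.
by apply: ge0_ler_powR; rewrite ?nnegrE ?invr_ge0 ?(ltW al0) //; have := e0; lra.
Qed.

Let l_small : e + l <= 1 / 12.
by have [_ h] := left_l; have := t_l ht; rewrite -/e; lra. Qed.

(** The next point of the orbit is at most [e + l <= 1 / 12], hence the orbit stays close to the
    fixed end point 0 of the flipped branch, far from its critical point on the scale [e]. *)
Lemma left_rr k z : (k < a)%N -> 0 <= z <= lK m' k Y ->
  [/\ z < e, 0 < rr e z, rr e z <= 1 & 3 / 4 <= rr e z `^ al].
move=> ka' /andP[z0 zk]; have zc : lK m' k Y < lc m' by case: hi => _; apply.
have ze : z < e by exact: le_lt_trans zk zc.
have hi' := itinS ka' hi; have nk : lK m' k.+1 Y <= e + l.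
  move: ka'; rewrite leq_eqVlt => /predU1P[->|h]; first by have := hax; rewrite -/Y /l; lra.
  by have : lK m' k.+1 Y < lc m' by [case: hi => _; apply]; rewrite /m' /= -/e; have := l0; lra.
have /andP[Zk0 _] := lK_in hw' (itinS (ltnW ka') hi).
set Z := lK m' k Y in zk zc nk Zk0 *.
have c1' := wf_c1 hw'; have Ze : 0 <= Z <= lc m' by rewrite Zk0 ltW.
have /andP[q0 q1] := qf_in1 (wf_u hw') c1' Ze.
have [h _] := sl_expand ed (wf_p hw') (lexx 0) q0 q1; have [f0 _ _] := wf_p hw'.
rewrite f0 subr0 -[lp m' _]/(lK m' k.+1 Y) in h.
have h2 : lv m * (1 - rr e Z `^ al) <= 3 / 2 * (e + l).
  by move: h nk; rewrite /qf -/e /= -/e; set W := lv m * _; lra.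
have h3 : 1 / 2 * (1 - rr e Z `^ al) <= lv m * (1 - rr e Z `^ al).
  rewrite ler_wpM2r // subr_ge0.
  have /andP[r0 r1] := rr_in c1' Ze.
  have /andP[_ r3] := powR_in01 (introT andP (conj r0 r1)); exact: le_trans r3 r1.
have h4 : 3 / 4 <= rr e Z `^ al by move: h2 h3 l_small; set X := _ `^ _; set W := _ * _; lra.
have ze' : 0 <= z <= lc m' by rewrite z0 ltW.
have /andP[r0 r1] := rr_in c1' ze'; have r3 := rr_gt0 c1' ze; split; [exact: ze|exact: r3|exact: r1|].
apply: le_trans h4 _; have /andP[s0 _] := rr_in c1' Ze; apply: ge0_ler_powR; rewrite ?nnegrE; [exact: ltW|exact: s0|exact: r0|].
by rewrite /rr ler_pM2r ?invr_gt0 // lerD2l lerN2.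
Qed.

(** Near the fixed end the branch has slope at least 1 / (4e): the factor 3/8 is half of the 3/4
    from [left_rr], since [lv m >= 1 / 2], and the diffeomorphism costs at most 2/3. *)
Lemma left_expand k y1 y2 : (k <= a)%N -> 0 <= y1 -> y1 <= y2 -> y2 <= Y ->
  2 / 3 * (y2 - y1) <= (4 * e) ^+ k * (lK m' k y2 - lK m' k y1).
move=> hk y10 y12 y2Y; elim: k hk => [|k IH] hk.
  have hs := sl_flip (wf_q hw'); have [h _] := sl_expand ed hs y10 y12 (le_trans y2Y Y1).
  by rewrite expr0 mul1r.
have hk' := ltnW hk; have h := IH hk'; apply: le_trans h _.
have y20 : 0 <= y2 by lra.
have [hi2 [m2 _]] := lK_mono hw' y20 y2Y (itinS hk' hi).
have [hi1 [m1 _]] := lK_mono hw' y10 y12 hi2.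
have /andP[z10 _] := lK_in hw' hi1.
rewrite -[lK m' k.+1 y2]/(lp m' (qf (lu m') (lc m') (lK m' k y2))).
rewrite -[lK m' k.+1 y1]/(lp m' (qf (lu m') (lc m') (lK m' k y1))).
have hz2 : 0 <= lK m' k y2 <= lK m' k Y by rewrite m2 (le_trans z10 m1).
have [z2e r20 r21 r24] := left_rr hk hz2.
set z1 := lK m' k y1 in m1 z10 *; set z2 := lK m' k y2 in m1 m2 hz2 z2e r20 r21 r24 *.
have z1e : z1 < e by lra.
have hz1 : 0 <= z1 <= lc m' by rewrite z10 ltW.
have hz2' : 0 <= z2 <= lc m' by rewrite (le_trans z10 m1) ltW.
have c1' := wf_c1 hw'.
have /andP[q10 _] := qf_in1 (wf_u hw') c1' hz1; have /andP[_ q21] := qf_in1 (wf_u hw') c1' hz2'.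
have q12 := qf_le (wf_u hw') c1' m1 (ltW z2e).
have [hs _] := sl_expand ed (wf_p hw') q10 q12 q21; rewrite exprSr -mulrA ler_wpM2l //.
  by rewrite exprn_ge0 //; have := e0; lra.
have hq : 3 / 8 * ((z2 - z1) / e) <= qf (lu m') (lc m') z2 - qf (lu m') (lc m') z1.
  rewrite qf_diff; have rz : rr e z2 <= rr e z1 by rewrite /rr ler_pM2r ?invr_gt0 //; lra.
  have [pm _] := powR_mvt r20 rz; rewrite rr_diff in pm.
  have s0 : 0 <= (z2 - z1) / e by apply: divr_ge0; [rewrite subr_ge0; exact: m1 | exact: ltW].
  have p1 : 3 / 4 <= al * rr e z2 `^ (al - 1).
    have p2 : rr e z2 `^ al <= rr e z2 `^ (al - 1).
      by rewrite powR_split // ler_piMl ?powR_ge0.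
    have : 1 * rr e z2 `^ (al - 1) <= al * rr e z2 `^ (al - 1) by rewrite ler_wpM2r ?powR_ge0 // ltW.
    by rewrite mul1r; lra.
  have p3 : 3 / 4 * ((z2 - z1) / e) <= rr e z1 `^ al - rr e z2 `^ al.
    by apply: le_trans pm; rewrite ler_wpM2r.
  have := v2; have -> : lu m' = lv m by []; have -> : lc m' = e by [].
  move=> v2'; apply: (@le_trans _ _ (1 / 2 * (rr e z1 `^ al - rr e z2 `^ al))).
    by move: p3; set X := (z2 - z1) / e; set W := _ - _; lra.
  by rewrite ler_wpM2r //; apply: le_trans p3; rewrite mulr_ge0.
have ->  : z2 - z1 = e * ((z2 - z1) / e) by rewrite mulrC divfK // gt_eqF.
rewrite [4 * e]mulrC -mulrA ler_pM2l //.
by move: hs hq; set X := (z2 - z1) / e; set W := qf _ _ z2 - _; set G := lp m' _ - _; lra.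
Qed.

(** The [a] steps expand the piece beyond the critical value by (4e) ^ (-a), but its image has
    length at most [l + ka * e]. As that piece has length of order [l ^ al], the assumption
    [l > ka * e] would give [l ^ (al - 1) <= 6 * (4 * e) ^+ a], against [t_U]. *)
Lemma est_l : l <= ka * e.
have w1 : 0 <= 1 - lu m by rewrite subr_ge0.
have wY : 1 - lu m <= Y by rewrite YE lerDl mulr_ge0 ?powR_ge0 // ltW.
have h := left_expand (leqnn a) w1 wY (lexx _).
have [_ _ _ h1 _] := hL; have := hax; rewrite -/Y => h2.
rewrite -[1 - lu m]/(1 - lv m') in h.
have eY : Y - (1 - lv m') = lu m * (l / lc m) `^ al by rewrite YE /=; ring.
rewrite eY in h; have E0 : 0 < (4 * e) ^+ a by rewrite exprn_gt0 // mulr_gt0.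
have h3 : 2 / 3 * (lu m * (l / lc m) `^ al) <= (4 * e) ^+ a * (l + ka * e).
  apply: le_trans h _; rewrite ler_pM2l //; move: h1 h2 r2; rewrite /l /e; lra.
rewrite leNgt; apply/negP => hlt.
have le0 : 0 < l by apply: lt_trans hlt; rewrite mulr_gt0.
have c0 : 0 < lc m by have := c_half; lra.
have lq : l <= l / lc m by rewrite ler_pdivlMr // ler_piMr // ltW //; case/andP: (wf_c hw).
have p1 : l `^ al <= (l / lc m) `^ al by apply: ge0_ler_powR; rewrite ?nnegrE ?(ltW al0) // (le_trans l0).
have p2 : 1 / 2 * l `^ al <= lu m * (l / lc m) `^ al.
  by apply: ler_pM => //; exact: powR_ge0.
have p3 : l * l `^ (al - 1) <= 6 * (4 * e) ^+ a * l.
  rewrite -powR_split //; have : (4 * e) ^+ a * (l + ka * e) <= (4 * e) ^+ a * (2 * l) by rewrite ler_pM2l //; lra.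
  by move: h3 p2; set X := lu m * _; set W := (4 * e) ^+ a; set Z := W * (l + _); lra.
have p4 : l `^ (al - 1) <= 6 * (4 * e) ^+ a by rewrite -(ler_pM2r le0) mulrC.
have := le_trans p4 (t_U ht); rewrite leNgt => /negP; apply.
apply: gt0_ltr_powR; rewrite ?nnegrE ?mulr_ge0 ?(ltW e0) ?(ltW k0) //; rewrite subr_gt0; exact: al1.
Qed.
End LeftOrbit.

Lemma est_p : lc m - p <= ka * e.
have p1 : 1 - p <= 1 by rewrite lerBlDr lerDl; have [] := ren_bd hr.
have hx : lc m' < 1 - p <= 1 by rewrite cp.
have := est_l hx iL; have [_ _ -> _ _] := hL; rewrite lexx => /(_ isT).
by rewrite /e; lra.
Qed.

Lemma est_U W1 : preimage m' a (1 - q) (1 - p) W1 ->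
  lV m' (1 - p) - W1 <= 3 / 2 * (4 * e) ^+ a * (q - p).
move=> hW; have [/andP[W0 Wv] eW _] := hW; have WW := preimage_lt hw' cp hW.
have p1 : 1 - p <= 1 by rewrite lerBlDr lerDl; have [] := ren_bd hr.
have hx : lc m' < 1 - p <= 1 by rewrite cp.
have [_ _ eP _ _] := hL; have hax : lK m' a (lV m' (1 - p)) <= 1 - p by rewrite eP.
have := left_expand hx iL hax (leqnn a) W0 (ltW WW) (lexx _).
rewrite eW eP; have -> : 1 - p - (1 - q) = q - p by ring.
by set X := _ ^+ _; rewrite -[3 / 2 * X * _]mulrA; set Z := X * _; set W := lV _ _; lra.
Qed.

Section Slopes.
Variables (Dp Dq : R -> R).
Hypothesis hDp : forall x, 0 <= x <= 1 -> expR (- d) <= Dp x <= expR d.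
Hypothesis hDq : forall x, 0 <= x <= 1 -> expR (- d) <= Dq x <= expR d.
Let hDq' x : 0 <= x <= 1 -> expR (- d) <= Dq (1 - x) <= expR d.
by move=> /andP[h1 h2]; apply: hDq; andlra. Qed.
Let hDp' x : 0 <= x <= 1 -> expR (- d) <= Dp (1 - x) <= expR d.
by move=> /andP[h1 h2]; apply: hDp; andlra. Qed.

Let dn (n : nat) : (n <= a + b)%N -> 4 * d * n%:R + 2 * d <= ka.
move=> h; apply: le_trans (t_dab ht); rewrite lerD2r ler_wpM2l ?ler_nat //.
by rewrite mulr_ge0.
Qed.

(** In [KK_slopes] the last points lie within [ka * e] of [c], while A is at distance at least
    [e / 4] from them; the logarithmic gap is therefore at most [8 * ka], and the distortions of the
    decompositions add at most [ka]. *)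
Lemma slopes_right x y1 y : lc m < x <= 1 -> litin m b (lV m x) -> lK m b (lV m x) <= x ->
  0 <= y1 -> p <= lK m b y1 -> y1 <= y <= lV m x ->
  slopes (9 * ka) (lK m b) y1 (lV m x)
    (Dn (lu m) (lc m) (lp m) Dp (flip (lq m)) (fun y => Dq (1 - y)) b y).
move=> hx hi hbx y10 py hy; have hr' := est_r hx hi; rewrite -/e in hr'.
have hp := est_p; have ke : ka * e <= e / 16.
  by have : ka * e <= 1 / 16 * e by [rewrite ler_pM2r]; lra.
have hA : lK m b (lV m x) < A by have := rho2; have := e0; lra.
have s := KK_slopes (wf_u hw) (wf_c1 hw) (wf_p hw) (sl_flip (wf_q hw)) hDp hDq' (wf_A hw) y10 hy hi hA.
case/andP: (hy) => y1y yx; have y0 : 0 <= y by lra.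
have [hiy _] := lK_mono hw y0 yx hi.
have [hi1 [Kle _]] := lK_mono hw y10 (le_trans y1y yx) hi.
apply: slopes_weak s.
- exact: ltW (Dn_gt0 (wf_u hw) (wf_c1 hw) (wf_p hw) (sl_flip (wf_q hw)) hDp hDq' hiy).
- have h1 : ln (A - lK m b y1) - ln (A - lK m b (lV m x)) <= 8 * ka.
    apply: lnB_le; [lra|lra|].
    have t1 : e / 4 <= A - lK m b (lV m x) by have := rho2; lra.
    have t2 : 8 * ka * (e / 4) <= 8 * ka * (A - lK m b (lV m x)) by rewrite ler_wpM2l // mulr_ge0 // ltW.
    by move: t2; set X := _ * (A - _); rewrite -/(lK m b y1) -/(lK m b (lV m x)); lra.
  by have := dn (leq_addl a b); rewrite -/A -/(lK m b y1) -/(lK m b (lV m x)); lra.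
- move=> z w h1 h2 h3; have z0 : 0 <= z by lra.
  have [hiw _] := lK_mono hw (le_trans z0 h2) h3 hi.
  by have [_ []] := lK_mono hw z0 h2 hiw.
Qed.

(** Here the critical value is of order 1 and all last points are of order [e <= ka], which bounds
    the logarithmic gap even for [y1 = 0]. *)
Lemma slopes_left x y1 y : lc m' < x <= 1 -> litin m' a (lV m' x) -> lK m' a (lV m' x) <= x ->
  0 <= y1 -> y1 <= y <= lV m' x ->
  slopes (9 * ka) (lK m' a) y1 (lV m' x)
    (Dn (lu m') (lc m') (lp m') Dq (flip (lq m')) (fun y => Dp (1 - y)) a y).
move=> hx hi hax y10 hy; have hl := est_l hx hi hax.
have ke : ka * e <= e / 16.
  by have : ka * e <= 1 / 16 * e by [rewrite ler_pM2r]; lra.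
have [B0 _] := sl_expand ed (wf_q hw) (lexx 0) (ltW v0) v1.
have [f0 _ _] := wf_q hw; rewrite f0 in B0; pose B := lq m (lv m).
have B1 : 1 / 3 <= B by rewrite /B; have := v2; lra.
have hB : lK m' a (lV m' x) < lp m' (lu m') by rewrite -[lp m' _]/B; have := e1; lra.
have s := KK_slopes (wf_u hw') (wf_c1 hw') (wf_p hw') (sl_flip (wf_q hw')) hDq hDp' (wf_A hw') y10 hy hi hB.
case/andP: (hy) => y1y yx; have y0 : 0 <= y by lra.
have [hiy _] := lK_mono hw' y0 yx hi.
have [hi1 [Kle _]] := lK_mono hw' y10 (le_trans y1y yx) hi.
have /andP[K0 _] := lK_in hw' hi1.
apply: slopes_weak s.
- exact: ltW (Dn_gt0 (wf_u hw') (wf_c1 hw') (wf_p hw') (sl_flip (wf_q hw')) hDq hDp' hiy).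
- have h1 : ln (B - lK m' a y1) - ln (B - lK m' a (lV m' x)) <= 8 * ka.
    apply: lnB_le; [move: hB; rewrite -[lp m' _]/B; lra|lra|].
    have t1 : 1 / 4 <= B - lK m' a (lV m' x) by have := e1; lra.
    have t2 : 8 * ka * (1 / 4) <= 8 * ka * (B - lK m' a (lV m' x)) by rewrite ler_wpM2l // mulr_ge0 // ltW.
    by have := t_eka ht; rewrite -/e; move: t2; set X := _ * (B - _); lra.
  have := dn (leq_addr b a); rewrite -[lp m' (lu m')]/B -/(lK m' a y1) -/(lK m' a (lV m' x)); lra.
- move=> z w h1' h2 h3; have z0 : 0 <= z by lra.
  have [hiw _] := lK_mono hw' (le_trans z0 h2) h3 hi.
  by have [_ []] := lK_mono hw' z0 h2 hiw.
Qed.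
End Slopes.

Let one_bd (x : R) : 0 <= x <= 1 -> expR (- d) <= 1 <= expR d.
by move=> _; apply/andP; split; rewrite -expR0 ler_expR; have := d0; lra. Qed.

(** Only the existence of a reference slope matters, so that the derivatives of phi and psi are
    replaced by the constant 1. *)
Lemma dist_both : dist (9 * ka) m b /\ dist (9 * ka) m' a.
split=> x hx hi hK.
  have hx' : lc m <= x <= 1 by case/andP: hx => /ltW -> ->.
  have /andP[h1 h2] := lV_in hw hx'; have w1 : 0 <= 1 - lv m by rewrite subr_ge0.
  have [_ _ _ hp _] := hR; have hy : 1 - lv m <= lV m x <= lV m x by rewrite h1 lexx.
  eexists; last exact: (slopes_right one_bd one_bd hx hi hK w1 hp hy).
  exact: (Dn_gt0 (wf_u hw) (wf_c1 hw) (wf_p hw) (sl_flip (wf_q hw)) one_bd one_bd hi).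
have hx' : lc m' <= x <= 1 by case/andP: hx => /ltW -> ->.
have /andP[h1 h2] := lV_in hw' hx'; have w1 : 0 <= 1 - lv m' by rewrite subr_ge0.
have hy : 1 - lv m' <= lV m' x <= lV m' x by rewrite h1 lexx.
eexists; last exact: (slopes_left one_bd one_bd hx hi hK w1 hy).
exact: (Dn_gt0 (wf_u hw') (wf_c1 hw') (wf_p hw') (sl_flip (wf_q hw')) one_bd one_bd hi).
Qed.

(** [Dn_low] at [V1], where the final gap [A - p] is at least [e / 2], gives slope at least
    [al ^+ b * e / 4]; the distortion [9 * ka] costs another factor 2. *)
Lemma est_Vlen V1 : preimage m b p q V1 ->
  lV m q - V1 <= 8 / (e * al ^+ b) * (q - p).
move=> hV; have [/andP[V0 Vv] eV iV] := hV; have VV := preimage_lt hw cq hV.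
have hx : lc m < q <= 1 by rewrite cq; case: hR => /andP[].
have [_ _ eQ _ _] := hR; have hbx : lK m b (lV m q) <= q by rewrite eQ.
have hy : V1 <= V1 <= lV m q by rewrite lexx ltW.
have pV : p <= lK m b V1 by rewrite eV.
have s := slopes_right one_bd one_bd hx iV hbx V0 pV hy.
have [h _] := s V1 (lV m q) (lexx _) (ltW VV) (lexx _); rewrite eV eQ in h.
have [iV1 _] := lK_mono hw V0 (ltW VV) iV.
have low := Dn_low (wf_u hw) (wf_c1 hw) (wf_p hw) (sl_flip (wf_q hw)) one_bd one_bd (wf_A hw) iV1.
rewrite -/(lK m b V1) eV -/A in low; move: h low; set D := Dn _ _ _ _ _ _ _ _ => h low.
have P0 : 0 < al ^+ b by rewrite exprn_gt0.
have k2 : expR (9 * ka) <= 2.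
  have h2 : expR (9 * ka) * expR (- (9 * ka)) = 1 :> R by rewrite -expRD subrr expR0.
  have h3 : 1 + - (9 * ka) <= expR (- (9 * ka)) :> R by exact: expR_ge1Dx.
  have h4 := expR_gt0 (9 * ka); set X := expR (9 * ka) in h2 h4 *.
  have h5 : X * (1 / 2) <= X * expR (- (9 * ka)) by rewrite ler_pM2l //; have := k1'; lra.
  by move: h5; rewrite h2; lra.
have e2 : 1 / 2 <= expR (- d) * expR (- (d + d)) ^+ b.
  have e3 : expR (- d) * expR (- (d + d)) ^+ b = expR (- (d + (d + d) * b%:R)).
    by rewrite -expRM_natr -expRD; congr expR; ring.
  have e4 : expR (d + (d + d) * b%:R) * expR (- (d + (d + d) * b%:R)) = 1 by rewrite -expRD subrr expR0.
  have e5 : expR (d + (d + d) * b%:R) <= 2.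
    apply: le_trans (t_db ht); rewrite ler_expR.
    have b1 : 1 <= b%:R :> R by rewrite ler1n; exact: t_b ht.
    have := ler_wpM2l d0 b1; rewrite mulr1 !mulrDl -!mulrA; set t := d * b%:R; have := d0; lra.
  rewrite e3; have := expR_gt0 (- (d + (d + d) * b%:R)); set Y := expR (- _) in e4 *; set X := expR _ in e4 e5 *.
  by move=> y0; have : X * Y <= 2 * Y by [rewrite ler_pM2r]; lra.
have D1 : al ^+ b * e / 4 <= D.
  apply: le_trans low; rewrite exprMn.
  have -> : expR (- d) * (al ^+ b * expR (- (d + d)) ^+ b) * (A - p) =
    expR (- d) * expR (- (d + d)) ^+ b * (al ^+ b * (A - p)) by ring.
  have -> : al ^+ b * e / 4 = 1 / 2 * (al ^+ b * (e / 2)) by field.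
  apply: ler_pM => //; first by rewrite !mulr_ge0 ?(ltW P0) ?(ltW e0).
  by rewrite ler_pM2l //; have := pc; have := rho2; lra.
have pe : 0 < e * al ^+ b by rewrite mulr_gt0.
rewrite mulrAC ler_pdivlMr //; have vv : 0 < lV m q - V1 by rewrite subr_gt0.
have h6 : al ^+ b * e / 4 * (lV m q - V1) <= D * (lV m q - V1) by rewrite ler_pM2r.
have qp : 0 <= q - p by have := pc; have := cq; lra.
have h7 : expR (9 * ka) * (q - p) <= 2 * (q - p) by rewrite ler_wpM2r.
have -> : (lV m q - V1) * (e * al ^+ b) = 4 * (al ^+ b * e / 4 * (lV m q - V1)) by field.
have := le_trans h6 (le_trans h h7); set X := _ * (lV m q - V1); lra.
Qed.
End Estimates.

(** * First-order perturbation theory of one half of the renormalization *)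

Section OneSided.
Implicit Types (x y z : R).

(** Perturbations of the diffeomorphisms vanish at both ends at a linear rate; both rates are
    recorded, so that the condition is stable under the flip. *)
Record tbd (L N : R) (t : lmap) : Prop := Tbd {
  tb_u : `|lu t| <= N; tb_v : `|lv t| <= N; tb_c : `|lc t| <= N;
  tb_p : forall x, 0 <= x <= 1 -> `|lp t x| <= L * N * x /\ `|lp t x| <= L * N * (1 - x);
  tb_q : forall x, 0 <= x <= 1 -> `|lq t x| <= L * N * x /\ `|lq t x| <= L * N * (1 - x) }.

Lemma tbd_flip L N t : tbd L N t -> tbd L N (tflip t).
by case=> h1 h2 h3 h4 h5; split=> //=; rewrite normrN. Qed.

Lemma tbd_tof : exists2 L, 0 <= L & forall (d0 d1 : Order.disp_t) (T0 : orderType d0)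
  (T1 : orderType d1) (f z : coords R T0 T1) N, small f (@rb / 2) -> nle z N ->
    tbd L N (tof f z).
have [K K0 hK] := mu_param_lip; exists (K * expR 2); first by rewrite mulr_ge0 ?expR_ge0 // ltW.
move=> d0 d1 T0 T1 f z N [hs ht] hz; have [h1 h2 h3 h4 h5] := hz; split=> // x hx.
  exact: (cds_bound predT (conj K0 hK) hs h4 hx).
have hx' : 0 <= 1 - x <= 1 by case/andP: hx => a1 a2; andlra.
have [b1 b2] := cds_bound predT (conj K0 hK) ht h5 hx'.
by rewrite /= normrN subKr in b2 *; split.
Qed.

Variables (d L N : R) (m t : lmap) (px qx : R -> R).
Hypothesis hw : wf d m.
Hypothesis hreg : reg d m px qx.
Hypothesis hd : expR d <= 3 / 2.
Hypothesis hu : 1 / 2 <= lu m.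
Hypothesis L0 : 0 <= L.
Hypothesis htb : tbd L N t.
Notation lD := (lD m px qx).
Let N0 : 0 <= N. by case: htb => h _ _ _ _; exact: le_trans h. Qed.
Let d0 : 0 <= d. exact: wf_d hw. Qed.
Let c0 : 0 < lc m. by case/andP: (wf_c hw). Qed.
Let hpx x : 0 <= x <= 1 -> expR (- d) <= px x <= expR d. by case: hreg => h _ _; apply: h. Qed.
Let hqx x : 0 <= x <= 1 -> expR (- d) <= qx (1 - x) <= expR d.
by case: hreg => _ h _ /andP[h1 h2]; apply: h; andlra. Qed.

Definition kapM := (3 / 2 * L + 5) * (1 + (lc m)^-1) * N.
Let M0 : 0 <= kapM.
by rewrite /kapM !mulr_ge0 // ?addr_ge0 ?mulr_ge0 ?invr_ge0 ?(ltW c0). Qed.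

(* Perturbations at step j are at most proportional to the j-th point, and by
   KK_star such points, divided by D_j, are dominated by the last one. *)
Lemma kap_bound n y : litin m n y ->
  `|dlK m px qx t n y 0| <= kapM * n.+1%:R * expR ((d + d) * n%:R) * lK m n y.
elim: n => [|n IH] hi.
  have [/andP[y0 y1] _] := hi; have h01 : 0 <= 1 - y <= 1 by andlra.
  have hy : 0 <= y <= 1 by rewrite y0.
  have [_] := tb_q htb h01; rewrite subKr => b.
  have [s _] := sl_expand hd (sl_flip (wf_q hw)) (lexx 0) y0 y1.
  have [f0 _ _] := sl_flip (wf_q hw); rewrite f0 in s.
  rewrite /= mulr0 addr0 normrN mulr0 expR0 !mulr1; apply: le_trans b _.
    have LN : 0 <= L * N by exact: mulr_ge0.
  apply: (@le_trans _ _ (3 / 2 * (L * N) * flip (lq m) y)).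
    by have : 0 <= L * N * (flip (lq m) y - 2 / 3 * y) by [apply: mulr_ge0 => //; lra]; lra.
  apply: ler_wpM2r; first by lra.
  have c1 : 0 <= (lc m)^-1 by rewrite invr_ge0 ltW.
  have e1 : 0 <= (3 / 2 * L + 5) * (lc m)^-1 * N by rewrite !mulr_ge0 // addr_ge0 // mulr_ge0.
  have -> : kapM = 3 / 2 * (L * N) + 5 * N + (3 / 2 * L + 5) * (lc m)^-1 * N by rewrite /kapM; ring.
  by have := N0; lra.
have hn := itinS (leqnSn n) hi; have {}IH := IH hn.
have zc : lK m n y < lc m by case: hi => _; apply.
have /andP[z0 _] := lK_in hw hn; have c1 := wf_c1 hw.
have hz : 0 <= lK m n y <= lc m by rewrite z0 ltW.
have hq := qf_in1 (wf_u hw) c1 hz; have /andP[q0 q1] := hq.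
have [s _] := sl_expand hd (wf_p hw) (lexx 0) q0 q1; have [f0 _ _] := wf_p hw.
rewrite f0 !subr0 -[lp m _]/(lK m n.+1 y) in s.
have [bp _] := tb_p htb hq; have /andP[p1 p2] := hpx hq.
have star := br_star (wf_u hw) c1 (wf_p hw) hpx z0 zc.
rewrite -[br _ _ _ _]/(lK m n.+1 y) in star.
have B0 := brd_gt0 (wf_u hw) c1 hpx z0 zc.
(* Contributions of phi, of [u], of [c], and the transported earlier perturbation. The first two are
   multiples of Q at the point, and [br_star] makes the third comparable with the new point as
   well. *)
have -> : dlK m px qx t n.+1 y 0 = lp t (qf (lu m) (lc m) (lK m n y)) +
   px (qf (lu m) (lc m) (lK m n y)) * ((1 - rr (lc m) (lK m n y) `^ al) * lu t) -
   brd px (lu m) (lc m) (lK m n y) * lK m n y / lc m * lc t +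
   brd px (lu m) (lc m) (lK m n y) * dlK m px qx t n y 0.
  by rewrite /= /dqf /qfd /brd; ring.
have eq : 1 - rr (lc m) (lK m n y) `^ al = qf (lu m) (lc m) (lK m n y) / lu m.
  by rewrite /qf; field; rewrite gt_eqF //; have := hu; lra.
move: bp; rewrite eq; set Q := qf _ _ _ in q0 q1 p1 p2 s *; set z := lK m n y in z0 zc hz IH star B0 *.
set z' := lK m n.+1 y in s star *; set Br := brd _ _ _ _ in star B0 * => bp.
have z'0 : 0 <= z' by lra.
have e2 : expR (d + d) <= 9 / 4.
  rewrite expRD; have := expR_ge0 d; have := hd; set X := expR d => h1 h2.
  by have := ler_pM h2 h2 h1 h1; lra.
have b1 : `|lp t Q| <= 3 / 2 * L * N * z'.
  apply: le_trans bp _; have h : 0 <= L * N * (3 / 2 * z' - Q).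
    by apply: mulr_ge0; [exact: mulr_ge0|lra].
  lra.
have b2 : `|px Q * (Q / lu m * lu t)| <= 9 / 2 * N * z'.
  have px0 : 0 <= px Q by apply: le_trans p1; exact: expR_ge0.
  have ui : 0 < (lu m)^-1 by rewrite invr_gt0; have := hu; lra.
  have ui2 : (lu m)^-1 <= 2.
    by rewrite -[2]invrK lef_pV2 ?posrE ?invr_gt0 //; have := hu; lra.
  have Qu : 0 <= Q / lu m by apply: mulr_ge0 => //; exact: ltW.
  rewrite [X in X <= _]normrM (ger0_norm px0) [X in _ * X <= _]normrM (ger0_norm Qu).
  have h1 : Q / lu m * `|lu t| <= 3 / 2 * z' * 2 * N.
    by apply: ler_pM => //; [apply: ler_pM => //; [exact: ltW|lra]|exact: tb_u htb].
  have h2 : px Q * (Q / lu m * `|lu t|) <= 3 / 2 * (3 / 2 * z' * 2 * N).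
    by apply: ler_pM => //; [exact: mulr_ge0|exact: le_trans p2 hd].
  by apply: le_trans h2 _; have -> : 3 / 2 * (3 / 2 * z' * 2 * N) = 9 / 2 * N * z' by field.
have star' : Br * z <= 9 / 4 * z'.
  rewrite mulrC; apply: le_trans star _; exact: ler_wpM2r.
have ci : 0 < (lc m)^-1 by rewrite invr_gt0.
have b3 : `|Br * z / lc m * lc t| <= 9 / 4 * z' * (lc m)^-1 * N.
  have Bz : 0 <= Br * z by rewrite mulr_ge0 // ltW.
  have Bzc : 0 <= Br * z / lc m by rewrite divr_ge0 // ltW.
  rewrite [X in X <= _]normrM (ger0_norm Bzc).
  by apply: ler_pM => //; [apply: ler_pM => //; exact: ltW|exact: tb_c htb].
have E : `|lp t Q + px Q * (Q / lu m * lu t) - Br * z / lc m * lc t| <= kapM * z'.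
  apply: (@le_trans _ _ (3 / 2 * L * N * z' + 9 / 2 * N * z' + 9 / 4 * z' * (lc m)^-1 * N)).
    by apply: (le_trans (ler_normB _ _)); apply: lerD => //; apply: (le_trans (ler_normD _ _)); exact: lerD.
  have -> : kapM * z' = 3 / 2 * L * N * z' + 5 * (N * z') + 3 / 2 * (L * N * z' * (lc m)^-1) + 5 * (z' * (lc m)^-1 * N).
    by rewrite /kapM; field; rewrite gt_eqF.
  have g1 : 0 <= N * z' by exact: mulr_ge0.
  have g2 : 0 <= L * N * z' * (lc m)^-1 by rewrite !mulr_ge0 // ltW.
  have g3 : 0 <= z' * (lc m)^-1 * N by rewrite !mulr_ge0 // ltW.
  lra.
have G : `|Br * dlK m px qx t n y 0| <= kapM * n.+1%:R * (expR ((d + d) * n.+1%:R) * z').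
  rewrite normrM (gtr0_norm B0); apply: (@le_trans _ _ (Br * (kapM * n.+1%:R * expR ((d + d) * n%:R) * z))).
    by rewrite ler_pM2l.
  have -> : Br * (kapM * n.+1%:R * expR ((d + d) * n%:R) * z) = kapM * n.+1%:R * (expR ((d + d) * n%:R) * (z * Br)) by ring.
  apply: ler_wpM2l; first by rewrite mulr_ge0.
  have -> : expR ((d + d) * n.+1%:R) = expR ((d + d) * n%:R) * expR (d + d).
    by rewrite -expRD -natr1; congr expR; ring.
  by rewrite -mulrA ler_wpM2l // expR_ge0.
apply: (le_trans (ler_normD _ _)); apply: (le_trans (lerD E G)).
have e1 : 1 <= expR ((d + d) * n.+1%:R).
  by rewrite -expR0 ler_expR mulr_ge0 // addr_ge0.
have -> : kapM * n.+2%:R * expR ((d + d) * n.+1%:R) * z' =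
   kapM * (expR ((d + d) * n.+1%:R) * z') + kapM * n.+1%:R * (expR ((d + d) * n.+1%:R) * z').
  by rewrite -[in LHS]natr1; ring.
by rewrite lerD2r ler_wpM2l // ler_peMl.
Qed.

Variables (n : nat) (p q V1 eta B Hx dp : R).
Hypothesis hh : half m n p q.
Hypothesis hpc : p < lc m.
Hypothesis hV : preimage m n p q V1.
Notation V2 := (lV m q).
Hypothesis hs : forall y, V1 <= y <= V2 -> slopes eta (lK m n) V1 V2 (lD n y).
Notation ka := (lkap m px qx n q).
Notation e := (1 - lc m).
Let v' := (lv m - 1 + V2) / (V2 - V1).
Let hw' := wf_flip hw.
Let e0 : 0 < e. by case/andP: (wf_c hw'). Qed.
Let v0 : 0 < lv m. by case/andP: (wf_v hw). Qed.
Let cq : lc m < q. by case: hh => /andP[]. Qed.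
Let pq : 0 < q - p. by have := hpc; have := cq; lra. Qed.
Let VV : V1 < V2. exact: (preimage_lt hw cq hV). Qed.
Let vl : 0 < V2 - V1. by rewrite subr_gt0. Qed.
Let iV2 : litin m n V2. by case: hV. Qed.
Let V10 : 0 <= V1. by case: hV => /andP[]. Qed.
Let iV1 : litin m n V1. by have [] := lK_mono hw V10 (ltW VV) iV2. Qed.
Let D2 : 0 < lD n V2. exact: (lD_gt0 hw hreg iV2). Qed.
Let D1 : 0 < lD n V1. exact: (lD_gt0 hw hreg iV1). Qed.
Let K2 : lK m n V2 = q. by case: hh. Qed.
Let K1 : lK m n V1 = p. by case: hV. Qed.
Let V1v : V1 <= 1 - lv m. by case: hV => /andP[]. Qed.
Let rq := (q - lc m) / e.
Let rq0 : 0 < rq. by rewrite divr_gt0 // subr_gt0. Qed.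
Let V2E : V2 = 1 - lv m + lv m * rq `^ al. exact: lVE. Qed.
Let rrE : rr (lc (lflip m)) (1 - q) = rq.
by rewrite /rr /rq /=; congr (_ / _); ring. Qed.
Let Q' := qfd (lflip m) (1 - q).
Let kaE : ka * (q - lc m) = al * (lD n V2 * (lv m * rq `^ al)).
rewrite /lkap /qfd rrE /= [rq `^ al]powR_split //; set P := rq `^ (al - 1).
have -> : q - lc m = rq * e by rewrite divfK // gt_eqF.
by field; rewrite gt_eqF.
Qed.
Let E0 : 0 < expR eta. exact: expR_gt0. Qed.

Let DV y : V1 <= y <= V2 -> lD n y * (V2 - V1) <= expR eta * (q - p) /\
  q - p <= expR eta * (lD n y * (V2 - V1)).
by move=> hy; have := hs hy (lexx _) (ltW VV) (lexx _); rewrite K1 K2. Qed.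
Lemma lD_len : lD n V2 * (V2 - V1) <= expR eta * (q - p) /\
  q - p <= expR eta * (lD n V2 * (V2 - V1)).
by apply: DV; rewrite lexx ltW. Qed.
Let DV2 := lD_len.
Let DV1 := DV (introT andP (conj (lexx V1) (ltW VV))).
Let vV : 1 - lv m <= V2. by rewrite V2E lerDl mulr_ge0 ?powR_ge0 // ltW. Qed.

(** The power law gives F'(q) (q - c) = al D |Q(R)| with D the slope after Q ([kaE]). Up to
    distortion D |Q(R)| is the length of the image of R, which contains [[c, q]] since the return
    branch starts below [c]. *)
Lemma lkap_ge : al <= expR eta * ka.
have h2 : V1 <= V2 <= V2 by rewrite lexx ltW.
have [_ h] := hs h2 V1v vV (lexx _); rewrite K2 in h.
have [_ _ _ _ h3] := hh; rewrite -(@ler_pM2r _ (q - lc m)) ?subr_gt0 // -mulrA kaE mulrCA ler_pM2l //.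
have -> : lv m * rq `^ al = V2 - (1 - lv m) by rewrite V2E; ring.
by apply: le_trans h; rewrite lerD2l lerN2 ltW.
Qed.

Lemma renorm_v01 : 0 <= v' <= 1.
by rewrite /v' divr_ge0 ?(ltW vl) //= ?ler_pdivrMr // ?mul1r; have := vV; have := V1v; lra.
Qed.

(** From [kaE] and |C| <= e^eta D |V|. Added to its flipped counterpart it bounds u' / F'(p) + v' /
    F'(q), because |L| + |R| = |C|. *)
Lemma renorm_v_lkap : v' * al * (q - p) <= expR eta * (q - lc m) * ka.
have [_ h] := DV2; have /andP[v'0 _] := renorm_v01.
have -> : expR eta * (q - lc m) * ka = v' * al * (expR eta * (lD n V2 * (V2 - V1))).
  have -> : expR eta * (q - lc m) * ka = expR eta * (ka * (q - lc m)) by ring.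
  by rewrite kaE /v' V2E; field; rewrite -V2E gt_eqF.
by rewrite ler_wpM2l // mulr_ge0 // ltW.
Qed.

Notation dq := (dQ m px qx n q t).
Notation dv2 := (dlV m t q dq).
Notation dv1 := (dY m px qx n V1 t dp).
(** Normalized shifts: the motion of [q], or of [p], minus what the affine stretching of its side of
    [c] produces when [c] moves, divided by a quantity comparable with |C|. [Hx] is the divisor that
    the other half uses for [p]. *)
Let y := (dq - (1 - q) / e * lc t) / (lD n V2 * (V2 - V1)).
Let x := - (dp - p / lc m * lc t) / Hx.
Let W := expR eta * ((1 + B) * N) / (q - p).

Hypothesis eta_al : expR eta < al.
Hypothesis V2h : V2 <= 1 / 2.
Hypothesis p0 : 0 <= p.
Hypothesis q1 : q <= 1.
Hypothesis Hx0 : 0 < Hx.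
Hypothesis Hx1 : q - p <= expR eta * Hx.
Hypothesis Hx2 : Hx <= expR eta * (q - p).
Hypothesis hB2 : `|dlK m px qx t n V2 0| <= B * N.
Hypothesis hB1 : `|dlK m px qx t n V1 0| <= B * N.

Let ka1 : 1 < ka.
by rewrite -(ltr_pM2l E0) mulr1; apply: lt_le_trans lkap_ge. Qed.

Let w3 := ((1 - q) / e * lc t - dlK m px qx t n V2 0) / (lD n V2 * (V2 - V1)).
Let w4 := (p / lc m * lc t - dlK m px qx t n V1 0) / (lD n V1 * (V2 - V1)).

Let wb (D k u : R) : 0 <= k <= 1 -> 0 < D -> q - p <= expR eta * (D * (V2 - V1)) -> `|u| <= B * N ->
  `|(k * lc t - u) / (D * (V2 - V1))| <= W.
move=> /andP[k0 k1] hD h hu'; have DV0 : 0 < D * (V2 - V1) by rewrite mulr_gt0.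
rewrite normrM normfV (gtr0_norm DV0) ler_pdivrMr // /W mulrAC ler_pdivlMr //.
have hk : `|k * lc t - u| <= (1 + B) * N.
  apply: (le_trans (ler_normB _ _)); rewrite mulrDl mul1r; apply: lerD => //.
  rewrite normrM (ger0_norm k0); apply: le_trans (tb_c htb); exact: ler_piMl.
have -> : expR eta * ((1 + B) * N) * (D * (V2 - V1)) = (1 + B) * N * (expR eta * (D * (V2 - V1))) by ring.
by apply: ler_pM => //; exact: ltW.
Qed.

(** The fixed point equation, differentiated: [q] moves by the direct perturbation plus the slope
    times the motion of [V2]. *)
Let dqE : dq = dlK m px qx t n V2 0 + lD n V2 * dv2.
have e1 : dlV m t q dq = dlV m t q 0 + Q' * dq by rewrite /dlV /dqf /Q'; ring.
rewrite e1 /dQ dlK_split -/Q'; have -> : ka = lD n V2 * Q' by [].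
by field; rewrite subr_eq0 gt_eqF //; exact: ka1.
Qed.

Let dv2E1 : dv2 = (V2 - V1) * (y + w3).
rewrite /y /w3; have -> : dv2 = (dq - dlK m px qx t n V2 0) / lD n V2.
  by rewrite {2}dqE; field; rewrite gt_eqF.
by field; rewrite !gt_eqF.
Qed.

Let dv2E2 : dv2 = - ((1 - V2) / lv m) * lv t + ka * (V2 - V1) * y.
have -> : ka * (V2 - V1) * y = Q' * (dq - (1 - q) / e * lc t).
  rewrite /y; have -> : ka = lD n V2 * Q' by [].
  by field; rewrite !gt_eqF.
have -> : (1 - V2) / lv m = 1 - rq `^ al by rewrite V2E; field; rewrite gt_eqF.
by rewrite /dlV /dqf rrE -/Q' /=; ring.
Qed.

Let dv1E : dv1 = - (Hx / lD n V1) * x + (V2 - V1) * w4.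
by rewrite /dY /x /w4; field; rewrite !gt_eqF. Qed.

Let g := lv m / (1 - V2).
Let Vp : 0 < 1 - V2. by have := V2h; lra. Qed.
Let g1 : 0 <= g - 1 <= 2 * V2.
have -> : g - 1 = (lv m - 1 + V2) / (1 - V2) by rewrite /g; field; rewrite gt_eqF.
have V20 : 0 <= V2 by case: iV2 => /andP[].
rewrite divr_ge0 ?(ltW Vp) //=; last by have := vV; lra.
rewrite ler_pdivrMr //; case/andP: (wf_v hw) => _ h.
by have : 0 <= V2 * (1 / 2 - V2) by [apply: mulr_ge0 => //; have := V2h; lra]; lra.
Qed.

(** Two expressions of the motion of [V2], one through the fixed point equation and one through Q,
    are equated and solved for the change of [v]. The factor [V2 - V1] obtained here is the source
    of the expansion. *)
Let lvt : lv t = g * (V2 - V1) * ((ka - 1) * y - w3).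
have h : - ((1 - V2) / lv m) * lv t + ka * (V2 - V1) * y = (V2 - V1) * (y + w3) by rewrite -dv2E2 dv2E1.
have -> : lv t = g * ((1 - V2) / lv m * lv t) by rewrite /g; field; rewrite !gt_eqF.
by rewrite -[g * _ * _]mulrA; congr (_ * _); move: h; set a1 := (1 - V2) / _ * _; rewrite mulNr -/a1; lra.
Qed.

Let qe01 : 0 <= (1 - q) / e <= 1.
apply/andP; split; first by apply: divr_ge0; [rewrite subr_ge0 | exact: ltW].
by rewrite ler_pdivrMr // mul1r lerD2l lerN2 ltW.
Qed.

(** Read backwards: a change of [v] that is large compared with |V| requires a shift [y] of order 1,
    up to the error [W]. *)
Lemma onesided_dv : `|lv t| <= 2 * (V2 - V1) * ((ka - 1) * `|y| + W).
have /andP[g0 g2] := g1; have gg : 0 <= g <= 2 by have := V2h; lra.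
have W3 : `|w3| <= W.
  by apply: wb => //; case: DV2.
case/andP: gg => gg0 gg2; have gv : 0 <= g * (V2 - V1) by rewrite mulr_ge0 // ltW.
rewrite lvt [X in X <= _]normrM (ger0_norm gv); apply: ler_pM => //.
  by rewrite ler_pM2r.
apply: (le_trans (ler_normB _ _)); rewrite normrM gtr0_norm ?subr_gt0 //; first by rewrite lerD2l.
Qed.

(** The quotient rule for v' with the motions of both ends of V inserted. The errors come from [g]
    differing from 1 by at most [2 * V2], from the direct perturbations, and from the two different
    divisors used for [p]. *)
Lemma onesided_dv' : `|(lv t + dv2 - v' * (dv2 - dv1)) / (V2 - V1) - (ka * y - v' * (x + y))| <=
  2 * V2 * ((ka - 1) * `|y|) + 4 * W + (expR (eta + eta) - 1) * `|x|.
have /andP[g0 g2] := g1; have gg : 0 <= g <= 2 by have := V2h; lra.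
have /andP[v'0 v'1] := renorm_v01.
have W3 : `|w3| <= W.
  by apply: wb => //; case: DV2.
have W4 : `|w4| <= W.
  apply: wb => //; last by case: DV1.
  by rewrite divr_ge0 ?(ltW c0) //= ler_pdivrMr // mul1r ltW.
(* Both divisors are |C| up to the factor e^eta, so their ratio is within e^(2 eta) of 1. *)
pose ro := Hx / (lD n V1 * (V2 - V1)).
have DD : 0 < lD n V1 * (V2 - V1) by rewrite mulr_gt0.
have Ro : `|ro - 1| <= expR (eta + eta) - 1.
  have [h1 h2] := DV1; have eE : expR (eta + eta) = expR eta * expR eta by rewrite expRD.
  have r1 : ro <= expR (eta + eta).
    rewrite /ro ler_pdivrMr // eE -mulrA; apply: (le_trans Hx2); exact: ler_wpM2l (ltW E0) _ _ h2.
  have r2 : 1 <= expR (eta + eta) * ro.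
    rewrite /ro mulrA ler_pdivlMr // mul1r eE -mulrA; apply: (le_trans h1); exact: ler_wpM2l (ltW E0) _ _ Hx1.
  have r0 : 0 < ro by rewrite divr_gt0.
  rewrite ler_norml; move: r1 r2 r0; set E := expR (eta + eta); set r := ro => r1 r2 r0.
  apply/andP; split; last by lra.
  have Ep : 0 < E by exact: expR_gt0.
  have [r1'|r1'] := leP 1 r; first by lra.
  have : 0 <= (E - 1) * (1 - r) by apply: mulr_ge0; [have : E * r <= E * 1 by [rewrite ler_pM2l // ltW]; lra|lra].
  by lra.
have -> : (lv t + dv2 - v' * (dv2 - dv1)) / (V2 - V1) - (ka * y - v' * (x + y)) =
   (g - 1) * ((ka - 1) * y) + ((1 - v' - g) * w3 + v' * w4) - v' * ((ro - 1) * x).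
  by rewrite dv2E1 dv1E lvt /ro; field; rewrite !gt_eqF.
apply: (le_trans (ler_normB _ _)); apply: lerD.
  apply: (le_trans (ler_normD _ _)); apply: lerD.
    rewrite !normrM (ger0_norm g0) (gtr0_norm (_ : 0 < ka - 1)) ?subr_gt0; last exact: ka1.
    apply: ler_wpM2r g2; apply: mulr_ge0 => //; rewrite subr_ge0 ltW //; exact: ka1.
  apply: (le_trans (ler_normD _ _)).
  have k3 : `|(1 - v' - g) * w3| <= 3 * W.
    rewrite normrM; apply: ler_pM => //; case/andP: gg => a1 a2; rewrite ler_norml; andlra.
  have k4 : `|v' * w4| <= 1 * W by rewrite normrM (ger0_norm v'0); exact: ler_pM.
  by lra.
rewrite normrM (ger0_norm v'0) normrM; apply: le_trans (_ : `|ro - 1| * `|x| <= _); last exact: ler_wpM2r.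
by rewrite ler_piMl // mulr_ge0.
Qed.
End OneSided.

(** * The cone estimate *)

Section Cone.
Context {d0 d1 : Order.disp_t} {T0 : orderType d0} {T1 : orderType d1}.
Variables (f : coords R T0 T1) (dl ka L : R) (a b : nat) (p q V1 W1 : R).
Let m := mof f.
Let m' := lflip m.
Let px := pxo f.
Let qx := qxo f.
Let e := 1 - lc m.
Hypothesis L0 : 0 <= L.
Hypothesis hreg : reg dl m px qx.
Hypothesis hw : wf dl m.
Hypothesis hr : ren m a b p q.
Hypothesis hV : preimage m b p q V1.
Hypothesis hW : preimage m' a (1 - q) (1 - p) W1.
Hypothesis ht : tiny dl e ka a b.
Hypothesis hka : expR (9 * ka) * ((1 + al) / 2) <= al.
Hypothesis hka64 : ka <= 1 / 64.
Let w0 := 2 * (1 + 9 * (3 / 2 * L + 5)).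
Hypothesis hw0 : w0 * ka <= 1 / 8.
Hypothesis hK : coneK al * (10 + 16 * w0 + 72 / (al - 1)) * ka <= 1 / 2.
Let hw' := wf_flip hw.
Let hreg' := reg_flip hreg.
Let hR : half m b p q. by case: hr. Qed.
Let hL : half m' a (1 - q) (1 - p). by case: hr. Qed.
Let p0 : 0 <= p. by have [] := ren_bd hr. Qed.
Let pc : p < lc m. by have [] := ren_bd hr. Qed.
Let cq : lc m < q. by have [] := ren_bd hr. Qed.
Let q1 : q <= 1. by have [] := ren_bd hr. Qed.
Let qc : 1 - q < lc m'. by rewrite /m' /= ltrD2l ltrN2. Qed.
Let cp : lc m' < 1 - p. by rewrite /m' /= ltrD2l ltrN2. Qed.
Let k0 : 0 < ka. by case/andP: (t_ka ht). Qed.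
Let e0 : 0 < e. by case/andP: (t_e ht). Qed.
Let e1 : e <= 1 / 100. by case/andP: (t_e ht). Qed.
Let c_half : 98 / 100 <= lc m. by have := e1; rewrite /e; lra. Qed.
Notation V2 := (lV m q).
Notation W2 := (lV m' (1 - p)).
Let S := q - p.
Let S0 : 0 < S. by have := pc; have := cq; rewrite /S; lra. Qed.
Let SE : 1 - p - (1 - q) = S. by rewrite /S; ring. Qed.

Let sR y : V1 <= y <= V2 -> slopes (9 * ka) (lK m b) V1 V2 (lD m px qx b y).
move=> hy; have hx : lc m < q <= 1 by rewrite cq.
have [/andP[V10 _] eV iV] := hV; have [_ _ eQ _ _] := hR; have [hp hq _] := hreg.
apply: (slopes_right hw hr ht hp hq hx iV _ V10 _ hy); first by rewrite eQ.
by rewrite eV.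
Qed.

Let sL y : W1 <= y <= W2 -> slopes (9 * ka) (lK m' a) W1 W2 (lD m' qx px a y).
move=> hy; have hx : lc m' < 1 - p <= 1 by rewrite cp lerBlDr lerDl.
have [/andP[V10 _] eV iV] := hW; have [_ _ eQ _ _] := hL; have [hp hq _] := hreg.
by apply: (slopes_left hw hr ht hp hq hx iV _ V10 hy); rewrite eQ.
Qed.

Let eta2 : expR (9 * ka) <= 2.
by have := @exp_lin R (9 * ka); have := k0; have := hka64; lra. Qed.

Let F_ge F : al <= expR (9 * ka) * F -> (1 + al) / 2 <= F.
by move=> h; rewrite -(ler_pM2l (expR_gt0 (9 * ka))); exact: le_trans hka h. Qed.

Lemma lkap_ge2 : (1 + al) / 2 <= lkap m px qx b q /\ (1 + al) / 2 <= lkap m' qx px a (1 - p).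
by split; apply: F_ge; [exact: (lkap_ge hw hR hV sR) | exact: (lkap_ge hw' hL hW sL)]. Qed.

Let eta_al : expR (9 * ka) < al.
apply: lt_le_trans hka; rewrite -[ltLHS]mulr1 ltr_pM2l ?expR_gt0 //; have := al1; lra.
Qed.

Let V2s : V2 <= 5 * ka.
have hx : lc m < q <= 1 by rewrite cq.
have iV : litin m b V2 by case: hV.
have h := est_V hw hr ht hx iV; apply: (le_trans h).
have kk : 0 <= ka <= 1 by have := k0; have := hka64; lra.
by have /andP[_ h2] := powR_in01 kk; have := k0; lra.
Qed.

Let W2s : W2 <= 5 * ka.
have hx : lc m' < 1 - p <= 1 by rewrite cp lerBlDr lerDl.
have iW : litin m' a W2 by case: hW.
have [h _] := left_l hw ht hx iW; have hu := est_u hw ht.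
have -> : W2 = 1 - lu m + lu m * ((1 - p - e) / lc m) `^ al by rewrite lVE /m' /= subKr.
have /andP[u0 u1] := wf_u hw.
have h2 : lu m * ((1 - p - e) / lc m) `^ al <= ((1 - p - e) / lc m) `^ al by rewrite ler_piMl ?powR_ge0.
by have := t_eka ht; rewrite -/e in h hu *; move: h h2; rewrite -/m'; set X := _ `^ al; set Y := lu m * X; lra.
Qed.

Let exp_n (n : nat) : (n <= a + b)%N -> expR ((dl + dl) * n%:R) <= 2.
move=> hn; have h := t_dab ht; have dl0 := wf_d hw.
have h2 : dl * n%:R <= dl * (a + b)%:R by rewrite ler_wpM2l // ler_nat.
have h3 : 0 <= dl * n%:R by rewrite mulr_ge0.
have -> : (dl + dl) * n%:R = 2 * (dl * n%:R) by ring.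
move: h h2 h3; rewrite -mulrA; set x := dl * n%:R; set z := dl * (a + b)%:R => h h2 h3.
have h4 : 0 <= 2 * x <= 1 / 2 by apply/andP; split; have := hka64; have := dl0; lra.
by have := exp_lin h4; have := hka64; lra.
Qed.

(** On the left [(lc mm)^-1] is 1 / e, hence large; it is compensated by the last point [z], which
    is of order [e]. This is why [kap_bound] is proportional to the last point. *)
Let kapB mm n z N : (0 < n)%N -> (n <= a + b)%N -> 0 <= N -> 0 <= z -> (1 + (lc mm)^-1) * z <= 21 / 10 ->
  kapM L N mm * n.+1%:R * expR ((dl + dl) * n%:R) * z <= 9 * (3 / 2 * L + 5) * (a + b)%:R * N.
move=> n0 hn N0 z0 hz; rewrite /kapM.
have -> : (3 / 2 * L + 5) * (1 + (lc mm)^-1) * N * n.+1%:R * expR ((dl + dl) * n%:R) * z =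
  (3 / 2 * L + 5) * N * ((1 + (lc mm)^-1) * z * (n.+1%:R * expR ((dl + dl) * n%:R))) by ring.
have -> : 9 * (3 / 2 * L + 5) * (a + b)%:R * N = (3 / 2 * L + 5) * N * (9 / 4 * ((2 * (a + b)%:R) * 2)) by field.
have LN : 0 <= (3 / 2 * L + 5) * N by apply: mulr_ge0 => //; have := L0; lra.
apply: ler_wpM2l => //.
have n2 : n.+1%:R <= 2 * (a + b)%:R :> R by rewrite -natrM ler_nat mul2n -addnn -add1n leq_add // (leq_trans n0 hn).
have h1 : n.+1%:R * expR ((dl + dl) * n%:R) <= 2 * (a + b)%:R * 2 :> R.
  by apply: ler_pM => //; exact: exp_n.
have h2 : 0 <= n.+1%:R * expR ((dl + dl) * n%:R) by rewrite mulr_ge0 ?expR_ge0.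
apply: (@le_trans _ _ (21 / 10 * (n.+1%:R * expR ((dl + dl) * n%:R)))); first exact: ler_wpM2r.
by lra.
Qed.

Let u2 : 1 / 2 <= lu m. by have := est_u hw ht; have := e1; rewrite /e; lra. Qed.
Let v2 : 1 / 2 <= lv m. exact: (est_v2 hw hr ht). Qed.
Let ed := t_d ht.
Let B := 9 * (3 / 2 * L + 5) * (a + b)%:R.

Let right_kap t N y : tbd L N t -> 0 <= y <= V2 -> `|dlK m px qx t b y 0| <= B * N.
move=> htb /andP[y0 yV]; have iV : litin m b V2 by case: hV.
have [iy [Ky _]] := lK_mono hw y0 yV iV; have /andP[K0 _] := lK_in hw iy.
apply: le_trans (kap_bound hw hreg ed u2 L0 htb iy) _; apply: kapB => //.
- exact: t_b ht.
- exact: leq_addl.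
- by case: htb => h _ _ _ _; exact: le_trans h.
have [_ _ eQ _ _] := hR; rewrite eQ in Ky; have c0 : 0 < lc m by have := c_half; lra.
have ci : (lc m)^-1 <= 11 / 10.
  have -> : 11 / 10 = (10 / 11)^-1 :> R by field.
  by rewrite lef_pV2 ?posrE //; have := c_half; lra.
have -> : 21 / 10 = (1 + 11 / 10) * 1 :> R by field.
by apply: ler_pM => //; [rewrite addr_ge0 // invr_ge0 ltW | rewrite lerD2l | apply: le_trans Ky q1].
Qed.

Let left_kap t N y : tbd L N t -> 0 <= y <= W2 -> `|dlK m' qx px t a y 0| <= B * N.
move=> htb /andP[y0 yV]; have iV : litin m' a W2 by case: hW.
have [iy [Ky _]] := lK_mono hw' y0 yV iV; have /andP[K0 _] := lK_in hw' iy.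
apply: le_trans (kap_bound hw' hreg' ed v2 L0 htb iy) _; apply: kapB => //.
- exact: t_a ht.
- exact: leq_addr.
- by case: htb => h _ _ _ _; exact: le_trans h.
have [_ _ eQ _ _] := hL; rewrite eQ in Ky; have hp := est_p hw hr ht; rewrite -/e in hp.
have ke : ka * e <= e / 64 by have : ka * e <= 1 / 64 * e by [rewrite ler_pM2r]; lra.
have K2 : lK m' a y <= 65 / 64 * e by have : 1 - lc m = e by []; lra.
rewrite -[lc m']/e mulrDl mul1r; have : e^-1 * lK m' a y <= 65 / 64 by rewrite mulrC ler_pdivrMr.
by have := e1; lra.
Qed.

Let eal : expR (9 * ka) / al <= 2 / (1 + al).
have a0 : 0 < al := lt_trans ltr01 al1; have a1 : 0 < 1 + al by rewrite addr_gt0.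
by rewrite ler_pdivrMr // mulrAC ler_pdivlMr //; have := hka; lra.
Qed.

Let F0 F : (1 + al) / 2 <= F -> 0 <= F - 1.
by move=> h; have := al1; lra. Qed.

Let fin X Y W V' : 0 <= X -> V' <= 5 * ka -> 0 <= Y ->
  2 * V' * X + 4 * W + (expR (9 * ka + 9 * ka) - 1) * Y <= 10 * ka * X + 4 * W + 36 * ka * Y.
have h : 0 <= 9 * ka + 9 * ka <= 1 / 2 by apply/andP; split; have := k0; have := hka64; lra.
have e4 := exp_lin h; move=> X0 hV' Y0; apply: lerD; last by apply: ler_wpM2r => //; lra.
by rewrite lerD2r ler_wpM2r //; lra.
Qed.

(* The constant of the cone estimate is 1 / (8 coneK). *)
Lemma cone_bound (z : coords R T0 T1) N : tbd L N (tof f z) ->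
  N <= `|co_u z| \/ N <= `|co_v z| ->
  N * Num.min (W2 - W1)^-1 (V2 - V1)^-1 <=
  8 * coneK al * Num.max `|Du' f a b p q W1 z| `|Dv' f a b p q V1 z|.
move=> htb hN; have htb' := tbd_flip htb.
have N0 : 0 <= N by case: htb => h _ _ _ _; exact: le_trans h.
have VV := preimage_lt hw cq hV; have WW := preimage_lt hw' cp hW.
have vl : 0 < V2 - V1 by rewrite subr_gt0. have wl : 0 < W2 - W1 by rewrite subr_gt0.
have V10 : 0 <= V1 by case: hV => /andP[]. have W10 : 0 <= W1 by case: hW => /andP[].
have hV2 : 0 <= V2 <= V2 by rewrite lexx (le_trans V10 (ltW VV)).
have hW2 : 0 <= W2 <= W2 by rewrite lexx (le_trans W10 (ltW WW)).
have hV1 : 0 <= V1 <= V2 by rewrite V10 ltW. have hW1 : 0 <= W1 <= W2 by rewrite W10 ltW.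
have V2h : V2 <= 1 / 2 by have := V2s; have := hka64; lra.
have W2h : W2 <= 1 / 2 by have := W2s; have := hka64; lra.
have p1' : 1 - p <= 1 by rewrite lerBlDr lerDl.
have q1' : 0 <= 1 - q by rewrite subr_ge0.
have [l1 l2] := lD_len hw hR hV sR; have [l3 l4] := lD_len hw' hL hW sL; rewrite SE in l3 l4.
have HR0 : 0 < lD m px qx b V2 * (V2 - V1).
  by rewrite mulr_gt0 //; apply: (lD_gt0 hw hreg); case: hV.
have HL0 : 0 < lD m' qx px a W2 * (W2 - W1).
  by rewrite mulr_gt0 //; apply: (lD_gt0 hw' hreg'); case: hW.
have r1 := onesided_dv hw hreg htb hR pc hV sR eta_al V2h q1 (right_kap htb hV2).
have r2 := onesided_dv' hw hreg htb (Dp f a p z) hR pc hV sR eta_al V2h p0 q1 HL0 l4 l3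
  (right_kap htb hV2) (right_kap htb hV1).
have s1 := onesided_dv hw' hreg' htb' hL qc hW sL eta_al W2h p1' (left_kap htb' hW2).
have l1s := l1; have l2s := l2; rewrite -[q - p]/S -SE in l1s l2s.
have s2 := onesided_dv' hw' hreg' htb' (- Dq f b q z) hL qc hW sL eta_al W2h q1' p1' HR0
  l2s l1s (left_kap htb' hW2) (left_kap htb' hW1); rewrite !SE in s1 s2.
have -> : Dv' f a b p q V1 z = (lv (tof f z) + DV2 f b q z - (lv m - 1 + V2) / (V2 - V1) *
   (DV2 f b q z - DV1 f a b p V1 z)) / (V2 - V1) by [].
have -> : Du' f a b p q W1 z = (lv (tflip (tof f z)) + DW2 f a p z - (lv m' - 1 + W2) / (W2 - W1) *
   (DW2 f a p z - DW1 f a b q W1 z)) / (W2 - W1) by [].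
have eDp : dQ m' qx px a (1 - p) (tflip (tof f z)) = - Dp f a p z by rewrite /Dp opprK.
rewrite eDp in s1 s2.
have ex : (- Dp f a p z - (1 - (1 - p)) / (1 - lc m') * lc (tflip (tof f z))) =
   - (Dp f a p z - p / lc m * lc (tof f z)) by rewrite /m' /= !subKr; ring.
have ey : - (- Dq f b q z - (1 - q) / lc m' * lc (tflip (tof f z))) =
   Dq f b q z - (1 - q) / (1 - lc m) * lc (tof f z) by rewrite /m' /=; ring.
rewrite ex in s1 s2; rewrite ey in s2.
rewrite -/(Dq f b q z) in r1 r2.
rewrite -/(DV2 f b q z) -/(DV1 f a b p V1 z) in r2.
rewrite -/(DW2 f a p z) -/(DW1 f a b q W1 z) in s2.
set x := - (_ - _) / _ in r2 s1 s2; set y := (_ - _) / _ in r1 r2 s2.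
set W := expR _ * _ / _ in r1 r2; rewrite -[expR _ * _ / S]/W in s1 s2.
have [g1 g2] := lkap_ge2; have u01 := renorm_v01 hw' hL hW; have v01 := renorm_v01 hw hR hV.
have ab1 : 1 <= (a + b)%:R :> R by rewrite ler1n addn_gt0 (t_a ht).
have W0 : 0 <= W.
  have B0 : 0 <= B by rewrite /B !mulr_ge0 // addr_ge0 // mulr_ge0.
  by rewrite /W divr_ge0 ?(ltW S0) // !mulr_ge0 ?expR_ge0 // addr_ge0.
set mu := Num.min _ _; have mu0 : 0 < mu by rewrite lt_min !invr_gt0 wl.
have muU : mu * (W2 - W1) <= 1 by rewrite -ler_pdivlMr // mul1r ge_min lexx.
have muV : mu * (V2 - V1) <= 1 by rewrite -ler_pdivlMr // mul1r ge_min lexx orbT.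
(* |U| and |V| are so much shorter than |C| that even after multiplication by [a + b] a factor [ka]
   remains; so perturbations of the order (a + b) N / |C| are small errors. *)
have abS : (a + b)%:R / S <= ka * mu.
  have bnd (l K : R) : 0 < l -> l <= K * S -> K * (a + b)%:R <= ka -> (a + b)%:R / S <= ka * l^-1.
    move=> l0 h1 h2; rewrite ler_pdivrMr // mulrAC ler_pdivlMr //.
    apply: (@le_trans _ _ ((a + b)%:R * (K * S))); first by rewrite ler_wpM2l.
    by rewrite mulrA ler_pM2r // mulrC.
  rewrite /mu; case: (leP (W2 - W1)^-1 (V2 - V1)^-1) => _.
    apply: bnd (est_U hw hr ht hW) _ => //; rewrite mulrAC; exact: (t_bU ht).
  apply: bnd (est_Vlen hw hr ht hV) _ => //; rewrite mulrAC; exact: (t_bV ht).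
have B0 : 0 <= 9 * (3 / 2 * L + 5) by rewrite mulr_ge0 // addr_ge0 // mulr_ge0.
have WB : W <= w0 * ka * (N * mu).
  have h1 : 1 + B <= (1 + 9 * (3 / 2 * L + 5)) * (a + b)%:R by rewrite mulrDl mul1r lerD2r.
  have h2 : expR (9 * ka) * ((1 + B) * N) <= 2 * ((1 + 9 * (3 / 2 * L + 5)) * (a + b)%:R * N).
    apply: ler_pM => //; last exact: ler_wpM2r.
    by apply: mulr_ge0 => //; apply: addr_ge0 => //; exact: mulr_ge0.
  apply: (@le_trans _ _ (2 * ((1 + 9 * (3 / 2 * L + 5)) * (a + b)%:R * N) / S)).
    by rewrite ler_pM2r // invr_gt0.
  have -> : 2 * ((1 + 9 * (3 / 2 * L + 5)) * (a + b)%:R * N) / S = w0 * N * ((a + b)%:R / S) by rewrite /w0; ring.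
  have -> : w0 * ka * (N * mu) = w0 * N * (ka * mu) by ring.
  by apply: ler_wpM2l => //; rewrite mulr_ge0 // /w0 mulr_ge0 // addr_ge0.
(* [renorm_v_lkap] on both sides: the two right-hand sides add up through |L| + |R| = |C|, and [eal]
   absorbs the distortion. *)
have th : (lv m' - 1 + W2) / (W2 - W1) / lkap m' qx px a (1 - p) +
    (lv m - 1 + V2) / (V2 - V1) / lkap m px qx b q <= 2 / (1 + al).
  have a0 : 0 < al by exact: lt_trans ltr01 al1.
  have hF F w r : (1 + al) / 2 <= F -> w * al * S <= expR (9 * ka) * r * F -> w / F <= expR (9 * ka) / al * (r / S).
    move=> hF h; have Fp : 0 < F by apply: lt_le_trans hF; rewrite divr_gt0 // addr_gt0.
    rewrite ler_pdivrMr //; have -> : expR (9 * ka) / al * (r / S) * F = expR (9 * ka) * r * F / (al * S) by field; rewrite !gt_eqF.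
    by rewrite ler_pdivlMr ?mulr_gt0 // mulrA.
  have h1 := hF _ _ _ g1 (renorm_v_lkap hw hR hV sR).
  have h2 := renorm_v_lkap hw' hL hW sL; rewrite SE in h2; have {}h2 := hF _ _ _ g2 h2.
  apply: (le_trans (lerD h2 h1)); rewrite -mulrDr -mulrDl.
  have -> : 1 - p - lc m' + (q - lc m) = S by rewrite /m' /= /S; ring.
  by rewrite divff ?gt_eqF // mulr1.
have hN' : N <= `|lv (tflip (tof f z))| \/ N <= `|lv (tof f z)| by [].
apply: (cone_combine al1 g2 g1 u01 v01 th s1 r1 hN' N0 mu0 muU muV W0 WB (ltW k0) _ hw0 _ _ hK).
- by rewrite /w0 mulr_ge0 // addr_ge0.
- rewrite [x + y]addrC; apply: (le_trans s2); apply: fin => //; apply: mulr_ge0 => //; exact: F0.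
- apply: (le_trans r2); apply: fin => //; apply: mulr_ge0 => //; exact: F0.
Qed.
End Cone.

(** * Inward directions and uniqueness of the (u, v) part of the derivative *)

Section HalfNear.
Context {I : Type} (F : set_system I) (nu : I -> R).
Hypothesis hj : jctx F nu.
Hypothesis hs : forall e : R, 0 < e -> F [set i | nu i <= e].
#[local] Instance hjF10 : Filter F := proj1 hj.
Notation jet := (jet F nu).
Variables (d : R) (m : lmap) (m_ t_ : I -> lmap) (px qx : R -> R).
Hypothesis hl : lj F nu d m_ m t_ px qx.

(* The renormalization structure persists in a direction along which the
   parameter v' of the renormalized map decreases. *)
Lemma half_near n p q y P Q dP dq de : half m n p q -> p < lc m -> q < 1 ->
  preimage m n p q y -> 0 < y -> 0 < lD m px qx n y ->
  jet P (fun=> p) dP -> jet Q (fun=> q) dq ->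
  F [set i | [/\ lc (m_ i) < Q i < 1, litin (m_ i) n (lV (m_ i) (Q i)) & lK (m_ i) n (lV (m_ i) (Q i)) = Q i]] ->
  0 < de ->
  F [set i | (lv (t_ i) + dlV m (t_ i) q (dq i) - (lv m - 1 + lV m q) / (lV m q - y) *
    (dlV m (t_ i) q (dq i) - dY m px qx n y (t_ i) (dP i))) / (lV m q - y) <= - (de * nu i)] ->
  F [set i | half (m_ i) n (P i) (Q i)].
move=> hh pc q1 hy y0 D0 hP hQ hQi de0 hin; have [[hwf hw] _ hv hc _ _] := hl.
have [/andP[cq _] gap _ _ hlast] := hh.
have yv := preimage_lt hw cq hy; have [/andP[_ y1v] eK iV] := hy.
have [iy _] := lK_mono hw (ltW y0) (ltW yv) iV.
have y1 : y < 1 by apply: lt_le_trans yv _; case: iV => /andP[].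
have cq1 : lc m < q < 1 by rewrite cq.
have [jV _ V01] := lV_near hj hs hl hQ cq1.
have y01 : 0 < y < 1 by rewrite y0.
have hP' : jet P (fun=> lK m n y) dP by rewrite eK.
have [Y [jY fY]] := V_exists hj hs hl y01 iy D0 hP'.
have vy : 0 < lV m q - y by rewrite subr_gt0.
have jD := jetB hj jV jY.
have jX := jet_div hj hs (jetD hj (jetB hj hv (jet_const hj 1)) jV) jD vy.
(* The only closed condition of [half] that may hold with equality says that the return branch
   starts no lower than [p], which amounts to v' <= 1. A strictly negative derivative of v'
   preserves it; all other conditions are open or hold by construction. *)
have n1 : F [set i | Y i <= 1 - lv (m_ i)].
  have [K hK] := jX; have k0 : 0 < `|K| + 1 by rewrite ltr_wpDl.
  have e0 : 0 < de / (`|K| + 1) by rewrite divr_gt0.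
  apply: filterS3 (filterI hK hin) (filterI (hs e0) (proj2 hj)) (jet_near_gt hj hs jD vy).
  move=> i /= [[_ _ h1] h2] [h3 /andP[h4 _]] h5; rewrite /= subr0 in h1.
  have dp : 0 < lV (m_ i) (Q i) - Y i by apply: lt_le_trans h5; rewrite divr_gt0.
  have kn : K * nu i ^+ 2 <= de * nu i.
    rewrite expr2 mulrA ler_wpM2r //; rewrite ler_pdivlMr // in h3; apply: le_trans h3.
    by rewrite mulrC ler_wpM2l // (le_trans (ler_norm K)) // lerDl.
  have /andP[_ v1] := renorm_v01 hw hh hy.
  have {}h1 := le_trans (ler_norm _) h1.
  suff : (lv (m_ i) - 1 + lV (m_ i) (Q i)) / (lV (m_ i) (Q i) - Y i) <= 1.
    by rewrite ler_pdivrMr // mul1r => h; clear - al1 hj hs hl h; lra.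
  by rewrite -/(dY m px qx n y (t_ i) (dP i)) in h1; move: h1 h2 kn v1; clear - al1 hj hs hl; lra.
have w1 : 0 <= 1 - lv m by rewrite subr_ge0; case/andP: (wf_v hw).
have vV := lV_le hw (lexx _) (ltW cq); rewrite (lV_c) in vV.
have [iv _] := lK_mono hw w1 vV iV.
have jv : jet (fun i => 1 - lv (m_ i)) (fun=> 1 - lv m) (fun i => 0 - lv (t_ i)) := jetB hj (jet_const hj 1) hv.
have v01 : F [set i | 0 <= 1 - lv (m_ i) <= 1].
  by apply: filterS hwf => i /wf_v/andP[h1 h2]; andlra.
have [jKv _] := lK_near hj hs hl jv v01 iv.
have hl0 : 0 < lc m - lK m n (1 - lv m) by rewrite subr_gt0.
have n2 := jet_near_gt hj hs (jetB hj hc jKv) hl0.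
have n3 : F [set i | forall j, (j < n)%N -> lK (m_ i) j (lV (m_ i) (Q i)) < P i].
  have [_ h] : exists K : R, F [set i | forall j, (j < n)%N -> lK (m_ i) j (lV (m_ i) (Q i)) < P i].
    apply: (@fin_filter I F _ n (fun j _ i => lK (m_ i) j (lV (m_ i) (Q i)) < P i)) => // j jn; exists 0.
    have [jK _] := lK_near hj hs hl jV V01 (itinS (ltnW jn) iV).
    have g0 : 0 < p - lK m j (lV m q) by rewrite subr_gt0; exact: gap.
    apply: filterS (jet_near_gt hj hs (jetB hj hP jK) g0) => i /= h.
    by rewrite -subr_gt0; apply: lt_le_trans h; rewrite divr_gt0.
  exact: h.
apply: filterS3 (filterI hwf hQi) (filterI fY n1) (filterI n2 n3).
move=> i /= [hwi [/andP[cQ Q1] iQ eQ]] [[iY eY] hYv] [h2 h3].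
have W1 : 0 <= 1 - lv (m_ i) by rewrite subr_ge0; case/andP: (wf_v hwi).
have VV := lV_le hwi (lexx _) (ltW cQ); rewrite (lV_c) in VV.
have [iw _] := lK_mono hwi W1 VV iQ; have Y0 : 0 <= Y i by case: iY => /andP[].
have [_ [h _]] := lK_mono hwi Y0 hYv iw; split=> //; first by rewrite cQ ltW.
  by rewrite -eY.
by rewrite -subr_gt0; apply: lt_le_trans h2; rewrite divr_gt0.
Qed.
End HalfNear.

Section Uniqueness.
Context {d0 d1 : Order.disp_t} {T0 : orderType d0} {T1 : orderType d1}.
Implicit Types (g z : coords R T0 T1).
Variables (f : coords R T0 T1) (dl ka rho : R) (a b : nat) (p q V1 W1 : R).
Hypothesis hb : base f dl (9 * ka) a b p q V1 W1.
Hypothesis hdec : decomposed f.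
Hypothesis hdl : dl <= rb / 2.
Hypothesis he4 : expR (dl + dl + (dl + dl)) < al.
Hypothesis rho0 : 0 < rho.
Hypothesis near : forall g, nle (g - f) rho -> small g dl /\ tiny dl (1 - co_c g) ka a b.
Notation Du := (Du' f a b p q W1).
Notation Dv := (Dv' f a b p q V1).
Let m := mof f.
Let hw : wf dl m := b_wf hb.
Let hf := b_small hb.
Let ht : tiny dl (1 - lc m) ka a b.
have h0 : nle (f - f) 0 by rewrite subrr; split; rewrite ?normr0 //; exact: l1_le_eq (l1_le0 (T := _)).
by have [] := near (nle_weak (ltW rho0) h0).
Qed.
Let small_weak g : small g dl -> small g (rb / 2).
by move=> [h1 h2]; split; exact: l1_le_weak hdl _. Qed.

Section Inward.
Variables (z : coords R T0 T1) (N : R).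
Hypothesis hz : nle z N.
Hypothesis hzu : Du z < 0.
Hypothesis hzv : Dv z < 0.
(** Right neighbourhoods of 0: the index [r] stands for the map [f + r z], with scale
    [r * (N + 1)]. *)
Let F : set_system R := fun S => exists2 e, 0 < e & forall r, 0 < r -> r <= e -> S r.
Let N1 := N + 1.
Let nu r := r * N1.
Let g_ r : coords R T0 T1 := f + r *: z.

#[local] Instance right_filter : Filter F.
split.
- by exists 1.
- move=> S S' [e e0 h] [e' e0' h']; exists (Num.min e e'); first by rewrite lt_min e0.
  by move=> r r0; rewrite le_min => /andP[h1 h2]; split; [exact: h|exact: h'].
- by move=> S S' SS [e e0 h]; exists e => // r r0 re; apply: SS; exact: h.
Qed.

Let N10 : 0 < N1. by rewrite ltr_wpDl // (nle_ge0 hz). Qed.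
Let rpos : F [set r | 0 < r]. by exists 1. Qed.
Let hs e : 0 < e -> F [set r | nu r <= e].
move=> e0; exists (e / N1); first by rewrite divr_gt0.
by move=> r _; rewrite ler_pdivlMr.
Qed.
Let hj : jctx F nu.
split; first exact: right_filter.
by apply: filterS2 rpos (hs ltr01) => r r0 /= ->; rewrite mulr_ge0 // ltW.
Qed.
Let gE r : g_ r - f = r *: z. by rewrite /g_ addrAC subrr add0r. Qed.
Let hg : F [set r | nle (g_ r - f) (nu r)].
apply: filterS rpos => r r0 /=; rewrite gE.
have h0 : nle (0 : coords R T0 T1) 0.
  by split; rewrite ?normr0 //; exact: l1_le_eq (l1_le0 (T := _)).
have h := nle_lin r hz h0; rewrite !addr0 (gtr0_norm r0) in h.
by apply: nle_weak h; rewrite /nu /N1 ler_pM2l // lerDl.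
Qed.
Let hn : F [set r | small (g_ r) dl /\ tiny dl (1 - co_c (g_ r)) ka a b].
by apply: filterS2 hg (hs rho0) => r h1 h2; apply: near; exact: nle_weak h2 h1. Qed.
Let hgs : F [set r | small (g_ r) rb].
by apply: filterS hn => r [/small_weak/(small_rb)]. Qed.
Let jc (L : coords R T0 T1 -> R) : (forall z w, L (z - w) = L z - L w) ->
  (forall z N, nle z N -> `|L z| <= N) -> jet F nu (fun r => L (g_ r)) (fun=> L f) (fun r => L (g_ r - f)).
by move=> h1 h2; apply: (coord_jet hj h1); apply: filterS hg => r; exact: h2. Qed.
Let cj (L : coords R T0 T1 -> R) x : (forall z w, L (z - w) = L z - L w) ->
  (forall z N, nle z N -> `|L z| <= N) -> 0 < L f - x -> F [set r | x < L (g_ r)].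
move=> hL hb' h; have jL := jc hL hb'.
apply: filterS (jet_near_gt hj hs (jetB hj jL (jet_const hj x)) h) => r /= h2.
by rewrite -subr_gt0; apply: lt_le_trans h2; rewrite divr_gt0.
Qed.

Let pc : p < lc m. by have [] := ren_bd (b_ren hb). Qed.
Let cq : lc m < q. by have [] := ren_bd (b_ren hb). Qed.
Let cp : lc (lflip m) < 1 - p. by rewrite /= ltrD2l ltrN2. Qed.
Let qc : 1 - q < lc (lflip m). by rewrite /= ltrD2l ltrN2. Qed.
Let hR : half m b p q. by have [] := b_ren hb. Qed.
Let hL : half (lflip m) a (1 - q) (1 - p). by have [] := b_ren hb. Qed.
Let q1 : q < 1. exact: (half_lt1 hw hR pc (b_b hb)). Qed.
Let p1 : 1 - p < 1. exact: (half_lt1 (wf_flip hw) hL qc (b_a hb)). Qed.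
Let V10 : 0 < V1. by apply: (preimage_gt0 hw (b_V hb)); have := p1; rewrite ltrBlDr ltrDl. Qed.
Let W10 : 0 < W1. by apply: (preimage_gt0 (wf_flip hw) (b_W hb)); rewrite subr_gt0. Qed.
(** The left end of V is positive and at most 1 - v. Hence [u] and [v] may be moved in any direction
    without leaving their range. *)
Let v1 : co_v f < 1.
by have [/andP[_ h] _ _] := b_V hb; have := V10; move: h; rewrite /=; lra. Qed.
Let u1 : co_u f < 1.
by have [/andP[_ h] _ _] := b_W hb; have := W10; move: h; rewrite /=; lra. Qed.

Let coords_near : F [set r | [/\ 0 < co_u (g_ r) < 1, 0 < co_v (g_ r) < 1 & 0 < co_c (g_ r) < 1]].
have below (L : coords R T0 T1 -> R) : (forall z w, L (z - w) = L z - L w) ->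
    (forall z N, nle z N -> `|L z| <= N) -> 0 < L f < 1 -> F [set r | 0 < L (g_ r) < 1].
  move=> h1 h2 /andP[h3 h4]; have n1 := cj h1 h2 (_ : 0 < L f - 0).
  have n2 := @cj (fun z => - L z) (- 1) _ _ _.
  apply: filterS2 (n1 _) (n2 _ _ _); rewrite ?subr0 ?opprK ?subr_gt0 //.
  - by move=> r /= h5; rewrite ltrN2 h5.
  - by move=> z0 w0; rewrite h1 opprB opprK addrC.
  - by move=> z0 M /h2; rewrite normrN.
  - by rewrite addrC subr_gt0.
have sub z0 w0 := co_sub z0 w0 : [/\ _, _, _, _ & _].
apply: filterS3 (below (@co_u _ _ _ T0 T1) _ _ _) (below (@co_v _ _ _ T0 T1) _ _ _) (below (@co_c _ _ _ T0 T1) _ _ _).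
- by move=> r h1 h2 h3; split.
- by move=> z0 w0; have [] := co_sub z0 w0.
- by move=> z0 M [].
- by have /andP[h _] := wf_u hw; rewrite u1 andbT.
- by move=> z0 w0; have [] := co_sub z0 w0.
- by move=> z0 M [].
- by have /andP[h _] := wf_v hw; rewrite v1 andbT.
- by move=> z0 w0; have [] := co_sub z0 w0.
- by move=> z0 M [].
- exact: (wf_c hw).
Qed.

(** The conditions on the critical values are strict at [f] by [est_A], hence stable. *)
Let wf_near : F [set r | wf dl (mof (g_ r))].
have [hs0 ht0] := hf; have dl_rb : dl <= rb by have := hdl; have := @rb_gt0; lra.
have hs1 : F [set r | l1_le (co_s (g_ r)) rb /\ l1_le (fun t => co_s (g_ r) t - co_s f t) (nu r)].
  by apply: filterS2 hgs hg => r [h1 _] [_ _ _ h2 _]; split.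
have ht1 : F [set r | l1_le (co_t (g_ r)) rb /\ l1_le (fun t => co_t (g_ r) t - co_t f t) (nu r)].
  by apply: filterS2 hgs hg => r [_ h1] [_ _ _ _ h2]; split.
have ju : jet F nu (fun r => co_u (g_ r)) (fun=> co_u f) (fun r => co_u (g_ r - f)).
  by apply: (jc (L := @co_u _ _ _ T0 T1)) => [z0 w0|z0 M []] //; have [] := co_sub z0 w0.
have jv : jet F nu (fun r => co_v (g_ r)) (fun=> co_v f) (fun r => co_v (g_ r - f)).
  by apply: (jc (L := @co_v _ _ _ T0 T1)) => [z0 w0|z0 M []] //; have [] := co_sub z0 w0.
have jcc : jet F nu (fun r => co_c (g_ r)) (fun=> co_c f) (fun r => co_c (g_ r - f)).
  by apply: (jc (L := @co_c _ _ _ T0 T1)) => [z0 w0|z0 M []] //; have [] := co_sub z0 w0.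
have [qA _ eB _] := est_A hw (b_ren hb) ht.
have u01 : F [set r | 0 <= co_u (g_ r) <= 1 /\ 0 <= co_u f <= 1].
  by apply: filterS coords_near => r [/andP[/ltW h1 /ltW h2] _ _]; case: hdec => h _ _ _; rewrite /= h1 h2.
have v01 : F [set r | 0 <= co_v (g_ r) <= 1 /\ 0 <= co_v f <= 1].
  by apply: filterS coords_near => r [_ /andP[/ltW h1 /ltW h2] _]; case: hdec => _ h _ _; rewrite /= h1 h2.
have jA := jetB hj (mjet_comp hj hs0 hs1 ju u01) jcc.
have jB := jetB hj (mjet_flip hj (mjet_comp hj ht0 ht1) jv v01) (jetB hj (jet_const hj 1) jcc).
have pA : 0 < comp_all al (co_s f) (co_u f) - co_c f by rewrite subr_gt0; exact: lt_trans cq qA.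
have pB : 0 < flip (comp_all al (co_t f)) (co_v f) - (1 - co_c f) by rewrite subr_gt0.
apply: filterS3 (filterI coords_near hn) (jet_near_gt hj hs jA pA) (jet_near_gt hj hs jB pB).
move=> r [[/andP[a1 a2] /andP[b1 b2] hc] [[s1 s2] _]] h1 h2; split=> //=.
- exact: wf_d hw.
- by rewrite a1 ltW.
- by rewrite b1 ltW.
- by apply: (comp_sl) => //; exact: l1_le_weak s1.
- by apply: sl_flip; apply: (comp_sl) => //; exact: l1_le_weak s2.
- by rewrite -subr_ge0; apply: le_trans h1; rewrite divr_ge0 // ltW.
- by rewrite -subr_ge0; apply: le_trans h2; rewrite divr_ge0 // ltW.
Qed.

Let scal (L : coords R T0 T1 -> R) : bl L -> forall r, L (g_ r - f) = r * L z.
move=> [h1 _] r; rewrite gE; have tz : tangent z by apply/tangentP; exists N.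
have t0 : tangent (0 : coords R T0 T1).
  by apply/tangentP; exists 0; split; rewrite ?normr0 //; exact: l1_le_eq (l1_le0 (T := _)).
have L0 : L 0 = 0 by have := h1 1 0 0 t0 t0; rewrite scaler0 addr0 mul1r => h; lra.
by have := h1 r z 0 tz t0; rewrite addr0 L0 addr0.
Qed.

(** The fixed points move by [q_exists] on both sides, [half_near] keeps both halves because the
    derivatives of u' and v' are negative, and [ren_Lset] identifies the interval they bound as the
    maximal return interval. *)
Lemma inward_Lset : exists2 r0, 0 < r0 & forall r, 0 < r -> r <= r0 -> Lset al a b (f + r *: z).
have hreg := reg_mof hf (b_smalld hb); have hreg' := reg_flip hreg.
have hl := lj_mof hj hf hg hgs wf_near hw; have hl' := lj_flip hj hl.
have VV := preimage_lt hw cq (b_V hb); have WW := preimage_lt (wf_flip hw) cp (b_W hb).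
have iV : litin m b (lV m q) by case: (b_V hb).
have iW : litin (lflip m) a (lV (lflip m) (1 - p)) by case: (b_W hb).
have [iV1 _] := lK_mono hw (ltW V10) (ltW VV) iV.
have [iW1 _] := lK_mono (wf_flip hw) (ltW W10) (ltW WW) iW.
have cq1 : lc m < q < 1 by rewrite cq q1.
have cp1 : lc (lflip m) < 1 - p < 1 by rewrite cp p1.
have [_ _ eQ _ _] := hR; have [_ _ eP _ _] := hL.
have [X [jX fX]] := q_exists hj hs hl cq1 iV eQ (b_kR hb).
have [X' [jX' fX']] := q_exists hj hs hl' cp1 iW eP (b_kL hb).
have jX2 : jet F nu X' (fun=> 1 - p) (fun r => - Dp f a p (g_ r - f)).
  by apply: (jet_eq hj jX') => // r; rewrite /Dp opprK.
have jP : jet F nu (fun r => 1 - X' r) (fun=> p) (fun r => Dp f a p (g_ r - f)).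
  apply: (jet_ext hj _ (jetB hj (jet_const hj 1) jX2)); apply: filterE => r.
  by split; rewrite ?subKr // sub0r opprK.
have jQ' : jet F nu (fun r => 1 - X r) (fun=> 1 - q) (fun r => - Dq f b q (g_ r - f)).
  apply: (jet_ext hj _ (jetB hj (jet_const hj 1) jX)); apply: filterE => r.
  by split=> //; rewrite sub0r.
have de (D : R) : D < 0 -> 0 < - D / N1 by move=> h; rewrite divr_gt0 // oppr_gt0.
have hin (D r : R) : r * D <= - (- D / N1 * nu r).
  by rewrite /nu mulrCA divfK ?gt_eqF // mulrN opprK.
have H1 : F [set r | half (mof (g_ r)) b (1 - X' r) (X r)].
  apply: (half_near hj hs hl hR pc q1 (b_V hb) V10 (lD_gt0 hw hreg iV1) jP jX fX (de _ hzv)).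
  by apply: filterE => r /=; have := scal (bl_Dv' hb) r => E; rewrite -[leLHS]/(Dv (g_ r - f)) E.
have H2 : F [set r | half (lflip (mof (g_ r))) a (1 - X r) (X' r)].
  apply: (half_near hj hs hl' hL qc p1 (b_W hb) W10 (lD_gt0 (wf_flip hw) hreg' iW1) jQ' jX2 fX' (de _ hzu)).
  by apply: filterE => r /=; have := scal (bl_Du' hb) r => E; rewrite -[leLHS]/(Du (g_ r - f)) E.
suff [e e0 h] : F [set r | Lset al a b (g_ r)] by exists e.
apply: filterS3 (filterI H1 H2) (filterI wf_near hn) coords_near.
move=> r [h1 h2] [hwr [hsm htn]] [hu hv hc].
have hr : ren (mof (g_ r)) a b (1 - X' r) (X r) by split=> //; rewrite subKr.
have [di di'] := dist_both hwr hr htn.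
have dec : decomposed (g_ r).
  case/andP: hu => ? ?; case/andP: hv => ? ?; split; rewrite ?ltW //.
  case: hdec => _ _ _ /tangentP[M hM]; apply/tangentP; exists (`|r| * N + M).
  by rewrite /g_ addrC; exact: nle_lin.
by have [] := ren_Lset dec hwr (reg_mof (small_weak hsm) hsm) di di' (b_eta hb) he4 hr (b_a hb) (b_b hb).
Qed.
End Inward.

Lemma near_Lset g : Lset al a b g -> nle (g - f) rho ->
  [/\ small g rb, wf dl (mof g), ren (mof g) a b (retC al g).1 (retC al g).2,
   dist (9 * ka) (mof g) b & dist (9 * ka) (lflip (mof g)) a].
move=> hL hg; have [hs htn] := near hg; have [h1 h2] := hs.
have rl : dl <= rb by have := hdl; have := @rb_gt0; lra.
have [hwg hr] := Lset_ren hL h1 h2 rl (b_a hb) (b_b hb).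
by have [di di'] := dist_both hwg hr htn; split=> //; exact: small_rb (small_weak hs).
Qed.

Notation is_D := (is_derivative_within (renorm al a b) (Lset al a b) f).

Let zero_t : tangent (0 : coords R T0 T1).
by apply/tangentP; exists 0; split; rewrite ?normr0 //; exact: l1_le_eq (l1_le0 (T := _)). Qed.

Lemma dir_derivative A z N e : is_D A -> nle z N -> 0 < e ->
  (exists2 r0, 0 < r0 & forall r, 0 < r -> r <= r0 -> Lset al a b (f + r *: z)) ->
  exists2 r1, 0 < r1 & forall r, 0 < r -> r <= r1 ->
    nle (renorm al a b (f + r *: z) - renorm al a b f - r *: A z) (e * r).
move=> [lin _ hd] hz e0 [r0 r00 hr0]; have N1 : 0 < N + 1 by rewrite ltr_wpDl // (nle_ge0 hz).
have e1 : 0 < e / (N + 1) by rewrite divr_gt0.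
have [de de0 h] := hd _ e1; exists (Num.min r0 (de / 2 / (N + 1))); first by rewrite lt_min r00 !divr_gt0.
move=> r rp; rewrite le_min => /andP[h1 h2]; rewrite ler_pdivlMr // in h2.
have gE : f + r *: z - f = r *: z by rewrite addrAC subrr add0r.
have z0 : nle (0 : coords R T0 T1) 0 by split; rewrite ?normr0 //; exact: l1_le_eq (l1_le0 (T := _)).
have hrz : nle (r *: z) (r * (N + 1)).
  have := nle_lin r hz z0; rewrite !addr0 gtr0_norm // => k; apply: nle_weak k.
  by rewrite ler_pM2l // lerDl.
have tz : tangent z by apply/tangentP; exists N.
have A0 : A 0 = 0.
  have := lin 1 0 0 zero_t zero_t; rewrite scaler0 addr0 scale1r => k.
  by apply: (addrI (A 0)); rewrite addr0 -k.
have Ar : A (r *: z) = r *: A z by have := lin r z 0 tz zero_t; rewrite addr0 A0 addr0.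
have [en en'] := fine_normP hrz; have /normP hrz' := hrz.
have := h _ (hr0 r rp h1); rewrite gE Ar en lte_fin -EFinM => /(_ _)/normP k.
rewrite en lee_fin in hrz'; apply: nle_weak (k _); last by apply: le_lt_trans hrz' _; lra.
apply: (@le_trans _ _ (e / (N + 1) * (r * (N + 1)))); first by rewrite ler_pM2l.
by have -> : e / (N + 1) * (r * (N + 1)) = e * r by field; rewrite gt_eqF.
Qed.

Let DRf := DR f a b p q V1 W1.

Let DRf_der : is_D DRf.
by apply: (DR_is_derivative hb rho0) => g; exact: near_Lset. Qed.

(** Two derivatives approximate the same difference along a ray that stays in [Lset] up to o(r), so
    they agree on its direction. *)
Lemma inward_unique A z N : is_D A -> nle z N -> Du z < 0 -> Dv z < 0 ->
  co_u (A z) = Du z /\ co_v (A z) = Dv z.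
move=> hA hz hu hv; have hL := inward_Lset hz hu hv.
have key e : 0 < e -> `|co_u (A z) - Du z| <= 2 * e /\ `|co_v (A z) - Dv z| <= 2 * e.
  move=> e0; have [r1 r10 h1] := dir_derivative hA hz e0 hL; have [r2 r20 h2] := dir_derivative DRf_der hz e0 hL.
  pose r := Num.min r1 r2; have r0 : 0 < r by rewrite lt_min r10.
  have [|a1 a2 _ _ _] := h1 r r0; first by rewrite ge_min lexx.
  have [|b1 b2 _ _ _] := h2 r r0; first by rewrite ge_min lexx orbT.
  have E (L : coords R (rtime T0 T1 a) (rtime T1 T0 b) -> R) (k : R) X B :
      (forall x y, L (x - y) = L x - L y) -> (forall x, L (r *: x) = r * L x) -> L (DRf z) = k ->
      `|L (X - B - r *: A z)| <= e * r -> `|L (X - B - r *: DRf z)| <= e * r -> `|L (A z) - k| <= 2 * e.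
    move=> l1 l2 <- c1 c2; rewrite !l1 !l2 in c1 c2; rewrite -(ler_pM2l r0) -[X in X * `|_|](gtr0_norm r0) -normrM.
    move: c1 c2; rewrite !ler_norml => /andP[x1 x2] /andP[x3 x4]; rewrite mulrBr.
    by andlra.
  split.
    exact: (E (@co_u _ _ _ _ _) _ _ _ (fun x y => erefl) (fun x => erefl) erefl a1 b1).
  exact: (E (@co_v _ _ _ _ _) _ _ _ (fun x y => erefl) (fun x => erefl) erefl a2 b2).
have lim (x : R) : (forall e, 0 < e -> `|x| <= 2 * e) -> x = 0.
  move=> h; apply/eqP; rewrite -normr_le0 leNgt; apply/negP => x0.
  by have := h (`|x| / 4); rewrite divr_gt0 // => /(_ isT); lra.
by split; apply/eqP; rewrite -subr_eq0; apply/eqP; apply: lim => e e0; have [] := key e e0.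
Qed.

Let base_v (x y : R) : coords R T0 T1 := ((x, y), (0, fun=> 0, fun=> 0)).

Hypothesis inj : forall x y : R, Du (base_v x y) = 0 -> Dv (base_v x y) = 0 -> x = 0 /\ y = 0.

(* On the (u, v)-plane DR is invertible, so that inward directions exist; every
   direction is a difference of two inward ones. *)
Lemma derivative_unique A z : is_D A -> tangent z -> co_u (A z) = Du z /\ co_v (A z) = Dv z.
move=> hA tz; have [lA _ _] := hA; have [lu _] := bl_Du' hb; have [lv _] := bl_Dv' hb.
have tb x y : tangent (base_v x y).
  apply/tangentP; exists (`|x| + `|y|); split; rewrite /= ?lerDl ?lerDr //.
  - by rewrite normr0 addr_ge0.
  - by apply: l1_le_weak (l1_le_eq _ (l1_le0 (T := _))) => [|t]; rewrite ?addr_ge0 //= normr0.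
  - by apply: l1_le_weak (l1_le_eq _ (l1_le0 (T := _))) => [|t]; rewrite ?addr_ge0 //= normr0.
have bE x y : base_v x y = x *: base_v 1 0 + y *: base_v 0 1.
  have ceq (z1 z2 : coords R T0 T1) : co_u z1 = co_u z2 -> co_v z1 = co_v z2 -> co_c z1 = co_c z2 ->
      co_s z1 =1 co_s z2 -> co_t z1 =1 co_t z2 -> z1 = z2.
    case: z1 => [[? ?] [[? s1] t1]]; case: z2 => [[? ?] [[? s2] t2]].
    by rewrite /co_u /co_v /co_c /co_s /co_t /= => -> -> -> /funext -> /funext ->.
  rewrite -[y *: _]addr0.
  have [e1 e2 e3 e4 e5] := co_lin x (base_v 1 0) (y *: base_v 0 1 + 0).
  have [f1 f2 f3 f4 f5] := co_lin y (base_v 0 1) 0.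
  have zz : (0 : R) = x * 0 + (y * 0 + 0) by ring.
  apply: ceq => [|||t|t].
  - by rewrite e1 f1; change (x = x * 1 + (y * 0 + 0)); ring.
  - by rewrite e2 f2; change (y = x * 0 + (y * 1 + 0)); ring.
  - by rewrite e3 f3; exact: zz.
  - by rewrite e4 f4; exact: zz.
  - by rewrite e5 f5; exact: zz.
have sc (L : coords R T0 T1 -> R) : (forall r z w, tangent z -> tangent w -> L (r *: z + w) = r * L z + L w) ->
    forall x y, L (base_v x y) = x * L (base_v 1 0) + y * L (base_v 0 1).
  move=> l x y; have L0 : L 0 = 0 by have := l 1 0 0 zero_t zero_t; rewrite scaler0 addr0 mul1r => h; lra.
  have Ly : L (y *: base_v 0 1) = y * L (base_v 0 1) by have := l y _ 0 (tb 0 1) zero_t; rewrite addr0 L0 addr0.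
  rewrite bE l //; first by rewrite Ly.
  by have := tb 0 y; rewrite bE scale0r add0r.
have [eu ev] := (sc _ lu, sc _ lv).
set a1 := Du (base_v 1 0) in eu; set a2 := Du (base_v 0 1) in eu.
set b1 := Dv (base_v 1 0) in ev; set b2 := Dv (base_v 0 1) in ev.
have det : a1 * b2 - a2 * b1 != 0.
  apply/eqP => h; have z1 x y : x * a1 + y * a2 = 0 -> x * b1 + y * b2 = 0 -> x = 0 /\ y = 0.
    by move=> h1 h2; apply: inj; rewrite ?eu ?ev.
  have [a20 a10] : a2 = 0 /\ - a1 = 0 by apply: z1; [ring | rewrite -[RHS]oppr0 -h; ring].
  have [b20 b10] : b2 = 0 /\ - b1 = 0 by apply: z1; [rewrite -[RHS]h; ring | ring].
  have E1 : 1 * a1 + 0 * a2 = 0 by rewrite mul1r mul0r addr0 -[a1]opprK a10 oppr0.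
  have E2 : 1 * b1 + 0 * b2 = 0 by rewrite mul1r mul0r addr0 -[b1]opprK b10 oppr0.
  by have [/eqP] := z1 1 0 E1 E2; rewrite oner_eq0.
(* Cramer's rule for the vector whose (u, v) image is (-1, -1). *)
pose z0 := base_v ((a2 - b2) / (a1 * b2 - a2 * b1)) ((b1 - a1) / (a1 * b2 - a2 * b1)).
have u0 : Du z0 = -1 by rewrite /z0 eu; field.
have v0 : Dv z0 = -1 by rewrite /z0 ev; field.
(* Large enough that adding [s *: z0] makes both components of the image of [z] negative. *)
pose s := `|Du z| + `|Dv z| + 1; have s0 : 0 < s by rewrite ltr_wpDl // addr_ge0.
have tz0 : tangent z0 := tb _ _.
have tw : tangent (s *: z0 + z).
  have [[M hM] [M' hM']] := (proj1 (tangentP z0) tz0, proj1 (tangentP z) tz).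
  by apply/tangentP; exists (`|s| * M + M'); exact: nle_lin.
have Uw : Du (s *: z0 + z) < 0 by rewrite lu // u0; have := ler_norm (Du z); have := normr_ge0 (Dv z); rewrite /s; lra.
have Vw : Dv (s *: z0 + z) < 0 by rewrite lv // v0; have := ler_norm (Dv z); have := normr_ge0 (Du z); rewrite /s; lra.
have [M hM] := proj1 (tangentP z0) tz0; have [M' hM'] := proj1 (tangentP _) tw.
have [x1 x2] : co_u (A z0) = Du z0 /\ co_v (A z0) = Dv z0.
  by apply: inward_unique hM _ _ => //; rewrite ?u0 ?v0 ltrN10.
have [y1 y2] := inward_unique hA hM' Uw Vw.
have [c1 c2 _ _ _] := co_lin s (A z0) (A z).
rewrite lA // c1 x1 lu // in y1; rewrite lA // c2 x2 lv // in y2.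
by split; [apply: (addrI (s * Du z0)) | apply: (addrI (s * Dv z0))].
Qed.
End Uniqueness.

End Main.

(** * Choice of the lower bound for b0 *)

Section Asymptotics.
Context {R : realType} {al sg : R}.
Hypothesis al1 : 1 < al.
Hypothesis sg0 : 0 < sg.
Let al0 : 0 < al. exact: lt_trans ltr01 al1. Qed.

Let pow_small (x k s : R) : 0 < k -> 0 < s -> 0 <= x -> x <= k `^ s^-1 -> x `^ s <= k.
move=> k0 s0 x0 h; have -> : k = (k `^ s^-1) `^ s by rewrite -powRrM mulVf ?gt_eqF // powRr1 // ltW.
by apply: ge0_ler_powR; rewrite ?nnegrE ?powR_ge0 // ltW.
Qed.

Lemma tiny_small (ka : R) : 0 < ka -> ka <= 1 / 64 -> exists2 k, 0 < k & forall (n a b : nat) (d e : R),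
  (64 <= n)%N -> 36 <= ka * n%:R -> 0 <= d -> d * n%:R <= 2 / n%:R -> al - 1 + sg <= a%:R -> a%:R <= 2 * n%:R :> R ->
  (n <= b)%N -> b%:R <= 2 * n%:R :> R -> 0 < e -> n%:R * e <= k -> n%:R / (e * al ^+ b) <= k ->
  tiny (al:=al) d e ka a b.
move=> ka0 ka1.
pose k1 := (1 / 14) `^ (al - 1)^-1 / 9 : R; pose k2 := (1 / 24) `^ al / 3 : R.
pose k3 := ka `^ al / (8 * al); pose k4 := ((ka / 4) `^ (al - 1) / 6) `^ sg^-1 / 4.
(* One bound per group of conditions: [ka / 96] for [t_bV] and [t_bU], [1 / 100] for [t_e], and
   [k1], [k2], [k3], [k4] for [t_e2], [t_l], [t_V], [t_U]. *)
pose ks := [:: ka / 96; 1 / 100; k1; k2; k3; k4].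
pose k := \big[Num.min/1]_(x <- ks) x.
have pos : 0 < k.
  have a1 : 0 < al - 1 by rewrite subr_gt0.
  have h1 : 0 < k1 by apply: divr_gt0 => //; apply: powR_gt0; exact: divr_gt0.
  have h2 : 0 < k2 by apply: divr_gt0 => //; apply: powR_gt0; exact: divr_gt0.
  have h3 : 0 < k3 by apply: divr_gt0; [exact: powR_gt0 | exact: mulr_gt0].
  have h4 : 0 < k4 by apply: divr_gt0 => //; apply: powR_gt0; apply: divr_gt0 => //; apply: powR_gt0; exact: divr_gt0.
  have h5 : 0 < ka / 96 by exact: divr_gt0.
  have h6 : 0 < 1 / 100 :> R by exact: divr_gt0.
  by rewrite /k unlock /= !lt_min h1 h2 h3 h4 h5 h6 ltr01.
have kle x : x \in ks -> k <= x.
  rewrite /k; move: ks {k pos}; elim=> // y s IH; rewrite inE big_cons => /predU1P[->|/IH h]; first by rewrite ge_min lexx.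
  by rewrite ge_min h orbT.
exists k => // n a b d e n64 nka d0 hd ha ha2 nb hb e0 hne hnV.
have n1 : 64 <= n%:R :> R by rewrite ler_nat.
have n0 : 0 < n%:R :> R by lra.
have ek : e <= k by apply: le_trans hne; rewrite ler_peMl // ?(ltW e0) //; lra.
have [c1 c2 c3] : [/\ k <= ka / 96, k <= 1 / 100 & k <= k1] by split; apply: kle; rewrite !inE eqxx ?orbT.
have [c4 c5 c6] : [/\ k <= k2, k <= k3 & k <= k4] by split; apply: kle; rewrite !inE eqxx ?orbT.
have a0 : (0 < a)%N by rewrite -(ltr_nat R); have := al1; have := sg0; lra.
have b0 : (0 < b)%N by apply: leq_trans nb; apply: leq_trans n64.
have dn : d * n%:R <= 1 / 32.
  by apply: le_trans hd _; rewrite ler_pdivrMr //; lra.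
have dd : d <= 1 / 4 by have : d * 64 <= d * n%:R by [rewrite ler_wpM2l]; lra.
have db : d * b%:R <= 2 * (d * n%:R) by rewrite mulrCA ler_wpM2l.
have e4 : 0 < 4 * e by rewrite mulr_gt0.
have e41 : 4 * e <= 1 by lra.
have pa : (4 * e) ^+ a <= 4 * e.
  by rewrite -(prednK a0) exprS ler_piMr ?(ltW e4) // exprn_ile1 // ltW.
have ab : (a + b)%:R <= 4 * n%:R :> R by rewrite natrD; lra.
have e1 : 0 <= al - 1 by rewrite subr_ge0 ltW.
have e2 : 0 < al - 1 by rewrite subr_gt0.
have V0 : 0 < e * al ^+ b by rewrite mulr_gt0 // exprn_gt0.
split=> //.
- by have := @exp_lin R d; rewrite d0 => h; apply: le_trans (h _) _; lra.
- have h : 0 <= 8 * d * b%:R <= 1 / 2 by rewrite -mulrA mulr_ge0 ?mulr_ge0 //=; lra.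
  by apply: le_trans (exp_lin h) _; case/andP: h => _ h; lra.
- by rewrite e0 /=; lra.
- by rewrite ka0 /=; lra.
- apply: pow_small => //; [lra | by move: c3; rewrite /k1; set X := _ `^ _; lra].
- have h : (3 * e) `^ al^-1 <= 1 / 24.
    apply: pow_small; rewrite ?invr_gt0 ?invrK //; first lra.
    by move: c4; rewrite /k2; set X := _ `^ _; lra.
  by move: h; set X := _ `^ _; lra.
- have e5 : e * al ^+ b = e * al ^+ b.-1 * al by rewrite -mulrA -exprSr prednK.
  have V1 : 0 < e * al ^+ b.-1 by rewrite mulr_gt0 // exprn_gt0.
  rewrite ler_pdivrMr //; have := le_trans hnV c5; rewrite /k3 e5 ler_pdivrMr; last exact: mulr_gt0.
  move=> h.
  have e6 : ka `^ al / (8 * al) * (e * al ^+ b.-1 * al) = ka `^ al * (e * al ^+ b.-1) / 8 by field; rewrite gt_eqF.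
  by move: h; rewrite e6; set X := ka `^ al * _; lra.
- lra.
- have h : d * (a + b)%:R <= 4 * (d * n%:R) by rewrite mulrCA ler_wpM2l.
  have : ka * n%:R * (d * n%:R) <= ka * n%:R * (2 / n%:R) by rewrite ler_wpM2l // mulr_ge0 // ltW.
  have -> : ka * n%:R * (2 / n%:R) = 2 * ka by field; rewrite gt_eqF.
  have : 36 * (d * n%:R) <= ka * n%:R * (d * n%:R) by rewrite ler_wpM2r // mulr_ge0 // ltW.
  have dn0 : 0 <= d * n%:R by rewrite mulr_ge0 // ltW.
  have : d * 64 <= d * n%:R by rewrite ler_wpM2l.
  have -> : 4 * d * (a + b)%:R = 4 * (d * (a + b)%:R) by ring.
  by set X := d * (a + b)%:R in h *; set Y := d * n%:R in h dn0 *; set Z := ka * n%:R * Y; lra.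
- rewrite ler_pdivrMr //; have := le_trans hnV c1; rewrite ler_pdivrMr // => h.
  by move: h; rewrite mulrAC; set X := ka * (e * _); lra.
- have : 3 / 2 * (a + b)%:R * (4 * e) ^+ a <= 3 / 2 * (4 * n%:R) * (4 * e).
    by apply: ler_pM => //; rewrite ?mulr_ge0 ?exprn_ge0 ?(ltW e4) // ler_pM2l.
  move=> h; apply: (le_trans h); have : 3 / 2 * (4 * n%:R) * (4 * e) = 24 * (n%:R * e) by field.
  by set X := n%:R * e in hne *; lra.
- have h1 : (4 * e) ^+ a <= (4 * e) `^ (al - 1) * (4 * e) `^ sg.
    rewrite -powRD; last by apply/implyP => _; rewrite gt_eqF.
    rewrite -powR_mulrn ?(ltW e4) //; have := e41; rewrite le_eqVlt => /predU1P[->|lt1]; first by rewrite !powR1.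
    rewrite /powR gt_eqF // ler_expR ler_nM2r // ln_lt0 // e4; exact: lt1.
  have h2 : (4 * e) `^ sg <= (ka / 4) `^ (al - 1) / 6.
    apply: pow_small => //; [by rewrite divr_gt0 // powR_gt0 // divr_gt0|exact: ltW|].
    by move: c6; rewrite /k4; set X := _ `^ sg^-1; lra.
  have -> : ka * e = (ka / 4) * (4 * e) by field.
  rewrite powRM ?(ltW e4) ?divr_ge0 ?(ltW ka0) //.
  have h3 : (4 * e) `^ (al - 1) * (4 * e) `^ sg <= (4 * e) `^ (al - 1) * ((ka / 4) `^ (al - 1) / 6).
    by rewrite ler_wpM2l // powR_ge0.
  have -> : (ka / 4) `^ (al - 1) * (4 * e) `^ (al - 1) = 6 * ((4 * e) `^ (al - 1) * ((ka / 4) `^ (al - 1) / 6)) by field.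
  by rewrite ler_pM2l //; exact: le_trans h1 h3.
Qed.

(** Squaring e^(x/2) >= x/2 gives quadratic growth of the exponential, hence the explicit threshold
    [M]. *)
Lemma exp_decay (c k : R) : 0 < c -> 0 < k -> exists B : nat, forall n, (B <= n)%N ->
  n%:R * expR (- (c * n%:R)) <= k.
move=> c0 k0; pose M := 4 / (c ^+ 2 * k).
have [B hB] : exists B : nat, M <= B%:R.
  by exists (Num.bound `|M|); apply: le_trans (ler_norm M) _; apply: ltW; apply: archi_boundP.
exists B.+1 => n hn; have Mn : M <= n%:R by apply: le_trans hB _; rewrite ler_nat ltnW.
have n0 : 0 < n%:R :> R by rewrite ltr0n; exact: leq_ltn_trans hn.
have h : c * n%:R / 2 <= expR (c * n%:R / 2) by apply: le_trans (expR_ge1Dx _); rewrite lerDr.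
have x0 : 0 <= c * n%:R / 2 by rewrite divr_ge0 // mulr_ge0 // ltW.
have h2 : c ^+ 2 * n%:R ^+ 2 / 4 <= expR (c * n%:R).
  have -> : c * n%:R = c * n%:R / 2 + c * n%:R / 2 by field.
  rewrite expRD; have -> : c ^+ 2 * n%:R ^+ 2 / 4 = c * n%:R / 2 * (c * n%:R / 2) by field.
  exact: ler_pM.
rewrite expRN ler_pdivrMr ?expR_gt0 //; apply: le_trans (ler_wpM2l (ltW k0) h2).
rewrite /M ler_pdivrMr ?mulr_gt0 ?exprn_gt0 // in Mn.
have : n%:R * 4 <= n%:R * (n%:R * (c ^+ 2 * k)) by rewrite ler_pM2l.
by have -> : k * (c ^+ 2 * n%:R ^+ 2 / 4) = n%:R * (n%:R * (c ^+ 2 * k)) / 4 by [field]; lra.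
Qed.
End Asymptotics.

(** The range of [e] and the value of [d] exceed what [Kset] allows by constant factors, so that the
    conclusion holds on a whole neighbourhood of a map of [Kset]. The upper bound on [e] makes n e
    decay; the lower bound and [b >= n] make n / (e al ^ b) decay at the rate (1 - 1 / al) ln al. *)
Lemma tiny_eventually {R : realType} (al sg be ka : R) : 1 < al -> 0 < sg < 1 -> 0 < be -> 0 < ka ->
  ka <= 1 / 64 -> exists B : nat, forall n : nat, (B <= n)%N -> (0 < n)%N /\
  forall a b, Omega al sg be n (a, b) -> let d := 2 / n%:R ^+ 2 in
  [/\ (0 < a)%N, (0 < b)%N, d <= @rb R al / 2, expR (d + d + (d + d)) < al &
  forall e, al `^ (- n%:R / al) / 2 <= e -> e <= 4 * al `^ (- n%:R * sg / al ^+ 2) ->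
    tiny (al:=al) d e ka a b].
move=> al1 /andP[sg0 sg1] be0 ka0 ka1; have al0 : 0 < al := lt_trans ltr01 al1.
have [k k0 hk] := tiny_small al1 sg0 ka0 ka1.
have l0 : 0 < ln al by rewrite ln_gt0.
have r0 := @rb_gt0 R al al1.
have c1 : 0 < ln al * (sg / al ^+ 2) by rewrite mulr_gt0 // divr_gt0 // exprn_gt0.
have c2 : 0 < ln al * (1 - al^-1) by rewrite mulr_gt0 // subr_gt0 invf_lt1.
have k4 : 0 < k / 4 by rewrite divr_gt0.
have [B1 h1] := exp_decay c1 k4; have [B2 h2] := exp_decay c2 k4.
(* The summands serve, in order, the hypothesis of [tiny_small] on [ka * n], the bound on [a], the
   bound of [d] by [rb], and the smallness of the distortion relative to [al - 1]. *)
pose M := 36 / ka + al + 4 / @rb R al + 16 / (al - 1).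
exists (maxn 64 (maxn B1 (maxn B2 (Num.bound `|M|)))) => n; rewrite !geq_max => /and4P[n64 nB1 nB2 nM'].
have nM : M <= n%:R.
  apply: (le_trans (ler_norm M)); apply: (@le_trans _ _ (Num.bound `|M|)%:R); last by rewrite ler_nat.
  by apply: ltW; apply: archi_boundP.
have a1 : 0 < al - 1 by rewrite subr_gt0.
have p1 : 0 < 36 / ka by exact: divr_gt0.
have p3 : 0 < 4 / @rb R al by exact: divr_gt0.
have p4 : 0 < 16 / (al - 1) by exact: divr_gt0.
have [m1 m2 m3 m4] : [/\ 36 / ka <= n%:R, al <= n%:R, 4 / @rb R al <= n%:R & 16 / (al - 1) <= n%:R].
  by move: nM; rewrite /M => nM; split; lrc nM a1 p1 p3 p4.
rewrite ler_pdivrMr // in m1; rewrite ler_pdivrMr // in m3; rewrite ler_pdivrMr // in m4.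
have n0 : (0 < n)%N by exact: leq_trans n64.
have N0 : 0 < n%:R :> R by rewrite ltr0n.
have N64 : 64 <= n%:R :> R by rewrite ler_nat.
split=> // a b hO d; case: hO => /= /andP[w1 w2] [w3 w4].
have d0 : 0 < d by rewrite divr_gt0 // exprn_gt0.
have dn : d * n%:R = 2 / n%:R by rewrite /d; field; rewrite gt_eqF.
have dnn : d * n%:R * n%:R = 2 by rewrite dn divfK // gt_eqF.
have dx (x c : R) : 0 < c -> c <= n%:R * x -> c * d <= x / 32.
  move=> c0 h; rewrite -(ler_pM2r N0) -(ler_pM2r N0).
  have -> : c * d * n%:R * n%:R = c * (d * n%:R * n%:R) by ring.
  rewrite dnn.
  have h3 : 64 * c <= n%:R * (n%:R * x) by apply: ler_pM => //; exact: ltW.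
  by have -> : x / 32 * n%:R * n%:R = n%:R * (n%:R * x) / 32 by [field]; lrc h3.
have e1 := dx _ _ (ltr0n R 4) m3; have e2 := dx _ _ (ltr0n R 16) m4.
have ha : (0 < a)%N by rewrite -(ltr_nat R); lrc al1 sg0 w1.
have hb : (n <= b)%N by rewrite -(ler_nat R).
split=> //.
- exact: leq_trans hb.
- lrc d0 e1.
- have h : 0 <= d + d + (d + d) <= 1 / 2.
    have d64 : 64 * d <= 1 / 32 by apply: dx => //; rewrite mulr1.
    by apply/andP; split; lrc d0 d64.
  by apply: le_lt_trans (exp_lin h) _; lrc d0 e2.
move=> e he1 he2; have pl : 0 < al `^ (- n%:R / al) by exact: powR_gt0.
have e0 : 0 < e by apply: lt_le_trans he1; exact: divr_gt0.
have powE x : al `^ x = expR (x * ln al) by rewrite /powR gt_eqF.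
have h3 : al - 1 + sg <= a%:R by lrc w1.
have h4 : a%:R <= 2 * n%:R :> R by lrc al1 sg0 sg1 be0 ka0 c1 m2 m1 m3 m4 n0 N0 N64 w1 w2.
have h5 : b%:R <= 2 * n%:R :> R.
  apply: (le_trans w4); have h : (sg / al) ^+ 2 <= 1.
    by rewrite exprn_ile1 ?divr_ge0 ?(ltW sg0) ?(ltW al0) // ler_pdivrMr // mul1r; lrc N64 w1 w2 w3 w4 d0 dn dnn e1 e2.
  by rewrite ler_pM2r //; lrc be0 h.
have h6 : d * n%:R <= 2 / n%:R by rewrite dn.
rewrite mulrC in m1; apply: (hk n a b d e n64 m1 (ltW d0) h6 h3 h4 hb h5 e0).
- have := h1 n nB1; have -> : expR (- (ln al * (sg / al ^+ 2) * n%:R)) = al `^ (- n%:R * sg / al ^+ 2).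
    by rewrite powE; congr expR; ring.
  have : n%:R * e <= n%:R * (4 * al `^ (- n%:R * sg / al ^+ 2)) by rewrite ler_pM2l.
  by rewrite mulrCA; set X := n%:R * _ `^ _; lrc.
- have h := h2 n nB2.
  have pb : al ^+ n <= al ^+ b by rewrite ler_weXn2l // ltW.
  have eb : al `^ (- n%:R / al) / 2 * al ^+ n <= e * al ^+ b.
    by apply: ler_pM => //; [rewrite divr_ge0 // ltW | rewrite exprn_ge0 // ltW].
  have q0 : 0 < al `^ (- n%:R / al) / 2 * al ^+ n by rewrite mulr_gt0 ?divr_gt0 ?exprn_gt0.
  apply: (@le_trans _ _ (n%:R / (al `^ (- n%:R / al) / 2 * al ^+ n))).
    by rewrite ler_pM2l // lef_pV2 // posrE // (lt_le_trans q0).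
  have -> : n%:R / (al `^ (- n%:R / al) / 2 * al ^+ n) = 2 * (n%:R * expR (- (ln al * (1 - al^-1) * n%:R))).
    have -> : expR (- (ln al * (1 - al^-1) * n%:R)) = (al `^ (- n%:R / al) * al ^+ n)^-1.
      rewrite -powR_mulrn ?(ltW al0) // -powRD; last by apply/implyP => _; rewrite gt_eqF.
      by rewrite powE -expRN; congr expR; ring.
    by field; rewrite !gt_eqF ?exprn_gt0.
  by move: h; set X := n%:R * _; lra.
Qed.

(** * Conclusion *)

Lemma coneK_gt0 {R : realType} (al : R) : 1 < al -> 0 < coneK al.
move=> al1; have h : 2 / (1 + al) < 1 by rewrite ltr_pdivrMr; lra.
by rewrite /coneK ltr_wpDr // divr_ge0 // subr_ge0 ltW.
Qed.

Lemma main_bound {R : realType} (al sg be : R) : 1 < al -> 0 < sg < 1 -> 0 < be ->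
  exists B : nat, forall b0 : nat, (B <= b0)%N ->
  forall (d0 d1 : Order.disp_t) (T0 : orderType d0) (T1 : orderType d1) (f : coords R T0 T1) (a b : nat),
  Kset al sg 2 b0 f -> Omega al sg be b0 (a, b) -> Lset al a b f ->
  let is_DR := is_derivative_within (renorm al a b) (Lset al a b) f in
  (exists DR, is_DR DR) /\
  forall DR, is_DR DR -> forall z, hcone z ->
    (((8 * coneK al)^-1 * Num.min (ilen (intU al a f))^-1 (ilen (intV al b f))^-1)%:E
       * norm z <= norm (DR z))%E.
move=> al1 hsg be0; have al0 : 0 < al := lt_trans ltr01 al1; have a1 : 0 < al - 1 by rewrite subr_gt0.
have [L L0 hL] := tbd_tof al1.
pose w0 := 2 * (1 + 9 * (3 / 2 * L + 5)); have w00 : 0 < w0 by rewrite /w0; lra.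
have cK := coneK_gt0 al1.
pose K := coneK al * (10 + 16 * w0 + 72 / (al - 1)).
have K0 : 0 < K.
  by apply: mulr_gt0 => //; apply: addr_gt0; [lra | exact: divr_gt0].
(* Each summand yields one smallness condition: [ka <= 1 / 64], [w0 * ka <= 1 / 8],
   [K * ka <= 1 / 2], and the comparison of [expR (9 * ka)] and [expR (18 * ka)] with [al]. *)
pose ka := (64 + 8 * w0 + 2 * K + 40 * (1 + al) / (al - 1))^-1.
have t0 : 0 < 40 * (1 + al) / (al - 1) by rewrite divr_gt0 // mulr_gt0 // addr_gt0.
have S0 : 0 < 64 + 8 * w0 + 2 * K + 40 * (1 + al) / (al - 1) by lra.
have ka0 : 0 < ka by rewrite invr_gt0.
have kaS : (64 + 8 * w0 + 2 * K + 40 * (1 + al) / (al - 1)) * ka = 1 by rewrite mulfV // gt_eqF.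
have [k1 k2 k3 k4] : [/\ 64 * ka <= 1, 8 * (w0 * ka) <= 1, 2 * (K * ka) <= 1 & 40 * (1 + al) / (al - 1) * ka <= 1].
  have b2 : 0 < w0 * ka by exact: mulr_gt0.
  have b3 : 0 < K * ka by exact: mulr_gt0.
  have b4 : 0 < 40 * (1 + al) / (al - 1) * ka by exact: mulr_gt0.
  have : 64 * ka + 8 * (w0 * ka) + 2 * (K * ka) + 40 * (1 + al) / (al - 1) * ka = 1 by apply: etrans kaS; ring.
  by set X := 40 * _ / _ * ka in b4 *; move=> h; split; lrd al1 hsg be0 al0 a1 L0 w00 cK K0 t0 S0 kaS.
rewrite mulrAC ler_pdivrMr // mul1r in k4.
have ka64 : ka <= 1 / 64 by lra.
have ka1 : ka * (1 + al) >= ka * 2 by rewrite ler_pM2l //; lra.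
have he9 : expR (9 * ka) * ((1 + al) / 2) <= al.
  have h : 0 <= 9 * ka <= 1 / 2 by apply/andP; split; lrc ka0 ka64.
  apply: (@le_trans _ _ ((1 + 2 * (9 * ka)) * ((1 + al) / 2))); last by lrc k4 ka1 h.
  by apply: ler_wpM2r (exp_lin h); rewrite divr_ge0 // addr_ge0 // ltW.
have he18 : expR (9 * ka + 9 * ka) < al.
  have h : 0 <= 9 * ka + 9 * ka <= 1 / 2 by apply/andP; split; lrc ka0 k1.
  by apply: le_lt_trans (exp_lin h) _; lrc ka0 k4 ka1.
have [B hB] := tiny_eventually al1 hsg be0 ka0 ka64; exists B => n /hB[n0 {}hB].
move=> d0 d1 T0 T1 f a b [hdec c1 c2 hs ht] hO hLf.
have [ha hb dr d4 htiny] := hB a b hO; set d := 2 / n%:R ^+ 2 in dr d4 htiny.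
have N0 : 0 < n%:R :> R by rewrite ltr0n.
have d0' : 0 < d by rewrite divr_gt0 // exprn_gt0.
have rb0 := @rb_gt0 R al al1; have eN : (n%:R^-1 ^+ 2 : R) = d / 2 by rewrite /d; field; rewrite gt_eqF.
have sm : small f (d / 2) by rewrite -eN; split; apply/l1_leP.
have sw x : d / 2 <= x -> small f x by move=> h; case: sm => h1 h2; split; exact: l1_le_weak h _.
pose E := al `^ (- n%:R / al); have E0 : 0 < E by exact: powR_gt0.
(* Within [rho] of [f] the distortions stay below [d], twice the bound of [Kset], and 1 - c stays in
   the range of [tiny_eventually]. *)
pose rho := Num.min (d / 2) (E / 2); have rho0 : 0 < rho by rewrite lt_min; apply/andP; split; exact: divr_gt0.
have near g : nle (g - f) rho -> small g d /\ tiny (al:=al) d (1 - co_c g) ka a b.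
  move=> [_ _ hc h1 h2]; have [_ _ ec es et] := co_sub g f; have [s1 s2] := sm.
  have r1 : rho <= d / 2 by rewrite ge_min lexx.
  have r2 : rho <= E / 2 by rewrite ge_min lexx orbT.
  have wk (dd : Order.disp_t) (T : orderType dd) (x y : T -> R) : l1_le (fun t => x t - y t) rho -> l1_le y (d / 2) -> l1_le x d.
    move=> k k'; apply: l1_le_weak (l1_le_eq _ (l1_leD k k')) => [|t]; first by lrc r1.
    by rewrite subrK.
  split; first by split; [apply: wk s1; rewrite -es | apply: wk s2; rewrite -et].
  rewrite ec ler_norml in hc; case/andP: hc => hc1 hc2; rewrite -/E in c1.
  by apply: htiny; rewrite -/E; lrc c2 r2 hc1 hc2 c1.
have nf : nle (f - f) rho.
  apply: nle_weak (ltW rho0) _; rewrite subrr; split; rewrite ?normr0 //; exact: l1_le_eq (l1_le0 (T := _)).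
have [smd tf] := near f nf; have [sd1 sd2] := smd.
have dr' : d <= @rb R al by lrc dr rb0.
have [] := Lset_ren al1 hLf sd1 sd2 dr' ha hb; case er : (retC al f) => [p q] /= hw hr.
have [[V1 hV] [W1 hW]] := ren_preimages al1 hw hr.
have smr : small f (@rb R al / 2) by apply: sw; lrc dr'.
have reg0 := reg_mof al1 smr smd.
have w0k : w0 * ka <= 1 / 8 by lrc k2.
have Kk : coneK al * (10 + 16 * w0 + 72 / (al - 1)) * ka <= 1 / 2 by rewrite -/K; lrc k3.
have [g1 g2] := lkap_ge2 al1 reg0 hw hr hV hW tf he9.
have hbase : base (al:=al) f d (9 * ka) a b p q V1 W1 by split=> //; apply: lt_le_trans (_ : (1 + al) / 2 <= _) => //; lrc ka0 k4 ka1.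
have cone z N := cone_bound al1 L0 reg0 hw hr hV hW tf he9 ka64 w0k Kk (z := z) (N := N).
split; first by exists (DR (al:=al) f a b p q V1 W1); exact: (DR_is_derivative al1 hbase rho0 (near_Lset al1 hbase dr near)).
have [p0 pc cq q1] := ren_bd hr.
have cp : lc (lflip (mof (al:=al) f)) < 1 - p by rewrite /= ltrD2l ltrN2.
have VV := preimage_lt al1 hw cq hV; have WW := preimage_lt al1 (wf_flip hw) cp hW.
set mu := Num.min _ _ in cone; have mu0 : 0 < mu by rewrite lt_min !invr_gt0 !subr_gt0 VV WW.
move=> D hD z [tz hc].
have [N hN] := proj1 (tangentP z) tz.
(* The cone estimate itself: a vector of the (u, v)-plane is in the cone, so a vanishing image
   forces it to vanish, as [mu] is positive. *)
have inj (x y : R) : let w : coords R T0 T1 := ((x, y), (0, fun=> 0, fun=> 0)) in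
    Du' (al:=al) f a b p q W1 w = 0 -> Dv' (al:=al) f a b p q V1 w = 0 -> x = 0 /\ y = 0.
  move=> w h1 h2; pose M := Num.max `|x| `|y|.
  have xM : `|x| <= M by rewrite le_max lexx. have yM : `|y| <= M by rewrite le_max lexx orbT.
  have M0 : 0 <= M by exact: le_trans xM.
  have hM : nle w M.
    by split; rewrite /= ?normr0 //; apply: l1_le_weak M0 (l1_le_eq _ (l1_le0 (T := _))) => t; rewrite normr0.
  have hMxy : M <= `|co_u w| \/ M <= `|co_v w|.
    by rewrite /M; case: (leP `|x| `|y|) => _; [right|left].
  have := cone _ _ (hL _ _ _ _ f w M smr hM) hMxy; rewrite h1 h2 normr0 maxxx mulr0.
  rewrite pmulr_lle0 // => M0'; split; apply/eqP; rewrite -normr_le0; exact: le_trans M0'.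
have [eu ev] := derivative_unique al1 hbase hdec dr d4 rho0 near inj hD tz.
pose N1 := Num.max `|co_u z| `|co_v z|.
(* Membership in the cone means that the norm is attained by the (u, v) part. *)
have nz : norm z = N1%:E.
  by rewrite /norm; apply/max_idPl.
have hN1 : nle z N1 by apply/normP; rewrite nz.
have hN2 : N1 <= `|co_u z| \/ N1 <= `|co_v z|.
  by rewrite /N1; case: (leP `|co_u z| `|co_v z|) => _; [right|left].
have := cone _ _ (hL _ _ _ _ f z N1 smr hN1) hN2; rewrite -eu -ev => h.
have nD : ((Num.max `|co_u (D z)| `|co_v (D z)|)%:E <= norm (D z))%E by rewrite /norm le_max lexx.
apply: le_trans nD; rewrite nz -EFinM lee_fin (intUE al1 hw hr er hW) (intVE al1 hw hr er hV) /ilen /=.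
have -> : 1 - W1 - (1 - lV (al:=al) (lflip (mof (al:=al) f)) (1 - p)) =
  lV (al:=al) (lflip (mof (al:=al) f)) (1 - p) - W1 by ring.
have k8 : 0 < 8 * coneK al by rewrite mulr_gt0.
by rewrite -/mu -mulrA ler_pdivrMl // [mu * _]mulrC.
Qed.

Theorem proposition10p3 (R : realType) (alpha sigma beta : R)
  (halpha : 1 < alpha) (hsigma : 0 < sigma < 1)
  (ha : exists a : int, alpha + sigma <= a%:~R + 1 <= 2 * alpha - sigma)
  (hbeta : 0 < beta < (sigma / alpha) ^+ 2) :
  exists2 theta : R, 1 < theta &
  forall lambda : R, 0 < lambda < 1 ->
  exists (k : R) (B : nat), 0 < k /\
  forall b0 : nat, (B <= b0)%N ->
  forall (d0 d1 : Order.disp_t) (T0 : orderType d0) (T1 : orderType d1),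
  countable [set: T0] -> countable [set: T1] ->
  forall (f : coords R T0 T1) (a b : nat),
  Kset alpha sigma theta b0 f ->
  Omega alpha sigma beta b0 (a, b) -> Lset alpha a b f ->
  lambda <= 1 - crit_right (mapO alpha (renorm alpha a b f))
                           (co_c (renorm alpha a b f)) ->
  let is_DR := is_derivative_within (renorm alpha a b) (Lset alpha a b) f in
  (exists DR, is_DR DR) /\
  forall DR, is_DR DR -> forall z, hcone z -> z != 0 ->
    ((k * Num.min (ilen (intU alpha a f))^-1 (ilen (intV alpha b f))^-1)%:E
       * norm z <= norm (DR z))%E.
Proof.
(* With the factor 2 in [Kset], the factor 4 in [tiny_eventually] leaves room for the perturbations
   of size [rho]. *)
case/andP: hbeta => be0 _; exists 2; first by rewrite ltr1n.
move=> lambda _; have [B hB] := main_bound halpha hsigma be0; exists (8 * coneK alpha)^-1, B.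
split; first by rewrite invr_gt0 mulr_gt0 // coneK_gt0.
move=> b0 hB0 d0 d1 T0 T1 _ _ f a b hK hO hL _ is_DR.
have [ex bd] := hB b0 hB0 d0 d1 T0 T1 f a b hK hO hL.
by split=> // D hD z hz _; exact: bd.
Qed.
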